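(* For every integer $n\ge 3$, the bubble-sort graph $B_n$ satisfies $\kappa_4(B_n)=n-2$, where $\kappa_4$ denotes the generalized $4$-connectivity.
   Context: All graphs are finite, simple and undirected; $V(G)$ denotes the vertex set of $G$. Bubble-sort graph: for $n\ge 2$ write $[n]=\{1,\dots,n\}$ and let $\mathrm{Sym}(n)$ be the group of all permutations of $[n]$, where the composition $\sigma\pi$ maps $i$ to $\sigma(\pi(i))$. For $1\le i<j\le n$ let $[i,j]$ denote the transposition swapping $i$ and $j$. The bubble-sort graph $B_n$ is the Cayley graph $\mathrm{Cay}(\mathrm{Sym}(n),\mathcal{T})$ with $\mathcal{T}=\{[i,i+1]: 1\le i\le n-1\}$; that is, its vertex set is $\mathrm{Sym}(n)$, and $g,h\in\mathrm{Sym}(n)$ are adjacent if and only if $h=gs$ for some $s\in\mathcal{T}$. (Equivalently, writing a permutation $\sigma$ as the sequence $(\sigma(1),\dots,\sigma(n))$, two permutations are adjacent if and only if one is obtained from the other by swapping the entries in two consecutive positions.) Generalized connectivity: let $G$ be a connected graph and $S\subseteq V(G)$ with $|S|\ge 2$. A tree connecting $S$ in $G$ is a subgraph of $G$ that is a tree and whose vertex set contains $S$. Trees $T_1,\dots,T_\ell$ connecting $S$ in $G$ are called internally (edge) disjoint if they are pairwise edge disjoint and $V(T_i)\cap V(T_j)=S$ for all distinct $i,j\in\{1,\dots,\ell\}$. Let $\kappa_G(S)$ be the maximum number of internally disjoint trees connecting $S$ in $G$. For an integer $k$ with $2\le k\le |V(G)|$, the generalized $k$-connectivity of $G$ is $$\kappa_k(G)=\min\{\kappa_G(S):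 S\subseteq V(G),\ |S|=k\}.$$ *)

(* Defs.v *)
From mathcomp Require Import all_boot all_fingroup.

Set Implicit Arguments.
Unset Strict Implicit.
Unset Printing Implicit Defensive.

Record sgraph := SGraph {
  svertex :> finType;
  sedge : rel svertex;
  sedge_sym : symmetric sedge;
  sedge_irrefl : irreflexive sedge }.

Definition edges (G : sgraph) : {set {set G}} :=
  [set [set p.1; p.2] | p : G * G & sedge p.1 p.2].

(* A candidate subgraph is a pair (vertex set, edge set). *)
Definition vegraph (G : sgraph) : finType := ({set G} * {set {set G}})%type.

Section Trees.
Variable G : sgraph.
Implicit Types (H K : vegraph G) (S : {set G}) (P : {set vegraph G}).

Definition verts H : {set G} := H.1.
Definition eset H : {set {set G}} := H.2.
Definition adj H : rel G := fun x y => [set x; y] \in eset H.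

Definition is_subgraph H : bool :=
  (eset H \subset edges G) && [forall e in eset H, e \subset verts H].

Definition connected H : bool :=
  (verts H != set0) &&
  [forall x in verts H, forall y in verts H, connect (adj H) x y].

(* A duplicate-free sequence has at most #|G| terms, so it is enough to let c
   range over sequences of bounded length; see acyclicP. *)
Definition acyclic H : bool :=
  [forall c : {bseq #|G| of G}, ucycleb (adj H) c ==> (size c <= 2)].

Lemma acyclicP H :
  reflect (forall c : seq G, 2 < size c -> ~ ucycle (adj H) c) (acyclic H).
Proof.
apply: (iffP forallP) => [ac c c2 cyc | ac c].
  have sz : size c <= #|G|.
    by have /andP[_ uc] := cyc; rewrite -(card_uniqP uc) max_card.
  have := ac (Bseq sz); rewrite /= /ucycleb; case/andP: cyc => -> -> /=.
  by rewrite leqNgt c2.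
by apply/implyP => cyc; rewrite leqNgt; apply/negP => /ac; apply.
Qed.

Definition is_tree H : bool := connected H && acyclic H.

Definition tree_connecting S H : bool :=
  [&& is_subgraph H, is_tree H & S \subset verts H].

(* A family of trees is encoded as a set.  This loses nothing when
   2 <= #|S|: every tree connecting S then has an edge, so edge-disjoint
   members of an indexed family are distinct. *)
Definition internally_disjoint S P : bool :=
  [forall H in P, forall K in P,
     (H != K) ==> [disjoint eset H & eset K] && (verts H :&: verts K == S)].

Definition kappaS S : nat :=
  \max_(P : {set vegraph G} |
          [forall H in P, tree_connecting S H] && internally_disjoint S P) #|P|.

Lemma kappaS_le S : kappaS S <= #|{: vegraph G}|.
Proof. by apply/bigmax_leqP => P _; apply: max_card. Qed.

End Trees.

(* The starting value of the iterated minimum is an upper bound of kappaS, hence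
   irrelevant as soon as there is a set of size k; see kappaP. *)
Definition kappa (k : nat) (G : sgraph) : nat :=
  \big[minn/#|{: vegraph G}|]_(S : {set G} | #|S| == k) kappaS S.

Lemma kappa_le k (G : sgraph) (S : {set G}) : #|S| = k -> kappa k G <= kappaS S.
Proof.
move/eqP=> Sk; rewrite /kappa; move: (mem_index_enum S).
elim: (index_enum _) => // S' r IHr; rewrite inE big_cons.
case/predU1P => [<- | /IHr le_r]; first by rewrite Sk geq_minl.
by case: ifP => // _; rewrite geq_min le_r orbT.
Qed.

Lemma kappa_attained k (G : sgraph) :
  k <= #|G| -> exists2 S : {set G}, #|S| = k & kappaS S = kappa k G.
Proof.
move=> kG; pose S0 : {set G} := [set x in take k (enum G)].
have S0k : #|S0| = k.
  by rewrite cardsE (card_uniqP _) ?take_uniq ?enum_uniq // size_takel -?cardE.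
have [|[S Sk <-]] : kappa k G = #|{: vegraph G}| \/
    exists2 S : {set G}, #|S| = k & kappaS S = kappa k G; last by exists S.
- rewrite /kappa; elim/big_ind: _ => [|x y Px Py|S /eqP Sk]; first by left.
    by rewrite /minn; case: ifP.
  by right; exists S.
- move=> e; exists S0 => //; apply/eqP.
  by rewrite eqn_leq kappa_le // e kappaS_le.
Qed.

Lemma kappaP k (G : sgraph) m : k <= #|G| ->
  kappa k G = m <->
  (exists2 S : {set G}, #|S| = k & kappaS S = m) /\
  (forall S : {set G}, #|S| = k -> m <= kappaS S).
Proof.
move=> kG; split=> [<- | [[S Sk <-] min]].
  by split=> [|S]; [apply: kappa_attained | apply: kappa_le].
have [S1 S1k e] := kappa_attained kG.
by apply/eqP; rewrite eqn_leq kappa_le //= -e min.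
Qed.

Section BubbleSort.
Variable n : nat.

(* The transpositions [i, i+1], on {0, ..., n-1}. *)
Definition adj_transp : {set 'S_n} :=
  [set tperm p.1 p.2 | p : 'I_n * 'I_n & p.2 == p.1.+1 :> nat].

(* MathComp composes permutations from left to right, (s * g) x = g (s x), so
   the function composition "g after s" is s * g. *)
Definition bubble_rel : rel 'S_n :=
  fun g h => [exists s in adj_transp, h == (s * g)%g].

Lemma bubble_sym : symmetric bubble_rel.
Proof.
suff sub g h : bubble_rel g h -> bubble_rel h g.
  by move=> g h; apply/idP/idP; apply: sub.
case/exists_inP => s /imsetP[[i j] ij ->] /eqP ->; apply/exists_inP.
by exists (tperm i j); [apply/imsetP; exists (i, j) | rewrite mulgA tperm2 mul1g].
Qed.

Lemma bubble_irrefl : irreflexive bubble_rel.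
Proof.
move=> g; apply/exists_inP; case=> s /imsetP[[i j]].
rewrite inE /= => /eqP ij -> /eqP.
rewrite -[LHS]mul1g => /mulIg /permP/(_ i); rewrite perm1 tpermL => e.
by move: ij; rewrite -e => /n_Sn.
Qed.

Definition bubble_sort_graph : sgraph := SGraph bubble_sym bubble_irrefl.

End BubbleSort.

(* Main.v *)
(** Upper bound: a set [S] containing two adjacent vertices admits at most [n - 2] trees,
    for [n - 1] of them would use each of the [n - 1] edges at either vertex exactly once,
    and the tree using the common edge would consist of this edge only.

    Lower bound: it suffices to colour the vertices outside [S] so that each of [n - 2]
    colour classes joins all members of [S], a few points of [S] being allowed to reach a
    class through an edge inside [S] ([exempt_ok]).  Such colourings are built by induction
    on [n].  Let [v] be a value which no member of [S] has in first position.  Deleting [v]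
    splits a permutation into its column, a permutation of the other values, and its level,
    the position of [v].  A colouring of the columns extends along the levels, and the
    permutations at level 0 form the new class.  The lift is adjusted near [S] according to
    the members of [S] which share a column.  It fails only if the columns of [S] disagree on
    at most three pairs of values ([near]) or if [S] contains one special configuration
    ([forked]).  When every value fails, and also fails after reversal of the permutations,
    counting the pairs of values on which members of [S] disagree leaves, up to one
    exception, the sets with at most four such pairs touching all values, whence [n <= 8].
    These sets, and the sets for [n <= 5] which the induction does not reach, are treated by
    explicit colourings, one for each orbit under relabelling and reversal. *)

Require Import Defs.
From mathcomp Require Import all_boot all_fingroup.
From mathcomp Require Import zify.
From Stdlib Require Import Classical_Prop.
From Stdlib Require Decimal Number.

Set Implicit Arguments.
Unset Strict Implicit.
Unset Printing Implicit Defensive.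

(** * Spanning trees and disjoint packings *)

(** Exemptions are forced by degrees. A permutation has $n-1$ neighbours; a member of $S$ with two
    neighbours in $S$ has $n-3$ others and misses one of the $n-2$ classes, and the centre of a star
    misses two. [exempt_ok] admits such gaps when $S$ contains a path with two edges or spans a
    tree; edges inside $S$ then fill them. The obstacle in the lift: a member crosses to a
    neighbouring column at its own level unless [v] stands between the two entries to be exchanged.
    Each member thus has a missing direction, and the colour waiting there must be fetched one level
    higher or lower in its own column. Members sharing a column compete for these levels and bar
    each other's way to level 0. Coinciding columns also leave fewer than four of them, so dummy
    columns are added before the induction hypothesis is applied, and they are surrendered to the
    new class. The 3 in [near 3] is the number of edges of a tree on four vertices, each moving one
    pair of values. The induction starts at $n=5$ because the orbits in [bad4] require edges inside
    $S$ beyond those that [exempt_ok] allows. *)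

Lemma set2_eq (T : finType) (a b c d : T) : [set a; b] = [set c; d] ->
  a = c /\ b = d \/ a = d /\ b = c.
Proof.
move=> e.
have : a \in [set c; d] by rewrite -e set21.
have : b \in [set c; d] by rewrite -e set22.
have : c \in [set a; b] by rewrite e set21.
have : d \in [set a; b] by rewrite e set22.
by rewrite !inE => /orP[]/eqP hd /orP[]/eqP hc /orP[]/eqP hb /orP[]/eqP ha; subst; auto.
Qed.

Section Spanning.

Variable G : sgraph.
Implicit Types (x z : G) (E : {set {set G}}) (V : {set G}).

Lemma adj_symm (H : vegraph G) : symmetric (adj H).
Proof. by move=> x z; rewrite /adj setUC. Qed.

Lemma cycle_edge_redundant V E c : connected (V, E) -> 2 < size c -> ucycle (adj (V, E)) c ->
  exists2 e, e \in E & connected (V, E :\ e).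
Proof.
case: c => [|x [|z p]] // /andP[V0 con] p0 /andP[cyc uc].
set w := last z p; pose e := [set w; x]; pose K : vegraph G := (V, E :\ e).
move: cyc; rewrite (cycle_path x) /= -/w => /and3P[wx xz zp].
have [nxz xp zNp] : [/\ x != z, x \notin z :: p & z \notin p].
  move: uc => /= /and3P[nx nz _]; split=> //.
  by apply: contraNneq nx => ->; rewrite mem_head.
have wp : w \in p by rewrite /w; case: (p) p0 => //= a q _; apply: mem_last.
have nwz : w != z by apply: contraNneq zNp => <-.
exists e => //; apply/andP; split=> //.
have symK : connect_sym (adj K) by apply: sym_connect_sym; apply: adj_symm.
have Kxz : adj K x z.
  rewrite /adj /= in_setD1 [X in _ && X]xz andbT; apply/eqP => /setP/(_ z).
  by rewrite !inE eqxx orbT [z == w]eq_sym (negPf nwz) [z == x]eq_sym (negPf nxz).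
have Kzp : path (adj K) z p.
  have sub : {in mem (z :: p) &, subrel (adj (V, E)) (adj K)}.
    move=> a b ap bp ab; rewrite /adj /= in_setD1 [X in _ && X]ab andbT; apply/eqP => /setP/(_ x).
    rewrite !inE eqxx orbT; apply/negP; rewrite negb_or.
    by apply/andP; split; apply: contraNneq xp => ->.
  by apply: (sub_in_path sub) zp; apply/allP.
have xw : connect (adj K) x w.
  by apply/connectP; exists (z :: p); rewrite //= Kxz.
have step a b : adj (V, E) a b -> connect (adj K) a b.
  move=> ab; have [ee|ne] := eqVneq [set a; b] e; last first.
    by apply: connect1; rewrite /adj /= in_setD1 ne.
  case: (set2_eq ee) => -[-> ->]; first by rewrite symK.
  exact: xw.
apply/forall_inP => a aV; apply/forall_inP => b bV.
have := forall_inP (forall_inP con a aV) b bV; apply: connect_sub => a' b'.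
exact: step.
Qed.

(** Take an inclusion-minimal set of edges that keeps [V] connected; by [cycle_edge_redundant] it
    contains no cycle. *)
Lemma spanning_tree V E : is_subgraph ((V, E) : vegraph G) -> connected (V, E) ->
  exists2 E' : {set {set G}}, E' \subset E & is_subgraph ((V, E') : vegraph G) && is_tree ((V,
      E') : vegraph G).
Proof.
move=> sg con; pose P (E' : {set {set G}}) := connected ((V, E') : vegraph G).
have [E' /minsetP[PE' min] sub] := @minset_exists _ P E con.
exists E' => //; apply/andP; split.
  have /andP[se /forall_inP sv] := sg; apply/andP; split; first exact: subset_trans se.
  by apply/forall_inP => e eE; apply: sv; apply: (subsetP sub).
rewrite /is_tree [connected _]PE' /=; apply/acyclicP => c c2 cyc.
have [e eE con'] := cycle_edge_redundant PE' c2 cyc.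
have := min _ con' (subsetDl _ _) => /setP/(_ e).
by rewrite !inE eqxx eE.
Qed.

(* Colours [j < N] give connected subgraphs meeting exactly in [S]; a spanning tree of each
   is one of the required trees. *)
Lemma kappaS_packing (S : {set G}) N (R : nat -> rel G) : 1 < #|S| ->
    (forall j, symmetric (R j)) -> (forall j, j < N -> subrel (R j) (@sedge G)) ->
    (forall j x z, j < N -> x \in S -> z \in S -> connect (R j) x z) ->
    (forall i j x z w, i < N -> j < N -> R i x z -> R j x w -> i != j -> x \in S) ->
    (forall i j x z, i < N -> j < N -> R i x z -> R j x z -> i = j) ->
  N <= kappaS S.
Proof.
move=> S2 symR subR conR meetR edgeR; have [s sS] : exists s, s \in S by apply/card_gt0P/ltnW.
(* Only the component of [s] is kept, so that fragments of the relation elsewhere do no harm. *)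
pose V j := [set x | connect (R j) s x].
pose E j := [set [set p.1; p.2] | p : G * G & R j p.1 p.2 && connect (R j) s p.1].
have symc j : connect_sym (R j) by apply: sym_connect_sym.
have adjE j x z : adj ((V j, E j) : vegraph G) x z = R j x z && connect (R j) s x.
  apply/imsetP/idP => [[[a b] /=]|h]; last by exists (x, z); rewrite ?inE.
  rewrite inE /= => /andP[ab sa] e; have sb : connect (R j) s b by apply: connect_trans sa
      (connect1 ab).
  by case: (set2_eq e) => -[-> ->]; [rewrite ab sa | rewrite symR ab sb].
have sg j : j < N -> is_subgraph ((V j, E j) : vegraph G).
  move=> lt_j; apply/andP; split.
    apply/subsetP => e /imsetP[p]; rewrite inE => /andP[rp _] ->; apply/imsetP; exists p => //.
    by rewrite inE; apply: (subR j lt_j).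
  apply/forall_inP => e /imsetP[p]; rewrite inE => /andP[rp cp] ->.
  by apply/subsetP => x; rewrite !inE => /orP[]/eqP-> //; apply: connect_trans cp (connect1 rp).
have con j : connected ((V j, E j) : vegraph G).
  apply/andP; split; first by apply/set0Pn; exists s; rewrite inE connect0.
  have to x : connect (R j) s x -> connect (adj ((V j, E j) : vegraph G)) s x.
    case/connectP=> p pp ->; elim/last_ind: p pp => [|p z IHp]; first by move=> _; apply: connect0.
    rewrite last_rcons rcons_path => /andP[pp lz]; apply: connect_trans (IHp pp) (connect1 _).
    by rewrite adjE lz; apply/connectP; exists p.
  have symA : connect_sym (adj ((V j, E j) : vegraph G)) by apply: sym_connect_sym; apply: adj_symm.
  apply/forall_inP => x; rewrite inE => /to sx; apply/forall_inP => z; rewrite inE => /to sz.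
  by apply: connect_trans sz; rewrite symA.
have tree (j : 'I_N) : exists T : vegraph G, (verts T == V j) && (eset T \subset E j) &&
    (is_subgraph T && is_tree T).
  have [E' sub ok] := spanning_tree (sg j (ltn_ord j)) (con j).
  by exists (V j, E'); rewrite eqxx sub.
pose T (j : 'I_N) := xchoose (tree j).
have TP j : [/\ verts (T j) = V j, eset (T j) \subset E j, is_subgraph (T j) & is_tree (T j)].
  by have /andP[/andP[/eqP ? ?] /andP[? ?]] := xchooseP (tree j).
have SV (j : 'I_N) : S \subset V j by apply/subsetP => x xS; rewrite inE; apply: conR.
have inR j x : x \in V j -> x \notin S -> exists z, R j x z.
  rewrite inE => /connectP[p pp ->]; case/lastP: p pp => [|p z]; first by rewrite /= sS.
  by rewrite rcons_path last_rcons => /andP[_ lz] _; exists (last s p); rewrite symR.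
have meet (i j : 'I_N) : i != j -> V i :&: V j = S.
  move=> nij; apply/eqP; rewrite eqEsubset; apply/andP; split; last by rewrite subsetI !SV.
  apply/subsetP => x.
  rewrite in_setI => /andP[xi xj]; apply: contraT => nx.
  have [z xz] := inR i x xi nx; have [w xw] := inR j x xj nx.
  by case/negP: nx; apply: (meetR _ _ _ _ _ (ltn_ord i) (ltn_ord j) xz xw).
have disj (i j : 'I_N) : i != j -> [disjoint E i & E j].
  move=> nij; apply/pred0P => e /=; apply/negP => /andP[/imsetP[[a b]]].
  rewrite inE /= => /andP[ab _] -> /imsetP[[c d]]; rewrite inE /= => /andP[cd _] e'.
  have ab' : R j a b by case: (set2_eq e') => -[-> ->]; rewrite // symR.
  by case/eqP: nij; apply/val_inj; apply: (edgeR _ _ _ _ (ltn_ord i) (ltn_ord j) ab ab').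
have TT (i j : 'I_N) : i != j -> [disjoint eset (T i) & eset (T j)].
  move=> /disj; have [_ Ei _ _] := TP i; have [_ Ej _ _] := TP j.
  by move=> d; apply: disjointWl Ei (disjointWr Ej d).
(* [kappaS] counts a set of trees, so the trees must be distinct. Two equal ones would be edge
   disjoint from themselves, hence without edges, and yet join two points of [S]. *)
have injT : injective T.
  move=> i j eT; apply/eqP; apply: contraT => nij.
  have := TT i j nij; rewrite eT -setI_eq0 setIid => /eqP E0.
  have [VT _ _ /andP[/andP[_ /forall_inP cT] _]] := TP j.
  case/card_gt1P: S2 => x [z [xS zS nxz]].
  have mem u : u \in S -> u \in verts (T j) by rewrite VT; apply: (subsetP (SV j)).
  have /connectP[[|u p] /= pp ez] := forall_inP (cT x (mem x xS)) z (mem z zS).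
    by rewrite ez eqxx in nxz.
  by case/andP: pp; rewrite /adj E0 inE.
pose P := [set T j | j : 'I_N].
have <- : #|P| = N by rewrite card_imset // card_ord.
apply: leq_bigmax_cond; apply/andP; split.
  apply/forall_inP => _ /imsetP[j _ ->]; have [VT _ sgT trT] := TP j.
  by rewrite /tree_connecting sgT trT VT SV.
apply/forall_inP => _ /imsetP[i _ ->]; apply/forall_inP => _ /imsetP[j _ ->].
apply/implyP => nT; have nij : i != j by apply: contraNneq nT => ->.
have [Vi _ _ _] := TP i; have [Vj _ _ _] := TP j.
by rewrite TT // Vi Vj meet // eqxx.
Qed.

End Spanning.

(** * The upper bound *)

Section UpperBound.
Variable G : sgraph.
Implicit Types (H K : vegraph G) (S A : {set G}) (P : {set vegraph G}).

Definition incident H (x : G) : {set G} := [set y | adj H x y].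

Lemma adjC H : symmetric (adj H).
Proof. by move=> x y; rewrite /adj setUC. Qed.

Lemma incident_sedge H x y : is_subgraph H -> y \in incident H x -> sedge x y.
Proof.
case/andP=> /subsetP sub _; rewrite inE => /sub /imsetP[[a b]].
rewrite inE /= => ab /setP eq_xy.
have [] : x \in [set a; b] /\ y \in [set a; b].
  by split; rewrite -eq_xy !inE eqxx ?orbT.
have [] : a \in [set x; y] /\ b \in [set x; y].
  by split; rewrite eq_xy !inE eqxx ?orbT.
rewrite !inE => /orP[] /eqP Ea /orP[] /eqP Eb; subst a b => //.
- by rewrite sedge_irrefl in ab.
- by rewrite sedge_sym.
- by rewrite sedge_irrefl in ab.
Qed.

Lemma incident_trivI S P x H K : internally_disjoint S P ->
  H \in P -> K \in P -> H != K -> [disjoint incident H x & incident K x].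
Proof.
move=> /forall_inP dP HP KP HK; have /forall_inP/(_ K KP) := dP H HP.
rewrite HK /= => /andP[/pred0P d _]; apply/pred0P => y /=.
by rewrite !inE; apply: (d [set x; y]).
Qed.

Lemma connected_closed H A x y : connected H ->
  x \in verts H -> y \in verts H -> x \in A ->
  (forall z, z \in A -> incident H z \subset A) -> y \in A.
Proof.
case/andP=> _ /forall_inP cH xH yH xA clA.
have /forall_inP/(_ y yH) := cH x xH; case/connectP=> p pth Ey; rewrite Ey {y Ey yH}.
elim: p x xA pth {xH} => //= z p IHp x xA /andP[xz pth]; apply: IHp => //.
by apply: (subsetP (clA x xA)); rewrite inE.
Qed.

Lemma incident_gt0 S H x : 1 < #|S| -> x \in S -> tree_connecting S H ->
  0 < #|incident H x|.
Proof.
move=> S1 xS /and3P[_ /andP[cH _] /subsetP SH]; rewrite card_gt0.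
apply/negP => /eqP N0; move: S1; rewrite ltnNge => /negP; apply.
rewrite -(cards1 x); apply/subset_leq_card/subsetP => y yS.
apply: (connected_closed cH (SH x xS) (SH y yS) (set11 x)) => z.
by rewrite inE => /eqP->; rewrite N0 sub0set.
Qed.

(** Edge-disjoint trees use different neighbours of [x], so the pairs of a tree and a neighbour
    inject into the neighbourhood. *)
Lemma sum_incident S P x :
  [forall H in P, tree_connecting S H] -> internally_disjoint S P ->
  \sum_(H in P) #|incident H x| <= #|[set y : G | sedge x y]|.
Proof.
move=> /forall_inP tP dP.
pose pairs := [set p : vegraph G * G | (p.1 \in P) && (p.2 \in incident p.1 x)].
have -> : \sum_(H in P) #|incident H x| = #|pairs|.
  rewrite -sum1_card -[LHS](eq_bigr _ (fun H _ => sum1_card _)) pair_big_dep.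
  by apply: eq_bigl => p; rewrite !inE.
have inj : {in pairs &, injective (@snd (vegraph G) G)}.
  move=> [H y] [K z]; rewrite !inE /= => /andP[HP Hy] /andP[KP Kz] yz; subst z.
  have [-> // | HK] := eqVneq H K.
  have /pred0P/(_ y) := incident_trivI x dP HP KP HK.
  by rewrite /= !inE Hy Kz.
rewrite -(card_in_imset inj); apply/subset_leq_card/subsetP => z /imsetP[[H y] Hy ->].
move: Hy; rewrite !inE /= => /andP[HP Hy].
by have /and3P[sH _ _] := tP H HP; apply: incident_sedge sH _; rewrite inE.
Qed.

Lemma kappaS_adjacent S d x y : 2 < #|S| -> x \in S -> y \in S -> sedge x y ->
  #|[set z : G | sedge x z]| <= d -> #|[set z : G | sedge y z]| <= d ->
  kappaS S <= d.-1.
Proof.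
move=> S2 xS yS xy dx dy; apply/bigmax_leqP => P /andP[tP dP].
have S1 : 1 < #|S| by apply: ltnW.
have ge1 z H : z \in S -> H \in P -> 0 < #|incident H z|.
  by move=> zS HP; apply: incident_gt0 S1 zS _; apply: (forall_inP tP).
rewrite leqNgt; apply/negP => Pd.
(* With more than [d.-1] trees, each having an edge at [z], all the estimates become equalities. *)
have sumE z : z \in S -> #|[set t : G | sedge z t]| <= d ->
    {in P, forall H, #|incident H z| = 1} /\ #|[set t : G | sedge z t]| = #|P|.
  move=> zS dz; have le1 := sum_incident z tP dP.
  have le2 : #|P| <= \sum_(H in P) #|incident H z|.
    by rewrite -sum1_card leq_sum // => H; apply: ge1.
  have Pdz : #|[set t : G | sedge z t]| <= #|P|.
    by apply: leq_trans dz _; case: (d) Pd.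
  have eqs : #|P| = \sum_(H in P) #|incident H z|.
    by apply/eqP; rewrite eqn_leq le2 (leq_trans le1).
  split=> [H HP|]; last by apply/eqP; rewrite eqn_leq Pdz (leq_trans le2).
  apply/eqP; rewrite eqn_leq ge1 // andbT leqNgt; apply/negP => H2.
  have : \sum_(K in P) #|incident K z| > #|P|.
    rewrite (bigD1 H) //= -(sum1_card (mem P)) (bigD1 H) //=.
    rewrite -addSn leq_add // leq_sum // => K /andP[KP _]; exact: ge1.
  by rewrite -eqs ltnn.
have [x1 xP] := sumE x xS dx; have [y1 _] := sumE y yS dy.
(* The neighbours used by the trees exhaust the neighbourhood of [x], so some tree contains the edge
   to [y]. *)
have [H HP xyH] : exists2 H, H \in P & y \in incident H x.
  pose U := \bigcup_(H in P) incident H x.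
  suff /bigcupP[H HP yH] : y \in U by exists H.
  suff -> : U = [set t : G | sedge x t] by rewrite inE.
  apply/eqP; rewrite eqEcard; apply/andP; split.
    apply/bigcupsP => H HP; apply/subsetP => z zH; rewrite inE.
    by have /and3P[sH _ _] := forall_inP tP H HP; apply: incident_sedge sH zH.
  rewrite xP; apply: eq_leq; rewrite -sum1_card.
  have -> : #|U| = \sum_(H in P) #|incident H x|.
    pose f (H : vegraph G) := incident H x.
    rewrite /U -cover_imset.
    have /eqP <- : trivIset (f @: P).
      apply/trivIsetP => A B /imsetP[H HP ->] /imsetP[K KP ->] AB.
      by apply: incident_trivI dP _ _ _ => //; apply: contraNneq AB => ->.
    rewrite big_imset // => H K HP KP /= E; apply/eqP/negPn/negP => HK.
    have := incident_trivI x dP HP KP HK; rewrite -/(f H) -/(f K) E.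
    by rewrite -setI_eq0 setIid -cards_eq0 -E x1.
  by apply: eq_bigr => H HP; rewrite x1.
have Nx : incident H x = [set y].
  by apply/eqP; rewrite eq_sym eqEcard sub1set xyH cards1 x1.
have Ny : incident H y = [set x].
  apply/eqP; rewrite eq_sym eqEcard sub1set cards1 y1 // leqnn andbT.
  by move: xyH; rewrite !inE adjC.
have /and3P[_ /andP[cH _] /subsetP SH] := forall_inP tP H HP.
move: S2; rewrite ltnNge => /negP; apply.
have -> : 2 = #|[set x; y]|.
  by rewrite cards2; case: eqVneq xy => // ->; rewrite sedge_irrefl.
apply/subset_leq_card/subsetP => z zS.
apply: (connected_closed cH (SH x xS) (SH z zS)); first by rewrite !inE eqxx.
by move=> t; rewrite !inE => /orP[]/eqP->; rewrite ?Nx ?Ny sub1set !inE eqxx ?orbT.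
Qed.

End UpperBound.

(** * Permutations as sequences of values *)

(* [lia] is slow in large contexts. *)
Ltac arith :=
  repeat match goal with
  | H : is_true (leq _ _) |- _ => revert H
  | H : is_true (leq _ _ && leq _ _) |- _ => revert H
  | H : is_true (~~ leq _ _) |- _ => revert H
  | H : is_true (@eq_op _ ?a _) |- _ => let t := type of a in unify t nat; revert H
  | H : is_true (~~ (@eq_op _ ?a _)) |- _ => let t := type of a in unify t nat; revert H
  | H : @eq ?t _ _ |- _ => unify t nat; revert H
  end; clear; lia.

Notation vtx := (seq nat).
Implicit Types (s t u : vtx) (S T : seq vtx) (v i j k : nat).

(** Out of range the sequence is left unchanged. For a member with [v] in last position this makes
    the missing direction a trivial one ([top_dir]). *)
Fixpoint sw k s : vtx :=
  match s with
  | a :: s' => if k is k'.+1 then a :: sw k' s'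
               else if s' is b :: r then b :: a :: r else s
  | [::] => [::]
  end.

Definition swadj s t := t \in [seq sw k s | k <- iota 0 (size s).-1].

Lemma size_sw k s : size (sw k s) = size s.
Proof. by elim: k s => [|k IHk] [|a [|b s]] //=; rewrite IHk. Qed.

Lemma perm_sw k s : perm_eq (sw k s) s.
Proof.
elim: k s => [|k IHk] [|a s] //=; last by rewrite perm_cons.
by case: s => [|b r] //; rewrite (perm_catCA [:: b] [:: a]).
Qed.

Lemma swK k s : sw k (sw k s) = s.
Proof. by elim: k s => [|k IHk] [|a [|b s]] //=; rewrite IHk. Qed.

Lemma sw_uniq k s : uniq (sw k s) = uniq s.
Proof. exact: perm_uniq (perm_sw k s). Qed.

Lemma adjP s t : reflect (exists2 k, k.+1 < size s & t = sw k s) (swadj s t).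
Proof.
apply: (iffP mapP) => [[k] | [k lt_k ->]]; last by exists k; rewrite ?mem_iota //; lia.
by rewrite mem_iota => lt_k ->; exists k => //; lia.
Qed.

Lemma adj_sw k s : k.+1 < size s -> swadj s (sw k s).
Proof. by move=> lt_k; apply/adjP; exists k. Qed.

Lemma adj_sym : symmetric swadj.
Proof.
move=> s t; apply/adjP/adjP => -[k lt_k ->]; exists k; rewrite ?size_sw ?swK //.
Qed.

Lemma adj_perm s t : swadj s t -> perm_eq s t.
Proof. by case/adjP=> k _ ->; rewrite perm_sym perm_sw. Qed.

Lemma sw_inj k k' s : uniq s -> k.+1 < size s -> k'.+1 < size s ->
  sw k s = sw k' s -> k = k'.
Proof.
elim: s k k' => [|a s IHs] [|k] [|k'] //=; first last.
- move=> /andP[_ us] lt_k lt_k' [] /(IHs k k' us lt_k lt_k') -> //.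
- by case: s IHs => [|b r] //= _; rewrite inE negb_or => /andP[/andP[/eqP nab _] _] _ _ [].
by case: s IHs => [|b r] //= _; rewrite inE negb_or => /andP[/andP[/eqP nab _] _] _ _ [/esym].
Qed.

Lemma sw_neq k s : uniq s -> k.+1 < size s -> sw k s != s.
Proof.
elim: s k => [|a s IHs] [|k] //=; last first.
  by case/andP=> _ us lt_k; rewrite eqseq_cons eqxx IHs.
case: s IHs => [|b r] //= _; rewrite inE negb_or => /andP[/andP[nab _] _] _.
by rewrite eqseq_cons eq_sym (negPf nab).
Qed.

Lemma adj_neq s t : uniq s -> swadj s t -> s != t.
Proof. by move=> us /adjP[k lt_k ->]; rewrite eq_sym sw_neq. Qed.

(** * Columns and levels: insertion of a value *)

Section Insertion.

Variable v : nat.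

Fixpoint ins k s : vtx :=
  if k is k'.+1 then (if s is a :: s' then a :: ins k' s' else [:: v]) else v :: s.

Lemma size_ins k s : size (ins k s) = (size s).+1.
Proof. by elim: k s => [|k IHk] [|a s] //=; rewrite IHk. Qed.

Lemma rem_ins k s : v \notin s -> rem v (ins k s) = s.
Proof.
elim: k s => [|k IHk] [|a s]; rewrite /= ?eqxx // inE negb_or => /andP[nva ns].
by rewrite eq_sym (negPf nva) IHk.
Qed.

Lemma index_ins k s : v \notin s -> k <= size s -> index v (ins k s) = k.
Proof.
elim: k s => [|k IHk] [|a s]; rewrite /= ?eqxx // inE negb_or => /andP[nva ns] lt_k.
by rewrite eq_sym (negPf nva) IHk.
Qed.

Lemma ins_rem s : v \in s -> ins (index v s) (rem v s) = s.
Proof.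
elim: s => //= a s IHs; case: eqVneq => [-> //|nav]; rewrite inE eq_sym (negPf nav) /=.
by move/IHs=> ->.
Qed.

Lemma insV k s : k < size s -> ins k.+1 s = sw k (ins k s).
Proof. by elim: k s => [|k IHk] [|a s] //= lt_k; rewrite -IHk. Qed.

Lemma insHl k i s : k <= i -> ins k (sw i s) = sw i.+1 (ins k s).
Proof.
elim: k i s => [|k IHk] [|i] [|a [|b s]] //= le_ki; by rewrite IHk.
Qed.

Lemma insHr k i s : i.+1 < k -> i.+1 < size s -> ins k (sw i s) = sw i (ins k s).
Proof.
elim: i k s => [|i IHi] [|k] [|a [|b s]] //=; first by case: k.
by move=> lt_ik lt_is; rewrite -IHi.
Qed.

Lemma adj_insV k s : k < size s -> swadj (ins k s) (ins k.+1 s).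
Proof. by move=> lt_k; rewrite insV // adj_sw // size_ins. Qed.

(** At level [i.+1] the inserted value stands between the two entries to be exchanged; at every
    other level they remain consecutive, shifted by one if the value precedes them. *)
Lemma adj_insH k i s : i.+1 < size s -> k <= size s -> k != i.+1 ->
  swadj (ins k s) (ins k (sw i s)).
Proof.
move=> lt_i le_k ne_k; case: (leqP k i) => [le_ki | lt_ik].
  by rewrite insHl // adj_sw // size_ins.
by rewrite insHr ?adj_sw ?size_ins //; lia.
Qed.

End Insertion.

Section Connectivity.

Variables (A : eqType) (R : rel A).
Implicit Types x y z : A.

(** Sequences do not form a finite type, so [connect] does not apply and the path is given
    explicitly. *)
Definition conn x y := exists2 p, path R x p & last x p = y.

Lemma conn_refl x : conn x x.
Proof. by exists [::]. Qed.

Lemma conn1 x y : R x y -> conn x y.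
Proof. by move=> Rxy; exists [:: y]; rewrite //= Rxy. Qed.

Lemma conn_trans y x z : conn x y -> conn y z -> conn x z.
Proof.
case=> p pp lp [q qq lq]; exists (p ++ q); last by rewrite last_cat lp.
by rewrite cat_path pp lp.
Qed.

Lemma conn_sym : symmetric R -> forall x y, conn x y -> conn y x.
Proof.
move=> symR x y [p pp <-]; exists (rev (belast x p)); last first.
  by case: p {pp} => //= z p; rewrite rev_cons last_rcons.
by rewrite rev_path (eq_path (e' := R)) // => a b; rewrite symR.
Qed.

End Connectivity.

Lemma conn_map (A B : eqType) (R : rel A) (Q : rel B) (f : A -> B) x y :
  (forall a b, R a b -> Q (f a) (f b)) -> conn R x y -> conn Q (f x) (f y).
Proof.
move=> RQ [p pp <-]; exists (map f p); last by rewrite last_map.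
elim: p x pp => //= z p IHp x /andP[Rxz pp]; rewrite RQ //=; exact: IHp.
Qed.

Lemma conn_mono (A : eqType) (R Q : rel A) x y :
  subrel R Q -> conn R x y -> conn Q x y.
Proof. by move=> RQ [p pp lp]; exists p => //; apply: sub_path pp. Qed.

Lemma adj_cons a s t : swadj s t -> swadj (a :: s) (a :: t).
Proof. by case/adjP=> k lt_k ->; apply/adjP; exists k.+1. Qed.

Lemma adj_rcons a s t : swadj s t -> swadj (rcons s a) (rcons t a).
Proof.
case/adjP=> k lt_k ->; apply/adjP; exists k; first by rewrite size_rcons; lia.
elim: k s lt_k => [|k IHk] [|b s] //=; first by case: s.
by rewrite ltnS => /IHk ->.
Qed.

Lemma adj_last2 a b s : swadj (rcons (rcons s a) b) (rcons (rcons s b) a).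
Proof.
elim: s => [|c s IHs] /=; last exact: adj_cons.
by apply/adjP; exists 0.
Qed.

Lemma conn_front a s : a \in s -> conn swadj s (a :: rem a s).
Proof.
elim: s => //= b s IHs; rewrite inE; case: eqVneq => [-> _|nab /= as_]; first exact: conn_refl.
apply: (@conn_trans _ _ (b :: a :: rem a s)).
  by apply: conn_map (IHs as_) => x y; apply: adj_cons.
by apply: conn1; apply/adjP; exists 0.
Qed.

(** Bring the first entry of [t] to the front of [s], then recurse behind it. *)
Lemma perm_conn s t : perm_eq s t -> conn swadj s t.
Proof.
elim: t s => [|a t IHt] s; first by move/perm_nilP->; apply: conn_refl.
move=> st; have as_ : a \in s by rewrite (perm_mem st) mem_head.
apply: conn_trans (conn_front as_) _.
apply: (@conn_map _ _ swadj swadj (cons a)) => [x y|]; first exact: adj_cons.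
by apply: IHt; rewrite -(perm_cons a) (perm_trans _ st) // perm_sym perm_to_rem.
Qed.

Definition adjX (B : pred vtx) s t := [&& swadj s t, ~~ B s & ~~ B t].

Lemma conn_adjX_rcons (B : pred vtx) c s t :
    (forall u, B (rcons u c) = false) -> perm_eq s t ->
  conn (adjX B) (rcons s c) (rcons t c).
Proof.
move=> Bc /perm_conn; apply: (@conn_map _ _ swadj _ (rcons^~ c)) => x y xy.
by rewrite /adjX !Bc adj_rcons.
Qed.

Lemma adjX_sym B : symmetric (adjX B).
Proof. by move=> s t; rewrite /adjX adj_sym; case: (B s); case: (B t). Qed.

(** The permutations with a given last entry [c != a] are connected among themselves and avoid [B].
    Exchanging the last two entries links these copies to each other, and also leads from any
    permutation ending in [a] into one of them. *)
Lemma perm_conn_avoid (B : pred vtx) a base s t :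
    uniq base -> 1 < size base -> (forall u c, c != a -> B (rcons u c) = false) ->
    perm_eq s base -> perm_eq t base -> ~~ B s -> ~~ B t ->
  conn (adjX B) s t.
Proof.
move=> ub lt1 Ba.
have [c cb nca] : exists2 c, c \in base & c != a.
  case: base ub lt1 => [|x [|y b]] //= /andP[xy _] _.
  have [exa|nxa] := eqVneq x a; last by exists x; rewrite ?mem_head.
  exists y; first by rewrite !inE eqxx orbT.
  by apply: contra xy => /eqP eya; rewrite exa -eya mem_head.
pose r := rcons (rem c base) c.
have Pr u d : perm_eq (rcons u d) base -> perm_eq u (rem d base).
  move=> ud; have db : d \in base by rewrite -(perm_mem ud) mem_rcons mem_head.
  by rewrite -(perm_cons d) (perm_trans _ (perm_to_rem db)) // -(perm_rcons d u).
have lastc u : perm_eq (rcons u c) base -> conn (adjX B) (rcons u c) r.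
  by move=> /Pr; apply: conn_adjX_rcons => w; rewrite Ba.
have lastd u d : d != a -> perm_eq (rcons u d) base -> conn (adjX B) (rcons u d) r.
  move=> nda ud; have [edc|ndc] := eqVneq d c.
    by rewrite edc in ud *; apply: lastc.
  have cu : c \in u.
    by move: cb; rewrite -(perm_mem ud) mem_rcons inE eq_sym (negPf ndc).
  apply: (@conn_trans _ _ (rcons (rcons (rem c u) c) d)).
    apply: conn_adjX_rcons => [w|]; first by rewrite Ba.
    by rewrite perm_sym perm_rcons perm_sym perm_to_rem.
  apply: conn_trans (lastc (rcons (rem c u) d) _); last first.
    apply: perm_trans ud; rewrite perm_rcons -cats1 -cat_cons perm_sym perm_rcons.
    by rewrite perm_sym cats1 perm_rcons perm_cons perm_sym perm_to_rem.
  by apply: conn1; rewrite /adjX adj_last2 !Ba.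
suff toR u : perm_eq u base -> ~~ B u -> conn (adjX B) u r.
  move=> sb tb Bs Bt; apply: conn_trans (toR s sb Bs) _.
  by apply: conn_sym; [apply: adjX_sym | apply: toR].
case/lastP: u => [|u d] ub'; first by move: lt1; rewrite -(perm_size ub').
have [eda|nda] := eqVneq d a; last by move=> _; apply: lastd.
rewrite eda in ub' * => Bu {d eda}.
case/lastP: u ub' Bu => [|u d] ub' Bu; first by move: lt1; rewrite -(perm_size ub').
have nda : d != a.
  have := ub; rewrite -(perm_uniq ub') !rcons_uniq mem_rcons inE negb_or eq_sym.
  by case/andP=> /andP[].
apply: (@conn_trans _ _ (rcons (rcons u a) d)).
  by apply: conn1; rewrite /adjX adj_last2 Bu Ba.
apply: lastd => //; apply: perm_trans ub'; exact: adj_perm (adj_last2 _ _ _).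
Qed.

(** * Lifting a colouring through the insertion of a value *)

(** At least one end has colour [j], so an edge inside [S] belongs to no class; such edges enter
    only through exemptions. *)
Definition ecol (F : vtx -> nat) S j : rel vtx := fun s t =>
  [&& swadj s t, (F s == j) || (F t == j), (F s == j) || (s \in S)
    & (F t == j) || (t \in S)].

Lemma ecol_sym F S j : symmetric (ecol F S j).
Proof.
by move=> s t; rewrite /ecol adj_sym orbC; congr (_ && (_ && _)); rewrite andbC.
Qed.

(* At an exempt pair (vertex, colour) the tree of this colour uses edges inside [S]. *)
Inductive exempt_ok S : seq (vtx * nat) -> Prop :=
| ExNone : exempt_ok S [::]
| ExMid y x w j of y \in S & x \in S & w \in S & x != w & swadj y x & swadj y w :
    exempt_ok S [:: (y, j)]
| ExPath a b c d j of perm_eq S [:: a; b; c; d] & swadj a b & swadj b c & swadj c d :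
    exempt_ok S [:: (a, j); (b, j); (c, j); (d, j)]
| ExStar c x y z i j of perm_eq S [:: c; x; y; z] & swadj c x & swadj c y & swadj c z
    & i != j : exempt_ok S [:: (c, i); (c, j)].

Definition coloring_of N S F (ex : seq (vtx * nat)) :=
  (forall s, s \in S -> N <= F s) /\
  forall j s t, j < N -> s \in S -> t \in S -> (s, j) \notin ex ->
    (t, j) \notin ex -> conn (ecol F S j) s t.

Definition good N S := exists F ex, exempt_ok S ex /\ coloring_of N S F ex.

(* Deleting the value [v] turns a permutation of [v :: base] into its column (a
   permutation of [base]) and its level (the position of [v]).  A colouring [f] of
   the columns around [T] extends constantly along each column; level 0 becomes a
   new colour class and [h] colours the columns lying in [T]. *)
Record liftable v base S T (f : vtx -> nat) : Prop := Liftable {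
  lift_uniq : uniq (v :: base);
  lift_perm : forall s, s \in S -> perm_eq s (v :: base);
  lift_pos : forall s, s \in S -> 0 < index v s;
  lift_col : forall s, s \in S -> rem v s \in T;
  lift_colperm : forall s, s \in T -> perm_eq s base;
  lift_free : forall s, s \in T -> (size base).-2 <= f s }.

Section Lift.

Variables (v : nat) (base : vtx) (S T : seq vtx).
Variables (f : vtx -> nat) (h : vtx -> nat -> nat) (B : pred vtx).
Local Notation m := (size base).
Local Notation ext := m.-2.
Local Notation pr := (rem v).
Local Notation lv := (index v).

Hypothesis L : liftable v base S T f.
Let ub := lift_uniq L.
Let S_perm := lift_perm L.
Let S_lv := lift_pos L.
Let S_T := lift_col L.
Let T_perm := lift_colperm L.
Let T_f := lift_free L.

Set Default Proof Using "All".

(** Permutations of [v :: base] have [m.+1] entries, so [m.-1] colours are wanted: the old ones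
    below [ext], and the new colour [ext]; the value [m] means no colour. [h] can be chosen freely
    on the columns of [T], and [B] marks columns that keep their old colour at level 0 because a
    detour passes there. *)
Definition lcol s :=
  if s \in S then m else
  if pr s \in T then h (pr s) (lv s) else
  if lv s == 0 then (if B (pr s) && (f (pr s) < ext) then f (pr s) else ext) else
  if f (pr s) < ext then f (pr s) else m.

Local Notation E := (ecol lcol S).

Lemma notin_base s : perm_eq s base -> v \notin s.
Proof. by move/perm_mem->; case/andP: ub. Qed.

Lemma S_ins s : s \in S -> ins v (lv s) (pr s) = s.
Proof. by move=> /S_perm/perm_mem Ps; rewrite ins_rem // Ps mem_head. Qed.

Lemma pr_perm s : s \in S -> perm_eq (pr s) base.
Proof.
move=> /S_perm Ps; rewrite -(perm_cons v) (perm_trans _ Ps) // perm_sym perm_to_rem //.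
by rewrite (perm_mem Ps) mem_head.
Qed.

Lemma lv_le s : s \in S -> lv s <= m.
Proof.
move=> /S_perm Ps; have := perm_size Ps; rewrite /= => sz.
by rewrite -ltnS -sz index_mem (perm_mem Ps) mem_head.
Qed.

Lemma size_base s : perm_eq s base -> size s = m.
Proof. exact: perm_size. Qed.

Lemma lcol_S s : s \in S -> lcol s = m.
Proof. by rewrite /lcol => ->. Qed.

Lemma lcol_T s k : perm_eq s base -> k <= m -> s \in T -> ins v k s \notin S ->
  lcol (ins v k s) = h s k.
Proof.
move=> Ps le_k sT nS; have nv := notin_base Ps.
by rewrite /lcol (negPf nS) rem_ins ?index_ins ?sT // (size_base Ps).
Qed.

Lemma ins_notinT s k : perm_eq s base -> s \notin T -> ins v k s \notin S.
Proof.
by move=> /notin_base nv; apply: contra => /S_T; rewrite rem_ins.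
Qed.

Lemma lcol_col s k : perm_eq s base -> 0 < k <= m -> s \notin T -> f s < ext ->
  lcol (ins v k s) = f s.
Proof.
move=> Ps /andP[k_gt0 le_k] nsT lt_fs; have nv := notin_base Ps.
rewrite /lcol (negPf (ins_notinT k Ps nsT)) rem_ins ?index_ins ?(size_base Ps) //.
by rewrite (negPf nsT) lt_fs; case: k k_gt0 {le_k}.
Qed.

Lemma lcol_bot s : perm_eq s base -> s \notin T -> ~~ B s -> lcol (ins v 0 s) = ext.
Proof.
move=> Ps nsT nB; have nv := notin_base Ps.
by rewrite /lcol (negPf (ins_notinT 0 Ps nsT)) rem_ins ?index_ins // (negPf nsT) (negPf nB).
Qed.

Lemma lcol_botB s : perm_eq s base -> s \notin T -> B s -> f s < ext ->
  lcol (ins v 0 s) = f s.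
Proof.
move=> Ps nsT nB fs; have nv := notin_base Ps.
rewrite /lcol (negPf (ins_notinT 0 Ps nsT)) rem_ins ?index_ins //.
by rewrite (negPf nsT) nB fs.
Qed.

Lemma lift_sym j s t : conn (E j) s t -> conn (E j) t s.
Proof. by apply: conn_sym; apply: ecol_sym. Qed.

Lemma lift_edge j s t : swadj s t -> lcol s = j -> lcol t = j \/ t \in S -> conn (E j) s t.
Proof.
move=> st sj tj; apply: conn1; rewrite /ecol st sj eqxx /=.
by case: tj => ->; rewrite ?eqxx ?orbT.
Qed.

Lemma segment j s a b : perm_eq s base -> a <= b <= m ->
  (forall i, a <= i <= b -> lcol (ins v i s) = j) -> conn (E j) (ins v a s) (ins v b s).
Proof.
move=> Ps; elim: b => [|b IHb] /andP[le_ab le_b] cj.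
  have -> : a = 0 by lia.
  exact: conn_refl.
have [->|ne] := eqVneq a b.+1; first exact: conn_refl.
have lt_ab : a <= b by lia.
apply: conn_trans (IHb _ _) _; first by lia.
  by move=> i /andP[? ?]; apply: cj; lia.
apply: lift_edge; first by apply: adj_insV; rewrite (size_base Ps).
  by apply: cj; lia.
by left; apply: cj; lia.
Qed.

Lemma column s k : perm_eq s base -> 0 < k <= m -> s \notin T -> f s < ext ->
  conn (E (f s)) (ins v k s) (ins v m s).
Proof.
move=> Ps /andP[k0 km] nsT fs; apply: segment; rewrite ?km ?leqnn // => i /andP[? ?].
by apply: lcol_col => //; lia.
Qed.

(** Crossing at the level of the member itself: [lv s != i.+1] says that [v] does not stand between
    the entries exchanged. *)
Lemma direct j s i : s \in S -> i.+1 < m -> lv s != i.+1 -> sw i (pr s) \notin T ->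
  f (sw i (pr s)) = j -> j < ext -> conn (E j) s (ins v m (sw i (pr s))).
Proof.
move=> sS lt_i ne nT fj lt_j.
have Ps := pr_perm sS; have Pi : perm_eq (sw i (pr s)) base.
  by rewrite (perm_trans (perm_sw _ _)).
have lv1 : 0 < lv s <= m by rewrite S_lv // lv_le.
rewrite -fj; apply: (@conn_trans _ _ (ins v (lv s) (sw i (pr s)))); last first.
  by apply: column; rewrite // fj.
apply: lift_sym; apply: lift_edge; first by rewrite adj_sym -{1}(S_ins sS) adj_insH // (size_base
    Ps) // lv_le.
  by rewrite lcol_col // fj.
by right.
Qed.

(* [detour s] : the only direction in which [s] fails to reach its column. *)
Definition detour s := forall i, lv s = i.+1 -> i.+1 < m -> sw i (pr s) \notin T ->
  f (sw i (pr s)) < ext ->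
  (ins v i.+2 (pr s) \notin S /\ h (pr s) i.+2 = f (sw i (pr s))) \/
  [/\ ins v i (pr s) \notin S, h (pr s) i = f (sw i (pr s)) & (i == 0) ==> B (sw i (pr s))].

(** In the missing direction, move within the own column to the level [i.+2] or [i] that [detour]
    provides with colour [j], cross there, and follow the neighbouring column to its top. *)
Lemma contact j s i : s \in S -> detour s -> i.+1 < m -> sw i (pr s) \notin T ->
  f (sw i (pr s)) = j -> j < ext -> conn (E j) s (ins v m (sw i (pr s))).
Proof.
move=> sS dt lt_i nT fj lt_j.
have [e|ne] := eqVneq (lv s) i.+1; last exact: direct.
have Ps := pr_perm sS; have Pi : perm_eq (sw i (pr s)) base.
  by rewrite (perm_trans (perm_sw _ _)).
have szp := size_base Ps; have sT := S_T sS.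
have es := S_ins sS; rewrite e in es.
case: (dt i e lt_i nT); first by rewrite fj.
- case=> nS hi; have lt2 : i.+2 <= m by [].
  apply: (@conn_trans _ _ (ins v i.+2 (pr s))).
    apply: lift_sym; apply: lift_edge; last by right.
      by rewrite adj_sym; have := @adj_insV v i.+1 (pr s); rewrite es szp; apply.
    by rewrite lcol_T // hi.
  apply: (@conn_trans _ _ (ins v i.+2 (sw i (pr s)))).
    apply: lift_edge; first by rewrite adj_insH ?szp // eqn_leq ltnn.
      by rewrite lcol_T // hi.
    by left; rewrite lcol_col // fj.
  by rewrite -fj; apply: column => //; rewrite fj.
case=> nS hi Bi.
(* At level 0 the neighbouring column has its old colour only because [B] holds there. *)
have bi : lcol (ins v i (sw i (pr s))) = j.
  case: (posnP i) Bi => [i0 /= Bi|ip _]; last by rewrite lcol_col ?fj // ip ltnW // ltnW.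
  by rewrite {1}i0 lcol_botB // fj.
apply: (@conn_trans _ _ (ins v i (pr s))).
  apply: lift_sym; apply: lift_edge; last by right.
    by have := @adj_insV v i (pr s); rewrite es szp; apply; lia.
  by rewrite lcol_T // ?hi //; lia.
apply: (@conn_trans _ _ (ins v i (sw i (pr s)))).
  apply: lift_edge; last by left.
    by rewrite adj_insH ?szp //; [lia | rewrite neq_ltn ltnSn].
  by rewrite lcol_T // ?hi //; lia.
apply: (@conn_trans _ _ (ins v i.+1 (sw i (pr s)))).
  apply: lift_edge => //; first by apply: adj_insV; rewrite size_sw szp; lia.
  by left; rewrite lcol_col // ?fj //; lia.
by rewrite -fj; apply: column; rewrite ?fj //; lia.
Qed.

(** A path of colour [j] among the columns is followed step by step: an ordinary column is
    represented by its top vertex, a column of [C] by one of its members, and [ct] provides each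
    passage between the two kinds. The condition [pr s != pr t] excludes the empty path, which says
    nothing about two members of one column. *)
Lemma lift_sim j (C : seq vtx) s t : j < ext -> {subset C <= S} ->
    {in C, forall s, forall i, i.+1 < m -> sw i (pr s) \notin T ->
       f (sw i (pr s)) = j -> conn (E j) s (ins v m (sw i (pr s)))} ->
    s \in C -> t \in C -> pr s != pr t ->
    conn (ecol f (map pr C) j) (pr s) (pr t) -> conn (E j) s t.
Proof.
move=> lt_j CS ct sC tC nst.
pose R := map pr C.
have RT a : a \in R -> a \in T by case/mapP=> u /CS uS ->; apply: S_T.
have fR a : a \in R -> (f a == j) = false.
  by move=> /RT/T_f le; apply/eqP=> e; move: le; rewrite e leqNgt lt_j.
pose lft a u := perm_eq a base /\
  ([/\ a \notin T, f a = j & u = ins v m a] \/ [/\ a \in R, u \in C & pr u = a]).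
have step a b u w : ecol f R j a b -> lft a u -> lft b w -> conn (E j) u w.
  case/and4P=> ab fab _ _ [Pa la] [Pb lb].
  have := fab; case: la lb => [[naT fa ->]|[aR uC ea]] [[nbT fb ->]|[bR wC eb]] _.
  - have szab : swadj (ins v m a) (ins v m b).
      case/adjP: ab => k; rewrite (size_base Pa) => lt_k ->.
      by apply: adj_insH; rewrite ?(size_base Pa) //; lia.
    apply: lift_edge szab _ _; last left; rewrite lcol_col ?fa ?fb ?leqnn ?andbT //.
      by case/adjP: ab => k; rewrite (size_base Pa); lia.
    by case/adjP: ab => k; rewrite (size_base Pa); lia.
  - apply: lift_sym; move: ab; rewrite adj_sym -eb => /adjP[i].
    rewrite (size_base (pr_perm (CS _ wC))) => lt_i ea; rewrite ea in naT fa *.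
    exact: ct.
  - move: ab; rewrite -ea => /adjP[i].
    rewrite (size_base (pr_perm (CS _ uC))) => lt_i eb; rewrite eb in nbT fb *.
    exact: ct.
  - by move: fab; rewrite !fR.
have stepE a b : ecol f R j a b -> perm_eq a base -> exists w, lft b w.
  case/and4P=> ab fab _ fb Pa; have Pb : perm_eq b base.
    by rewrite (perm_trans _ Pa) // perm_sym adj_perm.
  have [bR|nbR] := boolP (b \in R).
    by have /mapP[w wC ew] := bR; exists w; split=> //; right; split.
  move: fb; rewrite (negPf nbR) orbF => /eqP fb.
  have nbT : b \notin T by apply/negP => /T_f; rewrite fb leqNgt lt_j.
  by exists (ins v m b); split=> //; left.
have lftS u : u \in C -> lft (pr u) u.
  by move=> uC; split; [exact/pr_perm/CS | right; split=> //; apply: map_f].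
case=> p pp lp.
have gen a u b w q : path (ecol f R j) a (b :: q) -> last b q = pr t -> lft a u ->
    lft (pr t) w -> conn (E j) u w.
  elim: q a u b => [|c q IHq] a u b /= /andP[ab]; first by move=> _ eb la lw; apply: step ab la
      _; rewrite eb.
  move=> pq lq la lw; have [x lx] := stepE _ _ ab la.1.
  by apply: conn_trans (step _ _ _ _ ab la lx) _; apply: IHq pq lq lx lw.
case: p pp lp => [_ /= e|b q pq lq]; first by rewrite e eqxx in nst.
by apply: gen pq lq _ _; apply: lftS.
Qed.

Lemma ins_notinS s k : perm_eq s base -> k <= m ->
  (forall u, u \in S -> pr u = s -> lv u != k) -> ins v k s \notin S.
Proof.
move=> Ps le_k nk; have nv := notin_base Ps; apply/negP=> /nk.
by rewrite rem_ins // index_ins ?(size_base Ps) // eqxx => /(_ erefl).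
Qed.

(** Level 0 is a copy of the graph on [base]. The bottoms withheld from the new class are contained
    in [X]; they all end in the same entry [x], so [perm_conn_avoid] applies. *)
Lemma ext_bottom (X : pred vtx) x : 1 < m ->
    (forall u c, c != x -> X (rcons u c) = false) ->
    (forall s, perm_eq s base -> ~~ X s -> lcol (ins v 0 s) = ext) ->
  forall s t, perm_eq s base -> perm_eq t base -> ~~ X s -> ~~ X t ->
  conn (E ext) (ins v 0 s) (ins v 0 t).
Proof.
move=> m1 Xx Xe s t Ps Pt nXs nXt.
have ub' : uniq base by case/andP: ub.
have [p pp lp] := perm_conn_avoid ub' m1 Xx Ps Pt nXs nXt.
rewrite -{}lp {t Pt nXt}; elim: p s Ps nXs pp => [|b p IHp] s Ps nXs /=.
  by move=> _; apply: conn_refl.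
case/andP=> /and3P[sb _ nXb] pp; have Pb : perm_eq b base.
  by rewrite (perm_trans _ Ps) // perm_sym adj_perm.
apply: conn_trans (IHp b Pb nXb pp); apply: lift_edge; rewrite ?Xe //; last by left.
exact: adj_cons.
Qed.

(** The upward detour is available: the missing direction at level [l] is [sw l.-1], and the level
    above the member carries the colour found there. *)
Definition plain s := h (pr s) (lv s).+1 = f (sw (lv s).-1 (pr s)) /\
  (lv s < m -> ins v (lv s).+1 (pr s) \notin S).

Lemma plain_detour s : s \in S -> plain s -> detour s.
Proof. by move=> sS [hs ns] i e lt_i nT _; left; move: hs ns; rewrite e => -> ns; split=> //;
    apply: ns. Qed.

(** All levels below the member are free and of the new colour, so that it can descend to level
    0. *)
Definition sinks s := forall i, i < lv s -> h (pr s) i = ext /\ ins v i (pr s) \notin S.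

Lemma sinks_ext s : s \in S -> sinks s -> conn (E ext) s (ins v 0 (pr s)).
Proof.
move=> sS sk; have Ps := pr_perm sS; have lv0 := S_lv sS; have le_m := lv_le sS.
have ce i : i < lv s -> lcol (ins v i (pr s)) = ext.
  by move=> lt_i; have [hi ni] := sk i lt_i; rewrite lcol_T // ?S_T // ltnW // (leq_trans lt_i).
apply: (@conn_trans _ _ (ins v (lv s).-1 (pr s))).
  apply: lift_sym; apply: lift_edge; [|by apply: ce; lia|by right].
  have := @adj_insV v (lv s).-1 (pr s); rewrite prednK // S_ins // (size_base Ps).
  by apply; lia.
by apply: lift_sym; apply: segment => //; [lia | move=> i ?; apply: ce; lia].
Qed.

Lemma good_lift ex : 1 < m -> exempt_ok S ex ->
    (forall j s t, j < ext -> s \in S -> t \in S -> (s, j) \notin ex ->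
       (t, j) \notin ex -> conn (E j) s t) ->
    (forall s t, s \in S -> t \in S -> (s, ext) \notin ex ->
       (t, ext) \notin ex -> conn (E ext) s t) ->
  good m.-1 S.
Proof.
move=> m1 okx low up; exists lcol, ex; split=> //; split.
  by move=> s sS; rewrite lcol_S //; lia.
move=> j s t lt_j sS tS ns nt; have [lt_je|ge_je] := ltnP j ext; first exact: low.
have ej : j = ext by lia.
by rewrite ej in ns nt *; apply: up.
Qed.

Unset Default Proof Using.

End Lift.

(* A point of [T] has too few neighbours outside [T] to meet a colour class twice. *)
Lemma color_once N T (f : vtx -> nat) ex d (I0 J : seq nat) e :
    uniq d -> size d = N.+2 -> coloring_of N T f ex -> d \in T ->
    e \in T -> e != d -> (forall j, j \notin J -> (d, j) \notin ex /\ (e, j) \notin ex) ->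
    uniq I0 -> (forall i, i \in I0 -> i < N.+1 /\ sw i d \in T) -> size J < size I0 ->
  forall i1 i2 j, i1 < N.+1 -> i2 < N.+1 -> j < N -> f (sw i1 d) = j -> f (sw i2 d) = j ->
  i1 = i2.
Proof.
move=> ud szd [fT ct] dT eT ned nx uI I0T ltJI i1 i2 j0 lt1 lt2 lt_j0 f1 f2.
apply/eqP/negP => /negP ne12.
have notI0 i : f (sw i d) < N -> i \notin I0.
  by move=> fN; apply/negP => /I0T[_ /fT]; rewrite leqNgt fN.
(* The path of colour [j] from [d] to [e] must leave [d] by a neighbour of this colour. *)
have hit j : j < N -> j \notin J -> exists2 i, i < N.+1 & f (sw i d) = j.
  move=> lt_j nJ; have [nxd nxe] := nx j nJ.
  have [[|b p] /= pp lp] := ct j d e lt_j dT eT nxd nxe.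
    by rewrite lp eqxx in ned.
  case/andP: pp => /and4P[/adjP[i]]; rewrite szd => lt_i ->.
  have -> : (f d == j) = false by apply/eqP => fd; have := fT d dT; rewrite fd leqNgt lt_j.
  by move=> /= /eqP fb _ _ _; exists i => //; lia.
(* If [i1] and [i2] show the same colour, [i2] may be omitted. The remaining directions outside
   [I0], at most [N - size I0] of them, would together with [J] have to account for all [N] colours,
   although [size J < size I0]. *)
pose I : seq nat := [seq i <- iota 0 N.+1 | (i \notin I0) && (i != i2)].
have i2I0 : i2 \notin I0 by apply: notI0; rewrite f2.
have szI : size I + size I0 < N.+1.
  have -> : size I = count (fun i => (i \notin I0) && (i != i2)) (iota 0 N.+1) by rewrite
      size_filter.
  have := count_predC (fun i => (i \notin I0) && (i != i2)) (iota 0 N.+1).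
  rewrite size_iota => szc.
  suff : size (i2 :: I0) <= count (predC (fun i => (i \notin I0) && (i != i2))) (iota 0 N.+1).
    by rewrite [size (_ :: _)]/= => h; move: szc; arith.
  rewrite -size_filter; apply: uniq_leq_size; first by rewrite /= i2I0.
  move=> i; rewrite !inE mem_filter mem_iota /= negb_and !negbK.
  by case/predU1P=> [->|/[dup] iI /I0T[lt_i _]]; rewrite ?eqxx ?iI ?orbT ?lt2.
have sub : {subset iota 0 N <= J ++ [seq f (sw i d) | i <- I]}.
  move=> j; rewrite mem_iota /= add0n mem_cat => lt_j.
  have [//|nJ] := boolP (j \in J); have [i lt_i fi] := hit j lt_j nJ.
  have [ei|ni2] := eqVneq i i2.
    apply/mapP; exists i1; last by rewrite f1 -f2 -ei fi.
    by rewrite mem_filter ne12 mem_iota /= lt1 !andbT notI0 // f1.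
  by apply/mapP; exists i; rewrite // mem_filter ni2 mem_iota notI0 ?fi.
have := uniq_leq_size (iota_uniq 0 N) sub; rewrite size_iota size_cat size_map => le_N.
have le_N' : N <= size J + size I by [].
by clearbody I; clear le_N; arith.
Qed.

(** A simple path of colour [j] passing through a point of [T] outside [R] would enter and leave it
    by two different neighbours of that colour. Hence the paths found for [T] avoid the dummy
    columns. *)
Lemma drop_points T R (f : vtx -> nat) j a b : {subset R <= T} ->
    (forall d, d \in T -> f d != j) -> (forall s, s \in T -> uniq s) ->
    (forall d i1 i2, d \in T -> d \notin R -> i1.+1 < size d -> i2.+1 < size d ->
       f (sw i1 d) = j -> f (sw i2 d) = j -> i1 = i2) ->
    a \in R -> b \in R -> conn (ecol f T j) a b -> conn (ecol f R j) a b.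
Proof.
move=> RT fT uT once aR bR [p0 pp0 lp0].
have {p0 pp0 lp0}[p pp [up lp]] : exists2 p, path (ecol f T j) a p & uniq (a :: p) /\ last a p = b.
  by rewrite -lp0; case/shortenP: pp0 => p pp up _; exists p.
suff inR s : s \in a :: p -> s \in T -> s \in R.
  exists p => //; apply: (sub_in_path (P := mem (a :: p))) pp; last exact/allP.
  move=> x c xp cp /and4P[xc fxc fx fc]; apply/and4P; split=> //.
    by case/orP: fx => [->//|xT]; rewrite inR ?orbT.
  by case/orP: fc => [->//|cT]; rewrite inR ?orbT.
move=> si sT; apply/negP => /negP nsR.
have nsa : s != a by apply: contraNneq nsR => ->.
have nsb : s != b by apply: contraNneq nsR => ->.
move: si; rewrite inE (negPf nsa) /= => sp.
have [p1 [p2 ep]] : exists p1 p2, p = p1 ++ s :: p2.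
  by case/splitPr: sp => p1 p2; exists p1, p2.
case: p2 ep => [|c p2] ep.
  by move: lp nsb; rewrite ep last_cat /= => ->; rewrite eqxx.
move: up; rewrite ep -cat_cons cat_uniq => /and3P[_ /hasPn nh _].
move: pp; rewrite ep cat_path /= => /and4P[_ exs esc _].
set x := last a p1 in exs *.
have xin : x \in a :: p1 by apply: mem_last.
have ncx : c != x by apply: contraTneq xin => <-; apply: nh; rewrite !inE eqxx orbT.
have fs : (f s == j) = false by apply: negbTE; apply: fT.
case/and4P: exs; rewrite fs orbF => xs /eqP fx _ _.
case/and4P: esc; rewrite fs /= => sc /eqP fc _ _.
move: xs; rewrite adj_sym => /adjP[i1 lt1 ex]; case/adjP: sc => i2 lt2 ec.
case/eqP: ncx; rewrite ex ec (once s i1 i2) //; first by rewrite -ex.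
by rewrite -ec.
Qed.

(** Every kind of exemption involves a point with two neighbours in the set. *)
Lemma good_pure N T : good N T -> uniq T ->
    (forall y x w, y \in T -> x \in T -> w \in T -> x != w -> swadj y x -> swadj y w -> False) ->
  exists f, coloring_of N T f [::].
Proof.
case=> f [ex [okx cf]] uT no2.
case: okx cf => [|y x w j yT xT wT nxw yx yw|a b c d j PT ab bc cd|c x y z i j PT cx cy _ _] cf.
- by exists f.
- by case: (no2 y x w).
- have := uT; rewrite (perm_uniq PT) /= !inE !negb_or => /andP[/and3P[_ nac _] _].
  by case: (no2 b a c); rewrite ?(perm_mem PT) ?inE ?eqxx ?orbT // adj_sym.
have := uT; rewrite (perm_uniq PT) /= !inE !negb_or => /and3P[_ /andP[nxy _] _].
by case: (no2 c x y); rewrite ?(perm_mem PT) ?inE ?eqxx ?orbT.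
Qed.

Lemma coloring_exW N T f ex ex' : {subset ex <= ex'} ->
  coloring_of N T f ex -> coloring_of N T f ex'.
Proof.
move=> sub [fT ct]; split=> // j s t lt_j sT tT ns nt.
by apply: ct => //; [apply: contra ns | apply: contra nt]; apply: sub.
Qed.

Lemma uniq_map_inj (A B : eqType) (g : A -> B) r : uniq (map g r) -> {in r &, injective g}.
Proof.
elim: r => //= a r IHr /andP[na ur] x y; rewrite !inE.
case/predU1P=> [->|xr] /predU1P[->|yr] // e; last exact: IHr.
  by case/negP: na; rewrite e map_f.
by case/negP: na; rewrite -e map_f.
Qed.

Lemma rem_perm v base s : perm_eq s (v :: base) -> perm_eq (rem v s) base.
Proof.
move=> Ps; rewrite -(perm_cons v) (perm_trans _ Ps) // perm_sym perm_to_rem //.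
by rewrite (perm_mem Ps) mem_head.
Qed.

Definition section (v : nat) S (a : vtx) := nth [::] S (find (fun s => rem v s == a) S).

Lemma sectionK v S s : uniq (map (rem v) S) -> s \in S -> section v S (rem v s) = s.
Proof.
move=> uS sS; have hs : has (fun t => rem v t == rem v s) S by apply/hasP; exists s.
apply: (uniq_map_inj uS) => //; first by rewrite mem_nth // -has_find.
exact/eqP/(nth_find [::] hs).
Qed.

(** * Lifting when all columns are distinct *)

Section Basic.

Variables (v : nat) (base : vtx) (S : seq vtx).
Local Notation m := (size base).
Local Notation pr := (rem v).
Local Notation lv := (index v).
Hypothesis ub : uniq (v :: base).
Hypothesis S_perm : forall s, s \in S -> perm_eq s (v :: base).
Hypothesis S_lv : forall s, s \in S -> 0 < lv s.
Hypothesis m1 : 1 < m.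
Hypothesis uS : uniq (map pr S).

(** The function [h] gives the part of a column below its member to the new class and the part above
    to the colour of the missing direction. Every member is then both [plain] and [sinks], and
    exemptions are inherited from the columns. *)
Lemma basic_lift f ex0 ex : coloring_of m.-2 (map pr S) f ex0 -> exempt_ok S ex ->
    (forall s j, s \in S -> (pr s, j) \in ex0 -> (s, j) \in ex) ->
  good m.-1 S.
Proof.
move=> [fT ct] okx exs; pose g := section v S.
have inS : {in S &, injective pr} by apply: uniq_map_inj.
have gK s : s \in S -> g (pr s) = s by apply: sectionK.
pose h a i := let s := g a in if i < lv s then m.-2 else f (sw (lv s).-1 a).
have L : liftable v base S (map pr S) f.
  split=> //; first exact: map_f.
  by move=> s /mapP[t tS ->]; apply/rem_perm/S_perm.
have nS s i : s \in S -> i <= m -> i != lv s -> ins v i (pr s) \notin S.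
  move=> sS le_i ni; apply: (ins_notinS h pred0 L (pr_perm h pred0 L sS) le_i) => u uS' eu.
  by rewrite -(gK u uS') eu gK // eq_sym.
have pl s : s \in S -> plain v base S f h s.
  move=> sS; split; first by rewrite /h gK // ltnNge leqnSn.
  by move=> lt_s; apply: nS => //; rewrite neq_ltn ltnSn orbT.
have sk s : s \in S -> sinks v base S h s.
  move=> sS i lt_i; split; first by rewrite /h gK // lt_i.
  by apply: nS => //; [have := lv_le h pred0 L sS; lia | rewrite neq_ltn lt_i].
apply: (good_lift (h := h) (B := pred0) L m1 okx).
- move=> j s t lt_j sS tS ns nt; have [->|nst] := eqVneq s t; first exact: conn_refl.
  apply: (lift_sim L lt_j (C := S)) => //.
  + by move=> u uS' i lt_i nT fj; apply: (contact L) => //; apply: (plain_detour _ L) (pl u uS').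
  + by apply: contraNneq nst => /inS ->.
  by apply: ct; rewrite ?map_f //; [apply: contra ns | apply: contra nt]; apply: exs.
move=> s t sS tS _ _; apply: conn_trans (sinks_ext _ L sS (sk s sS)) _.
apply: conn_trans (lift_sym L (sinks_ext _ L tS (sk t tS))).
apply: (ext_bottom L (X := pred0) (x := 0)) => //; try exact: (pr_perm h pred0 L).
move=> a Pa _; have [aT|naT] := boolP (a \in map pr S); last exact: (lcol_bot _ L).
case/mapP: aT => u uS' ->; have [h0 n0] := sk u uS' 0 (S_lv uS').
by rewrite (lcol_T _ _ L) ?map_f ?(pr_perm h pred0 L).
Qed.

End Basic.

Lemma dummy_once N T (f : vtx -> nat) p i d e i0 :
    coloring_of N T f [:: (p, i)] -> uniq d -> size d = N.+2 ->
    d \in T -> d != p -> e \in T -> e != d -> e != p -> i0 < N.+1 -> sw i0 d \in T ->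
  forall i1 i2 j, i1 < N.+1 -> i2 < N.+1 -> j < N -> f (sw i1 d) = j -> f (sw i2 d) = j ->
  i1 = i2.
Proof.
move=> cf ud szd dT ndp eT ned nep lt0 s0T i1 i2 j lt1 lt2 lt_j f1 f2.
apply: (color_once (I0 := [:: i0]) (J := [::]) ud szd cf dT eT ned _ _ _ _ lt1 lt2 lt_j f1 f2) =>
    //.
  by move=> k _; rewrite !inE !xpair_eqE !negb_and ndp nep.
by move=> k; rewrite inE => /eqP->.
Qed.

(** * Combining local connections into a colouring *)

Section Assembly.

Variables (v : nat) (base : vtx) (S T : seq vtx).
Variables (f : vtx -> nat) (h : vtx -> nat -> nat) (B : pred vtx).
Local Notation m := (size base).
Local Notation ext := m.-2.
Local Notation pr := (rem v).
Local Notation lv := (index v).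
Local Notation E := (ecol (lcol v base S T f h B) S).
Hypothesis L : liftable v base S T f.

(** Common end of the lifts below, where the colouring of the columns may be exempt at one pair
    [(p, i)]. Paths found for [T] are freed of dummy columns by [drop_points]; members of column [p]
    first step over to another column within colour [i]; two members of one column are joined
    through a third member elsewhere. *)
Lemma assemble ex p i r0 : 1 < m -> exempt_ok S ex -> coloring_of ext T f [:: (p, i)] ->
    (forall d, d \in T -> d \notin map pr S -> forall i1 i2 j, i1 < m.-1 -> i2 < m.-1 ->
       j < ext -> f (sw i1 d) = j -> f (sw i2 d) = j -> i1 = i2) ->
    (forall s j, s \in S -> j < ext -> (s, j) \notin ex -> forall k, k.+1 < m ->
       sw k (pr s) \notin T -> f (sw k (pr s)) = j -> conn (E j) s (ins v m (sw k (pr s)))) ->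
    (forall s j, s \in S -> j < ext -> exists2 u, u \in S & pr u = pr s /\ (u, j) \notin ex) ->
    (forall s, s \in S -> exists2 u, u \in S & [/\ pr u != pr s, pr u != p &
       forall j, j < ext -> (u, j) \notin ex]) ->
    (forall s, s \in S -> pr s = p -> i < ext -> (s, i) \notin ex ->
       exists2 u, u \in S & [/\ pr u != p, (u, i) \notin ex & conn (E i) s u]) ->
    (forall s, s \in S -> (s, ext) \notin ex -> conn (E ext) s r0) ->
  good m.-1 S.
Proof.
move=> m1 okx cf once ct rep third bridge extc.
have [Tf ctf] := cf.
apply: (good_lift L m1 okx) => [j s t lt_j sS tS ns nt|s t sS tS ns nt]; last first.
  exact: conn_trans (extc s sS ns) (lift_sym L (extc t tS nt)).
pose C := [seq u <- S | (u, j) \notin ex].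
have CS : {subset C <= S} by move=> u; rewrite mem_filter => /andP[].
have inC u : u \in S -> (u, j) \notin ex -> u \in C by rewrite mem_filter => -> ->.
have CE : map pr C =i map pr S.
  move=> a; apply/mapP/mapP => -[u uC ->]; first by exists u => //; apply: CS.
  by have [w wS [ew nw]] := rep u j uC lt_j; exists w; rewrite ?ew // inC.
have main a b : a \in C -> b \in C -> pr a != pr b ->
    (pr a == p) && (i == j) = false -> (pr b == p) && (i == j) = false -> conn (E j) a b.
  move=> aC bC nab na nb; apply: (lift_sim L lt_j CS) => //.
    move=> u uC k lt_k nT fk; apply: ct => //; first exact: CS.
    by move: uC; rewrite mem_filter => /andP[].
  have aT := lift_col L (CS _ aC); have bT := lift_col L (CS _ bC).
  apply: (drop_points (T := T)); rewrite ?map_f //.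
  - by move=> c /mapP[u /CS uS ->]; apply: lift_col L u uS.
  - by move=> d /(lift_free L) fd; apply: contraTneq fd => ->; rewrite -ltnNge.
  - by move=> c /(lift_colperm L)/perm_uniq->; have /andP[] := lift_uniq L.
  - move=> d i1 i2 dT; rewrite CE => nd; rewrite (perm_size (lift_colperm L dT)) => l1 l2.
    move=> g1 g2; apply: (once d dT nd i1 i2 j) g1 g2 => //; rewrite ltn_predRL //.
  by apply: ctf; rewrite // inE xpair_eqE eq_sym [j == i]eq_sym ?[p == _]eq_sym ?na ?nb.
(* A member for which the colouring of the columns promises nothing is first moved, within its
   colour, out of the exempt column. *)
suff toward a : a \in S -> (a, j) \notin ex -> exists2 u, u \in C &
    (pr u == p) && (i == j) = false /\ conn (E j) a u.
  have [a aC [na sa]] := toward s sS ns; have [b bC [nb tb]] := toward t tS nt.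
  apply: conn_trans sa _; apply: conn_trans (lift_sym L tb).
  have [eab|nab] := eqVneq (pr a) (pr b); last exact: main.
  (* [lift_sim] needs distinct columns, so two members of the same column meet at a third one. *)
  have [w wS [nw nwp nwx]] := third a (CS _ aC).
  have wC := inC w wS (nwx j lt_j).
  have nw' : (pr w == p) && (i == j) = false by rewrite (negPf nwp).
  by apply: (@conn_trans _ _ w); apply: main; rewrite // ?(eq_sym (pr a)) // -eab.
move=> aS na; case: (boolP ((pr a == p) && (i == j))) => [/andP[/eqP ep /eqP ei]|/negPf nai].
  have [u uS [nu nux au]] : exists2 u, u \in S & [/\ pr u != p, (u, j) \notin ex & conn (E j) a u].
    by rewrite -ei; apply: bridge; rewrite ?ei.
  by exists u; rewrite ?inC // (negPf nu).
by exists a; rewrite ?inC //; split=> //; apply: conn_refl.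
Qed.

End Assembly.

Lemma sw_large k s : size s <= k.+1 -> sw k s = s.
Proof. by elim: k s => [|k IHk] [|a [|b s]] //= le; rewrite ?IHk //=; arith. Qed.

Lemma last_sw0 s : 2 < size s -> last 0 (sw 0 s) = last 0 s.
Proof. by case: s => [|a [|b [|c s]]]. Qed.

(** * Replacing an edge of columns that is lost in the lift *)

Section Bridge.

Variables (v : nat) (base : vtx) (S : seq vtx).
Local Notation m := (size base).
Local Notation ext := m.-2.
Local Notation pr := (rem v).
Local Notation lv := (index v).
Hypothesis ub : uniq (v :: base).
Hypothesis S_perm : forall s, s \in S -> perm_eq s (v :: base).
Hypothesis S_lv : forall s, s \in S -> 0 < lv s.
Hypothesis m2 : 2 < m.
Hypothesis uS : uniq (map pr S).

(* Two points [lo], [hi] on adjacent columns but not adjacent themselves: the part of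
   the column of [lo] above [lo] links them inside the colour class [i]. *)
Lemma bridge_lift f p i lo hi c : coloring_of ext (map pr S) f [:: (p, i)] ->
    lo \in S -> hi \in S -> pr lo != pr hi -> (p == pr lo) || (p == pr hi) ->
    c.+1 < m -> pr hi = sw c (pr lo) -> lv lo <= lv hi ->
    (lv lo == lv hi) ==> (lv lo == c.+1) ->
    (forall s, s \in S -> exists2 u, u \in S & pr u != pr s /\ pr u != p) ->
  good m.-1 S.
Proof.
move=> cf loS hiS nlh plh lt_c ehi le_lv unreal third; pose g := section v S.
have m1 : 1 < m by apply: ltnW.
have gK s : s \in S -> g (pr s) = s by apply: sectionK.
pose T := map pr S.
have L : liftable v base S T f.
  split=> //; [exact: map_f | by move=> s /mapP[s' s'S ->]; apply/rem_perm/S_perm | by case: cf].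
pose miss := sw (lv lo).-1 (pr lo) \notin T.
(* Above [lo] its column has colour [i], to make the link with [hi]; a detour of [lo], needed when
   [miss] holds, therefore uses the level just below it. If crossing at the level of [hi] is
   blocked, that is [c.+1 = lv hi], the crossing takes place one level higher, and this level of the
   column of [hi] receives colour [i] as well. *)
pose h a k := if a == pr lo then
    if k < lv lo then (if (k == (lv lo).-1) && miss then f (sw (lv lo).-1 a) else ext) else i
  else if [&& a == pr hi, k == (lv hi).+1 & c == (lv hi).-1] then i
  else let s := g a in if k < lv s then ext else f (sw (lv s).-1 a).
(* When [lo] is at level 1 its detour passes through level 0 of both columns. These two bottoms,
   collected in [X], are lost to the new class. *)
pose B a := [&& miss, lv lo == 1 & a == sw 0 (pr lo)].
pose X a := [&& miss, lv lo == 1 & (a == pr lo) || (a == sw 0 (pr lo))].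
have [lv0 lvm] : 0 < lv lo /\ lv hi <= m by rewrite S_lv // (lv_le h B L).
have prP s : s \in S -> perm_eq (pr s) base by apply: (pr_perm h B L).
have prT s : s \in S -> pr s \in T by apply: map_f.
have lvS s : s \in S -> lv s <= m by apply: (lv_le h B L).
have inS : {in S &, injective pr} by apply: uniq_map_inj.
have nS s k : s \in S -> k <= m -> k != lv s -> ins v k (pr s) \notin S.
  move=> sS le_k nk; apply: (ins_notinS h B L (prP s sS) le_k) => u uS' /inS-> //.
  by rewrite eq_sym.
have col s k : s \in S -> k <= m -> k != lv s ->
    lcol v base S T f h B (ins v k (pr s)) = h (pr s) k.
  by move=> sS le_k nk; rewrite (lcol_T _ _ L) ?prP ?prT ?nS.
have szp s : s \in S -> size (pr s) = m by move=> /prP/perm_size.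
have lvlt : lv lo < m.
  rewrite ltn_neqAle lvS // andbT; apply/eqP => e.
  have e2 : lv lo == lv hi by have := lvS _ hiS; arith.
  by move: unreal; rewrite e2 /=; arith.
have h_plain s k : s \in S -> s != lo -> k < lv s -> h (pr s) k = ext.
  move=> sS nlo lt_k; rewrite /h gK // lt_k.
  have -> : (pr s == pr lo) = false by apply/eqP => /inS e; rewrite e ?eqxx in nlo.
  case: eqP => //= /inS e; case: eqP => //= ek.
  by move: lt_k; rewrite ek e // ltnNge leqnSn.
have dt s : s \in S -> detour v base S T f h B s.
  move=> sS; have [->|nlo] := eqVneq s lo.
    move=> k ek lt_k nT fk; right; have ms : miss by rewrite /miss ek.
    split; first by apply: nS => //; arith.
      by rewrite /h eqxx ek leqnn /= eqxx ms.
    by apply/implyP => /eqP k0; rewrite /B ms ek k0 /= eqxx.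
  move=> k ek lt_k nT fk; left; split; first by apply: nS => //; arith.
  rewrite /h gK //.
  have -> : (pr s == pr lo) = false by apply/eqP => /inS e; rewrite e ?eqxx in nlo.
  rewrite ek ltnNge ltnW //=; case: ifP => // /and3P[/eqP/inS es _ /eqP ec].
  case/negP: nT; rewrite es // ehi ec -(es sS hiS) ek swK; exact: prT.
have bot a : perm_eq a base -> ~~ X a -> lcol v base S T f h B (ins v 0 a) = ext.
  move=> Pa nXa; have [aT|naT] := boolP (a \in T).
    case/mapP: aT nXa => s sS -> nXs; rewrite col ?S_lv //; last by rewrite neq_ltn S_lv.
    have [es|nlo] := eqVneq s lo; last by apply: h_plain => //; apply: S_lv.
    rewrite es /h eqxx lv0; case: ifP => // /andP[/eqP l1 ms].
    by move: nXs; rewrite /X ms es eqxx andbT /= => /eqP; arith.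
  by apply: (lcol_bot _ L) => //; apply: contra nXa => /and3P[ms l1 /eqP->]; rewrite /X ms l1
      eqxx orbT.
have nX s : s \in S -> s != lo -> ~~ X (pr s).
  move=> sS nlo; have nsl : pr s != pr lo by apply: contraNneq nlo => /inS ->.
  rewrite /X (negPf nsl) orFb; apply/negP => /and3P[ms /eqP l1 /eqP e].
  by move: ms; rewrite /miss l1 [_.-1]/= -e prT.
have hin : hi != lo by apply: contraNneq nlh => ->.
have Xr u d : d != last 0 (pr lo) -> X (rcons u d) = false.
  move=> nd; apply/negP => /and3P[_ _ /orP[]/eqP e].
    by rewrite -e last_rcons eqxx in nd.
  by rewrite -last_sw0 ?szp // -e last_rcons eqxx in nd.
have r0 s : s \in S -> ~~ X (pr s) -> conn (ecol (lcol v base S T f h B) S ext) (ins v 0 (pr s))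
    (ins v 0 (pr hi)).
  move=> sS nXs; exact: (ext_bottom L m1 Xr bot (prP s sS) (prP hi hiS) nXs (nX hi hiS hin)).
have sk s : s \in S -> s != lo -> sinks v base S h s.
  by move=> sS nlo k lt_k; split; [apply: h_plain | apply: nS => //; have := lvS s sS; arith].
apply: (assemble L (ex := [::]) (p := p) (i := i) (r0 := ins v 0 (pr hi)) m1 (ExNone S) cf).
- by move=> d dT; rewrite dT.
- by move=> s j sS lt_j _ k lt_k nT fk; apply: (contact L) => //; apply: dt.
- by move=> s j sS _; exists s.
- by move=> s sS; have [w wS [nw nwp]] := third s sS; exists w.
- have lh : conn (ecol (lcol v base S T f h B) S i) lo hi.
    have hlo k : lv lo < k <= m -> lcol v base S T f h B (ins v k (pr lo)) = i.
      move=> /andP[lt_k le_k]; rewrite col // /h; last by arith.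
      by rewrite eqxx ltnNge ltnW.
    have up k : lv lo < k <= m ->
        conn (ecol (lcol v base S T f h B) S i) lo (ins v k (pr lo)).
      move=> lk; apply: (@conn_trans _ _ (ins v (lv lo).+1 (pr lo))).
        apply: (lift_sym L); apply: (lift_edge L); last by right.
          have := @adj_insV v (lv lo) (pr lo); rewrite szp // => /(_ lvlt).
          by rewrite adj_sym (S_ins h B L).
        by apply: hlo; rewrite ltnSn.
      by apply: (segment L); [apply: prP | arith | move=> b ?; apply: hlo; arith].
    have [ec|nc] := eqVneq c.+1 (lv hi).
      have lt2 : lv lo < (lv hi).+1 <= m by rewrite ltnS le_lv -ec.
      apply: conn_trans (up _ lt2) _.
      apply: (@conn_trans _ _ (ins v (lv hi).+1 (pr hi))).
        apply: (lift_edge L); [|exact: hlo|left].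
          by rewrite ehi; apply: adj_insH; rewrite ?szp //; arith.
        rewrite col //; try arith.
        by rewrite /h eq_sym (negPf nlh) eqxx -ec /= !eqxx.
      apply: (lift_edge L); last by right.
        have := @adj_insV v (lv hi) (pr hi); rewrite szp // (S_ins h B L) // adj_sym.
        by apply; arith.
      rewrite col //; try arith.
      by rewrite /h eq_sym (negPf nlh) eqxx -ec /= !eqxx.
    have lth : lv lo < lv hi <= m.
      by rewrite lvS // andbT ltn_neqAle le_lv andbT; apply/negP => e; move: unreal; rewrite e /=
          => /eqP; move/eqP: e; arith.
    apply: conn_trans (up _ lth) _; apply: (lift_edge L); [|exact: hlo|by right].
    rewrite -{2}(S_ins h B L hiS) ehi; apply: adj_insH; rewrite ?szp ?lvS //.
    by rewrite eq_sym.
  move=> s sS es _ _; case/orP: plh => /eqP ep.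
    exists hi => //; split=> //; first by rewrite ep eq_sym.
    by rewrite (inS s lo) // -ep.
  exists lo => //; split=> //; first by rewrite ep.
  by rewrite (inS s hi) // -?ep //; apply: lift_sym.
move=> s sS _; have [->|nlo] := eqVneq s lo; last first.
  by apply: conn_trans (sinks_ext _ L sS (sk s sS nlo)) (r0 s sS _); apply: nX.
have [ms|nms] := boolP miss; last first.
  apply: conn_trans (r0 lo loS _); last by rewrite /X (negPf nms).
  apply: (sinks_ext _ L loS) => k lt_k; split; last by apply: nS => //; arith.
  by rewrite /h eqxx lt_k (negPf nms) andbF.
(* The level below [lo] serves its detour, so [lo] reaches the new class by crossing to the column
   of [hi], which it enters below [hi]. *)
have nc : lv lo != c.+1.
  by apply: contra ms => /eqP e; rewrite e /= -ehi prT.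
have lth : lv lo < lv hi.
  by rewrite ltn_neqAle le_lv andbT; apply: contra nc => e; move: unreal; rewrite e.
have chi k : k < lv hi -> lcol v base S T f h B (ins v k (pr hi)) = ext.
  by move=> lt_k; rewrite col ?h_plain //; arith.
apply: (@conn_trans _ _ (ins v (lv lo) (pr hi))).
  apply: (lift_sym L); apply: (lift_edge L); [|exact: chi|by right].
  rewrite adj_sym -{1}(S_ins h B L loS) ehi; apply: adj_insH; rewrite ?szp //; arith.
apply: (lift_sym L); apply: (segment L); [exact: prP | arith | move=> k ?; apply: chi; arith].
Qed.

End Bridge.

(** * Lifting columns that hold several members *)

Section Collision.

Variables (v : nat) (base : vtx) (S T : seq vtx) (f : vtx -> nat).
Local Notation m := (size base).
Local Notation ext := m.-2.
Local Notation pr := (rem v).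
Local Notation lv := (index v).
Hypothesis L : liftable v base S T f.
Hypothesis m1 : 1 < m.

Definition low a := find (fun k => ins v k a \in S) (iota 0 m.+1).

Lemma low_le s : s \in S -> low (pr s) <= lv s.
Proof.
move=> sS; have le_m := lv_le (fun _ _ => 0) pred0 L sS.
rewrite leqNgt; apply/negP => lt_l; have := before_find 0 lt_l.
by rewrite nth_iota ?ltnS // add0n (S_ins (fun _ _ => 0) pred0 L sS) sS.
Qed.

Lemma low_in s : s \in S -> ins v (low (pr s)) (pr s) \in S.
Proof.
move=> sS; have le_m := lv_le (fun _ _ => 0) pred0 L sS.
have hs : has (fun k => ins v k (pr s) \in S) (iota 0 m.+1).
  by apply/hasP; exists (lv s); rewrite ?mem_iota ?ltnS // (S_ins (fun _ _ => 0) pred0 L sS).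
by have := nth_find 0 hs; rewrite nth_iota // -[X in _ < X](size_iota 0) -has_find.
Qed.

Lemma low_notin a k : k < low a -> ins v k a \notin S.
Proof.
move=> lt_k; have := before_find 0 lt_k; rewrite nth_iota; first by move->.
by rewrite -[X in _ < X](size_iota 0); apply: leq_trans lt_k (find_size _ _).
Qed.

(* The lowest point of a column holding several points of [S] uses the dummy column
   given by its missing direction; this column is left to the new colour. *)
Lemma collision_lift ex p i : exempt_ok S ex -> coloring_of ext T f [:: (p, i)] ->
    p \notin map pr S ->
    (forall d, d \in T -> d \notin map pr S -> forall i1 i2 j, i1 < m.-1 -> i2 < m.-1 ->
       j < ext -> f (sw i1 d) = j -> f (sw i2 d) = j -> i1 = i2) ->
    (forall s, s \in S -> low (pr s) < lv s ->
       sw (low (pr s)).-1 (pr s) \in T /\ sw (low (pr s)).-1 (pr s) \notin map pr S) ->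
    (forall s, s \in S -> [\/ sw (lv s).-1 (pr s) \in T, ins v (lv s).+1 (pr s) \notin S,
       [/\ low (pr s) < lv s, ins v (lv s).-1 (pr s) \notin S &
         ins v (lv s).-2 (pr s) \in S -> sw (lv s).-2.-1 (pr s) \in T] |
       (s, f (sw (lv s).-1 (pr s))) \in ex]) ->
    (forall s j, s \in S -> j < ext -> exists2 u, u \in S & pr u = pr s /\ (u, j) \notin ex) ->
    (forall s, s \in S -> exists2 u, u \in S & pr u != pr s /\
       forall j, j < ext -> (u, j) \notin ex) ->
  good m.-1 S.
Proof.
move=> okx cf npS once dum opts rep third.
(* Dummy columns and the levels below the lowest member go to the new class. A higher level [k] can
   serve the upward detour of a member at level [k.-1], whose missing direction is [sw k.-2], or the
   downward detour of a member at level [k.+1], whose missing direction is [sw k]. The first has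
   priority unless its direction stays in [T]. *)
pose h a k := if a \notin map pr S then ext else if k < low a then ext else
  if (ins v k.-1 a \in S) && (sw k.-2 a \notin T) then f (sw k.-2 a) else f (sw k a).
have prP s : s \in S -> perm_eq (pr s) base by apply: (pr_perm h pred0 L).
have prT s : s \in S -> pr s \in T by apply: lift_col L s.
have lvS s : s \in S -> lv s <= m by apply: (lv_le h pred0 L).
have szp s : s \in S -> size (pr s) = m by move=> /prP/perm_size.
have low0 s : s \in S -> 0 < low (pr s).
  move=> sS; rewrite lt0n; apply/eqP => l0; have := low_in sS; rewrite l0 => i0.
  have := lift_pos L i0; rewrite index_ins //; exact: (notin_base h pred0 L (prP s sS)).
have mapS s : s \in S -> (pr s \notin map pr S) = false by move=> sS; rewrite map_f.
have h_low s k : s \in S -> k < low (pr s) -> h (pr s) k = ext.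
  by move=> sS lt_k; rewrite /h mapS // lt_k.
have dt s j : s \in S -> (s, j) \notin ex -> j < ext -> forall k, k.+1 < m ->
    sw k (pr s) \notin T -> f (sw k (pr s)) = j ->
    conn (ecol (lcol v base S T f h pred0) S j) s (ins v m (sw k (pr s))).
  move=> sS nx lt_j k lt_k nT fk.
  have [e|ne] := eqVneq (lv s) k.+1; last by apply: (direct h pred0 L).
  apply: (contact L) => // k' ek' _ _ _; have {k' ek'}-> : k' = k by arith.
  have sl := low_le sS; have [o|o|[o1 o2 o3]|o] := opts s sS.
  - by rewrite e (negPf nT) in o.
  - left; rewrite e in o; split=> //; rewrite /h mapS // ltnNge.
    by rewrite (leq_trans sl) ?e // [_.-1]/= -e (S_ins h pred0 L sS) sS e /= nT.
  - rewrite e /= in o1 o2 o3; have o0 := low0 s sS; right; split=> //; last by apply/implyP =>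
      /eqP; arith.
    rewrite /h mapS // ltnNge -ltnS o1 /=; case: ifP => // /andP[i1 i2].
    by rewrite o3 in i2.
  by rewrite e /= fk (negPf nx) in o.
have bot a : perm_eq a base -> lcol v base S T f h pred0 (ins v 0 a) = ext.
  move=> Pa; have [aT|naT] := boolP (a \in T); last exact: (lcol_bot _ L).
  have [aS|naS] := boolP (a \in map pr S).
    case/mapP: aS => s sS ->; rewrite (lcol_T _ _ L) ?h_low ?low0 ?prP ?prT //.
    by apply: low_notin; apply: low0.
  rewrite (lcol_T _ _ L) //; first by rewrite /h naS.
  apply: contra naS => /(map_f pr); rewrite rem_ins //; exact: (notin_base h pred0 L Pa).
have r0 a : perm_eq a base ->
    conn (ecol (lcol v base S T f h pred0) S ext) (ins v 0 a) (ins v 0 base).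
  move=> Pa; have X0 u d : d != 0 -> (pred0 : pred vtx) (rcons u d) = false by [].
  exact: (ext_bottom L m1 X0 (fun a Pa _ => bot a Pa) Pa (perm_refl _) isT isT).
have np s : s \in S -> pr s != p by move=> sS; apply: contraNneq npS => <-; apply: map_f.
apply: (assemble L (p := p) (i := i) (r0 := ins v 0 base) m1 okx) => //.
- by move=> s j sS lt_j nx k; apply: dt.
- by move=> s sS; have [u uS [nu nx]] := third s sS; exists u; rewrite ?np.
- by move=> s sS e; have := np s sS; rewrite e eqxx.
move=> s sS _; have sl := low_le sS; have [lt_s|ge_s] := ltnP (low (pr s)) (lv s); last first.
  apply: conn_trans (sinks_ext _ L sS _) (r0 _ (prP s sS)) => k lt_k.
  by split; [apply: h_low | apply: low_notin]; rewrite ?(leq_trans lt_k).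
(* A member above the lowest one crosses to the dummy column, a direction that is blocked only at
   the level of the lowest, and descends there inside the new class. *)
have [dT dS] := dum s sS lt_s; set d := sw _ _ in dT dS.
have o0 := low0 s sS; have le_s := lvS s sS.
have Pd : perm_eq d base by apply: lift_colperm L d dT.
have cd k : k <= m -> lcol v base S T f h pred0 (ins v k d) = ext.
  move=> le_k; rewrite (lcol_T _ _ L) //; first by rewrite /h dS.
  apply: contra dS => /(map_f pr); rewrite rem_ins //; exact: (notin_base h pred0 L Pd).
apply: conn_trans (r0 _ Pd); apply: (@conn_trans _ _ (ins v (lv s) d)).
  apply: (lift_sym L); apply: (lift_edge L); [|exact: cd|by right].
  rewrite adj_sym -{1}(S_ins h pred0 L sS) /d; apply: adj_insH; rewrite ?szp //; arith.
by apply: (lift_sym L); apply: (segment L); [exact: Pd | arith | move=> k ?; apply: cd; arith].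
Qed.

End Collision.

(** * Two members in one column and a third in an adjacent column *)

Section Stacked.

Variables (v : nat) (base : vtx) (x y z w : vtx) (t : nat).
Local Notation m := (size base).
Local Notation ext := m.-2.
Local Notation pr := (rem v).
Local Notation lv := (index v).
Local Notation S := [:: x; y; z; w].

Hypothesis ub : uniq (v :: base).
Hypothesis S_perm : forall s, s \in S -> perm_eq s (v :: base).
Hypothesis S_lv : forall s, s \in S -> 0 < lv s.
Hypothesis m2 : 2 < m.
Hypothesis exy : pr x = pr y.
Hypothesis lt_yx : lv y < lv x.
Hypothesis lt_t : t.+1 < m.
Hypothesis ez : pr z = sw t (pr y).
Hypothesis nwy : pr w != pr y.
Hypothesis nwz : pr w != pr z.

Lemma pr_zy : pr z != pr y.
Proof.
have Py : perm_eq (pr y) base by apply/rem_perm/S_perm; rewrite !inE eqxx orbT.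
rewrite ez sw_neq ?(perm_size Py) //; rewrite (perm_uniq Py).
by case/andP: ub.
Qed.

Lemma notin_stack k s : s \in S -> k <= m ->
    (pr s = pr y -> (k != lv y) && (k != lv x)) ->
    (pr s = pr z -> k != lv z) -> (pr s = pr w -> k != lv w) -> ins v k (pr s) \notin S.
Proof.
move=> sS le_k Hy Hz Hw; have Ps := rem_perm (S_perm sS).
have nv : v \notin pr s by rewrite (perm_mem Ps); case/andP: ub.
apply/negP => iS; have ei := index_ins nv; rewrite (perm_size Ps) in ei.
have := rem_ins k nv; have := ei k le_k; move: iS; rewrite !inE => /or4P[]/eqP-> e1 e2.
- by rewrite exy in e2; have := Hy (esym e2); rewrite e1 eqxx andbF.
- by have := Hy (esym e2); rewrite e1 eqxx.
- by have := Hz (esym e2); rewrite e1 eqxx.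
by have := Hw (esym e2); rewrite e1 eqxx.
Qed.

(** When [x] is immediately above [y], and [z] is lower than [x] or level with it while the crossing
    at this level is blocked, [x] reaches the new class through the part of the column of [z] above
    [z]. That part is then given to the new class, and the detour of [z] goes downwards. *)
Definition zfree := (lv x == (lv y).+1) &&
  ((lv z < lv x) || (lv z == lv x) && (t.+1 == lv x)).

(* [x] above [y] in one column, [z] in an adjacent column: either the missing
   direction of [y] points to the column of [z], or [z] is higher than [y]. *)
Lemma stacked_high f d : coloring_of ext [:: pr y; pr z; pr w; d] f [::] ->
    perm_eq d base -> d \notin [:: pr y; pr z; pr w] ->
    (forall i1 i2 j, i1 < m.-1 -> i2 < m.-1 ->
       j < ext -> f (sw i1 d) = j -> f (sw i2 d) = j -> i1 = i2) ->
    (lv y == t.+1) || (lv y < lv z) ->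
  good m.-1 S.
Proof.
move=> cf Pd nd once yz; set T := [:: pr y; pr z; pr w; d] in cf.
have m1 : 1 < m by apply: ltnW.
have L : liftable v base S T f.
  split=> //; last by case: cf.
    by move=> s; rewrite !inE => /or4P[]/eqP->; rewrite ?exy ?eqxx ?orbT.
  move=> s; rewrite !inE => /or4P[]/eqP-> //; apply/rem_perm/S_perm; rewrite !inE eqxx ?orbT //.
have [xS yS zS wS] : [/\ x \in S, y \in S, z \in S & w \in S] by rewrite !inE !eqxx ?orbT.
have nzy := pr_zy.
pose miss s := sw (lv s).-1 (pr s) \notin T.
pose dc s := f (sw (lv s).-1 (pr s)).
(* The levels between [y] and [x] belong to the new class, so the detour of [y] goes downwards and
   that of [x] upwards. The column of [z] depends on [zfree], and that of [w] follows the pattern of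
   [basic_lift]. *)
pose h a k := if a == pr y then
    if k < lv y then (if (k == (lv y).-1) && miss y then dc y else ext)
    else if k < lv x then ext else if miss x then dc x else ext
  else if a == pr z then
    if k < lv z then (if [&& zfree, miss z & k == (lv z).-1] then dc z else ext)
    else if zfree then ext else dc z
  else if a == pr w then (if k < lv w then ext else dc w) else ext.
pose Bz := [&& zfree, miss z & lv z == 1]; pose By := miss y && (lv y == 1).
pose B a := (Bz && (a == sw 0 (pr z))) || (By && (a == sw 0 (pr y))).
pose X a := (Bz && ((a == pr z) || (a == sw 0 (pr z)))) ||
            (By && ((a == pr y) || (a == sw 0 (pr y)))).
pose lc := lcol v base S T f h B.
have prP s : s \in S -> perm_eq (pr s) base by apply: (pr_perm h B L).
have prT s : s \in S -> pr s \in T by apply: lift_col L s.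
have lvS s : s \in S -> lv s <= m by apply: (lv_le h B L).
have szp s : s \in S -> size (pr s) = m by move=> /prP/perm_size.
have insS s : s \in S -> ins v (lv s) (pr s) = s by apply: (S_ins h B L).
have [y0 z0 w0] : [/\ 0 < lv y, 0 < lv z & 0 < lv w] by rewrite !S_lv.
have [xm ym zm wm] : [/\ lv x <= m, lv y <= m, lv z <= m & lv w <= m] by rewrite !lvS.
have col_y k : k <= m -> (k != lv y) && (k != lv x) -> lc (ins v k (pr y)) = h (pr y) k.
  move=> le_k /andP[n1 n2]; rewrite /lc (lcol_T _ _ L) ?prP ?prT //.
  apply: notin_stack => // [_|e|e]; first by rewrite n1.
    by rewrite e eqxx in nzy.
  by move: nwy; rewrite e eqxx.
have col_z k : k <= m -> k != lv z -> lc (ins v k (pr z)) = h (pr z) k.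
  move=> le_k n1; rewrite /lc (lcol_T _ _ L) ?prP ?prT //.
  apply: notin_stack => // [e|e]; first by rewrite e eqxx in nzy.
  by move: nwz; rewrite e eqxx.
have col_w k : k <= m -> k != lv w -> lc (ins v k (pr w)) = h (pr w) k.
  move=> le_k n1; rewrite /lc (lcol_T _ _ L) ?prP ?prT //.
  apply: notin_stack => // [e|e]; first by move: nwy; rewrite e eqxx.
  by move: nwz; rewrite e eqxx.
have nd' : d \notin map pr S.
  by apply: contra nd; rewrite /= exy !inE => /or4P[]->; rewrite ?orbT.
have col_d k : k <= m -> lc (ins v k d) = ext.
  have dT : d \in T by rewrite !inE eqxx !orbT.
  move=> le_k; rewrite /lc (lcol_T _ _ L) //.
    by move: nd; rewrite !inE !negb_or /h => /and3P[/negPf-> /negPf-> /negPf->].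
  apply: contra nd' => /(map_f pr); rewrite rem_ins //; exact: (notin_base h B L Pd).
have my : lv y = t.+1 -> miss y = false.
  by move=> e; rewrite /miss e /= -ez prT.
have mx : lv x = t.+1 -> miss x = false.
  by move=> e; rewrite /miss e /= exy -ez prT.
have mz : lv z = t.+1 -> miss z = false.
  by move=> e; rewrite /miss e /= ez swK prT.
have hy0 : miss y -> lv y != t.+1 /\ lv y < lv z.
  move=> ms; have ny : lv y != t.+1 by apply/eqP => /my; rewrite ms.
  by split=> //; move: yz; rewrite (negPf ny).
have hz0 : zfree -> miss z -> [/\ lv y = t.+1, lv z != t.+1 & lv z < lv y].
  move=> zf ms; have nz : lv z != t.+1 by apply/eqP => /mz; rewrite ms.
  move: zf => /andP[/eqP ex /orP[lt|/andP[/eqP e1 /eqP e2]]]; last by rewrite e1 e2 eqxx in nz.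
  case/orP: yz => [/eqP e|lt']; last by arith.
  by split=> //; arith.
have cy k : k < lv y -> ~~ miss y -> lc (ins v k (pr y)) = ext.
  move=> lt_k nm; rewrite col_y; [|arith|apply/andP; split; arith].
  by rewrite /h eqxx lt_k (negPf nm) andbF.
have cxy k : lv y < k < lv x -> lc (ins v k (pr y)) = ext.
  move=> /andP[k1 k2]; rewrite col_y; [|arith|apply/andP; split; arith].
  by rewrite /h eqxx ltnNge ltnW // k2.
have cz k : k < lv z -> ~~ (zfree && miss z) -> lc (ins v k (pr z)) = ext.
  move=> lt_k nm; rewrite col_z; [|arith|arith].
  by rewrite /h (negPf nzy) eqxx lt_k andbA (negPf nm).
have czu k : zfree -> lv z < k <= m -> lc (ins v k (pr z)) = ext.
  move=> zf /andP[k1 k2]; rewrite col_z; [|arith|arith].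
  by rewrite /h (negPf nzy) eqxx ltnNge ltnW // zf.
have dt s : s \in S -> detour v base S T f h B s.
  rewrite !inE => /or4P[]/eqP-> k ek lt_k nT _.
  - left; split.
      rewrite exy; apply: notin_stack => // [_|e|e]; last by move: nwy; rewrite e eqxx.
        by apply/andP; split; arith.
      by rewrite e eqxx in nzy.
    rewrite /h exy eqxx /miss /dc ek /= exy -exy nT exy.
    have -> : k.+2 < lv y = false by apply/negP; arith.
    by rewrite ltnNge leqnSn.
  - have ms : miss y by rewrite /miss ek.
    right; split.
    + apply: notin_stack => // [|_|e|e]; first by arith.
        by apply/andP; split; arith.
        by rewrite e eqxx in nzy.
      by move: nwy; rewrite e eqxx.
    + by rewrite /h eqxx ek ltnS leqnn /= eqxx ms /dc ek.
    by apply/implyP => /eqP k0; rewrite /B /By ms ek k0 !eqxx orbT.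
  - have ms : miss z by rewrite /miss ek.
    have [zf|nzf] := boolP zfree; [right|left]; split.
    + apply: notin_stack => // [|e|_|e]; first by arith.
        by rewrite e eqxx in nzy.
        by arith.
      by move: nwz; rewrite e eqxx.
    + by rewrite /h (negPf nzy) eqxx ek ltnS leqnn /= eqxx ms zf /dc ek.
    + by apply/implyP => /eqP k0; rewrite /B /Bz zf ms ek k0 !eqxx.
    + apply: notin_stack => // [e|_|e]; first by rewrite e eqxx in nzy.
        by arith.
      by move: nwz; rewrite e eqxx.
    by rewrite /h (negPf nzy) eqxx ek ltnNge leqnSn (negPf nzf) /dc ek.
  left; split.
    apply: notin_stack => // [e|e|_]; first by move: nwy; rewrite e eqxx.
      by move: nwz; rewrite e eqxx.
    by arith.
  by rewrite /h (negPf nwy) (negPf nwz) eqxx ek ltnNge leqnSn /dc ek.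
(* At most one of [y] and [z] makes its detour through level 0, so all lost bottoms have the same
   last entry, as [ext_bottom] requires. *)
have nBB : By -> ~~ Bz.
  move=> /andP[/hy0[_ lt] /eqP e]; apply/negP => /and3P[_ _ /eqP e2]; arith.
have nXs s : s \in S -> (pr s = pr y -> ~~ By) -> (pr s = pr z -> ~~ Bz) -> ~~ X (pr s).
  move=> sS hy hz; apply/negP => /orP[/andP[bz /orP[]/eqP e]|/andP[by_ /orP[]/eqP e]].
  - by have := hz e; rewrite bz.
  - by case/and3P: bz => _ ms /eqP e1; move: ms; rewrite /miss e1 [_.-1]/= -e prT.
  - by have := hy e; rewrite by_.
  by case/andP: by_ => ms /eqP e1; move: ms; rewrite /miss e1 [_.-1]/= -e prT.
have Xr u c : c != last 0 (if By then pr y else pr z) -> X (rcons u c) = false.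
  move=> nc; apply/negP => /orP[/andP[bz e]|/andP[by_ e]].
    have nby : By = false by apply/negP => /nBB; rewrite bz.
    rewrite nby in nc; case/orP: e => /eqP e; first by rewrite -e last_rcons eqxx in nc.
    by rewrite -last_sw0 ?szp // -e last_rcons eqxx in nc.
  rewrite by_ in nc; case/orP: e => /eqP e; first by rewrite -e last_rcons eqxx in nc.
  by rewrite -last_sw0 ?szp // -e last_rcons eqxx in nc.
have bot a : perm_eq a base -> ~~ X a -> lc (ins v 0 a) = ext.
  move=> Pa nXa; have [|naT] := boolP (a \in T); last first.
    apply: (lcol_bot _ L) => //; apply: contra nXa; rewrite /B /X.
    by case/orP=> /andP[-> ->]; rewrite ?orbT.
  rewrite !inE => /or4P[]/eqP ea; rewrite ea in nXa *.
  - rewrite col_y //; last by apply/andP; split; arith.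
    rewrite /h eqxx y0; case: ifP => // /andP[/eqP e ms].
    by move: nXa; rewrite /X /By ms eqxx (_ : lv y == 1) ?orbT //; arith.
  - rewrite col_z //; last by arith.
    rewrite /h (negPf nzy) eqxx z0; case: ifP => // /and3P[zf ms /eqP e].
    by move: nXa; rewrite /X /Bz zf ms eqxx (_ : lv z == 1) //; arith.
  - rewrite col_w //; last by arith.
    by rewrite /h (negPf nwy) (negPf nwz) eqxx w0.
  exact: col_d.
have nXw : ~~ X (pr w) by apply: nXs => // e; [move: nwy | move: nwz]; rewrite e eqxx.
pose C := conn (ecol lc S ext).
have Csym a b : C a b -> C b a by apply: (lift_sym L).
have r0 s : s \in S -> ~~ X (pr s) -> C (ins v 0 (pr s)) (ins v 0 (pr w)).
  move=> sS nXs'; exact: (ext_bottom L m1 Xr bot (prP s sS) (prP w wS) nXs' nXw).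
have lowz k : k < lv z -> ~~ (zfree && miss z) -> C (ins v k (pr z)) (ins v 0 (pr w)).
  move=> lt_k nm; apply: (@conn_trans _ _ (ins v 0 (pr z))).
    by apply/Csym/(segment L); [exact: prP | arith | move=> b ?; apply: cz => //; arith].
  apply: r0 => //; apply: nXs => // [e|_]; first by rewrite e eqxx in nzy.
  by apply: contra nm => /and3P[-> ->].
have lowy k : k < lv y -> ~~ miss y -> C (ins v k (pr y)) (ins v 0 (pr w)).
  move=> lt_k nm; apply: (@conn_trans _ _ (ins v 0 (pr y))).
    by apply/Csym/(segment L); [exact: prP | arith | move=> b ?; apply: cy => //; arith].
  apply: r0 => //; apply: nXs => // [_|e]; last by rewrite e eqxx in nzy.
  by apply: contra nm => /andP[].
have down s k : s \in S -> lv s = k.+1 -> lc (ins v k (pr s)) = ext -> C s (ins v k (pr s)).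
  move=> sS e c; apply/Csym/(lift_edge L) => //; last by right.
  by have := @adj_insV v k (pr s); rewrite -e insS // szp //; apply; have := lvS s sS; arith.
have upe s : s \in S -> lv s < m -> lc (ins v (lv s).+1 (pr s)) = ext ->
    C s (ins v (lv s).+1 (pr s)).
  move=> sS lt c; apply/Csym/(lift_edge L) => //; last by right.
  by have := @adj_insV v (lv s) (pr s); rewrite insS // szp // adj_sym; apply.
have Cz : C z (ins v 0 (pr w)).
  have [/andP[zf ms]|nm] := boolP (zfree && miss z); last first.
    apply: conn_trans (down z (lv z).-1 zS _ _) (lowz _ _ nm); try arith.
    by apply: cz => //; arith.
  have [ey nt lt] := hz0 zf ms; have nmy : ~~ miss y by rewrite my.
  apply: conn_trans (lowy (lv z) lt nmy).
  apply/Csym/(lift_edge L); [|exact: cy|by right].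
  rewrite -{2}(insS z) // ez; apply: adj_insH; rewrite ?szp //.
have Cy : C y (ins v 0 (pr w)).
  have [ms|nm] := boolP (miss y); last first.
    apply: conn_trans (down y (lv y).-1 yS _ _) (lowy _ _ nm); try arith.
    by apply: cy => //; arith.
  have [nt lt] := hy0 ms; have nmz : ~~ (zfree && miss z).
    by apply/negP => /andP[zf mz']; have [_ _ lt'] := hz0 zf mz'; arith.
  apply: conn_trans (lowz (lv y) lt nmz).
  apply/Csym/(lift_edge L); [|exact: cz|by right].
  rewrite adj_sym -{1}(insS y) // ez; apply: adj_insH; rewrite ?szp //.
have adjH k : k <= m -> k != t.+1 -> swadj (ins v k (pr z)) (ins v k (pr y)).
  by move=> le_k nk; rewrite adj_sym ez; apply: adj_insH; rewrite ?szp.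
(* With a gap below it, [x] descends to [y]. Otherwise it crosses to the column of [z], at its own
   level or, if [v] blocks this, one level higher; it arrives below [z], next to [z], or, under
   [zfree], above [z]. *)
have Cx : ~~ [&& lv x == (lv y).+1, lv z == lv x & t.+1 != lv x] -> C x (ins v 0 (pr w)).
  move=> nex; have [ex|nx] := eqVneq (lv x) (lv y).+1; last first.
    apply: conn_trans Cy; apply: (@conn_trans _ _ (ins v (lv x).-1 (pr y))).
      rewrite -exy; apply: down => //; first by arith.
      by rewrite exy; apply: cxy; apply/andP; split; arith.
    apply: (@conn_trans _ _ (ins v (lv y).+1 (pr y))).
      by apply/Csym/(segment L); [exact: prP | arith | move=> b ?; apply: cxy; arith].
    apply/Csym/upe => //; first by arith.
    by apply: cxy; apply/andP; split; arith.
  rewrite ex eqxx /= in nex.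
  have [et|nt] := eqVneq t.+1 (lv x).
    have nmx := mx (esym et).
    have yz' : lv x <= lv z by case/orP: yz => [/eqP e|]; arith.
    have cx : lc (ins v (lv x).+1 (pr x)) = ext.
      rewrite exy col_y; [|arith|by apply/andP; split; arith].
      by rewrite /h eqxx nmx; case: ifP => [|_]; [arith | rewrite ltnNge leqnSn].
    apply: conn_trans (upe x xS _ cx) _; first by arith.
    rewrite exy; have aH := adjH (lv x).+1; rewrite exy in cx.
    have [ezx|nzx] := eqVneq (lv z) (lv x).
      have zf : zfree by rewrite /zfree ex eqxx /= -ex ezx et !eqxx orbT.
      apply: conn_trans Cz; apply: (@conn_trans _ _ (ins v (lv z).+1 (pr z))).
        apply: (lift_edge L) => //; last by left; apply: czu => //; apply/andP; split; arith.
        by rewrite adj_sym ezx; apply: aH; arith.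
      by apply/Csym/upe => //; [arith | apply: czu => //; apply/andP; split; arith].
    have nzf : ~~ (zfree && miss z).
      by apply/negP => /andP[zf mz']; have [_ _ lt'] := hz0 zf mz'; arith.
    have [ezx|nzx2] := eqVneq (lv z) (lv x).+1.
      apply: conn_trans Cz; apply: (lift_edge L) => //; last by right.
      by rewrite -(insS z) // ezx adj_sym; apply: aH; arith.
    have lt2 : (lv x).+1 < lv z by arith.
    apply: conn_trans (lowz _ lt2 nzf).
    apply: (lift_edge L) => //; last by left; apply: cz.
    by rewrite adj_sym; apply: aH; arith.
  have aH : swadj (ins v (lv x) (pr z)) x.
    by rewrite -{2}(insS x) // exy; apply: adjH; rewrite ?xm // eq_sym.
  have [lt|ge] := ltnP (lv x) (lv z).
    have nzf : ~~ (zfree && miss z).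
      by apply/negP => /andP[zf mz']; have [_ _ lt'] := hz0 zf mz'; arith.
    apply: conn_trans (lowz _ lt nzf); apply/Csym/(lift_edge L) => //; last by right.
    exact: cz.
  have lt : lv z < lv x by rewrite ltn_neqAle ge andbT; move: nex; rewrite -ex nt andbT.
  have zf : zfree by rewrite /zfree ex eqxx /= -ex lt.
  have cu k : lv z < k <= m -> lc (ins v k (pr z)) = ext by apply: czu.
  apply: conn_trans Cz; apply: (@conn_trans _ _ (ins v (lv x) (pr z))).
    by apply/Csym/(lift_edge L) => //; [apply: cu; rewrite lt | right].
  apply: (@conn_trans _ _ (ins v (lv z).+1 (pr z))).
    by apply/Csym/(segment L); [exact: prP | arith | move=> b ?; apply: cu; arith].
  by apply/Csym/upe => //; [arith | apply: cu; apply/andP; split; arith].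
have Cw : C w (ins v 0 (pr w)).
  apply: (sinks_ext _ L wS) => k lt_k; split.
    by rewrite /h (negPf nwy) (negPf nwz) eqxx lt_k.
  apply: notin_stack => // [|e|e|_]; try arith; first by move: nwy; rewrite e eqxx.
  by move: nwz; rewrite e eqxx.
pose bad := [&& lv x == (lv y).+1, lv z == lv x & t.+1 != lv x].
have okx : exempt_ok S (if bad then [:: (x, ext)] else [::]).
  case: ifP => [/and3P[/eqP e1 /eqP e2 nt]|_]; last exact: ExNone.
  apply: (@ExMid S x y z) => //.
  - by apply: contra nzy => /eqP->.
  - have := @adj_insV v (lv y) (pr y); rewrite insS // -e1 -{2}exy insS // szp // adj_sym.
    by apply; arith.
  rewrite -(insS x) // -(insS z) // e2 exy adj_sym; apply: adjH; rewrite ?xm // eq_sym //.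
have nj s j : j < ext -> (s, j) \notin (if bad then [:: (x, ext)] else [::]).
  by case: ifP => // _ lt_j; rewrite inE xpair_eqE negb_and; apply/orP; right; arith.
have np s : s \in S -> pr s != [::].
  by move=> sS; apply/eqP => e; have := szp s sS; rewrite e => e0; move: m1; rewrite -e0.
(* The colouring of the columns has no exemption; the empty sequence stands for an exempt column in
   which no member lies. *)
apply: (assemble L (p := [::]) (i := 0) (r0 := ins v 0 (pr w)) m1 okx) => //.
- exact: coloring_exW cf.
- move=> d' + nS; rewrite !inE => /or4P[]/eqP ed; rewrite ed in nS *; last by move: once; apply.
  + by rewrite (map_f pr yS) in nS.
  + by rewrite (map_f pr zS) in nS.
  by rewrite (map_f pr wS) in nS.
- by move=> s j sS lt_j _ k lt_k nT fk; apply: (contact L) => //; apply: dt.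
- by move=> s j sS lt_j; exists s => //; split=> //; apply: nj.
- move=> s sS; have [e|ne] := eqVneq (pr w) (pr s); last by exists w; rewrite ?np //; split=> //
    j; apply: nj.
  by exists z; rewrite ?np // -e eq_sym; split=> // j; apply: nj.
- by move=> s sS e; have := np s sS; rewrite e.
move=> s; rewrite !inE => /or4P[]/eqP-> // nb.
by apply: Cx; apply: contra nb; rewrite -/bad => b; rewrite b mem_head.
Qed.
(* Here the missing direction of [y] is a dummy column [d], left to the new colour, and
   the column of [z] above [z] links [z] to [x] and [y] inside the colour class [i]. *)
Lemma stacked_low f i : let d := sw (lv y).-1 (pr y) in
    coloring_of ext [:: pr y; d; pr z; pr w] f [:: (pr y, i)] ->
    d \notin [:: pr y; pr z; pr w] ->
    (forall i1 i2 j, i1 < m.-1 -> i2 < m.-1 ->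
       j < ext -> f (sw i1 d) = j -> f (sw i2 d) = j -> i1 = i2) ->
    lv y != t.+1 -> (lv z < lv y) || (lv z == lv y) && ((lv y).+1 < lv x) ->
  good m.-1 S.
Proof.
move=> d cf nd once nyt zy; set T := [:: pr y; d; pr z; pr w] in cf.
have m1 : 1 < m by apply: ltnW.
have nd3 : [/\ d != pr y, d != pr z & d != pr w].
  by move: nd; rewrite !inE !negb_or => /and3P[].
have [ndy ndz ndw] := nd3.
have [xS yS zS wS] : [/\ x \in S, y \in S, z \in S & w \in S] by rewrite !inE !eqxx ?orbT.
have Pd : perm_eq d base by rewrite (perm_trans (perm_sw _ _)) //; apply/rem_perm/S_perm.
have L : liftable v base S T f.
  split=> //; last by case: cf.
    by move=> s; rewrite !inE => /or4P[]/eqP->; rewrite ?exy ?eqxx ?orbT.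
  move=> s; rewrite !inE => /or4P[]/eqP-> //; apply/rem_perm/S_perm; rewrite !inE eqxx ?orbT //.
have nzy := pr_zy.
pose miss s := sw (lv s).-1 (pr s) \notin T.
pose dc s := f (sw (lv s).-1 (pr s)).
(* If [z] is strictly lower than [y], its detour goes downwards and colour [i] starts right above
   [z]. Otherwise [z] and [y] are level, the level above [z] serves the detour, and colour [i]
   starts one level later. *)
pose zl := lv z < lv y.
pose h a k := if a == pr y then
    if k < lv y then ext
    else if (k < lv x) || (t.+1 == lv x) then i else dc x
  else if a == pr z then
    if k < lv z then (if [&& zl, miss z & k == (lv z).-1] then dc z else ext)
    else if ~~ zl && (k == (lv z).+1) then dc z else i
  else if a == pr w then (if k < lv w then ext else dc w) else ext.
pose Bz := [&& zl, miss z & lv z == 1].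
pose B a := Bz && (a == sw 0 (pr z)).
pose X a := Bz && ((a == pr z) || (a == sw 0 (pr z))).
pose lc := lcol v base S T f h B.
have prP s : s \in S -> perm_eq (pr s) base by apply: (pr_perm h B L).
have prT s : s \in S -> pr s \in T by apply: lift_col L s.
have dT : d \in T by rewrite !inE eqxx !orbT.
have lvS s : s \in S -> lv s <= m by apply: (lv_le h B L).
have szp s : s \in S -> size (pr s) = m by move=> /prP/perm_size.
have insS s : s \in S -> ins v (lv s) (pr s) = s by apply: (S_ins h B L).
have [y0 z0 w0] : [/\ 0 < lv y, 0 < lv z & 0 < lv w] by rewrite !S_lv.
have [xm ym zm wm] : [/\ lv x <= m, lv y <= m, lv z <= m & lv w <= m] by rewrite !lvS.
have zley : lv z <= lv y by case/orP: zy => [/ltnW|/andP[/eqP->]].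
have col_y k : k <= m -> (k != lv y) && (k != lv x) -> lc (ins v k (pr y)) = h (pr y) k.
  move=> le_k /andP[n1 n2]; rewrite /lc (lcol_T _ _ L) ?prP ?prT //.
  apply: notin_stack => // [_|e|e]; first by rewrite n1.
    by rewrite e eqxx in nzy.
  by move: nwy; rewrite e eqxx.
have col_z k : k <= m -> k != lv z -> lc (ins v k (pr z)) = h (pr z) k.
  move=> le_k n1; rewrite /lc (lcol_T _ _ L) ?prP ?prT //.
  apply: notin_stack => // [e|e]; first by rewrite e eqxx in nzy.
  by move: nwz; rewrite e eqxx.
have col_w k : k <= m -> k != lv w -> lc (ins v k (pr w)) = h (pr w) k.
  move=> le_k n1; rewrite /lc (lcol_T _ _ L) ?prP ?prT //.
  apply: notin_stack => // [e|e]; first by move: nwy; rewrite e eqxx.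
  by move: nwz; rewrite e eqxx.
have nd' : d \notin map pr S.
  by apply: contra nd; rewrite /= exy !inE => /or4P[]->; rewrite ?orbT.
have col_d k : k <= m -> lc (ins v k d) = ext.
  move=> le_k; rewrite /lc (lcol_T _ _ L) //.
    by rewrite /h (negPf ndy) (negPf ndz) (negPf ndw).
  apply: contra nd' => /(map_f pr); rewrite rem_ins //; exact: (notin_base h B L Pd).
have mz : lv z = t.+1 -> miss z = false.
  by move=> e; rewrite /miss e /= ez swK prT.
have cy k : k < lv y -> lc (ins v k (pr y)) = ext.
  move=> lt_k; rewrite col_y; [|arith|apply/andP; split; arith].
  by rewrite /h eqxx lt_k.
have cxy k : lv y < k < lv x -> lc (ins v k (pr y)) = i.
  move=> /andP[k1 k2]; rewrite col_y; [|arith|apply/andP; split; arith].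
  by rewrite /h eqxx ltnNge ltnW // k2.
have cz k : k < lv z -> ~~ (zl && miss z) -> lc (ins v k (pr z)) = ext.
  move=> lt_k nm; rewrite col_z; [|arith|arith].
  by rewrite /h (negPf nzy) eqxx lt_k andbA (negPf nm).
have czu k : lv z + ~~ zl < k <= m -> lc (ins v k (pr z)) = i.
  move=> /andP[k1 k2]; have k3 := leq_ltn_trans (leq_addr _ _) k1.
  rewrite col_z; [|arith|arith].
  rewrite /h (negPf nzy) eqxx ltnNge ltnW //=.
  by move: k1; case: (zl) => //=; rewrite addn1 => k1; rewrite [k == _]gtn_eqF.
have myT : sw (lv y).-1 (pr y) \in T by [].
have dt s : s \in S -> detour v base S T f h B s.
  rewrite !inE => /or4P[]/eqP-> k ek lt_k nT _.
  - left; split.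
      rewrite exy; apply: notin_stack => // [_|e|e]; last by move: nwy; rewrite e eqxx.
        by apply/andP; split; arith.
      by rewrite e eqxx in nzy.
    rewrite /h exy eqxx /dc ek /= exy.
    have -> : k.+2 < lv y = false by apply/negP; arith.
    rewrite ltnNge leqnSn orFb; case: eqP => // [[e]].
    by case/negP: nT; rewrite exy -e -ez prT.
  - by case/negP: nT; rewrite -[k]/(k.+1.-1) -ek.
  - have ms : miss z by rewrite /miss ek.
    have [zf|nzf] := boolP zl; [right|left]; split.
    + apply: notin_stack => // [|e|_|e]; first by arith.
        by rewrite e eqxx in nzy.
        by arith.
      by move: nwz; rewrite e eqxx.
    + by rewrite /h (negPf nzy) eqxx ek ltnS leqnn /= eqxx ms zf /dc ek.
    + by apply/implyP => /eqP k0; rewrite /B /Bz zf ms ek k0 !eqxx.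
    + apply: notin_stack => // [e|_|e]; first by rewrite e eqxx in nzy.
        by arith.
      by move: nwz; rewrite e eqxx.
    by rewrite /h (negPf nzy) eqxx ek ltnNge leqnSn (negPf nzf) /dc ek /= eqxx.
  left; split.
    apply: notin_stack => // [e|e|_]; first by move: nwy; rewrite e eqxx.
      by move: nwz; rewrite e eqxx.
    by arith.
  by rewrite /h (negPf nwy) (negPf nwz) eqxx ek ltnNge leqnSn /dc ek.
have nXs s : s \in S -> (pr s = pr z -> ~~ Bz) -> ~~ X (pr s).
  move=> sS hz; apply/negP => /andP[bz /orP[]/eqP e].
    by have := hz e; rewrite bz.
  by case/and3P: bz => _ ms /eqP e1; move: ms; rewrite /miss e1 [_.-1]/= -e prT.
have Xr u c : c != last 0 (pr z) -> X (rcons u c) = false.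
  move=> nc; apply/negP => /andP[bz /orP[]/eqP e]; first by rewrite -e last_rcons eqxx in nc.
  by rewrite -last_sw0 ?szp // -e last_rcons eqxx in nc.
have bot a : perm_eq a base -> ~~ X a -> lc (ins v 0 a) = ext.
  move=> Pa nXa; have [|naT] := boolP (a \in T); last first.
    apply: (lcol_bot _ L) => //; apply: contra nXa; rewrite /B /X.
    by case/andP=> -> ->; rewrite ?orbT.
  rewrite !inE => /or4P[]/eqP ea; rewrite ea in nXa *.
  - exact: cy.
  - exact: col_d.
  - rewrite col_z //; last by arith.
    rewrite /h (negPf nzy) eqxx z0; case: ifP => // /and3P[zf ms /eqP e].
    by move: nXa; rewrite /X /Bz zf ms eqxx (_ : lv z == 1) //; arith.
  rewrite col_w //; last by arith.
  by rewrite /h (negPf nwy) (negPf nwz) eqxx w0.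
have nXw : ~~ X (pr w) by apply: nXs => // e; move: nwz; rewrite e eqxx.
have nXy : ~~ X (pr y) by apply: nXs => // e; rewrite e eqxx in nzy.
have down j s k : s \in S -> lv s = k.+1 -> lc (ins v k (pr s)) = j ->
    conn (ecol lc S j) s (ins v k (pr s)).
  move=> sS e c; apply: (lift_sym L); apply: (lift_edge L) => //; last by right.
  by have := @adj_insV v k (pr s); rewrite -e insS // szp //; apply; have := lvS s sS; arith.
have upe j s : s \in S -> lv s < m -> lc (ins v (lv s).+1 (pr s)) = j ->
    conn (ecol lc S j) s (ins v (lv s).+1 (pr s)).
  move=> sS lt c; apply: (lift_sym L); apply: (lift_edge L) => //; last by right.
  by have := @adj_insV v (lv s) (pr s); rewrite insS // szp // adj_sym; apply.
have adjH k : k <= m -> k != t.+1 -> swadj (ins v k (pr z)) (ins v k (pr y)).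
  by move=> le_k nk; rewrite adj_sym ez; apply: adj_insH; rewrite ?szp.
pose C := conn (ecol lc S ext).
have Csym a b : C a b -> C b a by apply: (lift_sym L).
have r0 a : perm_eq a base -> ~~ X a -> C (ins v 0 a) (ins v 0 (pr w)).
  by move=> Pa nXa; exact: (ext_bottom L m1 Xr bot Pa (prP w wS) nXa nXw).
have lowy k : k < lv y -> C (ins v k (pr y)) (ins v 0 (pr w)).
  move=> lt_k; apply: (@conn_trans _ _ (ins v 0 (pr y))); last by apply: r0; rewrite ?prP.
  by apply/Csym/(segment L); [exact: prP | arith | move=> b ?; apply: cy => //; arith].
have Cy : C y (ins v 0 (pr w)).
  apply: conn_trans (down ext y (lv y).-1 yS _ _) (lowy _ _); try arith.
  by apply: cy => //; arith.
have Cz : C z (ins v 0 (pr w)).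
  have [/andP[zf ms]|nm] := boolP (zl && miss z); last first.
    apply: (@conn_trans _ _ (ins v 0 (pr z))); last first.
      apply: r0; rewrite ?prP //; apply: nXs => // _.
      by apply: contra nm => /and3P[-> ->].
    apply: (sinks_ext _ L zS) => k lt_k; split.
      by rewrite /h (negPf nzy) eqxx lt_k andbA (negPf nm).
    apply: notin_stack => // [|e|_|e]; try arith.
    by move: nwz; rewrite e eqxx.
  have nt : lv z != t.+1 by apply/eqP => /mz; rewrite ms.
  apply: conn_trans (lowy (lv z) zf).
  apply/Csym/(lift_edge L); [|exact: cy|by right].
  rewrite -{2}(insS z) // adj_sym; apply: adjH => //.
(* The direction of the dummy column is missing for [y] only, so [x] can cross to it. *)
have Cx : C x (ins v 0 (pr w)).
  have ndX : ~~ X d.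
    apply/negP => /andP[/and3P[_ ms /eqP e1] /orP[]]; first by rewrite (negPf ndz).
    by move=> /eqP e; move: ms; rewrite /miss e1 [_.-1]/= -e dT.
  apply: conn_trans (r0 d Pd ndX); apply: (@conn_trans _ _ (ins v (lv x) d)).
    apply/Csym/(lift_edge L); [|exact: col_d|by right].
    rewrite adj_sym -{1}(insS x) // exy /d; apply: adj_insH; rewrite ?szp //; arith.
  by apply/Csym/(segment L); [exact: Pd | arith | move=> k ?; apply: col_d; arith].
have Cw : C w (ins v 0 (pr w)).
  apply: (sinks_ext _ L wS) => k lt_k; split.
    by rewrite /h (negPf nwy) (negPf nwz) eqxx lt_k.
  apply: notin_stack => // [|e|e|_]; try arith; first by move: nwy; rewrite e eqxx.
  by move: nwz; rewrite e eqxx.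
have nzT : (pr z == pr y) = false by apply: negbTE.
have ztop : i < ext -> lv z + ~~ zl < m -> conn (ecol lc S i) z (ins v m (pr z)).
  move=> lt_i lt_m; have czu' := czu.
  have [ez0|ez1] : (~~ zl : nat) = 0 \/ (~~ zl : nat) = 1 by case: (zl); [left|right].
    rewrite ez0 addn0 in lt_m czu'.
    apply: (@conn_trans _ _ (ins v (lv z).+1 (pr z))).
      by apply: upe => //; apply: czu'; rewrite ltnSn.
    by apply: (segment L); [exact: prP | arith | move=> b ?; apply: czu'; arith].
  rewrite ez1 addn1 in lt_m czu'.
  (* The level above [z] is reserved for its detour, so [z] cannot simply climb. Colour [i] joins
     [pr z] to [pr w] in the lower colouring, hence some column next to that of [z] has colour [i];
     [z] follows it to the top and crosses back there. *)
  have [cT ct] := cf; have zT := prT z zS; have wT := prT w wS.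
  have [q pq lq] : conn (ecol f T i) (pr z) (pr w).
    by apply: ct; rewrite // inE xpair_eqE ?nzT ?(negPf nwy).
  case: q pq lq => [_ /= e|b q /= /andP[zb _] _]; first by move: nwz; rewrite -e eqxx.
  case/and4P: zb => /adjP[c]; rewrite szp // => lt_c eb fzb _ _.
  have fz : (f (pr z) == i) = false by apply/negbTE; have := cT _ zT; arith.
  rewrite fz /= in fzb; move/eqP: fzb => fb; rewrite eb in fb.
  have bT : sw c (pr z) \notin T.
    by apply/negP => /cT; rewrite fb => le_i; move: lt_i; rewrite ltnNge le_i.
  apply: (@conn_trans _ _ (ins v m (sw c (pr z)))).
    by apply: (contact L) => //; apply: dt.
  have Pb : perm_eq (sw c (pr z)) base by rewrite (perm_trans (perm_sw _ _)) ?prP.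
  apply: (lift_edge L); last by left; apply: czu'; rewrite leqnn lt_m.
    by rewrite adj_sym; apply: adj_insH; rewrite ?szp //; arith.
  by rewrite (lcol_col _ _ L) ?fb ?leqnn ?andbT //; arith.
have zcol k : i < ext -> lv z + ~~ zl < k <= m -> conn (ecol lc S i) z (ins v k (pr z)).
  move=> lt_i /andP[k1 k2]; apply: conn_trans (ztop lt_i (leq_trans k1 k2)) _.
  apply: (lift_sym L); apply: (segment L); [exact: prP | by rewrite k2 leqnn |].
  by move=> b /andP[b1 b2]; apply: czu; rewrite b2 (leq_trans k1).
have zlx : lv z + ~~ zl < lv x.
  by case: (boolP zl) => zf; rewrite ?addn0 ?addn1; [arith | case/orP: zy => [|/andP[/eqP-> //]];
      rewrite -/zl (negPf zf)].
have Ix : i < ext -> conn (ecol lc S i) x z.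
  move=> lt_i; have [et|nt] := eqVneq t.+1 (lv x); last first.
    apply: (lift_sym L); apply: conn_trans (zcol (lv x) lt_i _) _; first by rewrite zlx.
    apply: (lift_edge L); [|by apply: czu; rewrite zlx|by right].
    by rewrite -{2}(insS x) // exy; apply: adjH; rewrite // eq_sym.
  have cx : lc (ins v (lv x).+1 (pr x)) = i.
    rewrite exy col_y; [|arith|by apply/andP; split; arith].
    rewrite /h eqxx et eqxx orbT; case: ifP => //; arith.
  have lx : lv x < m by arith.
  have l2 : lv z + ~~ zl < (lv x).+1 <= m by rewrite lx andbT ltnW.
  apply: conn_trans (upe i x xS lx cx) _; rewrite exy; rewrite exy in cx.
  apply: (lift_sym L); apply: conn_trans (zcol _ lt_i l2) _.
  apply: (lift_edge L); [|by apply: czu|by left].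
  by apply: adjH; arith.
have Iy : i < ext -> conn (ecol lc S i) y z.
  move=> lt_i; case/orP: zy => [zf|/andP[_ lt2]].
    have l2 : lv z + ~~ zl < lv y <= m by rewrite /zl zf addn0 zf.
    apply: (lift_sym L); apply: conn_trans (zcol _ lt_i l2) _.
    apply: (lift_edge L); [|by apply: czu|by right].
    by rewrite -{2}(insS y) //; apply: adjH.
  apply: conn_trans (Ix lt_i).
  apply: (@conn_trans _ _ (ins v (lv y).+1 (pr y))).
    by apply: upe => //; [arith | apply: cxy; apply/andP; split; arith].
  apply: (@conn_trans _ _ (ins v (lv x).-1 (pr y))).
    by apply: (segment L); [exact: prP | arith | move=> b ?; apply: cxy; arith].
  apply: (lift_sym L); rewrite -exy; apply: down => //; first by arith.
  by rewrite exy; apply: cxy; apply/andP; split; arith.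
apply: (assemble L (p := pr y) (i := i) (r0 := ins v 0 (pr w)) m1 (ExNone S)) => //.
- move=> d' + nS; rewrite !inE => /or4P[]/eqP ed; rewrite ed in nS *.
  + by rewrite (map_f pr yS) in nS.
  + by move: once; apply.
  + by rewrite (map_f pr zS) in nS.
  by rewrite (map_f pr wS) in nS.
- by move=> s j sS lt_j _ k lt_k nT fk; apply: (contact L) => //; apply: dt.
- by move=> s j sS lt_j; exists s.
- move=> s sS; have [e|ne] := eqVneq (pr w) (pr s); last by exists w.
  by exists z => //; split=> //; rewrite -e eq_sym.
- move=> s; rewrite !inE => /or4P[]/eqP-> e lt_i _; exists z => //; split=> //.
  + exact: Ix.
  + exact: Iy.
  + exact: conn_refl.
  by move: nwy; rewrite e eqxx.
by move=> s; rewrite !inE => /or4P[]/eqP->.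
Qed.

End Stacked.

(** * Pairs of values on which two permutations disagree *)

Implicit Types (a b c d : vtx) (p q : nat).

Definition dif a b p q := (index p a < index q a) != (index p b < index q b).

Definition span (Q : seq (nat * nat)) a b :=
  forall p q, dif a b p q -> ((p, q) \in Q) || ((q, p) \in Q).

Lemma span_refl Q a : span Q a a.
Proof. by move=> p q; rewrite /dif eqxx. Qed.

Lemma span_sym Q a b : span Q a b -> span Q b a.
Proof. by move=> ab p q; rewrite /dif eq_sym; apply: ab. Qed.

Lemma span_trans Q b a c : span Q a b -> span Q b c -> span Q a c.
Proof.
move=> ab bc p q; have := ab p q; have := bc p q; rewrite /dif.
by do 3 case: (_ < _) => //=; auto.
Qed.

Lemma span_sub Q Q' a b : {subset Q <= Q'} -> span Q a b -> span Q' a b.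
Proof. by move=> sub ab p q /ab /orP[]/sub->; rewrite ?orbT. Qed.

Lemma nth_sw k s : k.+1 < size s ->
  nth 0 (sw k s) k = nth 0 s k.+1 /\ nth 0 (sw k s) k.+1 = nth 0 s k.
Proof. by elim: k s => [|k IHk] [|a [|b s]] //= lt_k; apply: (IHk (b :: s)). Qed.

Lemma dif_sw k s : uniq s -> k.+1 < size s -> dif s (sw k s) (nth 0 s k) (nth 0 s k.+1).
Proof.
move=> us lt_k; have [e1 e2] := nth_sw lt_k.
have lt_k' : k < size s by apply: ltnW.
rewrite /dif !index_uniq // ltnSn -{1}e2 -e1 !index_uniq ?size_sw ?sw_uniq //.
by rewrite ltnNge leqnSn.
Qed.

Lemma span_sw k s : uniq s -> k.+1 < size s -> span [:: (nth 0 s k, nth 0 s k.+1)] s (sw k s).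
Proof.
move=> us lt_k p q; rewrite !inE !xpair_eqE; apply: contraR; rewrite negb_or.
elim: k s us lt_k => [|k IHk] [|a s] //= /andP[na us] lt_k; last first.
  by move=> ne; case: (a == p); case: (a == q) => //=; rewrite !ltnS; apply: IHk.
case: s us na lt_k => [|b r] //= _; rewrite inE negb_or => /andP[nab _] _ ne.
move: ne; rewrite ![p == _]eq_sym ![q == _]eq_sym.
by case: (eqVneq a p) => [<-|]; case: (eqVneq a q) => [<-|];
   rewrite ?(negPf nab) ?[b == a]eq_sym ?(negPf nab) //=; case: (b == _) => //=; case: (b == _).
Qed.

Lemma adj_span a b : uniq a -> swadj a b -> exists e, span [:: e] a b.
Proof. by move=> ua /adjP[k lt_k ->]; eexists; apply: span_sw. Qed.

(** [sw i a] and [sw j a] disagree on the two different pairs exchanged from [a], whereas neighbours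
    disagree on a single pair. *)
Lemma no_triangle a b c : uniq a -> swadj a b -> swadj a c -> b != c -> ~~ swadj b c.
Proof.
move=> ua /adjP[i lt_i ->] /adjP[j lt_j ->] nbc; apply/negP => bc.
have nij : i != j by apply: contraNneq nbc => ->.
have [[x0 y0] se] : exists e, span [:: e] (sw i a) (sw j a) by apply: adj_span; rewrite ?sw_uniq.
have sym x y p q : dif x y p q = dif y x p q by rewrite /dif eq_sym.
have tri x y w p q : dif x y p q -> ~~ dif x w p q -> dif y w p q.
  by rewrite /dif; do 3 case: (_ < _).
have out k l : k.+1 < size a -> l.+1 < size a -> k != l ->
    ~~ dif a (sw l a) (nth 0 a k) (nth 0 a k.+1).
  move=> lt_k lt_l nkl; apply/negP => /(span_sw ua lt_l); rewrite !inE !xpair_eqE.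
  rewrite !nth_uniq ?(ltnW lt_k) ?(ltnW lt_l) //.
  by case/orP=> /andP[]; [rewrite (negPf nkl) | move=> *; arith].
have d1 := tri _ _ _ _ _ (dif_sw ua lt_i) (out i j lt_i lt_j nij).
have d2 := tri _ _ _ _ _ (dif_sw ua lt_j) (out j i lt_j lt_i (introN eqP (fun e => elimN eqP nij
    (esym e)))).
rewrite sym in d2; have := se _ _ d1; have := se _ _ d2; rewrite !inE !xpair_eqE.
move=> o1 o2; have [/eqP e1|[/eqP e1 /eqP e2]] : nth 0 a i = nth 0 a j \/
    nth 0 a i = nth 0 a j.+1 /\ nth 0 a i.+1 = nth 0 a j.
- case/orP: o1 => /andP[/eqP e1 /eqP e2]; case/orP: o2 => /andP[/eqP e3 /eqP e4].
  + by left; congruence.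
  + by right; split; congruence.
  + by right; split; congruence.
  by left; congruence.
- by move: e1; rewrite (nth_uniq 0 (ltnW lt_i) (ltnW lt_j) ua) (negPf nij).
move: e1 e2; rewrite (nth_uniq 0 (ltnW lt_i) lt_j ua) (nth_uniq 0 lt_i (ltnW lt_j) ua).
by move=> e1 e2; arith.
Qed.

(** A set of four permutations spanning a tree is [near 3]. Unlike the shape of a tree, this can be
    compared with the pairs of values counted before the deletion of [v]. *)
Definition near N (A : seq vtx) := exists2 Q, size Q <= N & {in A &, forall a b, span Q a b}.

Lemma near_path3 A a b c d : (forall s, s \in A -> uniq s) -> swadj a b -> swadj b c -> swadj c d ->
  a \in A -> b \in A -> c \in A -> {subset A <= [:: a; b; c; d]} -> near 3 A.
Proof.
move=> uA ab bc cd aA bA cA sub.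
have [e1 s1] := adj_span (uA a aA) ab; have [e2 s2] := adj_span (uA b bA) bc.
have [e3 s3] := adj_span (uA c cA) cd.
exists [:: e1; e2; e3] => // x y xA yA.
suff to_b s : s \in A -> span [:: e1; e2; e3] b s.
  by apply: span_trans (span_sym (to_b x xA)) (to_b y yA).
have bc' : span [:: e1; e2; e3] b c.
  by apply: span_sub s2 => e; rewrite !inE => ->; rewrite orbT.
move/sub; rewrite !inE => /or4P[]/eqP-> //.
- by apply/span_sym; apply: span_sub s1 => e; rewrite !inE => ->.
- exact: span_refl.
by apply: span_trans bc' _; apply: span_sub s3 => e; rewrite !inE => ->; rewrite !orbT.
Qed.

Lemma near_star3 A a b c d : (forall s, s \in A -> uniq s) -> swadj a b -> swadj a c -> swadj a d ->
  uniq a -> {subset A <= [:: a; b; c; d]} -> near 3 A.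
Proof.
move=> uA ab ac ad ua sub.
have [e1 s1] := adj_span ua ab; have [e2 s2] := adj_span ua ac.
have [e3 s3] := adj_span ua ad.
exists [:: e1; e2; e3] => // x y xA yA.
suff to_a s : s \in A -> span [:: e1; e2; e3] a s.
  by apply: span_trans (span_sym (to_a x xA)) (to_a y yA).
move/sub; rewrite !inE => /or4P[]/eqP->; first exact: span_refl.
- by apply: span_sub s1 => e; rewrite !inE => ->.
- by apply: span_sub s2 => e; rewrite !inE => ->; rewrite orbT.
by apply: span_sub s3 => e; rewrite !inE => ->; rewrite !orbT.
Qed.

Lemma near_sub N A A' : {subset A <= A'} -> near N A' -> near N A.
Proof.
move=> sub [Q sQ nQ]; exists Q => // a b aA bA.
by apply: nQ; apply: sub.
Qed.

Lemma adj_irrefl a : uniq a -> swadj a a = false.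
Proof. by move=> ua; apply/negP => /(adj_neq ua); rewrite eqxx. Qed.

(** A further edge would join the two given ones into a path on four vertices. Without one, no
    vertex has two neighbours and [good_pure] applies. *)
Lemma two_edges N a b c d : let T := [:: a; b; c; d] in
    good N T -> uniq T -> (forall s, s \in T -> uniq s) -> swadj a b -> swadj c d ->
  (exists f, coloring_of N T f [::]) \/ near 3 T.
Proof.
move=> T gT uT us ab cd.
have [aT bT cT dT] : [/\ a \in T, b \in T, c \in T & d \in T] by rewrite !inE !eqxx !orbT.
have ba : swadj b a by rewrite adj_sym.
have dc : swadj d c by rewrite adj_sym.
have sub s1 s2 s3 s4 : perm_eq [:: s1; s2; s3; s4] T -> {subset T <= [:: s1; s2; s3; s4]}.
  by move=> P x; rewrite (perm_mem P).
have [ac|nac] := boolP (swadj a c).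
  right; apply: (near_path3 us ba ac cd) => //; apply: sub.
  by rewrite (perm_catCA [:: b] [:: a]) perm_refl.
have [ad|nad] := boolP (swadj a d).
  right; apply: (near_path3 us ba ad dc) => // x; rewrite !inE.
  by case/or4P=> ->; rewrite ?orbT.
have [bc|nbc] := boolP (swadj b c).
  by right; apply: (near_path3 us ab bc cd).
have [bd|nbd] := boolP (swadj b d).
  right; apply: (near_path3 us ab bd dc) => // x; rewrite !inE.
  by case/or4P=> ->; rewrite ?orbT.
left; apply: good_pure gT uT _ => y x w yT xT wT nxw yx yw; move: nxw.
have irr e : e \in T -> swadj e e = false by move=> eT; apply/adj_irrefl/us.
have sy e e' : ~~ swadj e e' -> swadj e' e = false by move=> /negPf; rewrite adj_sym.
move: yx yw; move: yT xT wT; rewrite !inE.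
case/or4P=> /eqP-> /or4P[]/eqP->; rewrite ?irr ?(negPf nac) ?(negPf nad) ?(negPf nbc) ?(negPf nbd)
  ?(sy _ _ nac) ?(sy _ _ nad) ?(sy _ _ nbc) ?(sy _ _ nbd) // => /or4P[]/eqP->;
  rewrite ?irr ?(negPf nac) ?(negPf nad) ?(negPf nbc) ?(negPf nbd)
  ?(sy _ _ nac) ?(sy _ _ nad) ?(sy _ _ nbc) ?(sy _ _ nbd) ?eqxx //.
Qed.

(* The configuration in which deleting [v] does not lead to a colouring of [S]. *)
Definition forked v S := exists x y z i,
  [/\ x \in S, y \in S & z \in S] /\
  [/\ rem v x = rem v y, rem v z = sw i (rem v y), index v x = (index v y).+1,
      index v z = index v y & (i.+1 < size (rem v y)) && (i.+1 != index v y)].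

(** * Deleting a value when all columns differ *)

Section Distinct.

Variables (v : nat) (base : vtx) (S : seq vtx).
Local Notation m := (size base).
Local Notation pr := (rem v).
Local Notation lv := (index v).
Hypothesis ub : uniq (v :: base).
Hypothesis S_perm : forall s, s \in S -> perm_eq s (v :: base).
Hypothesis S_lv : forall s, s \in S -> 0 < lv s.
Hypothesis m2 : 2 < m.

(** An exemption in the middle of a path of columns is kept if both its edges are edges between the
    members; if one of them is lost, [bridge_lift] links its ends inside the class instead.
    Exemptions along a tree are left as the second alternative. *)
Lemma distinct_tree : uniq (map pr S) -> good m.-2 (map pr S) ->
  good m.-1 S \/ exists a b c d, [/\ perm_eq (map pr S) [:: a; b; c; d], swadj a b &
    swadj b c && swadj c d || swadj a c && swadj a d].
Proof.
move=> uS [f [ex [okx cf]]]; have m1 : 1 < m by apply: ltnW.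
have inS : {in S &, injective pr} by apply: uniq_map_inj.
have up s : s \in map pr S -> uniq s.
  case/mapP=> s' s'S ->; rewrite (perm_uniq (rem_perm (S_perm s'S))).
  by case/andP: ub.
have szp s : s \in S -> size (pr s) = m by move=> /S_perm/rem_perm/perm_size.
case: okx cf => [|y0 x0 w0 j|a b c d j PT ab bc cd|a b c d i j PT ab ac ad _] cf.
- by left; apply: basic_lift cf (ExNone S) _.
- case/mapP=> y yS ->{y0} in cf * => /mapP[x xS ->{x0}] /mapP[w wS ->{w0}] nxw yx yw.
  left; case: (boolP (swadj y x && swadj y w)) => [/andP[ryx ryw]|unreal].
    apply: (basic_lift ub S_perm S_lv m1 uS cf (ex := [:: (y, j)])).
      by apply: ExMid ryx ryw => //; apply: contraNneq nxw => ->.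
    by move=> s k sS; rewrite !inE !xpair_eqE => /andP[/eqP/inS-> // ->]; rewrite eqxx.
  have third s : s \in S -> exists2 u, u \in S & pr u != pr s /\ pr u != pr y.
    have ny u : swadj (pr y) (pr u) -> pr u != pr y.
      by move=> yu; rewrite eq_sym; apply: adj_neq yu; apply/up/map_f.
    move=> sS; have [e|nsx] := eqVneq (pr x) (pr s); last by exists x => //; split=> //; apply: ny.
    by exists w => //; split; [rewrite -e eq_sym | apply: ny].
  have [e eS [ye nye]] : exists2 e, e \in S & swadj (pr y) (pr e) /\ ~~ swadj y e.
    by move: unreal; rewrite negb_and => /orP[] n; [exists x | exists w].
  have ney : pr y != pr e by apply: adj_neq ye; apply/up/map_f.
  have [i lt_i ei] := adjP _ _ ye; rewrite (szp y) // in lt_i.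
  have ei' : pr y = sw i (pr e) by rewrite ei swK.
  have real : lv y = lv e -> lv y = i.+1.
    move=> el; apply/eqP; apply: contraNT nye => ni.
    have insS s : s \in S -> ins v (lv s) (pr s) = s.
      by move=> sS; rewrite ins_rem // (perm_mem (S_perm sS)) mem_head.
    rewrite -(insS y) // -(insS e) // -el ei; apply: adj_insH; rewrite ?szp //.
    have := perm_size (S_perm yS); have : lv y < size y by rewrite index_mem (perm_mem (S_perm
        yS)) mem_head.
    by move=> lt1 /= e2; rewrite -ltnS -e2.
  have [le|lt] := leqP (lv y) (lv e).
    apply: (bridge_lift ub S_perm S_lv m2 uS cf yS eS ney _ lt_i ei le _ third).
      by rewrite eqxx.
    by apply/implyP => /eqP/real/eqP.
  apply: (bridge_lift ub S_perm S_lv m2 uS cf eS yS _ _ lt_i ei' (ltnW lt) _ third).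
  - by rewrite eq_sym.
  - by rewrite eqxx orbT.
  by apply/implyP => /eqP el; rewrite el (real (esym el)).
- by right; exists a, b, c, d; rewrite bc cd.
by right; exists a, b, c, d; rewrite ac ad orbT.
Qed.

Lemma distinct_lift : uniq (map pr S) -> good m.-2 (map pr S) ->
  good m.-1 S \/ near 3 (map pr S).
Proof.
move=> uS gS; case: (distinct_tree uS gS) => [|[a [b [c [d [PT ab tr]]]]]]; [by left | right].
have up s : s \in map pr S -> uniq s.
  case/mapP=> s' s'S ->; rewrite (perm_uniq (rem_perm (S_perm s'S))).
  by case/andP: ub.
have sub : {subset map pr S <= [:: a; b; c; d]} by move=> s; rewrite (perm_mem PT).
case/orP: tr => /andP[h1 h2]; last first.
  by apply: (near_star3 up ab h1 h2 _ sub); apply: up; rewrite (perm_mem PT) mem_head.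
by apply: (near_path3 up ab h1 h2); rewrite ?(perm_mem PT) ?inE ?eqxx ?orbT.
Qed.

End Distinct.

(** * Members of the set with the same column *)

Lemma ecol_mem F S S' j : S =i S' -> subrel (ecol F S j) (ecol F S' j).
Proof. by move=> eS s t; rewrite /ecol !eS. Qed.

Lemma good_perm N S S' : perm_eq S S' -> good N S -> good N S'.
Proof.
move=> P [f [ex [okx [fS ct]]]]; have eS := perm_mem P; exists f, ex; split.
  case: okx {ct} => [|y x w j yS xS wS|a b c d j PT|c x y z i j PT].
  - exact: ExNone.
  - by apply: ExMid; rewrite -eS.
  - by apply: ExPath; rewrite -(permPl P).
  by apply: ExStar; rewrite -(permPl P).
split=> [s|j s t lt_j]; first by rewrite -eS; apply: fS.
rewrite -!eS => sS tS ns nt; apply: conn_mono (ct j s t lt_j sS tS ns nt).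
exact: ecol_mem.
Qed.

Section Collided.

Variables (v : nat) (base : vtx).
Local Notation m := (size base).
Local Notation pr := (rem v).
Local Notation lv := (index v).
Hypothesis ub : uniq (v :: base).
Hypothesis m2 : 2 < m.
Hypothesis IH : forall T, uniq T -> size T = 4 -> (forall s, s \in T -> perm_eq s base) ->
  good m.-2 T.

Lemma base_uniq s : perm_eq s base -> uniq s.
Proof. by move/perm_uniq->; case/andP: ub. Qed.

Lemma ins_lv s : perm_eq s (v :: base) -> ins v (lv s) (pr s) = s.
Proof. by move=> Ps; rewrite ins_rem // (perm_mem Ps) mem_head. Qed.

Lemma lv_le_size s : perm_eq s (v :: base) -> lv s <= m.
Proof.
move=> Ps; have := perm_size Ps; rewrite /= => sz.
by rewrite -ltnS -sz index_mem (perm_mem Ps) mem_head.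
Qed.

Lemma ins_in S a k : perm_eq a base -> k <= m -> ins v k a \in S ->
  exists2 u, u \in S & pr u = a /\ lv u = k.
Proof.
move=> Pa le_k iS; have nv : v \notin a by rewrite (perm_mem Pa); case/andP: ub.
by exists (ins v k a); rewrite // rem_ins // index_ins // (perm_size Pa).
Qed.

Lemma low_eq S T f s l : liftable v base S T f -> s \in S -> l \in S -> pr l = pr s ->
  (forall u, u \in S -> pr u = pr s -> lv l <= lv u) -> low v base S (pr s) = lv l.
Proof.
move=> L sS lS els min; apply/eqP; rewrite eqn_leq -els (low_le L lS) /=.
have Pl := rem_perm (lift_perm L lS).
have nv : v \notin pr l by rewrite (perm_mem Pl); case/andP: ub.
have le_low : low v base S (pr l) <= m.
  by apply: leq_trans (low_le L lS) _; apply: lv_le_size; apply: lift_perm L l lS.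
have := min _ (low_in L lS); rewrite rem_ins // index_ins ?(perm_size Pl) //.
exact.
Qed.

Definition lowest S s l := [/\ l \in S, pr l = pr s &
  forall u, u \in S -> pr u = pr s -> lv l <= lv u].

(* The colouring of [T] may be exempt at a dummy column only. *)
Lemma collide S T f ex (p : vtx) i : (forall s, s \in S -> perm_eq s (v :: base)) ->
    (forall s, s \in S -> 0 < lv s) -> {subset map pr S <= T} ->
    (forall a, a \in T -> perm_eq a base) ->
    coloring_of m.-2 T f [:: (p, i)] -> p \notin map pr S -> exempt_ok S ex ->
    (forall d, d \in T -> d \notin map pr S -> forall i1 i2 j, i1 < m.-1 -> i2 < m.-1 ->
       j < m.-2 -> f (sw i1 d) = j -> f (sw i2 d) = j -> i1 = i2) ->
    (forall s, s \in S -> exists2 l, lowest S s l &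
       l = s \/ sw (lv l).-1 (pr l) \in T /\ sw (lv l).-1 (pr l) \notin map pr S) ->
    (forall s, s \in S -> [\/ sw (lv s).-1 (pr s) \in T, ins v (lv s).+1 (pr s) \notin S,
       [/\ exists2 l, lowest S s l & lv l < lv s,
           ins v (lv s).-1 (pr s) \notin S &
           ins v (lv s).-2 (pr s) \in S -> sw (lv s).-2.-1 (pr s) \in T] |
       (s, f (sw (lv s).-1 (pr s))) \in ex]) ->
    (forall s j, s \in S -> j < m.-2 -> exists2 u, u \in S & pr u = pr s /\ (u, j) \notin ex) ->
    (forall s, s \in S -> exists2 u, u \in S & pr u != pr s /\
       forall j, j < m.-2 -> (u, j) \notin ex) ->
  good m.-1 S.
Proof.
move=> S_perm S_lv ST T_perm cf npS okx once lows opts rep third.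
have L : liftable v base S T f.
  split=> //; last by case: cf.
  by move=> s sS; apply/ST/map_f.
have lowE s l : s \in S -> lowest S s l -> low v base S (pr s) = lv l.
  by move=> sS [lS els min]; apply: (low_eq L).
apply: (collision_lift L (ltnW m2) okx cf npS once) => // s sS.
  have [l ll [e|ok]] := lows s sS; rewrite (lowE _ _ sS ll); first by rewrite e ltnn.
  by move: ok; have [_ -> _] := ll.
case: (opts s sS) => [o|o|[[l ll lt_l] o1 o2]|o]; first [by constructor 1 | by constructor 2 |
  by constructor 4 | by constructor 3; rewrite (lowE _ _ sS ll)].
Qed.

Lemma up_free S s : s \in S -> perm_eq s (v :: base) -> lv s < m ->
  (forall u, u \in S -> pr u = pr s -> lv u <= lv s) -> ins v (lv s).+1 (pr s) \notin S.
Proof.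
move=> sS Ps lt_s top; apply/negP => iS.
have [u uS [eu lu]] := ins_in (rem_perm Ps) lt_s iS.
by have := top u uS eu; rewrite lu ltnn.
Qed.

(** With [v] in last position no direction is missing; the formula for it is out of range and gives
    the column itself. *)
Lemma top_dir s : perm_eq s (v :: base) -> lv s = m -> sw (lv s).-1 (pr s) = pr s.
Proof.
move=> Ps e; have sz := perm_size (rem_perm Ps).
by apply: sw_large; rewrite sz e prednK //; apply: ltn_trans m2.
Qed.

End Collided.

(** * Exactly two members in one column *)

Section Pair.

Variables (v : nat) (base : vtx).
Local Notation m := (size base).
Local Notation pr := (rem v).
Local Notation lv := (index v).
Hypothesis ub : uniq (v :: base).
Hypothesis m2 : 2 < m.
Hypothesis IH : forall T, uniq T -> size T = 4 -> (forall s, s \in T -> perm_eq s base) ->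
  good m.-2 T.

(** The fourth column is a dummy that depends on the levels. For [stacked_high] it is a neighbour of
    the column of [w], and [two_edges] excludes exemptions. For [stacked_low] it is the missing
    direction of [y], and an exemption elsewhere than at [pr y] would make the columns [near 3].
    What neither lemma covers is [forked]. *)
Lemma pair_adjacent x y z w : let S := [:: x; y; z; w] in
    (forall s, s \in S -> perm_eq s (v :: base)) -> (forall s, s \in S -> 0 < lv s) ->
    pr x = pr y -> lv y < lv x -> pr w != pr y -> pr w != pr z ->
    swadj (pr y) (pr z) -> ~~ swadj (pr y) (pr w) ->
  [\/ good m.-1 S, near 3 (map pr S) | forked v S].
Proof.
move=> S S_perm S_lv exy lt_yx nwy nwz yz nyw.
have em : m.-1 = m.-2.+1 by arith.
have em2 : m.-2.+2 = m by arith.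
have [xS yS zS wS] : [/\ x \in S, y \in S, z \in S & w \in S] by rewrite !inE !eqxx ?orbT.
have Pb s : s \in S -> perm_eq (pr s) base by move/S_perm/rem_perm.
have ub' s : s \in S -> uniq (pr s) by move/Pb/(base_uniq ub).
have nyz : pr y != pr z by apply: adj_neq yz; apply: ub'.
have uR s : s \in map pr S -> uniq s by case/mapP=> s' s'S ->; apply: ub'.
have subT T : pr y \in T -> pr z \in T -> pr w \in T -> {subset map pr S <= T}.
  by move=> yT zT wT s; rewrite /= !inE exy => /or4P[]/eqP->.
have szp s : s \in S -> size (pr s) = m by move=> /Pb/perm_size.
have lvm s : s \in S -> lv s <= m by move/S_perm/(lv_le_size).
have [zw|nzw] := boolP (swadj (pr z) (pr w)).
  constructor 2; apply: (near_star3 uR (a := pr z) (b := pr y) (c := pr w) (d := pr w)) => //.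
  - by rewrite adj_sym.
  - exact: ub'.
  by move=> s; rewrite /= exy !inE => /or4P[]->; rewrite ?orbT.
have [t lt_t ez] := adjP _ _ yz; rewrite (szp y) // in lt_t.
have perm4 a b c d : perm_eq a base -> perm_eq b base -> perm_eq c base -> perm_eq d base ->
    forall s, s \in [:: a; b; c; d] -> perm_eq s base.
  by move=> Pa Pb' Pc Pd s; rewrite !inE => /or4P[]/eqP->.
have psw i s : s \in S -> perm_eq (sw i (pr s)) base.
  by move=> sS; rewrite (perm_trans (perm_sw _ _)) ?Pb.
have [hi|lo] := boolP ((lv y == t.+1) || (lv y < lv z)).
  pose d := sw 0 (pr w); have wd : swadj (pr w) d by apply: adj_sw; rewrite szp // ltnW.
  have nwd : pr w != d by apply: adj_neq wd; apply: ub'.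
  have nd : d \notin [:: pr y; pr z; pr w].
    rewrite !inE !negb_or [d == pr w]eq_sym nwd andbT.
    by apply/andP; split; [apply: contraNneq nyw => <- | apply: contraNneq nzw => <-]; rewrite
        adj_sym.
  have uT : uniq [:: pr y; pr z; pr w; d].
    move: nd; rewrite /= !inE !negb_or !(eq_sym d) => /and3P[-> -> ->].
    by rewrite nyz !(eq_sym _ (pr w)) nwy nwz.
  have pT := perm4 _ _ _ _ (Pb y yS) (Pb z zS) (Pb w wS) (psw 0 w wS).
  have gT := IH uT erefl pT.
  have [[f cf]|nr] := two_edges gT uT (fun s sT => base_uniq ub (pT s sT)) yz wd; last first.
    by constructor 2; apply: near_sub nr; apply: subT; rewrite !inE eqxx ?orbT.
  constructor 1; apply: (stacked_high ub S_perm S_lv m2 exy lt_yx lt_t ez nwy nwz cf) => //.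
    exact: psw.
  have szd : size d = m.-2.+2 by rewrite size_sw szp // em2.
  rewrite em; apply: (color_once (I0 := [:: 0]) (J := [::]) _ szd cf (e := pr w)) => //.
  - by apply: (base_uniq ub); apply: psw.
  - by rewrite !inE eqxx !orbT.
  - by rewrite !inE eqxx !orbT.
  by move=> i; rewrite inE => /eqP->; rewrite /d swK !inE eqxx !orbT.
move: lo; rewrite negb_or -leqNgt => /andP[nyt le_zy].
have [low|nlow] := boolP ((lv z < lv y) || (lv z == lv y) && ((lv y).+1 < lv x)); last first.
  constructor 3; exists x, y, z, t; split=> //; split=> //.
  - by move: nlow; rewrite negb_or -leqNgt => /andP[le1]; rewrite (_ : lv z == lv y) /=; arith.
  - by move: nlow; rewrite negb_or -leqNgt => /andP[le1]; arith.
  by rewrite szp // lt_t eq_sym.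
pose d := sw (lv y).-1 (pr y).
have y0 : 0 < lv y by apply: S_lv.
have lt_d : (lv y).-1.+1 < m by have := lvm x xS; arith.
have yd : swadj (pr y) d by apply: adj_sw; rewrite szp.
have nyd : pr y != d by apply: adj_neq yd; apply: ub'.
have ndz : d != pr z.
  apply/eqP; rewrite ez => /(sw_inj (ub' y yS)); rewrite szp // => /(_ lt_d lt_t).
  by move: nyt; arith.
have ndw : d != pr w by apply: contraNneq nyw => <-.
have uT : uniq [:: pr y; d; pr z; pr w].
  by rewrite /= !inE !negb_or nyd nyz ndz ndw !(eq_sym _ (pr w)) nwy nwz.
have pT := perm4 _ _ _ _ (Pb y yS) (psw (lv y).-1 y yS) (Pb z zS) (Pb w wS).
have uT' s : s \in [:: pr y; d; pr z; pr w] -> uniq s by move/pT/(base_uniq ub).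
have sT : {subset map pr S <= [:: pr y; d; pr z; pr w]} by apply: subT; rewrite !inE eqxx ?orbT.
have ndz' : swadj d (pr z) = false by apply/negbTE/(no_triangle (ub' y yS) yd yz).
have irr s : s \in [:: pr y; d; pr z; pr w] -> swadj s s = false.
  by move=> /uT'; apply: adj_irrefl.
suff [[f [i cf]]|nr] : (exists f i, coloring_of m.-2 [:: pr y; d; pr z; pr w] f [:: (pr y, i)]) \/
    near 3 [:: pr y; d; pr z; pr w].
- constructor 1; apply: (stacked_low ub S_perm S_lv m2 exy lt_yx lt_t ez nwy nwz cf) => //.
    by rewrite !inE !negb_or [d == pr y]eq_sym nyd ndz ndw.
  have szd : size d = m.-2.+2 by rewrite size_sw szp // em2.
  rewrite em; apply: (dummy_once (e := pr z) (i0 := (lv y).-1) cf) => //.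
  + by apply: (base_uniq ub); apply: psw.
  + by rewrite !inE eqxx !orbT.
  + by rewrite eq_sym.
  + by rewrite !inE eqxx !orbT.
  + by rewrite eq_sym.
  + by rewrite eq_sym.
  + by rewrite -em; arith.
  by rewrite /d swK !inE eqxx.
- by constructor 2; apply: near_sub nr.
have [f [ex [okx cf]]] := IH uT erefl pT.
case: okx cf => [|y0' x0 w0 j yT xT wT nxw yx yw|a b c e j PT ab bc ce|a b c e i j PT ab ac ae _]
    cf.
- by left; exists f, 0; apply: coloring_exW cf.
- move: yT xT wT yx yw nxw cf; rewrite !inE.
  have dzz : swadj (pr z) d = false by rewrite adj_sym.
  have wy : swadj (pr w) (pr y) = false by apply/negbTE; rewrite adj_sym.
  have wz : swadj (pr w) (pr z) = false by apply/negbTE; rewrite adj_sym.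
  have [dw|ndw'] := boolP (swadj d (pr w)).
    move=> *; right; apply: (near_path3 uT' (a := pr z) (b := pr y) (c := d) (d := pr w)) => //.
    + by rewrite adj_sym.
    + by rewrite !inE eqxx !orbT.
    + by rewrite !inE eqxx.
    + by rewrite !inE eqxx !orbT.
    by move=> s; rewrite !inE => /or4P[]->; rewrite ?orbT.
  have wd' : swadj (pr w) d = false by apply/negbTE; rewrite adj_sym.
  have i1 := irr (pr y); have i2 := irr d; have i3 := irr (pr z); have i4 := irr (pr w).
  rewrite !inE !eqxx ?orbT in i1 i2 i3 i4.
  case/or4P=> /eqP->; first by move=> _ _ _ _ _ cf; left; exists f, j.
  + case/or4P=> /eqP-> /or4P[]/eqP->; rewrite ?ndz' ?(negPf ndw') ?i2 ?eqxx //.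
  + case/or4P=> /eqP-> /or4P[]/eqP->; rewrite ?dzz ?(negPf nzw) ?i3 ?eqxx //.
  case/or4P=> /eqP-> /or4P[]/eqP->; rewrite ?wy ?wz ?wd' ?i4 ?eqxx //.
- right; apply: (near_path3 uT' ab bc ce); rewrite ?(perm_mem PT) ?inE ?eqxx ?orbT //.
  by move=> s; rewrite (perm_mem PT).
right; apply: (near_star3 uT' ab ac ae); first by apply: uT'; rewrite (perm_mem PT) mem_head.
by move=> s; rewrite (perm_mem PT).
Qed.

Lemma once_only S T a f : (forall s, s \in T -> (s == a) || (s \in map pr S)) ->
    (forall i1 i2 j, i1 < m.-1 -> i2 < m.-1 ->
       j < m.-2 -> f (sw i1 a) = j -> f (sw i2 a) = j -> i1 = i2) ->
  forall d, d \in T -> d \notin map pr S -> forall i1 i2 j, i1 < m.-1 -> i2 < m.-1 ->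
       j < m.-2 -> f (sw i1 d) = j -> f (sw i2 d) = j -> i1 = i2.
Proof. by move=> sT once d /sT/orP[/eqP->|->]. Qed.

(** The dummy [d] is the missing direction of [y]. An exemption at [d] is harmless: two neighbours
    of [d] then lie in [T], which outweighs the one exempt colour in [color_once]. *)
Lemma pair_isolated x y z w : let S := [:: x; y; z; w] in
    (forall s, s \in S -> perm_eq s (v :: base)) -> (forall s, s \in S -> 0 < lv s) ->
    pr x = pr y -> lv y < lv x -> pr z != pr y -> pr w != pr y -> pr w != pr z ->
    ~~ swadj (pr y) (pr z) -> ~~ swadj (pr y) (pr w) ->
  good m.-1 S \/ near 3 (map pr S).
Proof.
move=> S S_perm S_lv exy lt_yx nzy nwy nwz nyz' nyw.
have em : m.-1 = m.-2.+1 by arith.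
have em2 : m.-2.+2 = m by arith.
have [xS yS zS wS] : [/\ x \in S, y \in S, z \in S & w \in S] by rewrite !inE !eqxx ?orbT.
have Pb s : s \in S -> perm_eq (pr s) base by move/S_perm/rem_perm.
have ub' s : s \in S -> uniq (pr s) by move/Pb/(base_uniq ub).
have szp s : s \in S -> size (pr s) = m by move=> /Pb/perm_size.
have lvm s : s \in S -> lv s <= m by move/S_perm/(lv_le_size).
pose d := sw (lv y).-1 (pr y).
have y0 : 0 < lv y by apply: S_lv.
have lt_d : (lv y).-1.+1 < m by have := lvm x xS; arith.
have yd : swadj (pr y) d by apply: adj_sw; rewrite szp.
have nyd : pr y != d by apply: adj_neq yd; apply: ub'.
have ndz : d != pr z by apply: contraNneq nyz' => <-.
have ndw : d != pr w by apply: contraNneq nyw => <-.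
have Pd : perm_eq d base by rewrite (perm_trans (perm_sw _ _)) ?Pb.
pose T := [:: pr y; d; pr z; pr w].
have uT : uniq T.
  by rewrite /= !inE !negb_or nyd ndz ndw !(eq_sym _ (pr w)) (eq_sym _ (pr z)) nwy nwz nzy.
have pT s : s \in T -> perm_eq s base by rewrite !inE => /or4P[]/eqP->; rewrite ?Pb.
have uT' s : s \in T -> uniq s by move/pT/(base_uniq ub).
have sT : {subset map pr S <= T}.
  by move=> s; rewrite /= exy !inE => /or4P[]->; rewrite ?orbT.
have nearT : near 3 T -> near 3 (map pr S) by apply: near_sub.
have [yT dT zT wT] : [/\ pr y \in T, d \in T, pr z \in T & pr w \in T].
  by rewrite !inE !eqxx ?orbT.
have szd : size d = m.-2.+2 by rewrite size_sw szp // em2.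
have dy : sw (lv y).-1 d = pr y by rewrite /d swK.
suff [[f [i [cf once]]]|nr] : (exists f i, coloring_of m.-2 T f [:: (d, i)] /\
    forall i1 i2 j, i1 < m.-1 -> i2 < m.-1 ->
       j < m.-2 -> f (sw i1 d) = j -> f (sw i2 d) = j -> i1 = i2) \/ near 3 T;
  [left | by right; apply: nearT |].
- have dS : d \notin map pr S.
    by rewrite /= exy !inE !negb_or [d == pr y]eq_sym nyd ndz ndw.
  have once' := @once_only S T d f _ once.
  have lowy s : s = x \/ s = y -> lowest v S s y.
    move=> es; split=> //; first by case: es => ->.
    move=> u; rewrite !inE => /or4P[]/eqP-> // e; first exact: ltnW.
      by move: nzy; rewrite e; case: es => ->; rewrite ?exy eqxx.
    by move: nwy; rewrite e; case: es => ->; rewrite ?exy eqxx.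
  have lowz : lowest v S z z.
    split=> // u; rewrite !inE => /or4P[]/eqP-> // e; try by move: nzy; rewrite -e ?exy eqxx.
    by move: nwz; rewrite e eqxx.
  have loww : lowest v S w w.
    split=> // u; rewrite !inE => /or4P[]/eqP-> // e; try by move: nwy; rewrite -e ?exy eqxx.
    by move: nwz; rewrite e eqxx.
  have free s : s \in S -> (forall u, u \in S -> pr u = pr s -> lv u <= lv s) ->
      sw (lv s).-1 (pr s) \in T \/ ins v (lv s).+1 (pr s) \notin S.
    move=> sS top; have [e|ne] := eqVneq (lv s) m.
      by left; rewrite (top_dir m2 (S_perm s sS) e); apply/sT/map_f.
    right; apply: (up_free ub sS (S_perm s sS) _ top).
    by have := lvm s sS; arith.
  apply: (collide ub m2 S_perm S_lv sT pT cf dS (ExNone S)).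
  + apply: once'.
    by move=> s; rewrite !inE exy => /or4P[]->; rewrite ?orbT.
  + move=> s; rewrite !inE => /or4P[]/eqP->; [exists y|exists y|exists z|exists w]; auto.
  + move=> s sS; suff [o|o] : sw (lv s).-1 (pr s) \in T \/ ins v (lv s).+1 (pr s) \notin S.
      by constructor 1.
      by constructor 2.
    have : [|| s == x, s == y, s == z | s == w] by move: sS; rewrite !inE.
    case/or4P=> /eqP->.
    * apply: (free x xS) => u; rewrite !inE => /or4P[]/eqP-> // e; first exact: ltnW.
        by move: nzy; rewrite e exy eqxx.
      by move: nwy; rewrite e exy eqxx.
    * by left.
    * apply: (free z zS) => u; rewrite !inE => /or4P[]/eqP-> // e; try by move: nzy; rewrite -e
        ?exy eqxx.
      by move: nwz; rewrite e eqxx.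
    apply: (free w wS) => u; rewrite !inE => /or4P[]/eqP-> // e; try by move: nwy; rewrite -e
        ?exy eqxx.
    by move: nwz; rewrite e eqxx.
  + by move=> s j sS _; exists s.
  move=> s sS; have [e|ne] := eqVneq (pr w) (pr s); last by exists w.
  by exists z => //; rewrite -e eq_sym.
have irr s : s \in T -> swadj s s = false by move=> /uT'; apply: adj_irrefl.
have [f [ex [okx cf]]] := IH uT erefl pT.
have dirs s : swadj d s -> exists2 k, k < m.-2.+1 & sw k d = s.
  by move=> /adjP[k]; rewrite szd => lt_k ->; exists k.
case: okx cf => [|y0' x0 w0 j y0T x0T w0T nxw yx yw|a b c e j PT ab bc ce|a b c e i j PT ab ac ae
    _] cf.
- left; exists f, 0; split; first exact: coloring_exW cf.
  rewrite em; apply: (color_once (I0 := [:: (lv y).-1]) (J := [::]) (uT' d dT) szd cf dT yT nyd)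
      => //.
  by move=> k; rewrite inE => /eqP->; rewrite dy -em; split=> //; arith.
- have py := irr _ yT; have pz := irr _ zT; have pw := irr _ wT.
  have zy : swadj (pr z) (pr y) = false by rewrite adj_sym; apply/negbTE.
  have wy : swadj (pr w) (pr y) = false by rewrite adj_sym; apply/negbTE.
  have [ed|nd] := eqVneq y0' d.
    rewrite ed in cf yx yw; left; exists f, j; split=> //.
    have [k1 lt1 e1] := dirs _ yx; have [k2 lt2 e2] := dirs _ yw.
    rewrite em; apply: (color_once (I0 := [:: k1; k2]) (J := [:: j]) (uT' d dT) szd cf dT yT nyd)
        => //.
    + by move=> k; rewrite !inE !xpair_eqE eqxx (negPf nyd) => ->.
    + by rewrite /= inE andbT; apply: contraNneq nxw => e; rewrite -e1 -e2 e.
    by move=> k; rewrite in_cons mem_seq1 => /orP[]/eqP->; [rewrite e1 | rewrite e2]; split;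
        first [exact: lt1 | exact: x0T | exact: lt2 | exact: w0T].
  (* Such an exemption is impossible at [pr y]; at [pr z] or [pr w] its two edges and the edge from
     [pr y] to [d] form a path through all of [T]. *)
  right; have := y0T; rewrite !inE => /or4P[]/eqP ey; rewrite ey in yx yw nd *.
  + case/negP: nxw; move: x0T w0T yx yw; rewrite !inE.
    by case/or4P=> /eqP-> /or4P[]/eqP->; rewrite ?py ?(negPf nyz') ?(negPf nyw) ?eqxx.
  + by rewrite eqxx in nd.
  + have [dz zw] : swadj d (pr z) /\ swadj (pr z) (pr w).
      move: nxw yx yw; move: x0T w0T; rewrite !inE [swadj d _]adj_sym.
      by case/or4P=> /eqP-> /or4P[]/eqP->; rewrite ?zy ?pz ?eqxx.
    apply: (near_path3 uT' yd dz zw) => //.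
  have [dw wz] : swadj d (pr w) /\ swadj (pr w) (pr z).
    move: nxw yx yw; move: x0T w0T; rewrite !inE [swadj d _]adj_sym.
    by case/or4P=> /eqP-> /or4P[]/eqP->; rewrite ?wy ?pw ?eqxx.
  apply: (near_path3 uT' yd dw wz) => // s; rewrite !inE.
  by case/or4P=> ->; rewrite ?orbT.
- right; apply: (near_path3 uT' ab bc ce); rewrite ?(perm_mem PT) ?inE ?eqxx ?orbT //.
  by move=> s; rewrite (perm_mem PT).
right; apply: (near_star3 uT' ab ac ae); first by apply: uT'; rewrite (perm_mem PT) mem_head.
by move=> s; rewrite (perm_mem PT).
Qed.

End Pair.

Lemma near_edge A a b : (forall s, s \in A -> uniq s) -> a \in A -> swadj a b ->
  {subset A <= [:: a; b]} -> near 3 A.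
Proof.
move=> uA aA ab sub; have ua := uA a aA.
apply: (near_star3 uA ab ab ab ua) => s /sub; rewrite !inE.
by case/orP=> ->; rewrite ?orbT.
Qed.

Lemma near_path2 A a b c : uniq b -> (forall s, s \in A -> uniq s) -> swadj a b -> swadj b c ->
  {subset A <= [:: a; b; c]} -> near 3 A.
Proof.
move=> ub uA ab bc sub; have ba : swadj b a by rewrite adj_sym.
apply: (near_star3 uA ba bc bc ub) => s /sub; rewrite !inE.
by case/or3P=> ->; rewrite ?orbT.
Qed.

(** * Two columns only: two pairs, or three members and one *)

Section Columns.

Variables (v : nat) (base : vtx).
Local Notation m := (size base).
Local Notation pr := (rem v).
Local Notation lv := (index v).
Hypothesis ub : uniq (v :: base).
Hypothesis m2 : 2 < m.
Hypothesis IH : forall T, uniq T -> size T = 4 -> (forall s, s \in T -> perm_eq s base) ->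
  good m.-2 T.

(* [i] and [j] point at two new columns beside [a] and [b]; the lower colouring of
   these four columns is then exempt nowhere. *)
Lemma side_colouring a b i j : perm_eq a base -> perm_eq b base -> a != b ->
    i.+1 < m -> j.+1 < m -> let T := [:: a; sw i a; b; sw j b] in
  near 3 [:: a; b] \/ exists f, [/\ coloring_of m.-2 T f [::],
    forall s, s \in T -> perm_eq s base, sw i a \notin [:: a; b], sw j b \notin [:: a; b] &
    forall d, d \in T -> d \notin [:: a; b] -> forall i1 i2 j, i1 < m.-1 -> i2 < m.-1 ->
       j < m.-2 -> f (sw i1 d) = j -> f (sw i2 d) = j -> i1 = i2].
Proof.
move=> Pa Pb nab lt_i lt_j T.
have em : m.-1 = m.-2.+1 by arith.
have em2 : m.-2.+2 = m by arith.
have [ua ub'] := (base_uniq ub Pa, base_uniq ub Pb).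
have uS s : s \in [:: a; b] -> uniq s by rewrite !inE => /orP[]/eqP->.
have [za zb] := (perm_size Pa, perm_size Pb).
have ac : swadj a (sw i a) by apply: adj_sw; rewrite za.
have bd : swadj b (sw j b) by apply: adj_sw; rewrite zb.
have [uc ud] : uniq (sw i a) /\ uniq (sw j b) by rewrite !sw_uniq.
have nac := adj_neq ua ac; have nbd := adj_neq ub' bd.
have [ab|nadj] := boolP (swadj a b).
  by left; apply: (near_edge uS _ ab) => //; rewrite mem_head.
have ncb : sw i a != b by apply: contraNneq nadj => <-.
have nda : sw j b != a by apply: contraNneq nadj => e; rewrite adj_sym -{1}e.
have [ecd|ncd] := eqVneq (sw i a) (sw j b).
  left; apply: (near_path2 uc uS ac (c := b)); first by rewrite ecd adj_sym.
  by move=> s; rewrite !inE => /orP[]->; rewrite ?orbT.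
have Pc : perm_eq (sw i a) base by rewrite (perm_trans (perm_sw _ _)).
have Pd : perm_eq (sw j b) base by rewrite (perm_trans (perm_sw _ _)).
have uT : uniq T.
  by rewrite /= !inE !negb_or nac nab ncb ncd [a == _]eq_sym nda nbd.
have pT s : s \in T -> perm_eq s base by rewrite !inE => /or4P[]/eqP->.
have [[f cf]|nr] := two_edges (IH uT erefl pT) uT (fun s sT => base_uniq ub (pT s sT)) ac bd;
    last first.
  left; apply: near_sub nr => s; rewrite !inE.
  by case/orP=> ->; rewrite ?orbT.
right; exists f; split=> //.
- by rewrite !inE negb_or [sw i a == a]eq_sym nac ncb.
- by rewrite !inE negb_or nda [sw j b == b]eq_sym nbd.
move=> d dT dn; have szd : size d = m.-2.+2 by rewrite em2 (perm_size (pT d dT)).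
have [e eT [ed [k [lt_k ek]]]] : exists2 e, e \in T & e != d /\ exists k, k < m.-1 /\ sw k d = e.
  move: dT dn; rewrite !inE negb_or => /or4P[]/eqP-> /andP[]; rewrite ?eqxx // => _ _.
    exists a; first by rewrite inE eqxx.
    by split=> //; exists i; rewrite swK; split=> //; arith.
  exists b; first by rewrite !inE eqxx !orbT.
  by split=> //; exists j; rewrite swK; split=> //; arith.
rewrite em; apply: (color_once (I0 := [:: k]) (J := [::]) (base_uniq ub (pT d dT)) szd cf dT eT
    ed) => //.
by move=> k'; rewrite mem_seq1 => /eqP->; rewrite ek -em.
Qed.

(** The dummies are the missing directions of the lower member of each column; they serve the upper
    members as a way down. *)
Lemma two_pairs x y z w : let S := [:: x; y; z; w] in
    (forall s, s \in S -> perm_eq s (v :: base)) -> (forall s, s \in S -> 0 < lv s) ->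
    pr x = pr y -> lv y < lv x -> pr z = pr w -> lv w < lv z -> pr y != pr w ->
  good m.-1 S \/ near 3 (map pr S).
Proof.
move=> S S_perm S_lv exy lt_yx ezw lt_wz nyw.
have [xS yS zS wS] : [/\ x \in S, y \in S, z \in S & w \in S] by rewrite !inE !eqxx ?orbT.
have Pb s : s \in S -> perm_eq (pr s) base by move/S_perm/rem_perm.
have lvm s : s \in S -> lv s <= m by move/S_perm/(lv_le_size).
have [lt_i lt_j] : (lv y).-1.+1 < m /\ (lv w).-1.+1 < m.
  by have := lvm x xS; have := lvm z zS; have := S_lv y yS; have := S_lv w wS; split; arith.
have eS : map pr S =i [:: pr y; pr w].
  by move=> s; rewrite /= exy ezw !inE; case: (s == _) => //; case: (s == _).
have [nr|[f [cf pT n1 n2 once]]] := side_colouring (Pb y yS) (Pb w wS) nyw lt_i lt_j.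
  by right; apply: near_sub nr => s; rewrite eS.
left; set T := [:: _; _; _; _] in cf pT once.
have [yT cT wT dT] : [/\ pr y \in T, sw (lv y).-1 (pr y) \in T, pr w \in T &
    sw (lv w).-1 (pr w) \in T] by rewrite !inE !eqxx ?orbT.
have lowy : lowest v S y y /\ lowest v S x y.
  split; split=> // u; rewrite !inE => /or4P[]/eqP-> //; try by move=> _; apply: ltnW.
  - by rewrite ezw => e; rewrite e eqxx in nyw.
  - by move=> e; rewrite e eqxx in nyw.
  - by rewrite ezw exy => e; rewrite e eqxx in nyw.
  by rewrite exy => e; rewrite e eqxx in nyw.
have loww : lowest v S w w /\ lowest v S z w.
  split; split=> // u; rewrite !inE => /or4P[]/eqP-> //; try by move=> _; apply: ltnW.
  - by rewrite exy => e; rewrite e eqxx in nyw.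
  - by move=> e; rewrite e eqxx in nyw.
  - by rewrite ezw exy => e; rewrite e eqxx in nyw.
  by rewrite ezw => e; rewrite e eqxx in nyw.
have free s : s \in S -> (forall u, u \in S -> pr u = pr s -> lv u <= lv s) ->
    sw (lv s).-1 (pr s) \in T \/ ins v (lv s).+1 (pr s) \notin S.
  move=> sS top; have [e|ne] := eqVneq (lv s) m; last first.
    right; apply: (up_free ub sS (S_perm s sS) _ top).
    by have := lvm s sS; arith.
  left; rewrite (top_dir m2 (S_perm s sS) e).
  by have := map_f pr sS; rewrite eS !inE => /orP[]->; rewrite ?orbT.
have inS s : s \in S -> [|| s == x, s == y, s == z | s == w] by rewrite !inE.
apply: (collide ub m2 S_perm S_lv _ pT (coloring_exW _ cf) (i := 0) _ (ExNone S)).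
- by move=> s; rewrite eS => /[!inE] /orP[]/eqP->; rewrite eqxx ?orbT.
- by move=> e; rewrite in_nil.
- by rewrite eS; exact: n1.
- by move=> d dT' dn; apply: once => //; rewrite -eS.
- move=> s /inS/or4P[]/eqP->.
  + by exists y; [case: lowy | right; split=> //; rewrite eS].
  + by exists y; [case: lowy | left].
  + by exists w; [case: loww | right; split=> //; rewrite eS].
  by exists w; [case: loww | left].
- move=> s sS; suff [o|o] : sw (lv s).-1 (pr s) \in T \/ ins v (lv s).+1 (pr s) \notin S.
    by constructor 1.
    by constructor 2.
  case/or4P: (inS s sS) => /eqP->; [|by left| |by left].
  + apply: (free x xS) => u /inS/or4P[]/eqP-> //; first by move=> _; apply: ltnW.
      by rewrite ezw exy => e; rewrite e eqxx in nyw.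
    by rewrite exy => e; rewrite e eqxx in nyw.
  apply: (free z zS) => u /inS/or4P[]/eqP-> //; last by move=> _; apply: ltnW.
    by rewrite ezw exy => e; rewrite e eqxx in nyw.
  by rewrite ezw => e; rewrite e eqxx in nyw.
- by move=> s j sS _; exists s.
move=> s /inS/or4P[]/eqP->; [exists w|exists w|exists y|exists y]; rewrite ?exy ?ezw //;
  by split=> //; rewrite eq_sym.
Qed.

Lemma one_triple x y z w : let S := [:: x; y; z; w] in
    (forall s, s \in S -> perm_eq s (v :: base)) -> (forall s, s \in S -> 0 < lv s) ->
    pr x = pr z -> pr y = pr z -> lv z < lv y -> lv y < lv x -> pr z != pr w ->
  good m.-1 S \/ near 3 (map pr S).
Proof.
move=> S S_perm S_lv exz eyz lt_zy lt_yx nzw.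
have [xS yS zS wS] : [/\ x \in S, y \in S, z \in S & w \in S] by rewrite !inE !eqxx ?orbT.
have Pb s : s \in S -> perm_eq (pr s) base by move/S_perm/rem_perm.
have lvm s : s \in S -> lv s <= m by move/S_perm/(lv_le_size).
have [lt_i lt_j] : (lv z).-1.+1 < m /\ 0.+1 < m.
  by have := lvm x xS; have := S_lv z zS; split; arith.
have eS : map pr S =i [:: pr z; pr w].
  by move=> s; rewrite /= exz eyz !inE; case: (s == _) => //; case: (s == _).
have [nr|[f [cf pT n1 n2 once]]] := side_colouring (Pb z zS) (Pb w wS) nzw lt_i lt_j.
  by right; apply: near_sub nr => s; rewrite eS.
left; set T := [:: _; _; _; _] in cf pT once.
have [zT cT wT dT] : [/\ pr z \in T, sw (lv z).-1 (pr z) \in T, pr w \in T &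
    sw 0 (pr w) \in T] by rewrite !inE !eqxx ?orbT.
have inS s : s \in S -> [|| s == x, s == y, s == z | s == w] by rewrite !inE.
have lowz s : pr s = pr z -> lowest v S s z.
  move=> es; split=> // u /inS/or4P[]/eqP-> //; rewrite es => e; try by arith.
  by rewrite e eqxx in nzw.
have loww : lowest v S w w.
  by split=> // u /inS/or4P[]/eqP-> //; rewrite ?exz ?eyz => e; rewrite e eqxx in nzw.
have free s : s \in S -> (forall u, u \in S -> pr u = pr s -> lv u <= lv s) ->
    sw (lv s).-1 (pr s) \in T \/ ins v (lv s).+1 (pr s) \notin S.
  move=> sS top; have [e|ne] := eqVneq (lv s) m; last first.
    right; apply: (up_free ub sS (S_perm s sS) _ top).
    by have := lvm s sS; arith.
  left; rewrite (top_dir m2 (S_perm s sS) e).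
  by have := map_f pr sS; rewrite eS !inE => /orP[]->; rewrite ?orbT.
have insE s k : s \in S -> k <= m -> ins v k (pr s) \in S ->
    exists2 u, u \in S & pr u = pr s /\ lv u = k.
  by move=> sS le_k iS; apply: (ins_in ub (Pb s sS) le_k iS).
(* With [x], [y], [z] on consecutive levels there is no free level next to [y] for its detour. It is
   adjacent to [x] and [z], so it may be exempt for the colour of its missing direction. *)
pose tight := (lv x == (lv y).+1) && (lv y == (lv z).+1).
pose ex := if tight then [:: (y, f (sw (lv y).-1 (pr y)))] else [::].
have exy u j : u \in S -> u != y -> (u, j) \notin ex.
  by move=> uS nu; rewrite /ex; case: (tight); rewrite // inE xpair_eqE (negPf nu).
have okx : exempt_ok S ex.
  rewrite /ex; case E : (tight); last exact: ExNone.
  have [/eqP e1 /eqP e2] := andP E.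
  apply: (@ExMid _ y x z) => //.
  - by apply/eqP => e; move: lt_zy; rewrite -e => lt_zy; arith.
  - rewrite -(ins_lv (S_perm y yS)) -(ins_lv (S_perm x xS)) exz eyz e1.
    by apply: adj_insV; rewrite (perm_size (Pb z zS)); apply: leq_trans lt_yx (lvm x xS).
  rewrite adj_sym -(ins_lv (S_perm y yS)) -(ins_lv (S_perm z zS)) eyz e2.
  by apply: adj_insV; rewrite (perm_size (Pb z zS)); apply: leq_trans lt_zy (lvm y yS).
have nyx : x != y by apply/eqP => e; move: lt_yx; rewrite e ltnn.
have nyz : z != y by apply/eqP => e; move: lt_zy; rewrite e ltnn.
have nyw : w != y by apply/eqP => e; move: nzw; rewrite e eyz eqxx.
apply: (collide ub m2 S_perm S_lv _ pT (coloring_exW _ cf) (i := 0) _ okx).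
- by move=> s; rewrite eS => /[!inE] /orP[]/eqP->; rewrite eqxx ?orbT.
- by move=> e; rewrite in_nil.
- by rewrite eS; exact: n1.
- by move=> d dT' dn; apply: once => //; rewrite -eS.
- move=> s /inS/or4P[]/eqP->; try by exists z; [apply: lowz | right; split=> //; rewrite eS].
  by exists w; [ | left].
- move=> s sS; have down s' : sw (lv s').-1 (pr s') \in T \/ ins v (lv s').+1 (pr s') \notin S ->
      s = s' -> [\/ sw (lv s).-1 (pr s) \in T, ins v (lv s).+1 (pr s) \notin S,
       [/\ exists2 l, lowest v S s l & lv l < lv s,
           ins v (lv s).-1 (pr s) \notin S &
           ins v (lv s).-2 (pr s) \in S -> sw (lv s).-2.-1 (pr s) \in T] |
       (s, f (sw (lv s).-1 (pr s))) \in ex].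
    by move=> o ->; case: o => o; [constructor 1 | constructor 2].
  case/or4P: (inS s sS) => /eqP es.
  + apply: down es; apply: (free x xS) => u /inS/or4P[]/eqP-> //; try by move=> _; arith.
    by rewrite exz => e; rewrite e eqxx in nzw.
  + rewrite es; have [e1|n1'] := eqVneq (lv x) (lv y).+1; last first.
      have lym : (lv y).+1 <= m by apply: leq_trans lt_yx (lvm x xS).
      constructor 2; apply/negP => /(insE y _ yS lym)[u uS [eu lu]].
      move: (inS u uS) lu eu n1' => /or4P[]/eqP->; move=> lu eu; rewrite -?lu ?eqxx //.
      * by move: lu; arith.
      * by move: lu; arith.
      by rewrite eu eyz eqxx in nzw.
    have [e2|n2'] := eqVneq (lv y) (lv z).+1; last first.
      have lym : lv y <= m := lvm y yS.
      constructor 3; split; first by exists z => //; apply: lowz.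
      * apply/negP => /(insE y _ yS (leq_trans (leq_pred _) lym))[u uS [eu lu]].
        move: (inS u uS) lu eu n2' => /or4P[]/eqP->; move=> lu eu; try by move: lu; arith.
        by rewrite eu eyz eqxx in nzw.
      have lym2 : (lv y).-2 <= m by rewrite -subn2 (leq_trans (leq_subr _ _)).
      case/(insE y _ yS lym2)=> u uS [eu lu]; have lyz : (lv y).-2 = lv z.
        move: (inS u uS) lu eu n2' => /or4P[]/eqP->; move=> lu eu; try by move: lu; arith.
        by rewrite eu eyz eqxx in nzw.
      by rewrite lyz eyz.
    have t : tight by apply/andP; split; apply/eqP.
    by constructor 4; rewrite /ex t inE.
  + by rewrite es; constructor 1.
  apply: down es; apply: (free w wS) => u /inS/or4P[]/eqP-> //;
    by rewrite ?exz ?eyz => e; rewrite e eqxx in nzw.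
- move=> s j sS _; have [->|ns] := eqVneq s y; last by exists s => //; split=> //; apply: exy.
  by exists z => //; split=> //; apply: exy.
move=> s /inS/or4P[]/eqP->; [exists w|exists w|exists w|exists z] => //;
  rewrite ?exz ?eyz; split=> //; try (by move=> j _; apply: exy); by rewrite eq_sym.
Qed.

End Columns.

Lemma perm_pick S s t : size S = 4 -> uniq S -> s \in S -> t \in S -> s != t ->
  exists z w, perm_eq S [:: s; t; z; w].
Proof.
move=> sz uS sS tS nst; have P1 := perm_to_rem sS.
have tS' : t \in rem s S by rewrite (rem_filter _ uS) mem_filter /= eq_sym nst.
have P2 := perm_to_rem tS'; have := perm_size P2; rewrite (size_rem sS) sz /= => - [].
case E : (rem t (rem s S)) => [|z [|w []]] // _; exists z, w; rewrite -E.
by apply: perm_trans P1 _; rewrite perm_cons.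
Qed.

Lemma near0 (A : seq vtx) a : {subset A <= [:: a]} -> near 3 A.
Proof.
move=> sub; exists [::] => // x y /sub; rewrite mem_seq1 => /eqP-> /sub; rewrite mem_seq1 => /eqP->.
exact: span_refl.
Qed.

(** * Deleting a value: the general case *)

Section Delete.

Variables (v : nat) (base : vtx).
Local Notation m := (size base).
Local Notation pr := (rem v).
Local Notation lv := (index v).
Hypothesis ub : uniq (v :: base).
Hypothesis m2 : 2 < m.
Hypothesis IH : forall T, uniq T -> size T = 4 -> (forall s, s \in T -> perm_eq s base) ->
  good m.-2 T.

Let result S := [\/ good m.-1 S, near 3 (map pr S) | forked v S].

Lemma result_perm S S' : perm_eq S S' -> result S -> result S'.
Proof.
move=> P; have eS := perm_mem P; case=> [g|nr|[x [y [z [i [[xS yS zS] fk]]]]]].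
- by constructor 1; apply: good_perm g.
- constructor 2; apply: near_sub nr => s; rewrite (perm_mem (perm_map pr P)).
  exact.
by constructor 3; exists x, y, z, i; rewrite -!eS.
Qed.

Lemma near_result S : good m.-1 S \/ near 3 (map pr S) -> result S.
Proof. by case=> o; [constructor 1 | constructor 2]. Qed.

Lemma delete_sorted x y z w : let S := [:: x; y; z; w] in uniq S ->
    (forall s, s \in S -> perm_eq s (v :: base)) -> (forall s, s \in S -> 0 < lv s) ->
  pr x = pr y -> lv y < lv x -> result S.
Proof.
move=> S uS S_perm S_lv exy lt_yx.
have [xS yS zS wS] : [/\ x \in S, y \in S, z \in S & w \in S] by rewrite !inE !eqxx ?orbT.
have levels s t : s \in S -> t \in S -> pr s = pr t -> s != t -> lv s != lv t.
  move=> sS tS e; apply: contraNneq => el.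
  by rewrite -(ins_lv (S_perm s sS)) -(ins_lv (S_perm t tS)) e el eqxx.
have up s : s \in map pr S -> uniq s.
  by case/mapP=> u /S_perm/rem_perm P ->; apply: (base_uniq ub P).
have [nyz nyw nzw nxz nxw] : [/\ y != z, y != w, z != w, x != z & x != w].
  move: uS; rewrite /= !inE !negb_or => /and3P[/and3P[_ ? ?] /andP[? ?] /andP[? _]].
  by split.
have re S' : perm_eq S' S -> result S' -> result S by apply: result_perm.
have PS S' : perm_eq S' S -> (forall s, s \in S' -> perm_eq s (v :: base)) /\
    (forall s, s \in S' -> 0 < lv s).
  by move=> P; split=> s; rewrite (perm_mem P); [apply: S_perm | apply: S_lv].
have triple t e : perm_eq [:: x; y; t; e] S -> pr t = pr y -> pr e != pr y -> result S.
  move=> P ety ney.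
  have tS : t \in S by rewrite -(perm_mem P) !inE eqxx !orbT.
  have [ntx nty] : t != x /\ t != y.
    move: (perm_uniq P); rewrite uS /= !inE !negb_or => /andP[/and3P[_ ? _] /andP[/andP[? _] _]].
    by rewrite ![t == _]eq_sym.
  have lx := levels t x tS xS (etrans ety (esym exy)) ntx.
  have ly := levels t y tS yS ety nty.
  have [P1 L1] := PS _ P.
  have [lt_ty|le_yt] := ltnP (lv t) (lv y).
    apply: (re _ P); apply: near_result; apply: (one_triple ub m2 IH P1 L1); rewrite ?exy ?ety //.
    by rewrite eq_sym.
  have [lt_tx|le_xt] := ltnP (lv t) (lv x).
    have P' : perm_eq [:: x; t; y; e] S.
      by apply: perm_trans P; rewrite perm_cons (perm_catCA [:: t] [:: y]).
    have [P2 L2] := PS _ P'.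
    apply: (re _ P'); apply: near_result; apply: (one_triple ub m2 IH P2 L2); rewrite ?exy ?ety //.
      by rewrite ltn_neqAle eq_sym ly.
    by rewrite eq_sym.
  have P' : perm_eq [:: t; x; y; e] S.
    by apply: perm_trans P; rewrite (perm_catCA [:: t] [:: x; y]).
  have [P2 L2] := PS _ P'.
  apply: (re _ P'); apply: near_result; apply: (one_triple ub m2 IH P2 L2); rewrite ?exy ?ety //.
    by rewrite ltn_neqAle eq_sym lx.
  by rewrite eq_sym.
have PSw : perm_eq [:: x; y; w; z] S.
  by rewrite !perm_cons (perm_catC [:: w] [:: z]).
have [ezy|nzy] := eqVneq (pr z) (pr y).
  have [ewy|nwy] := eqVneq (pr w) (pr y); last exact: (triple z w).
  constructor 2; apply: (@near0 _ (pr y)) => s; rewrite /= exy ezy ewy !inE.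
  by rewrite !orbb.
have [ewy|nwy] := eqVneq (pr w) (pr y); first exact: (triple w z).
have [ezw|nwz] := eqVneq (pr w) (pr z).
  have := levels w z wS zS ezw; rewrite eq_sym => /(_ nzw); rewrite neq_ltn => /orP[] lt.
    apply: near_result; apply: (two_pairs ub m2 IH S_perm S_lv) => //.
    by rewrite eq_sym.
  have [P2 L2] := PS _ PSw; apply: (re _ PSw).
  by apply: near_result; apply: (two_pairs ub m2 IH P2 L2) => //; rewrite eq_sym.
have [az|naz] := boolP (swadj (pr y) (pr z)); have [aw|naw] := boolP (swadj (pr y) (pr w)).
- constructor 2; apply: (near_star3 up az aw aw); first by apply/up/map_f.
  by move=> s; rewrite /= exy !inE => /or4P[]->; rewrite ?orbT.
- exact: (pair_adjacent ub m2 IH S_perm S_lv).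
- have [P2 L2] := PS _ PSw; apply: (re _ PSw).
  by apply: (pair_adjacent ub m2 IH P2 L2) => //; rewrite eq_sym.
by apply: near_result; apply: (pair_isolated ub m2 IH S_perm S_lv).
Qed.

Lemma delete_value S : uniq S -> size S = 4 -> (forall s, s \in S -> perm_eq s (v :: base)) ->
    (forall s, s \in S -> 0 < lv s) ->
  [\/ good m.-1 S, near 3 (map pr S) | forked v S].
Proof.
move=> uS sz S_perm S_lv; have [uP|nuP] := boolP (uniq (map pr S)).
  apply: near_result; apply: (distinct_lift ub S_perm S_lv m2 uP).
  apply: IH; rewrite ?size_map // => s /mapP[u uS' ->].
  exact/rem_perm/S_perm.
have [x [y [xS yS exy lt_yx]]] : exists x y, [/\ x \in S, y \in S, pr x = pr y & lv y < lv x].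
  have [/hasP[s sS /hasP[t tS /andP[nst /eqP e]]]|none] :=
      boolP (has (fun s => has (fun t => (s != t) && (pr s == pr t)) S) S).
    have : lv s != lv t.
      apply: contraNneq nst => el.
      by rewrite -(ins_lv (S_perm s sS)) -(ins_lv (S_perm t tS)) e el eqxx.
    rewrite neq_ltn => /orP[] lt; first by exists t, s.
    by exists s, t.
  case/negP: nuP; rewrite map_inj_in_uniq // => s t sS tS e; apply/eqP; apply: contraNT none => nst.
  by apply/hasP; exists s => //; apply/hasP; exists t => //; rewrite nst e eqxx.
have nxy : x != y by apply: contraTneq lt_yx => ->; rewrite ltnn.
have [z [w P]] := perm_pick sz uS xS yS nxy.
have Pm := perm_mem P; apply: (result_perm (S := [:: x; y; z; w])); first by rewrite perm_sym.
by apply: delete_sorted; rewrite -?(perm_uniq P) // => s; rewrite -Pm; [apply: S_perm | apply: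
    S_lv].
Qed.

End Delete.

(** * Counting the moved pairs of values *)

Lemma sw_cat a x z b : sw (size a) (a ++ x :: z :: b) = a ++ z :: x :: b.
Proof. by elim: a => //= e a ->. Qed.

Lemma adj_split s t : swadj s t -> exists a x z b, s = a ++ x :: z :: b /\ t = a ++ z :: x :: b.
Proof.
case/adjP=> k lt_k ->; have sz : size (take k s) = k by rewrite size_takel // ltnW // ltnW.
have := cat_take_drop k s; case E : (drop k s) => [|x [|z b]] e.
- by move: (size_drop k s); rewrite E /=; arith.
- by move: (size_drop k s); rewrite E /=; arith.
by exists (take k s), x, z, b; rewrite e -sw_cat sz e.
Qed.

Lemma adj_cat a x z b : swadj (a ++ x :: z :: b) (a ++ z :: x :: b).
Proof.
rewrite -(sw_cat a x z b); apply: adj_sw.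
by rewrite size_cat /= !addnS !ltnS leq_addr.
Qed.

Lemma adj_rev s t : swadj (rev s) (rev t) = swadj s t.
Proof.
suff sub s' t' : swadj s' t' -> swadj (rev s') (rev t').
  by apply/idP/idP => [/sub|/sub //]; rewrite !revK.
case/adj_split=> a [x [z [b [-> ->]]]]; rewrite !rev_cat !rev_cons -!cats1 -!catA /=.
exact: adj_cat.
Qed.

Lemma sw_map (g : nat -> nat) k s : sw k (map g s) = map g (sw k s).
Proof. by elim: k s => [|k IHk] [|a [|b s]] //=; rewrite -IHk. Qed.

Lemma adj_map (g : nat -> nat) s t : swadj s t -> swadj (map g s) (map g t).
Proof.
by case/adjP=> k lt_k ->; rewrite -sw_map; apply: adj_sw; rewrite size_map.
Qed.

(* [phi] is an automorphism of the graph induced on the permutations of [base], with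
   inverse [psi]. *)
Lemma good_transport N S base (phi psi : vtx -> vtx) :
    (forall s, perm_eq s base -> psi (phi s) = s) ->
    (forall s t, perm_eq s base -> swadj s t -> swadj (phi s) (phi t)) ->
    (forall s, s \in S -> perm_eq s base) ->
  good N S -> good N (map phi S).
Proof.
move=> K A PS [f [ex [okx [fS ct]]]].
pose ex' := map (fun e : vtx * nat => (phi e.1, e.2)) ex.
have inj s t : s \in S -> t \in S -> phi s = phi t -> s = t.
  by move=> sS tS e; rewrite -(K s (PS s sS)) e K ?PS.
have exS e : e \in ex -> e.1 \in S.
  case: okx => [|y x w j yS _ _ _ _ _|a b c d j P _ _ _|c x y z i j P _ _ _ _]; rewrite ?in_nil //.
  - by rewrite inE => /eqP->.
  - by rewrite !inE => /or4P[]/eqP->; rewrite (perm_mem P) !inE eqxx ?orbT.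
  by rewrite !inE => /orP[]/eqP->; rewrite (perm_mem P) !inE eqxx ?orbT.
have exE s j : s \in S -> ((phi s, j) \in ex') = ((s, j) \in ex).
  move=> sS; apply/mapP/idP => [[[t i] te [e ->]]|e]; last by exists (s, j).
  by rewrite (inj s t sS (exS _ te) e).
exists (f \o psi), ex'; split.
  rewrite /ex'; move: okx; clear ex' exE exS ct => - [|y x w j yS xS wS nxw yx yw|a b c d j P ab
      bc cd|c x y z i j P cx cy cz nij].
  - exact: ExNone.
  - apply: ExMid (map_f phi xS) (map_f phi wS) _ _ _; rewrite ?map_f ?A ?PS //.
    by apply: contraNneq nxw => /inj->.
  - have [aS bS cS] : [/\ a \in S, b \in S & c \in S] by rewrite !(perm_mem P) !inE !eqxx !orbT.
    by apply: (ExPath _ (perm_map phi P)); rewrite A ?PS.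
  have cS : c \in S by rewrite !(perm_mem P) !inE !eqxx.
  by apply: (ExStar (perm_map phi P)); rewrite ?A ?PS.
split=> [_ /mapP[s sS ->] /=|j _ _ lt_j /mapP[s sS ->] /mapP[t tS ->]]; first by rewrite K ?PS ?fS.
rewrite !exE // => ns nt; have [p pp <-] := ct j s t lt_j sS tS ns nt.
move: (PS s sS) pp; clear sS ns; elim: p s => [|u p IHp] s Ps /=; first by move=> _; apply:
    conn_refl.
case/andP=> /and4P[su c1 c2 c3] pp.
have Pu : perm_eq u base by rewrite (perm_trans _ Ps) // perm_sym adj_perm.
apply: conn_trans (IHp u Pu pp); apply: conn1; rewrite /ecol A //= !K // c1 /=.
by apply/andP; split; [case/orP: c2 => [->|/(map_f phi)->] | case/orP: c3 => [->|/(map_f phi)->]];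
  rewrite ?orbT.
Qed.

Lemma good_rev N base S : (forall s, s \in S -> perm_eq s base) ->
  good N S -> good N (map rev S).
Proof.
by apply: (good_transport (psi := rev)) => [s _|s t _]; rewrite ?revK ?adj_rev.
Qed.

Lemma index_rev s p q : uniq s -> p \in s -> q \in s ->
  (index p (rev s) < index q (rev s)) = (index q s < index p s).
Proof.
elim: s => //= x s IHs /andP[nx us]; rewrite rev_cons -cats1 !inE.
have ir (t : nat) : t \in s -> index t (rev s ++ [:: x]) = index t (rev s).
  by move=> ts; rewrite index_cat mem_rev ts.
have ix : index x (rev s ++ [:: x]) = size s.
  by rewrite index_cat mem_rev (negPf nx) /= eqxx addn0 size_rev.
have lt (t : nat) : t \in s -> index t (rev s) < size s by rewrite -mem_rev -index_mem size_rev.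
have ne (t : nat) : t \in s -> (x == t) = false by apply: contraTF => /eqP <-.
case: (eqVneq p x) => [->|_]; case: (eqVneq q x) => [->|_] /= ps qs;
  rewrite ?eqxx ?ix ?ir ?ne ?ltnS ?IHs ?ltnn ?lt //.
by rewrite ltnNge ltnW ?lt.
Qed.

Lemma dif_mem base s t p q : perm_eq s base -> perm_eq t base -> dif s t p q ->
  (p \in base) && (q \in base).
Proof.
move=> Ps Pt; have [ms mt] := (perm_mem Ps, perm_mem Pt).
have [szs szt] := (perm_size Ps, perm_size Pt).
rewrite /dif; case: (boolP (p \in base)) => pb; last first.
  by rewrite (memNindex (x := p)) ?ms // (memNindex (x := p)) ?mt // !ltnNge !index_size.
case: (boolP (q \in base)) => // qb.
rewrite (memNindex (x := q)) ?ms // (memNindex (x := q)) ?mt //.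
by rewrite !index_mem ms mt pb.
Qed.

(** Reversal inverts every comparison, so the same pairs of values disagree. *)
Lemma near_rev N base A : uniq base -> (forall s, s \in A -> perm_eq s base) ->
  near N (map rev A) -> near N A.
Proof.
move=> ub PA [Q sQ nQ]; exists Q => // s t sA tA p q d.
have [Ps Pt] := (PA s sA, PA t tA); have /andP[pb qb] := dif_mem Ps Pt d.
have [us ut] : uniq s /\ uniq t by rewrite !(perm_uniq Ps) (perm_uniq Pt).
have [ms mt] := (perm_mem Ps, perm_mem Pt).
rewrite orbC; apply: (nQ _ _ (map_f rev sA) (map_f rev tA)).
by move: d; rewrite /dif !index_rev ?ms ?mt.
Qed.

Lemma rem_rev v s : uniq s -> rem v (rev s) = rev (rem v s).
Proof. by move=> us; rewrite !rem_filter ?rev_uniq // filter_rev. Qed.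

Lemma index_rem v p q s : uniq s -> p != v -> q != v ->
  (index p (rem v s) < index q (rem v s)) = (index p s < index q s).
Proof.
move=> us npv nqv; rewrite rem_filter //; elim: s us => //= x s IHs /andP[nx us].
case: (eqVneq x v) => [->|nxv] /=.
  rewrite ![v == _]eq_sym (negPf npv) (negPf nqv) ltnS -IHs //.
case: (x == p); case: (x == q) => //; rewrite ltnS; exact: IHs.
Qed.

Definition before s (e : nat * nat) := index e.1 s < index e.2 s.
Definition pairs_of s := [seq e <- [seq (p, q) | p <- s, q <- s] | before s e].
Definition touch v (e : nat * nat) := (v == e.1) || (v == e.2).

Section Moved.

Variables (y : vtx) (S : seq vtx).
Hypothesis uy : uniq y.
Hypothesis S_perm : forall s, s \in S -> perm_eq s y.

(** Each unordered pair of values is listed once, in its order in [y], and counts if some member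
    inverts it. By [moved_relabel] this becomes a set of inversions when [y] is relabelled to the
    identity. *)
Definition moved := [seq e <- pairs_of y | has (fun s => ~~ before s e) S].
Definition deg v := count (touch v) moved.

Lemma moved_uniq : uniq moved.
Proof. by rewrite !filter_uniq // allpairs_uniq // => -[a b] [c d]. Qed.

Lemma mem_moved p q : ((p, q) \in moved) =
  [&& has (fun s => ~~ before s (p, q)) S, index p y < index q y, p \in y & q \in y].
Proof.
rewrite !mem_filter; congr (_ && (_ && _)).
by apply/allpairsP/andP => [[[a b] /= [ay yb [-> ->]]] // | [py qy]]; exists (p, q).
Qed.

Lemma movedE s p q : s \in S -> p \in y -> q \in y ->
  index p y < index q y -> index q s <= index p s -> (p, q) \in moved.
Proof.
move=> sS py qy lt_pq le_qp; rewrite mem_moved lt_pq py qy /= andbT.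
by apply/hasP; exists s; rewrite // /before -leqNgt.
Qed.

Lemma sum_deg : \sum_(v <- y) deg v = (size moved).*2.
Proof.
have e : forall r, {subset r <= moved} -> \sum_(v <- y) count (touch v) r = (size r).*2.
  elim=> [|[p q] r IHr] sub /=; first by rewrite big1.
  rewrite big_split /= IHr; last by move=> e er; apply: sub; rewrite inE er orbT.
  have := sub (p, q) (mem_head _ _); rewrite mem_moved => /and4P[_ lt_pq py qy].
  have npq : p != q by apply: contraTneq lt_pq => ->; rewrite ltnn.
  rewrite (eq_bigr (fun v => (v == p) + (v == q))); last first.
    move=> v _; rewrite /touch /=; case: (eqVneq v p) => // ->.
    by rewrite (negPf npq).
  have one x : x \in y -> \sum_(v <- y) (v == x) = 1.
    move=> xy; rewrite (eq_bigr (fun v => if v == x then 1 else 0)); last by move=> v _; case: (v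
        == x).
    by rewrite -big_mkcond sum1_count -/(count_mem x y) count_uniq_mem // xy.
  by rewrite big_split /= !one // doubleS.
exact: e.
Qed.

Lemma near_moved : y \in S -> near 3 S -> size moved <= 3.
Proof.
move=> yS [Q sQ nQ].
(* The pairs of [Q] are oriented as in [y], to be comparable with moved pairs. *)
pose o (e : nat * nat) := if before y e then e else (e.2, e.1).
apply: leq_trans (_ : size (map o Q) <= 3); last by rewrite size_map.
apply: uniq_leq_size; first exact: moved_uniq.
case=> p q; rewrite mem_moved => /and4P[/hasP[s sS ns] lt_pq _ _].
have := nQ y s yS sS p q; rewrite /dif lt_pq; move: ns; rewrite /before /= => /negPf->.
case/(_ isT)/orP=> eQ; apply/mapP; first by exists (p, q); rewrite // /o /before /= lt_pq.
by exists (q, p); rewrite // /o /before /= ltnNge (ltnW lt_pq).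
Qed.

(** Deleting [v] loses exactly the moved pairs that contain [v]; three pairs cover the others. *)
Lemma near_deg v : y \in S -> near 3 (map (rem v) S) -> size moved <= deg v + 3.
Proof.
move=> yS [Q sQ nQ]; rewrite -(count_predC (touch v)) leq_add2l -size_filter.
pose o (e : nat * nat) := if before y e then e else (e.2, e.1).
apply: leq_trans (_ : size (map o Q) <= 3); last by rewrite size_map.
apply: uniq_leq_size; first by rewrite filter_uniq ?moved_uniq.
case=> p q; rewrite mem_filter mem_moved => /and5P[/= nv /hasP[s sS ns] lt_pq _ _].
move: nv; rewrite negb_or ![v == _]eq_sym => /andP[npv nqv].
have us : uniq s by rewrite (perm_uniq (S_perm sS)).
have := nQ _ _ (map_f (rem v) yS) (map_f (rem v) sS) p q; rewrite /dif !index_rem //.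
rewrite lt_pq; move: ns; rewrite /before /= => /negPf->.
case/(_ isT)/orP=> eQ; apply/mapP; first by exists (p, q); rewrite // /o /before /= lt_pq.
by exists (q, p); rewrite // /o /before /= ltnNge (ltnW lt_pq).
Qed.

Lemma deg0 v s q : v \in y -> q \in y -> deg v = 0 -> s \in S -> q != v ->
  (index q s < index v s) = (index q y < index v y).
Proof.
move=> vy qy d0 sS nqv; have none e : e \in moved -> ~~ touch v e.
  move=> em; apply: contraTN isT => te; move: d0; rewrite /deg => /eqP.
  by rewrite -leqn0 leqNgt -has_count; case/negP; apply/hasP; exists e.
have Ps := S_perm sS; have ms := perm_mem Ps.
have inj r : v \in r -> q \in r -> index q r = index v r -> False.
  by move=> vr qr e; move: nqv; rewrite -(nth_index 0 qr) e nth_index ?eqxx.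
have [lt_q|lt_v|e] := ltngtP (index q y) (index v y); last by case: (inj y).
- apply: contraTT lt_q; rewrite -leqNgt => le; apply/negP => lt_q.
  by case/negP: (none (q, v) (movedE sS qy vy lt_q le)); rewrite /touch eqxx orbT.
apply/negbTE; rewrite -leqNgt leqNgt; apply: contraTN lt_v => lt_q; apply/negP => lt_v.
by case/negP: (none (v, q) (movedE sS vy qy lt_v (ltnW lt_q))); rewrite /touch eqxx.
Qed.

End Moved.

(** When all adjacencies of columns come from adjacencies of members, even exemptions along a tree
    are inherited, and [basic_lift] suffices. *)
Lemma real_lift v base S : uniq (v :: base) -> 2 < size base ->
    (forall s, s \in S -> perm_eq s (v :: base)) -> (forall s, s \in S -> 0 < index v s) ->
    uniq S -> uniq (map (rem v) S) ->
    (forall s t, s \in S -> t \in S -> swadj (rem v s) (rem v t) -> swadj s t) ->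
  good (size base).-2 (map (rem v) S) -> good (size base).-1 S.
Proof.
move=> ub m2 PS S_lv uS uP real [f [ex [okx cf]]]; have m1 := ltnW m2.
have inS : {in S &, injective (rem v)} by apply: uniq_map_inj.
have lift4 a b c d : perm_eq (map (rem v) S) [:: a; b; c; d] ->
    exists a' b' c' d', [/\ perm_eq S [:: a'; b'; c'; d'], rem v a' = a, rem v b' = b, rem v c' =
        c &
      rem v d' = d].
  move=> P; have sz : size S = 4 by rewrite -(size_map (rem v)) (perm_size P).
  have inP e : e \in [:: a; b; c; d] -> exists2 e', e' \in S & rem v e' = e.
    by rewrite -(perm_mem P) => /mapP[e' e'S ->]; exists e'.
  have [a' aS ea] := inP a (mem_head _ _).
  have [b' bS eb] : exists2 e', e' \in S & rem v e' = b by apply: inP; rewrite !inE eqxx orbT.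
  have [c' cS ec] : exists2 e', e' \in S & rem v e' = c by apply: inP; rewrite !inE eqxx !orbT.
  have [d' dS ed] : exists2 e', e' \in S & rem v e' = d by apply: inP; rewrite !inE eqxx !orbT.
  exists a', b', c', d'; split=> //; have uR : uniq [:: a'; b'; c'; d'].
    apply: (@map_uniq _ _ (rem v)); have -> : map (rem v) [:: a'; b'; c'; d'] = [:: a; b; c; d].
      by rewrite /= ea eb ec ed.
    by rewrite -(perm_uniq P).
  rewrite perm_sym; apply: uniq_perm => //.
  have sub : {subset [:: a'; b'; c'; d'] <= S} by move=> s; rewrite !inE => /or4P[]/eqP->.
  by have [|_] := uniq_min_size uR sub; rewrite ?sz.
case: okx cf => [|y x w j|a b c d j P|c x y z i j P].
- move=> cf; exact: (basic_lift ub PS S_lv m1 uP cf (ExNone S)).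
- case/mapP=> y' yS -> /mapP[x' xS ->] /mapP[w' wS ->] nxw yx yw cf.
  apply: (basic_lift ub PS S_lv m1 uP cf (ex := [:: (y', j)])).
    apply: (ExMid j yS xS wS) (real _ _ yS xS yx) (real _ _ yS wS yw).
    by apply: contraNneq nxw => ->.
  by move=> s k sS; rewrite !inE !xpair_eqE (inj_in_eq inS).
- move=> ab bc cd cf; have [a' [b' [c' [d' [P' ea eb ec ed]]]]] := lift4 _ _ _ _ P.
  have [aS bS cS dS] : [/\ a' \in S, b' \in S, c' \in S & d' \in S].
    by rewrite !(perm_mem P') !inE !eqxx !orbT.
  apply: (basic_lift ub PS S_lv m1 uP cf (ex := [:: (a', j); (b', j); (c', j); (d', j)])).
    by apply: (ExPath j P'); apply: real; rewrite ?ea ?eb ?ec ?ed.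
  by move=> s k sS; rewrite -ea -eb -ec -ed !inE !xpair_eqE !(inj_in_eq inS).
move=> cx cy cz nij cf; have [c' [x' [y' [z' [P' ec ex' ey ez]]]]] := lift4 _ _ _ _ P.
have [cS xS yS zS] : [/\ c' \in S, x' \in S, y' \in S & z' \in S].
  by rewrite !(perm_mem P') !inE !eqxx !orbT.
apply: (basic_lift ub PS S_lv m1 uP cf (ex := [:: (c', i); (c', j)])).
  by apply: (ExStar P') => //; apply: real; rewrite ?ec ?ex' ?ey ?ez.
by move=> s k sS; rewrite -ec !inE !xpair_eqE !(inj_in_eq inS).
Qed.

Lemma index_count s v : uniq s -> v \in s ->
  count (fun q => index q s < index v s) s = index v s.
Proof.
move=> us vs; have lt_v : index v s <= size s by apply: index_size.
rewrite -[X in count _ X](cat_take_drop (index v s) s) count_cat.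
have -> : count (fun q => index q s < index v s) (take (index v s) s) = index v s.
  rewrite -[RHS](size_takel lt_v); apply/eqP; rewrite -all_count; apply/allP => q.
  exact: index_ltn.
rewrite (eq_in_count (a2 := pred0)) ?count_pred0 ?addn0 // => q qd /=.
rewrite -(in_take_leq q lt_v); apply: contraTF qd => qt.
by move: us; rewrite -{1}(cat_take_drop (index v s) s) cat_uniq => /and3P[_ /hasPn h _];
   apply: contraL qt => /h.
Qed.

Lemma index_lt_rem v (c : nat) s : uniq s -> v \in s -> c != v ->
  (index c s < index v s) = (index c (rem v s) < index v s).
Proof.
move=> us vs ncv; elim: s us vs => //= x s IHs /andP[nx us].
rewrite inE eq_sym; case: (eqVneq x v) => [-> _|nxv /= vs] /=; first by rewrite !ltn0.
by rewrite [x == c]eq_sym; case: (eqVneq c x) => // _; rewrite !ltnS IHs.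
Qed.

(** * Values that can be deleted *)

Section Step.

Variables (m : nat) (y : vtx) (S : seq vtx).
Hypothesis m2 : 2 < m.
Hypothesis IH : forall base T, uniq base -> size base = m -> uniq T -> size T = 4 ->
  (forall s, s \in T -> perm_eq s base) -> good m.-2 T.
Hypothesis uy : uniq y.
Hypothesis szy : size y = m.+1.
Hypothesis uS : uniq S.
Hypothesis szS : size S = 4.
Hypothesis S_perm : forall s, s \in S -> perm_eq s y.

Lemma delete_front v : v \in y -> (forall s, s \in S -> 0 < index v s) ->
  [\/ good m.-1 S, near 3 (map (rem v) S) | forked v S].
Proof.
move=> vy S_lv; have P := perm_to_rem vy.
have szb : size (rem v y) = m by rewrite size_rem // szy.
have ub : uniq (v :: rem v y) by rewrite -(perm_uniq P).
rewrite -szb; apply: (delete_value ub _ _ uS szS _ S_lv); rewrite ?szb //.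
  by move=> T uT szT PT; apply: (IH _ szb uT szT PT); case/andP: ub.
by move=> s /S_perm/permPl->.
Qed.

(** A value in no moved pair has the same predecessors in all members, hence the same position. Two
    members with adjacent columns are then adjacent themselves, so [real_lift] applies. *)
Lemma inert_front v : y \in S -> v \in y -> 0 < index v y -> deg y S v = 0 -> good m.-1 S.
Proof.
move=> yS vy lv0 d0; have P := perm_to_rem vy.
have szb : size (rem v y) = m by rewrite size_rem // szy.
have ub : uniq (v :: rem v y) by rewrite -(perm_uniq P).
have PS' s : s \in S -> perm_eq s (v :: rem v y) by move/S_perm/permPl->.
have us s : s \in S -> uniq s by move/S_perm/perm_uniq->.
have mS s : s \in S -> s =i y by move/S_perm/perm_mem.
have side s q : s \in S -> q \in y -> (index q s < index v s) = (index q y < index v y).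
  move=> sS qy; have [->|nqv] := eqVneq q v; first by rewrite !ltnn.
  exact: (deg0 S_perm vy qy d0 sS nqv).
have lvE s : s \in S -> index v s = index v y.
  move=> sS; rewrite -(index_count (us s sS)) ?mS // -(index_count uy vy).
  rewrite (seq.permP (S_perm sS)); apply: eq_in_count => q qy.
  by rewrite side.
have lv_s s : s \in S -> 0 < index v s by move/lvE->.
have insE s : s \in S -> ins v (index v y) (rem v s) = s.
  by move=> sS; rewrite -(lvE s sS) ins_rem // mS.
have inS : {in S &, injective (rem v)}.
  by move=> s t sS tS e; rewrite -(insE s sS) e insE.
rewrite -szb; apply: (real_lift ub _ PS' lv_s uS); rewrite ?szb ?map_inj_in_uniq //.
  move=> s t sS tS /adjP[i lt_i et].
  rewrite -(insE s sS) -(insE t tS) et; apply: adj_insH => //.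
    rewrite (perm_size (rem_perm (PS' s sS))) szb.
    by rewrite -ltnS -szy index_mem.
  (* Otherwise the exchanged entry [c] would pass from one side of [v] to the other. *)
  apply/eqP => el; have ur : uniq (rem v s) by rewrite rem_uniq ?us.
  pose c := nth 0 (rem v s) i; have c_in : c \in rem v s by apply: mem_nth; apply: ltnW.
  have ncv : c != v by move: c_in; rewrite mem_rem_uniq ?us // inE => /andP[].
  have cy : c \in y by rewrite -(mS s sS) (mem_rem c_in).
  have := side s c sS cy; rewrite -(side t c tS cy).
  rewrite !index_lt_rem ?us ?mS // !lvE // et el /c index_uniq ?(ltnW lt_i) // ltnSn.
  have [_ e2] := nth_sw lt_i.
  by rewrite -e2 index_uniq ?size_sw ?sw_uniq // ltnn.
by apply: (IH _ szb); rewrite ?size_map ?map_inj_in_uniq ?rem_uniq // => _ /mapP[s sS ->];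
   apply: rem_perm (PS' s sS).
Qed.

End Step.

(** * Forks *)

Lemma index_sw v k s : uniq s -> k.+1 < size s ->
  index v (sw k s) = if index v s == k then k.+1 else if index v s == k.+1 then k else index v s.
Proof.
elim: k s => [|k IHk] [|x [|z s]] //=; last first.
  move=> /andP[nx us] lt_k; case: (x == v) => //.
  by rewrite IHk // !eqSS; case: (_ == k) => //; case: (_ == _).
rewrite inE negb_or => /andP[/andP[nxz _] _] _.
case: (eqVneq x v) => [<-|_] /=; first by rewrite [z == x]eq_sym (negPf nxz).
by case: (z == v).
Qed.

Lemma sw_rev k s : k.+1 < size s -> sw k (rev s) = rev (sw (size s - k.+2) s).
Proof.
move=> lt_k; pose j := size s - k.+2.
have [a [x [z [b [es sza szb]]]]] : exists a x z b,
    [/\ s = a ++ x :: z :: b, size a = size s - k.+2 & size b = k].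
  have szd := size_drop j s; have szt : size (take j s) = j by rewrite size_takel // leq_subr.
  case E : (drop j s) szd (cat_take_drop j s) => [|x [|z b]] /= szb e.
  - by move: szb; rewrite /j; arith.
  - by move: szb; rewrite /j; arith.
  by exists (take j s), x, z, b; split=> //; move: szb; rewrite /j; arith.
rewrite -sza es sw_cat !rev_cat !rev_cons -!cats1 -!catA /= -szb -(size_rev b).
exact: sw_cat.
Qed.

Lemma head_index v s : s != [::] -> (head 0 s == v) = (index v s == 0).
Proof. by case: s => //= x s _; case: (x == v). Qed.

Lemma last_index v s : s != [::] -> uniq s -> (last 0 s == v) = (v \in s) && ((index v s).+1 ==
    size s).
Proof.
case: s => // x r _ us; rewrite -nth_last; case: (boolP (v \in x :: r)) => [vs|nv] /=; last first.
  by apply: contraNF nv => /eqP<-; apply: mem_nth.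
rewrite -{1}(nth_index 0 vs) nth_uniq ?index_mem //= eq_sym.
by case: (x == v).
Qed.

Definition fork S y p q :=
  [/\ y \in S, sw p y \in S, sw q y \in S, (p.+1 < size y) && (q.+1 < size y) & p != q].

(** Moving [v] one position further turns [y] into [x]. The exchange [i] of columns that leads to
    [z] becomes the exchange [i] or [i.+1] of [y], according to whether it takes place before or
    after [v]. *)
Lemma forked_fork v n S : (forall s, s \in S -> uniq s /\ size s = n.+1) ->
    (forall s, s \in S -> v \in s) -> forked v S ->
  exists y p q, [/\ fork S y p q, index v y = p & q.+1 != p].
Proof.
move=> PS vS [x [y [z [i [[xS yS zS] [exy ezy lx lz /andP[lt_i ni]]]]]]].
have insE s : s \in S -> ins v (index v s) (rem v s) = s by move=> /vS; apply: ins_rem.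
have szr s : s \in S -> size (rem v s) = n.
  by move=> sS; rewrite size_rem ?vS // (PS s sS).2.
set l := index v y in lx lz ni *.
have lt_l : l < n.
  have := vS x xS; rewrite -index_mem lx (PS x xS).2 ltnS; exact.
have ex : x = sw l y by rewrite -(insE x xS) lx exy insV ?szr // insE.
have szy := (PS y yS).2; rewrite szr // in lt_i.
have [lt_il|le_li] := ltnP i.+1 l.
  exists y, l, i; split=> //.
  have ez : z = sw i y by rewrite -(insE z zS) lz ezy insHr ?szr // insE.
  split=> //; rewrite -?ex -?ez // ?szy ?ltnS ?lt_l ?(ltnW lt_i) //.
  by rewrite neq_ltn (ltnW lt_il) orbT.
have le_li' : l <= i by move: ni; rewrite eq_sym; arith.
exists y, l, i.+1; split=> //; last by rewrite neq_ltn ltnS (leq_trans le_li') ?orbT.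
have ez : z = sw i.+1 y by rewrite -(insE z zS) lz ezy insHl // insE.
split=> //; rewrite -?ex -?ez // ?szy ?ltnS ?lt_l ?lt_i //.
by rewrite neq_ltn ltnS le_li'.
Qed.

(** Mirror image of [forked_fork]: reversal turns position [k] into [n - k] and the exchange [k]
    into [n - k.+1], so [v] is now the second of the entries exchanged by [p]. *)
Lemma forked_fork_rev v n S : (forall s, s \in S -> uniq s /\ size s = n.+1) ->
    (forall s, s \in S -> v \in s) -> forked v (map rev S) ->
  exists y p q, [/\ fork S y p q, index v y = p.+1 & q != p.+1].
Proof.
move=> PS vS fk.
have [||y' [p' [q' [[yS xS zS lt_pq npq] ly nq]]]] := forked_fork (n := n) _ _ fk.
- by move=> _ /mapP[s sS ->]; rewrite rev_uniq size_rev; apply: PS.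
- by move=> _ /mapP[s sS ->]; rewrite mem_rev vS.
case/mapP: yS => y yS ey; have [uy szy] := PS y yS; subst y'.
have /andP[lt_p lt_q] : (p' < n) && (q' < n) by move: lt_pq; rewrite size_rev szy.
rewrite !sw_rev ?szy // !subSS in xS zS.
have inj t : rev t \in map rev S -> t \in S by rewrite mem_map //; apply: (can_inj revK).
exists y, (n - p'.+1), (n - q'.+1); split=> //.
- split; [by [] | exact: inj xS | exact: inj zS | by rewrite szy; apply/andP; split; arith |].
  by apply: contraNneq npq => e; apply/eqP; move: e; arith.
- have lv : index v (rev y) = n - index v y.
    have vy := vS y yS; move: uy szy; case/splitPr: vy => a b.
    rewrite cat_uniq /= negb_or size_cat /= addnS => /and4P[_ /andP[na _] nb _] [<-].
    rewrite rev_cat rev_cons cat_rcons !index_cat mem_rev (negPf nb) (negPf na) /= eqxx size_rev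
        !addn0.
    by rewrite addKn.
  have := vS y yS; rewrite -index_mem szy ltnS => le_v.
  by move: ly; rewrite lv; arith.
by apply: contraNneq nq => e; apply/eqP; move: e; arith.
Qed.

(** * Deletion from either end *)

Section Orient.

Variables (m : nat) (y : vtx) (S : seq vtx).
Hypothesis m2 : 2 < m.
Hypothesis IH : forall base T, uniq base -> size base = m -> uniq T -> size T = 4 ->
  (forall s, s \in T -> perm_eq s base) -> good m.-2 T.
Hypothesis uy : uniq y.
Hypothesis szy : size y = m.+1.
Hypothesis uS : uniq S.
Hypothesis szS : size S = 4.
Hypothesis S_perm : forall s, s \in S -> perm_eq s y.

Let uS' : uniq (map rev S). Proof. by rewrite map_inj_uniq //; apply: (can_inj revK). Qed.
Let szS' : size (map rev S) = 4. Proof. by rewrite size_map. Qed.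
Let uy' : uniq (rev y). Proof. by rewrite rev_uniq. Qed.
Let szy' : size (rev y) = m.+1. Proof. by rewrite size_rev. Qed.
Let S_perm' s : s \in map rev S -> perm_eq s (rev y).
Proof.
case/mapP=> t /S_perm P ->; rewrite (perm_trans (y := t)) ?perm_rev //.
by rewrite (perm_trans P) // perm_sym perm_rev.
Qed.

Let good_unrev : good m.-1 (map rev S) -> good m.-1 S.
Proof. by move/(good_rev S_perm'); rewrite mapK //; apply: revK. Qed.

(** By [near_deg] too many pairs move for the columns to be [near 3], before or after reversal. So
    [delete_front] can fail only through a member that has [v] at the end in question, or through a
    fork. *)
Lemma obstructed v : ~ good m.-1 S -> y \in S -> v \in y -> deg y S v + 3 < size (moved y S) ->
  (has (fun s => head 0 s == v) S \/ forked v S) /\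
  (has (fun s => last 0 s == v) S \/ forked v (map rev S)).
Proof.
move=> ng yS vy lt_d; have nn s : s \in S -> s != [::].
  by move=> /S_perm/perm_size; rewrite szy; case: s.
have far : ~ near 3 (map (rem v) S).
  by move/(near_deg uy S_perm yS); rewrite leqNgt lt_d.
split.
- case: (boolP (has _ S)) => [_|none]; [by left | right].
  have [|//|//|//] := delete_front m2 IH uy szy uS szS S_perm vy.
  by move=> s sS; rewrite lt0n -(head_index _ (nn s sS)); move/hasPn: none; apply.
case: (boolP (has _ S)) => [_|none]; [by left | right].
have vy' : v \in rev y by rewrite mem_rev.
have [|/good_unrev//|nr|//] := delete_front m2 IH uy' szy' uS' szS' S_perm' vy'.
  move=> _ /mapP[s sS ->]; rewrite lt0n -head_index; last by rewrite -size_eq0 size_rev size_eq0 nn.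
  have -> : head 0 (rev s) = last 0 s by case/lastP: s {sS} => // s x; rewrite rev_rcons last_rcons.
  by move/hasPn: none; apply.
case: far; have P := perm_to_rem vy.
have us s : s \in S -> uniq s by move/S_perm/perm_uniq->.
apply: (near_rev (base := rem v y)); first by rewrite rem_uniq.
  move=> _ /mapP[s sS ->]; apply: rem_perm; rewrite (perm_trans (S_perm sS)) //.
congr (near 3 _): nr; rewrite -!map_comp; apply/eq_in_map => s sS /=.
by rewrite rem_rev ?us.
Qed.

(** A value in no moved pair could be deleted by [inert_front], after reversal if it is the first
    entry of [y]. *)
Lemma inert v : ~ good m.-1 S -> y \in S -> v \in y -> 0 < deg y S v.
Proof.
move=> ng yS vy; rewrite lt0n; apply/eqP => d0.
have ny : y != [::] by case: (y) szy.
have [e|lv0] := posnP (index v y); last first.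
  exact/ng/(inert_front m2 IH uy szy uS szS S_perm yS vy lv0 d0).
apply/ng/good_unrev; have vy' : v \in rev y by rewrite mem_rev.
have yS' : rev y \in map rev S by apply: map_f.
apply: (inert_front m2 IH uy' szy' uS' szS' S_perm' yS' vy').
  rewrite lt0n -head_index; last by rewrite -size_eq0 size_rev size_eq0.
  have -> : head 0 (rev y) = last 0 y by case/lastP: (y) => // s x; rewrite rev_rcons last_rcons.
  by rewrite last_index // vy e szy eqSS eq_sym -lt0n (ltn_trans _ m2).
apply/eqP; rewrite -leqn0 leqNgt -has_count; apply/hasP => -[[p q]].
rewrite mem_moved /touch => /and4P[/hasP[_ /mapP[s sS ->] ns]]; rewrite !mem_rev => lt_pq py qy te.
have ms := perm_mem (S_perm sS); have us : uniq s by rewrite (perm_uniq (S_perm sS)).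
move: ns lt_pq; rewrite /before /= !index_rev ?ms // -leqNgt => le_pq lt_qp.
have em : (q, p) \in moved y S := movedE sS qy py lt_qp le_pq.
have : has (touch v) (moved y S) by apply/hasP; exists (q, p); rewrite // /touch orbC.
by rewrite has_count -/(deg y S v) d0.
Qed.

End Orient.

(* Two forks of [S] with different centres or different branches would make [S] the
   vertex set of a tree. *)
Lemma fork_unique base S y p q : uniq base -> (forall s, s \in S -> perm_eq s base) ->
    uniq S -> size S = 4 -> ~ near 3 S -> fork S y p q ->
  exists w, perm_eq S [:: y; sw p y; sw q y; w] /\
    forall y' p' q', fork S y' p' q' -> y' = y /\ (p' = p /\ q' = q \/ p' = q /\ q' = p).
Proof.
move=> ub PS uS szS far [yS xS zS /andP[lt_p lt_q] npq].
have us s : s \in S -> uniq s by move/PS/perm_uniq->.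
have uy := us y yS.
have nxz : sw p y != sw q y by apply: contraNneq npq => /(sw_inj uy lt_p lt_q)->.
have [nxy nzy] := (sw_neq uy lt_p, sw_neq uy lt_q).
have [a [b P]] := perm_pick szS uS xS zS nxz.
have [w P'] : exists w, perm_eq S [:: y; sw p y; sw q y; w].
  move: (yS); rewrite (perm_mem P) !inE ![y == sw _ _]eq_sym (negPf nxy) (negPf nzy) /=.
  case/orP=> /eqP e; [exists b | exists a]; rewrite (permPl P) e.
    by rewrite (perm_catCA [:: _; _] [:: _]).
  by rewrite (perm_catCA [:: _; _; _] [:: _]) /= perm_cons (perm_catCA [:: _; _] [:: _]) perm_catCA.
exists w; split=> // y' p' q' [yS' xS' zS' /andP[lt_p' lt_q'] npq'].
have inS s : s \in S -> [|| s == y, s == sw p y, s == sw q y | s == w].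
  by rewrite (perm_mem P') !inE.
have [yx yz] := (adj_sw lt_p, adj_sw lt_q).
have xy : swadj (sw p y) y by rewrite adj_sym.
have zy : swadj (sw q y) y by rewrite adj_sym.
have nxz' := no_triangle uy yx yz nxz.
have nyw : ~~ swadj y w.
  apply/negP => yw; apply: far; apply: (near_star3 us yx yz yw uy) => s.
  by rewrite (perm_mem P').
have nxw : ~~ swadj (sw p y) w.
  apply/negP => xw; apply: far; apply: (near_path3 us zy yx xw) => // s /inS.
  by rewrite !inE => /or4P[]->; rewrite ?orbT.
have nzw : ~~ swadj (sw q y) w.
  apply/negP => zw; apply: far; apply: (near_path3 us xy yz zw) => // s /inS.
  by rewrite !inE => /or4P[]->; rewrite ?orbT.
have wS : w \in S by rewrite (perm_mem P') !inE eqxx !orbT.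
have irr s : s \in S -> swadj s s = false by move=> /us/adj_irrefl.
have nb s t : s \in S -> t \in S -> swadj s t -> (s == y) || (t == y).
  move=> sS tS; case/or4P: (inS s sS) => /eqP->; case/or4P: (inS t tS) => /eqP->;
    rewrite ?eqxx ?orbT ?irr // 1?adj_sym ?(negPf nxw) ?(negPf nzw) ?(negPf nyw) ?(negPf nxz') //;
    by rewrite adj_sym ?(negPf nxz') ?(negPf nxw) ?(negPf nzw).
have uy' := us y' yS'.
have [yx' yz'] := (adj_sw lt_p', adj_sw lt_q').
have nxz2 : sw p' y' != sw q' y' by apply: contraNneq npq' => /(sw_inj uy' lt_p' lt_q')->.
have ey : y' = y.
  have := nb _ _ yS' xS' yx'; have := nb _ _ yS' zS' yz'.
  case: (eqVneq y' y) => //= _ /eqP e1 /eqP e2.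
  by rewrite e1 e2 eqxx in nxz2.
subst y'; split=> //.
have branch k : k.+1 < size y -> sw k y \in S -> k = p \/ k = q.
  move=> lt_k /inS/or4P[]/eqP e.
  - by have := sw_neq uy lt_k; rewrite e eqxx.
  - by left; apply: (sw_inj uy lt_k lt_p e).
  - by right; apply: (sw_inj uy lt_k lt_q e).
  by move: (adj_sw lt_k); rewrite e (negPf nyw).
have := branch p' lt_p' xS'; have := branch q' lt_q' zS'.
by case=> e1 [] e2; subst; rewrite ?eqxx in npq' *; auto.
Qed.

Lemma fork_sym S y p q : fork S y p q -> fork S y q p.
Proof. by case=> yS xS zS lt_pq npq; split=> //; rewrite 1?andbC 1?eq_sym. Qed.

Lemma sum_lower (r : seq nat) (F : nat -> nat) k :
  (forall v, v \in r -> k <= F v) -> size r * k <= \sum_(v <- r) F v.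
Proof.
elim: r => [|x r IHr] le_k; first by rewrite mul0n.
rewrite big_cons /= mulSn leq_add ?le_k ?mem_head // IHr // => v vr.
by apply: le_k; rewrite inE vr orbT.
Qed.

Lemma sum_split (y l : vtx) (F : nat -> nat) k : uniq y -> uniq l -> {subset l <= y} ->
    (forall v, v \in y -> v \notin l -> k <= F v) ->
  (size y - size l) * k + \sum_(v <- l) F v <= \sum_(v <- y) F v.
Proof.
move=> uy ul sub le_k; have P : perm_eq (filter (mem l) y ++ filter (predC (mem l)) y) y by
    rewrite perm_filterC.
have Pl : perm_eq (filter (mem l) y) l.
  apply: uniq_perm; rewrite ?filter_uniq // => v; rewrite mem_filter /=.
  by case: (boolP (v \in l)) => // /sub->.
have := perm_size P; rewrite size_cat (perm_size Pl) => <-.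
rewrite addKn -(perm_big _ P) big_cat /= (perm_big _ Pl) /= addnC leq_add2l.
by apply: sum_lower => v; rewrite mem_filter /= => /andP[nl vy]; apply: le_k.
Qed.

(** * Counting moved pairs for at least six values *)

Section Six.

Variables (m : nat) (S : seq vtx) (base : vtx).
Hypothesis m5 : 4 < m.
Hypothesis IH : forall base T, uniq base -> size base = m -> uniq T -> size T = 4 ->
  (forall s, s \in T -> perm_eq s base) -> good m.-2 T.
Hypothesis ub : uniq base.
Hypothesis szb : size base = m.+1.
Hypothesis uS : uniq S.
Hypothesis szS : size S = 4.
Hypothesis S_base : forall s, s \in S -> perm_eq s base.
Hypothesis ng : ~ good m.-1 S.

Let m2 : 2 < m. Proof. exact: ltn_trans m5. Qed.
Let us s : s \in S -> uniq s. Proof. by move/S_base/perm_uniq->. Qed.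
Let szs s : s \in S -> size s = m.+1. Proof. by move/S_base/perm_size->. Qed.
Let ms s : s \in S -> s =i base. Proof. by move/S_base/perm_mem. Qed.
Let nn s : s \in S -> s != [::].
Proof. by move/szs; case: s. Qed.
Let SP y : y \in S -> forall s, s \in S -> perm_eq s y.
Proof. by move=> yS s sS; rewrite (perm_trans (S_base sS)) // perm_sym S_base. Qed.

Let first v := has (fun s => head 0 s == v) S.
Let final v := has (fun s => last 0 s == v) S.

Let firstP v : first v -> exists2 s, s \in S & index v s = 0.
Proof. by case/hasP=> s sS; rewrite head_index ?nn // => /eqP e; exists s. Qed.

Let finalP v : final v -> exists2 s, s \in S & index v s = m.
Proof.
case/hasP=> s sS; rewrite last_index ?nn ?us // => /andP[_].
by rewrite szs // eqSS => /eqP e; exists s.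
Qed.

Let obs y v : y \in S -> v \in base -> deg y S v + 3 < size (moved y S) ->
  (first v \/ forked v S) /\ (final v \/ forked v (map rev S)).
Proof.
move=> yS vb; apply: (obstructed m2 IH (us yS) (szs yS) uS szS (SP yS) ng yS).
by rewrite ms.
Qed.

Let fork_front v : v \in base -> forked v S ->
  exists y p q, [/\ fork S y p q, index v y = p & q.+1 != p].
Proof.
move=> vb; apply: (forked_fork (n := m)) => s sS; first by split; rewrite ?us ?szs.
by rewrite ms.
Qed.

Let fork_back v : v \in base -> forked v (map rev S) ->
  exists y p q, [/\ fork S y p q, index v y = p.+1 & q != p.+1].
Proof.
move=> vb; apply: (forked_fork_rev (n := m)) => s sS; first by split; rewrite ?us ?szs.
by rewrite ms.
Qed.

Section Fork.

Variables (y : vtx) (p q : nat).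
Hypothesis far : ~ near 3 S.
Hypothesis fk : fork S y p q.
Hypothesis lt_pq : p < q.

Let yS : y \in S. Proof. by case: fk. Qed.
Let lt_q : q.+1 < m.+1. Proof. by case: fk => _ _ _; rewrite szs // => /andP[]. Qed.

(** By [fork_unique] the fork is determined up to the order of its branches, so [v] must be the
    first entry exchanged by one of them. Dually, [back_values] yields the second entries. If
    [q = p.+1], the entry common to both branches is excluded. *)
Lemma front_values v : v \in base -> forked v S ->
  index v y = p \/ index v y = q /\ q != p.+1.
Proof.
move=> vb /(fork_front vb)[y' [p' [q' [fk' iv nq]]]].
have [w [_ uniqf]] := fork_unique ub S_base uS szS far fk.
have [ey [[ep eq]|[ep eq]]] := uniqf _ _ _ fk'; subst; first by left.
by right; rewrite eq_sym.
Qed.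

Lemma back_values v : v \in base -> forked v (map rev S) ->
  index v y = p.+1 /\ q != p.+1 \/ index v y = q.+1.
Proof.
move=> vb /(fork_back vb)[y' [p' [q' [fk' iv nq]]]].
have [w [_ uniqf]] := fork_unique ub S_base uS szS far fk.
by have [ey [[ep eq]|[ep eq]]] := uniqf _ _ _ fk'; subst; [left | right].
Qed.

Definition swapped k j := if j == k then k.+1 else if j == k.+1 then k else j.

(** Three of the members are [y] and its two branches, where positions are explicit; only [w] is
    unknown. *)
Lemma fork_rest : exists2 w, w \in S & forall s v, s \in S ->
  [\/ s = w, index v s = index v y, index v s = swapped p (index v y) |
     index v s = swapped q (index v y)].
Proof.
have [w [P _]] := fork_unique ub S_base uS szS far fk.
exists w; first by rewrite (perm_mem P) !inE eqxx !orbT.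
have [lt_p' lt_q'] : p.+1 < size y /\ q.+1 < size y by case: fk => _ _ _ /andP[].
move=> s v; rewrite (perm_mem P) !inE => /or4P[]/eqP->.
- by constructor 2.
- by constructor 3; rewrite index_sw ?us.
- by constructor 4; rewrite index_sw ?us.
by constructor 1.
Qed.

Let nthP j : j < m.+1 -> nth 0 y j \in base /\ index (nth 0 y j) y = j.
Proof.
move=> lt_j; have lt_j' : j < size y by rewrite szs.
by rewrite -(ms yS) mem_nth // index_uniq // us.
Qed.

Let index_inj s (x v : nat) : s \in S -> x \in base -> index x s = index v s -> x = v.
Proof.
rewrite /= => sS; rewrite -(ms sS) => xin e; have vin : v \in s by rewrite -index_mem -e index_mem.
by rewrite -(nth_index 0 xin) e nth_index.
Qed.

(** A value at a position not exchanged by the fork must be first in one member and last in another,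
    and only [w] can move it. For an interior position both members would be [w]. This places the
    branches at positions 1 to 4, after which the values at positions 0 and 1 of [y] would both be
    last in [w]. *)
Lemma fork_all_obstructed :
  ~ (forall v, v \in base -> (first v \/ forked v S) /\ (final v \/ forked v (map rev S))).
Proof.
move=> all_obs; have [w wS rest] := fork_rest.
have fixed v j : index v y = j -> j \notin [:: p; p.+1; q; q.+1] -> forall s, s \in S -> s = w \/
    index v s = j.
  move=> iv; rewrite !inE !negb_or => /and4P[n1 n2 n3 n4] s sS.
  case: (rest s v sS) => [|->|->|->]; rewrite ?iv /swapped ?(negPf n1) ?(negPf n2) ?(negPf n3)
      ?(negPf n4); auto.
have ends v j : index v y = j -> v \in base -> j \notin [:: p; p.+1; q; q.+1] -> first v /\ final v.
  move=> iv vb nj; have [o1 o2] := all_obs v vb; move: nj; rewrite !inE !negb_or => /and4P[n1 n2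
      n3 n4].
  split.
    case: o1 => // /(front_values vb)[|[]]; rewrite iv => e; first by rewrite e eqxx in n1.
    by rewrite e eqxx in n3.
  case: o2 => // /(back_values vb)[[]|]; rewrite iv => e; first by rewrite e eqxx in n2.
  by rewrite e eqxx in n4.
have m0 : 0 < m := ltn_trans (ltn0Sn 1) m2.
have interior j : 0 < j < m -> j \in [:: p; p.+1; q; q.+1].
  case/andP=> j0 jm; apply: contraT => nj; have [vb iv] := nthP (ltnW jm : j < m.+1).
  have [/firstP[s sS e0] /finalP[t tS em]] := ends _ _ iv vb nj.
  have [es|e] := fixed _ _ iv nj s sS; last by rewrite -e e0 in j0.
  have [et|e] := fixed _ _ iv nj t tS; last by rewrite -e em ltnn in jm.
  by move: m0; rewrite -em et -es e0.
(* Positions 1 to 4 are interior because [m >= 5], and [p], [p.+1], [q], [q.+1] must cover them. *)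
have [ep eq] : p = 1 /\ q = 3.
  have := interior 1; have := interior 2; have := interior 3; have := interior 4.
  rewrite !inE !(leq_trans _ m5) // => /(_ isT) i4 /(_ isT) i3 /(_ isT) i2 /(_ isT) i1.
  by move: i1 i2 i3 i4 lt_pq; clear; arith.
have lt0 : 0 < m.+1 by [].
have [v0b iv0] := nthP lt0; have [_ /finalP[t tS em]] : first (nth 0 y 0) /\ final (nth 0 y 0).
  by apply: (ends _ _ iv0 v0b); rewrite ep eq.
have n0 : 0 \notin [:: p; p.+1; q; q.+1] by rewrite ep eq.
have etw : t = w.
  by case: (fixed _ _ iv0 n0 t tS) => // e; move: m0; rewrite -em e.
(* Position 1 holds the first entry of the branch [p], which [back_values] does not admit; hence its
   value is last in some member. *)
have lt1 : 1 < m.+1 by rewrite ltnS.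
have [v1b iv1] := nthP lt1; have [_ [/finalP[t' tS' em']|fb]] := all_obs _ v1b; last first.
  by case: (back_values v1b fb) => [[]|]; rewrite iv1 ?ep ?eq.
have et'w : t' = w.
  move: m5; rewrite -em'; case: (rest t' (nth 0 y 1) tS') => // ->; by rewrite iv1 /swapped ?ep ?eq.
have := index_inj (x := nth 0 y 0) (v := nth 0 y 1) tS v0b.
rewrite em etw -et'w em' => /(_ erefl) e; move: iv1; rewrite -e iv0 //.
Qed.

End Fork.

Lemma obstructed_fork v : v \in base -> ~ (first v /\ final v) ->
    (first v \/ forked v S) /\ (final v \/ forked v (map rev S)) ->
  exists y p q, p < q /\ fork S y p q.
Proof.
move=> vb nff [o1 o2].
have [y [p [q fk]]] : exists y p q, fork S y p q.
  case: o1 => [fv|/(fork_front vb)[y [p [q [fk _ _]]]]]; last by exists y, p, q.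
  case: o2 => [lv|/(fork_back vb)[y [p [q [fk _ _]]]]]; last by exists y, p, q.
  by case: nff.
have npq : p != q by case: fk.
by move: npq; rewrite neq_ltn => /orP[] lt; [exists y, p, q | exists y, q, p; split=> //; apply:
    fork_sym].
Qed.

Lemma some_member : exists y, y \in S.
Proof. by case: S szS => // y T _; exists y; rewrite mem_head. Qed.

(** Between a member where [v0] is first and one where it is last, [v0] passes every other value. *)
Lemma moved_through y v0 : y \in S -> v0 \in base -> first v0 -> final v0 ->
  forall x, x \in base -> x != v0 -> (if index x y < index v0 y then (x, v0) else (v0, x)) \in
      moved y S.
Proof.
move=> yS vb /firstP[s sS e0] /finalP[t tS em] x xb nxv.
have [xy vy] : x \in y /\ v0 \in y by rewrite !ms.
have neq r : r \in S -> index x r != index v0 r.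
  move=> rS; apply: contraNneq nxv => e; have xr : x \in r by rewrite ms.
  by rewrite -(nth_index 0 xr) e nth_index // ms.
case: ltnP => [lt|le].
  by apply: (movedE sS xy vy lt); rewrite e0.
have lt : index v0 y < index x y by rewrite ltn_neqAle eq_sym neq.
apply: (movedE tS vy xy lt); rewrite em -ltnS -(szs tS) index_mem ms //.
Qed.

(** Otherwise [v0] is in [m] moved pairs, of which [m.-1 > 3] avoid any other given value, so that
    all values are obstructed. Four members cannot have all values in first position, which yields a
    fork and contradicts [fork_all_obstructed]. *)
Lemma all_admissible v0 : v0 \in base -> ~ (first v0 /\ final v0).
Proof.
move=> vb [fv lv]; have [y yS] := some_member.
have thr := moved_through yS vb fv lv.
pose o x := if index x y < index v0 y then (x, v0) else (v0, x).
have count_o r (A : pred (nat * nat)) : uniq r -> {subset r <= base} -> v0 \notin r ->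
    (forall x, x \in r -> A (o x)) -> size r <= count A (moved y S).
  move=> ur sub nv Ao; rewrite -(size_map o) -size_filter; apply: uniq_leq_size.
    rewrite map_inj_in_uniq // => x z xr zr; rewrite /o.
    have [nx nz] : x != v0 /\ z != v0 by split; apply: contraNneq nv => <-.
    case: ifP => _; case: ifP => _ [] //; move=> e _; first by rewrite e eqxx in nx.
    by rewrite -e eqxx in nz.
  move=> e /mapP[x xr ->]; rewrite mem_filter Ao // thr ?sub //.
  by apply: contraNneq nv => <-.
have base_rem : {subset rem v0 base <= base} := @mem_rem _ v0 base.
have nv0 : v0 \notin rem v0 base by rewrite mem_rem_uniq // inE eqxx.
have big : m <= size (moved y S).
  rewrite -(count_predT (moved y S)); apply: leq_trans (count_o (rem v0 base) predT _ _ _ _);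
      rewrite ?rem_uniq //.
  by rewrite size_rem // szb.
have far : ~ near 3 S.
  by move/(near_moved (us yS) yS) => le; move: m5 big le; clear; arith.
have all_obs v : v \in base -> (first v \/ forked v S) /\ (final v \/ forked v (map rev S)).
  move=> vb'; have [->|nv] := eqVneq v v0; first by split; left.
  apply: (obs yS vb'); rewrite -(count_predC (touch v) (moved y S)) -/(deg y S v) ltn_add2l.
  apply: leq_trans (count_o (rem v (rem v0 base)) _ _ _ _ _).
  - have vr : v \in rem v0 base by rewrite mem_rem_uniq // !inE nv.
    by rewrite size_rem // size_rem // szb; move: m5; clear; arith.
  - by rewrite !rem_uniq.
  - by move=> x /mem_rem/mem_rem.
  - by apply: contra nv0 => /mem_rem.
  move=> x; rewrite mem_rem_uniq ?rem_uniq // !inE => /andP[nxv xr].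
  by rewrite /o; case: ifP => _; rewrite /= /touch /= negb_or [v == x]eq_sym nxv nv.
have [/hasP[v vb' nfv]|/hasPn none] := boolP (has (fun v => ~~ first v) base); last first.
  have : size base <= size (map (head 0) S).
    by apply: uniq_leq_size => // v /none; rewrite negbK => /hasP[s sS /eqP <-]; apply: map_f.
  by rewrite size_map szS szb; move: m5; clear; arith.
have [y1 [p [q [lt_pq fk]]]] : exists y p q, p < q /\ fork S y p q.
  by apply: (obstructed_fork vb' _ (all_obs v vb')) => -[fv' _]; rewrite fv' in nfv.
exact: (fork_all_obstructed far fk lt_pq all_obs).
Qed.

(** The values after [x] in [y] precede it in the member where [x] is last. *)
Lemma final_deg y x : y \in S -> x \in base -> final x -> m - index x y <= deg y S x.
Proof.
move=> yS xb /finalP[t tS em]; have uy := us yS; have my := ms yS.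
have <- : size (map (pair x) (drop (index x y).+1 y)) = m - index x y.
  by rewrite size_map size_drop szs // subSS.
rewrite /deg -size_filter; apply: uniq_leq_size.
  by rewrite map_inj_uniq ?drop_uniq // => a b [].
move=> _ /mapP[z zd ->]; have zy := mem_drop zd; rewrite mem_filter /touch eqxx /=.
have lt : index x y < index z y.
  rewrite ltnNge -ltnS -in_take ?(leq_trans _ (index_size x y)) //.
  by move: uy; rewrite -{1}(cat_take_drop (index x y).+1 y) cat_uniq => /and3P[_ /hasPn h _];
      apply: h.
apply: (movedE tS _ zy lt); rewrite ?my // em -ltnS -(szs tS) index_mem.
by rewrite ms // -my.
Qed.

Lemma first_deg y x : y \in S -> x \in base -> first x -> index x y <= deg y S x.
Proof.
move=> yS xb /firstP[t tS em]; have uy := us yS; have my := ms yS.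
have xy : x \in y by rewrite my.
have <- : size (map (fun z => (z, x)) (take (index x y) y)) = index x y.
  by rewrite size_map size_takel // index_size.
rewrite /deg -size_filter; apply: uniq_leq_size.
  by rewrite map_inj_uniq ?take_uniq // => a b [].
move=> _ /mapP[z zd ->]; have zy := mem_take zd; rewrite mem_filter /touch eqxx orbT /=.
by apply: (movedE tS zy xy (index_ltn zd)); rewrite em.
Qed.

(** The equality case of the count that follows; it concerns the second entry of the first branch
    and the first entry of the second. *)
Definition exceptional y := size (moved y S) = 5 /\ exists p q,
  [/\ fork S y p q, p.+1 < q, deg y S (nth 0 y p.+1) = 1, deg y S (nth 0 y q) = 1 &
    forall v, v \in y -> v != nth 0 y p.+1 -> v != nth 0 y q -> 1 < deg y S v].

Lemma near_or_exceptional : exists y, [/\ y \in S, forall v, v \in y -> 0 < deg y S v &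
  size (moved y S) <= 4 /\ m < (size (moved y S)).*2 \/ m = 5 /\ exceptional y].
Proof.
have touched y : y \in S -> forall v, v \in y -> 0 < deg y S v.
  by move=> yS v vy; apply: (inert m2 IH (us yS) (szs yS) uS szS (SP yS) ng yS).
have small y : y \in S -> size (moved y S) <= 4 -> size (moved y S) <= 4 /\ m < (size (moved y
    S)).*2.
  move=> yS le4; split=> //; rewrite -(sum_deg S (us yS)) -(szs yS) -[size y]muln1.
  exact/sum_lower/touched.
have [y0 y0S] := some_member.
have [le4|gt4] := leqP (size (moved y0 S)) 4.
  by exists y0; split=> //; [apply: touched | left; apply: small].
have far : ~ near 3 S.
  by move/(near_moved (us y0S) y0S) => le; move: gt4 le; clear; arith.
have [y [p [q [lt_pq fk]]]] : exists y p q, p < q /\ fork S y p q.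
  have [/hasP[v vb lt]|none] := boolP (has (fun v => deg y0 S v + 3 < size (moved y0 S)) base).
    exact: (obstructed_fork vb (all_admissible vb) (obs y0S vb lt)).
  (* With no value of small degree the degrees would sum to at least [6 * (e - 3)], which exceeds
     [2 * e] for [e > 4]. *)
  have : size y0 * (size (moved y0 S) - 3) <= \sum_(v <- y0) deg y0 S v.
    apply: sum_lower => v vy; rewrite leq_subLR addnC leqNgt.
    by apply: contra none => lt; apply/hasP; exists v; rewrite // -(ms y0S).
  rewrite (sum_deg S (us y0S)) szs //; set e := size _ in gt4 *; move: gt4 m5; clear.
  move=> gt4 m5; have : 6 * (e - 3) <= m.+1 * (e - 3) by rewrite leq_mul.
  by rewrite -muln2; lia.
have yS : y \in S by case: fk.
(* The count is now made at the centre [y] of the fork, where the degrees of the exchanged entries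
   can be estimated. *)
exists y; split=> //; first exact: touched.
have [le4|gt4'] := leqP (size (moved y S)) 4; [by left; split=> //; case: (small y yS le4) | right].
set e := size (moved y S) in gt4' *.
have free v : v \in base -> ~ ((first v \/ forked v S) /\ (final v \/ forked v (map rev S))) ->
    e - 3 <= deg y S v.
  by move=> vb no; rewrite leq_subLR addnC leqNgt; apply/negP => /(obs yS vb).
have m0 : 0 < m := ltn_trans (ltn0Sn 1) m2.
have [lt_p lt_q] : p.+1 < m.+1 /\ q.+1 < m.+1 by case: fk => _ _ _; rewrite szs // => /andP[].
have adm v : v \in base -> ~ (first v /\ final v) by apply: all_admissible.
have sum : \sum_(v <- y) deg y S v = e.*2 := sum_deg S (us yS).
have gt5 : 2 <= e - 3 by rewrite leq_subRL // ltnW // ltnW.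
have at_pos j : j < m.+1 -> nth 0 y j \in base /\ index (nth 0 y j) y = j.
  by move=> lt_j; rewrite -(ms yS) mem_nth ?index_uniq ?us ?szs.
have pos v j : v \in y -> v != nth 0 y j -> index v y != j.
  by move=> vy; apply: contraNneq => <-; rewrite nth_index.
have pickP : uniq (map (nth 0 y) [:: p; p.+1; q; q.+1]) = uniq [:: p; p.+1; q; q.+1].
  apply: map_inj_in_uniq => i j; rewrite !inE => iP jP /eqP.
  have bnd k : [|| k == p, k == p.+1, k == q | k == q.+1] -> k < size y.
    by rewrite szs // => /or4P[]/eqP->; rewrite // ltnW.
  by rewrite nth_uniq ?us ?bnd // => /eqP.
have [ab ia] := at_pos p (ltnW lt_p); have [db id] := at_pos q.+1 lt_q.
set a := nth 0 y p in ab ia; set d := nth 0 y q.+1 in db id.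
(* The first entry of the branch [p] is not excused at the back by the fork; if its degree is small,
   it is last in some member, and [final_deg] applies. *)
have pa : e - 3 <= deg y S a \/ m - p <= deg y S a.
  have [le|gt] := leqP (e - 3) (deg y S a); [by left | right].
  rewrite -ia; apply: final_deg => //.
  have lt3 : deg y S a + 3 < e by rewrite addnC -ltn_subRL.
  have [_ [//|fa]] := obs yS ab lt3; case: (back_values far fk ab fa) => [[]|]; rewrite ia.
    by move/n_Sn.
  by move=> epq; move: lt_pq; rewrite epq ltnNge leqnSn.
have pd : e - 3 <= deg y S d \/ q.+1 <= deg y S d.
  have [le|gt] := leqP (e - 3) (deg y S d); [by left | right].
  rewrite -{1}id; apply: first_deg => //.
  have lt3 : deg y S d + 3 < e by rewrite addnC -ltn_subRL.
  have [[//|fd] _] := obs yS db lt3; case: (front_values far fk lt_pq db fd) => [|[]]; rewrite id.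
    by move=> epq; move: lt_pq; rewrite -epq ltnNge leqnSn.
  by move/esym/n_Sn.
(* By [all_admissible] a value of small degree needs the fork at one end at least, and only the four
   exchanged entries can use it; when [q = p.+1], only the outer two can. *)
have outside v : v \in y -> v != a -> v != d -> (v != nth 0 y p.+1) && (v != nth 0 y q) || (q ==
    p.+1) ->
    e - 3 <= deg y S v.
  move=> vy nva nvd mid; have vb : v \in base by rewrite -(ms yS).
  apply: free => // -[o1 o2]; apply: (adm v vb); split.
    case: o1 => // /(front_values far fk lt_pq vb)[iv|[iv nq]].
      by case/eqP: (pos _ _ vy nva).
    by case/orP: mid => [/andP[_ /(pos _ _ vy)]|]; rewrite ?iv ?eqxx // (negPf nq).
  case: o2 => // /(back_values far fk vb)[[iv nq]|iv].
    by case/orP: mid => [/andP[/(pos _ _ vy)]|]; rewrite ?iv ?eqxx // (negPf nq).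
  by case/eqP: (pos _ _ vy nvd).
have ek : e = (e - 3) + 3 by rewrite subnK // ltnW // ltnW.
(* If the branches share an entry, only [a] and [d] can have small degree. With [k = e - 3 >= 2] the
   degrees then sum to at least [4 * k + 4], more than [2 * k + 6]. *)
have [eq|nq] := eqVneq q p.+1.
  exfalso; have uad : uniq [:: a; d].
    rewrite /= inE andbT nth_uniq ?us ?szs //; last exact: ltnW.
    by rewrite neq_ltn (ltn_trans lt_pq).
  have sub : {subset [:: a; d] <= y} by move=> v; rewrite !inE (ms yS) => /orP[]/eqP->.
  have out v : v \in y -> v \notin [:: a; d] -> e - 3 <= deg y S v.
    rewrite !inE negb_or => vy /andP[nva nvd]; apply: outside => //.
    by rewrite eq eqxx orbT.
  have := sum_split (us yS) uad sub out; rewrite sum szs // !big_cons big_nil [size _]/= addn0.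
  have le4 : 4 * (e - 3) <= (m.+1 - 2) * (e - 3).
    by rewrite leq_mul2r; apply/orP; right; move: m5; clear; arith.
  have da2 : 2 <= deg y S a.
    by case: pa => h; apply: leq_trans h => //; move: lt_q; rewrite eq; clear; arith.
  have dd2 : 2 <= deg y S d.
    by case: pd => h; apply: leq_trans h => //; rewrite eq.
  move=> sums; move: sums le4 da2 dd2 gt5 ek; rewrite -mul2n; clear.
  by move: ((m.+1 - 2) * (e - 3)) (e - 3) (deg y S a) (deg y S d) => z k da dd; lia.
have lt_pq2 : p.+1 < q by rewrite ltn_neqAle eq_sym nq.
set b := nth 0 y p.+1 in outside; set c := nth 0 y q in outside.
have [bb ib] := at_pos p.+1 lt_p; have [cb ic] := at_pos q (ltnW lt_q).
rewrite -/b -/c in bb ib cb ic.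
have uabcd : uniq [:: a; b; c; d].
  suff : uniq [:: p; p.+1; q; q.+1] by rewrite -pickP.
  by move: lt_pq2; clear => lt; rewrite /= !inE; lia.
have sub : {subset [:: a; b; c; d] <= y}.
  by move=> v; rewrite !inE (ms yS) => /or4P[]/eqP->.
have out v : v \in y -> v \notin [:: a; b; c; d] -> e - 3 <= deg y S v.
  rewrite !inE !negb_or => vy /and4P[nva nvb nvc nvd]; apply: outside => //.
  by rewrite nvb nvc.
have := sum_split (us yS) uabcd sub out; rewrite sum szs // !big_cons big_nil [size _]/= addn0 =>
    sums.
have le2 : 2 * (e - 3) <= (m.+1 - 4) * (e - 3).
  by rewrite leq_mul2r; apply/orP; right; move: m5; clear; arith.
have le3 : 5 < m -> 3 * (e - 3) <= (m.+1 - 4) * (e - 3).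
  by move=> m6; rewrite leq_mul2r; apply/orP; right; move: m6; clear; arith.
have da3 : e - 3 <= deg y S a \/ 3 <= deg y S a.
  by case: pa => h; [left | right; apply: leq_trans h; move: lt_q lt_pq2; clear; arith].
have dd3 : e - 3 <= deg y S d \/ 3 <= deg y S d.
  by case: pd => h; [left | right; apply: leq_trans h; move: lt_pq2; clear; arith].
have [tb tc] : 0 < deg y S b /\ 0 < deg y S c by split; apply: (touched y yS); rewrite (ms yS).
(* With [k = e - 3] the degrees sum to at least [(m - 3) * k + 2 * minn k 3 + 2], while the sum is
   [2 * k + 6]. This forces [k = 2] and [m = 5], with equality everywhere. *)
have [e5 [b1 [c1 [a2 [d2 m6]]]]] : e = 5 /\ (deg y S b = 1 /\ (deg y S c = 1 /\
    (1 < deg y S a /\ (1 < deg y S d /\ m = 5)))).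
  move: sums le2 le3 da3 dd3 tb tc gt5 ek m5; clear.
  rewrite -mul2n; move: ((m.+1 - 4) * (e - 3)) (e - 3) (deg y S a) (deg y S b) (deg y S c) (deg y
      S d).
  by move=> z k da db dc dd; lia.
split=> //; split=> //; exists p, q; split=> // v vy nvb nvc.
have [->//|nva] := eqVneq v a; have [->//|nvd] := eqVneq v d.
by apply: leq_trans (outside v vy nva nvd _); rewrite ?e5 // nvb nvc.
Qed.

End Six.

(** * Certificates *)

Lemma mem_zip1 (A B : eqType) (r : seq A) (l : seq B) e : e \in zip r l -> e.1 \in r.
Proof.
elim: r l => [|x r IHr] [|z l] //=; rewrite !inE => /predU1P[->|/IHr->]; rewrite ?eqxx ?orbT //.
Qed.

Definition trace s (w : seq nat) := scanl (fun t k => sw k t) s w.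

Section Certificate.

Variables (S : seq vtx) (n N : nat) (ex : seq (vtx * nat)) (words : seq (seq nat)).

Definition active j := [seq s <- S | (s, j) \notin ex].

(* The words of colour [j] lead from each non-exempt vertex to the next. *)
Fixpoint legs_from j N' (ws : seq (seq nat)) : seq (seq ((vtx * vtx) * seq nat)) :=
  if N' is N''.+1 then
    let r := active j in
    let st := zip r (behead r) in
    zip st (take (size st) ws) :: legs_from j.+1 N'' (drop (size st) ws)
  else [::].

Definition legs := legs_from 0 N words.

(** The last condition keeps the walk off the edges inside [S]; passing through a member is
    allowed. *)
Definition leg_ok (l : (vtx * vtx) * seq nat) :=
  let p := trace l.1.1 l.2 in
  [&& last l.1.1 p == l.1.2, all (fun k => k.+1 < n) l.2 &
      path (fun a b => ~~ ((a \in S) && (b \in S))) l.1.1 p].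

Definition class_of (ls : seq ((vtx * vtx) * seq nat)) :=
  [seq u <- flatten [seq trace l.1.1 l.2 | l <- ls] | u \notin S].

Definition classes := [seq class_of ls | ls <- legs].

Definition cert_ok :=
  [&& all (all leg_ok) legs,
      all (fun j => size (nth [::] legs j) == (size (active j)).-1) (iota 0 N) &
      pairwise (fun A B : seq vtx => ~~ has (mem A) B) classes].

(** For a vertex in no class [find] returns the number of classes, which is [N] and thus no
    colour. *)
Definition paint u := if u \in S then N else find (fun A : seq vtx => u \in A) classes.

Hypothesis S_size : forall s, s \in S -> size s = n.

Lemma size_legs_from j N' ws : size (legs_from j N' ws) = N'.
Proof. by elim: N' j ws => //= N' IH j ws; rewrite IH. Qed.

Lemma legs_ends j0 N' ws j : j < N' -> size (nth [::] (legs_from j0 N' ws) j) = (size (active (j0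
    + j))).-1 ->
  map fst (nth [::] (legs_from j0 N' ws) j) = zip (active (j0 + j)) (behead (active (j0 + j))).
Proof.
elim: N' j0 ws j => // N' IH j0 ws [_|j lt_j] /=; last by rewrite addnS -addSn; apply: IH.
rewrite addn0; set r := active j0; rewrite !size_zip size_behead.
have -> : minn (size r) (size r).-1 = (size r).-1 by apply/minn_idPr/leq_pred.
move=> e; rewrite -/(unzip1 _) unzip1_zip // size_zip size_behead.
have -> : minn (size r) (size r).-1 = (size r).-1 by apply/minn_idPr/leq_pred.
by rewrite -{1}e geq_minr.
Qed.

Lemma consecutive_conn (R : rel vtx) (r : seq vtx) : symmetric R ->
    (forall e, e \in zip r (behead r) -> conn R e.1 e.2) ->
  forall s t, s \in r -> t \in r -> conn R s t.
Proof.
move=> symR; suff hd (x : vtx) (l : seq vtx) : (forall e, e \in zip (x :: l) l -> conn R e.1 e.2) ->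
    forall t, t \in x :: l -> conn R x t.
  case: r => [|x l] //= H s t sr tr; apply: conn_trans (hd x l H t tr).
  exact/(conn_sym symR)/(hd x l H).
elim: l x => [|z l IHl] x H t; first by rewrite inE => /eqP->; apply: conn_refl.
rewrite inE => /predU1P[->|tl]; first exact: conn_refl.
apply: conn_trans (H (x, z) (mem_head _ _)) (IHl z _ t tl) => e el.
by apply: H; rewrite /= inE el orbT.
Qed.

(** Disjointness of the classes makes [paint] constantly [j] on the class of [j], so the checked
    walks are paths of colour [j] joining consecutive active members. *)
Lemma cert_sound : cert_ok -> exempt_ok S ex -> good N S.
Proof.
case/and3P=> /allP okl /allP sz pw okx; exists paint, ex; split=> //; split.
  by move=> s sS; rewrite /paint sS.
have szl : size legs = N by apply: size_legs_from.
have szc : size classes = N by rewrite size_map.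
move=> j s t lt_j sS tS ns nt.
have in_class u : u \in nth [::] classes j -> paint u = j.
  move=> vc; have nvS : u \notin S.
    by move: vc; rewrite (nth_map [::]) ?szl // mem_filter => /andP[].
  rewrite /paint (negPf nvS).
  have := has_find (fun A : seq vtx => u \in A) classes.
  have -> : has (fun A : seq vtx => u \in A) classes.
    by apply/hasP; exists (nth [::] classes j) => //; apply: mem_nth; rewrite szc.
  move/esym=> lt_f; have := nth_find [::] (a := fun A : seq vtx => u \in A) (s := classes).
  rewrite has_find lt_f => /(_ isT); set f := find _ _ in lt_f *.
  move=> vf; have [//|ne] := eqVneq f j; move: (ne); rewrite neq_ltn.
  move/(pairwiseP [::]): pw => pw /orP[lt|lt].
    have := pw f j; rewrite !inE szc -{1}szc lt_f lt_j => /(_ isT isT lt)/hasP[].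
    by exists u.
  have := pw j f; rewrite !inE szc -{2}szc lt_f lt_j => /(_ isT isT lt)/hasP[].
  by exists u.
have ends := legs_ends (j0 := 0) (ws := words) lt_j.
rewrite !add0n -/legs in ends; have jN : j \in iota 0 N by rewrite mem_iota.
have {}ends := ends (eqP (sz j jN)).
apply: (consecutive_conn (r := active j)) => [|e||]; rewrite ?mem_filter ?sS ?ns ?tS ?nt //.
  exact: ecol_sym.
rewrite -ends => /mapP[[[a b] w] lin ->] /=.
have ljin : nth [::] legs j \in legs by apply: mem_nth; rewrite szl.
have /and3P[/= /eqP <- okw okp] := allP (okl _ ljin) _ lin.
have aS : a \in S.
  have : (a, b) \in zip (active j) (behead (active j)) by rewrite -ends; apply/mapP; exists ((a,
      b), w).
  by move/mem_zip1; rewrite mem_filter => /andP[].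
have inc u : u \in trace a w -> u \notin S -> paint u = j.
  move=> vt nv; apply: in_class; rewrite (nth_map [::]) ?szl // mem_filter nv.
  by apply/flattenP; exists (trace a w) => //; apply/mapP; exists ((a, b), w).
have start : a \in S \/ paint a = j by left.
move: inc start okw okp (S_size aS); rewrite /trace.
elim: w a {lin ends aS} => [|k w IHw] a inc start /=; first by move=> *; apply: conn_refl.
case/andP=> lt_k okw /andP[nab okp] sza.
have inc_b : sw k a \notin S -> paint (sw k a) = j by apply: inc; rewrite /= inE eqxx.
have start_b : sw k a \in S \/ paint (sw k a) = j.
  by case: (boolP (sw k a \in S)) => [|/inc_b]; [left | right].
apply: conn_trans (IHw _ _ start_b okw okp _); last by rewrite size_sw.
  apply: conn1; rewrite /ecol adj_sw ?sza //=.
  move: nab; rewrite negb_and => /orP[na|nb].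
    have -> : paint a = j by case: start => // aS; rewrite aS in na.
    by rewrite eqxx /=; case: start_b => ->; rewrite ?eqxx ?orbT.
  by rewrite inc_b // eqxx orbT /= andbT; case: start => ->; rewrite ?eqxx ?orbT.
by move=> u vt; apply: inc; rewrite /= inE vt orbT.
Qed.

End Certificate.

(** The length of the list tells the kind of exemption: one pair for the middle of a path, two for
    the centre of a star, four for a path through all of [S]. *)
Definition exempt_check S (ex : seq (vtx * nat)) :=
  match ex with
  | [::] => true
  | [:: (y, _)] => (y \in S) && (1 < count (swadj y) S)
  | [:: (a, i); (b, j)] => [&& a == b, i != j, a \in S, size S == 4 & all (swadj a) (rem a S)]
  | [:: (a, i); (b, j); (c, k); (d, l)] =>
      [&& (b, j) == (b, i), (c, k) == (c, i), (d, l) == (d, i), perm_eq S [:: a; b; c; d],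
          swadj a b, swadj b c & swadj c d]
  | _ => false
  end.

Lemma exempt_checkP S ex : uniq S -> exempt_check S ex -> exempt_ok S ex.
Proof.
move=> uS; case: ex => [|[a i] [|[b j] [|[c k] [|[d l] []]]]] //=; first by constructor.
- case/andP=> aS; rewrite -size_filter.
  case E : (filter _ S) (filter_uniq (swadj a) uS) => [|x [|w r]] //=.
  rewrite inE negb_or => /andP[/andP[nxw _] _] _.
  have inE' z : z \in x :: w :: r -> z \in S /\ swadj a z by rewrite -E mem_filter => /andP[].
  have [xS ax] := inE' x (mem_head _ _).
  have [wS aw] : w \in S /\ swadj a w by apply: inE'; rewrite !inE eqxx orbT.
  exact: ExMid xS wS nxw ax aw.
- case/and5P=> /eqP <- nij aS /eqP sz; have := size_rem aS; rewrite sz.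
  case E : (rem a S) => [|x [|z [|w []]]] //= _ /and4P[ax az aw _].
  have P : perm_eq S [:: a; x; z; w] by rewrite (perm_trans (perm_to_rem aS)) // E.
  exact: ExStar P ax az aw nij.
case/and5P=> /eqP[->] /eqP[->] /eqP[->] P /and3P[ab bc cd].
exact: ExPath.
Qed.

(** Certificates concern at most eight values, so all entries are at most 7 and the digit 9 is free
    to act as separator. *)
Fixpoint digits (e : Decimal.uint) : seq nat :=
  match e with
  | Decimal.Nil => [::]
  | Decimal.D0 e => 0 :: digits e
  | Decimal.D1 e => 1 :: digits e
  | Decimal.D2 e => 2 :: digits e
  | Decimal.D3 e => 3 :: digits e
  | Decimal.D4 e => 4 :: digits e
  | Decimal.D5 e => 5 :: digits e
  | Decimal.D6 e => 6 :: digits e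
  | Decimal.D7 e => 7 :: digits e
  | Decimal.D8 e => 8 :: digits e
  | Decimal.D9 e => 9 :: digits e
  end.

Fixpoint split9 (l : seq nat) : seq (seq nat) :=
  match l with
  | [::] => [:: [::]]
  | x :: l => if x == 9 then [::] :: split9 l
              else if split9 l is w :: r then (x :: w) :: r else [:: [:: x]]
  end.

Fixpoint unpair (l : seq nat) : seq (nat * nat) :=
  if l is i :: j :: l then (i, j) :: unpair l else [::].

(* A certificate is a numeral whose digits, cut at the digits 9, list the exemptions
   (pairs of an index in [S] and a colour), the members of [S] other than the identity,
   and the words joining, for each colour in turn, consecutive non-exempt members. *)
Definition cert_words (c : Number.uint) : seq (seq nat) :=
  if c is Number.UIntDecimal e then split9 (digits e) else [::].

Definition cert_set n (w : seq (seq nat)) : seq vtx := iota 0 n :: take 3 (behead w).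

Definition cert_check n (w : seq (seq nat)) :=
  let S := cert_set n w in
  let ex := [seq (nth [::] S e.1, e.2) | e <- unpair (head [::] w)] in
  [&& uniq S, all (fun s => size s == n) S, exempt_check S ex &
      cert_ok S n n.-2 ex (drop 4 w)].

Lemma cert_checkP n w : cert_check n w -> good n.-2 (cert_set n w).
Proof.
case/and4P=> uS /allP sz okx okc; apply: (cert_sound (n := n) _ okc (exempt_checkP uS okx)).
by move=> s /sz/eqP.
Qed.

(** * Canonical forms under relabelling and reversal *)

Fixpoint leqs (s t : seq nat) :=
  if s is x :: s' then if t is z :: t' then if x == z then leqs s' t' else x < z else false
  else true.

Definition relabel (y s : vtx) : vtx := map (index^~ y) s.

Definition forms S : seq (seq vtx) :=
  [seq sort leqs (map (relabel y) S) | y <- S] ++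
  [seq sort leqs (map (relabel y) (map rev S)) | y <- map rev S].

Definition pick_least (l : seq (seq vtx)) : seq vtx :=
  if l is x :: l' then foldl (fun A B : seq vtx => if leqs (flatten B) (flatten A) then B else A)
      x l'
  else [::].

(** Soundness uses only that [canon S] is one of the [forms S]; that equivalent sets share their
    least form just keeps the tables short. *)
Definition canon S := pick_least (forms S).

Lemma pick_least_mem l : l != [::] -> pick_least l \in l.
Proof.
case: l => // x l _ /=; suff : forall x, foldl (fun A B : seq vtx => if leqs (flatten B) (flatten
    A) then B else A) x l \in x :: l by apply.
elim: l => [|z l IHl] A /=; first by rewrite mem_head.
case: ifP => _; first by rewrite inE IHl orbT.
by have := IHl A; rewrite !inE => /orP[->|->]; rewrite ?orbT.
Qed.

Lemma relabelK y s : uniq y -> {subset s <= y} -> map (nth 0 y) (relabel y s) = s.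
Proof.
move=> uy sub; rewrite -map_comp -[RHS]map_id; apply/eq_in_map => x /sub xy /=.
exact: nth_index.
Qed.

Lemma relabel_iota y : uniq y -> relabel y y = iota 0 (size y).
Proof.
move=> uy; rewrite /relabel; apply: (@eq_from_nth _ 0); rewrite size_map ?size_iota // => i lt_i.
by rewrite (nth_map 0) // nth_iota // index_uniq.
Qed.

Lemma relabel_perm y s : uniq y -> perm_eq s y -> perm_eq (relabel y s) (iota 0 (size y)).
Proof. by move=> uy P; rewrite -(relabel_iota uy) perm_map. Qed.

Lemma good_relabel N y S : uniq y -> (forall s, s \in S -> perm_eq s y) ->
  good N (map (relabel y) S) -> good N S.
Proof.
move=> uy PS g; have -> : S = map (map (nth 0 y)) (map (relabel y) S).
  rewrite -map_comp -[LHS]map_id; apply/eq_in_map => s sS /=.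
  by rewrite relabelK // => x; rewrite (perm_mem (PS s sS)).
apply: (good_transport (psi := relabel y) (base := iota 0 (size y)) _ _ _ g).
- move=> s P; rewrite /relabel -map_comp -[RHS]map_id; apply/eq_in_map => x.
  by rewrite (perm_mem P) mem_iota /= => lt_x; rewrite index_uniq.
- by move=> s t _; apply: adj_map.
by move=> _ /mapP[s sS ->]; apply: relabel_perm (PS s sS).
Qed.

Lemma rev_perm base S : (forall s, s \in S -> perm_eq s base) ->
  forall s, s \in map rev S -> perm_eq s (rev base).
Proof.
move=> PS _ /mapP[s sS ->]; rewrite (perm_trans (y := s)) ?perm_rev //.
by rewrite (perm_trans (PS s sS)) // perm_sym perm_rev.
Qed.

Lemma canon_transfer (Q : seq vtx -> Prop) base S :
    (forall T T', perm_eq T T' -> Q T -> Q T') ->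
    (forall y T, uniq y -> (forall s, s \in T -> perm_eq s y) -> Q (map (relabel y) T) -> Q T) ->
    (forall T, (forall s, s \in T -> perm_eq s (rev base)) -> Q T -> Q (map rev T)) ->
    uniq base -> (forall s, s \in S -> perm_eq s base) -> S != [::] -> Q (canon S) -> Q S.
Proof.
move=> Qperm Qrel Qrev ub PS nS g.
have : canon S \in forms S by apply: pick_least_mem; case: (S) nS.
rewrite mem_cat => /orP[] /mapP[y yS e]; rewrite e in g.
  apply: (Qrel y).
  - by rewrite (perm_uniq (PS y yS)).
  - by move=> s sS; rewrite (perm_trans (PS s sS)) // perm_sym PS.
  by apply: Qperm g; rewrite perm_sort.
have PS' := rev_perm PS; suff : Q (map rev S).
  by move/(Qrev _ PS'); rewrite mapK //; apply: revK.
apply: (Qrel y).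
- by rewrite (perm_uniq (PS' y yS)) rev_uniq.
- by move=> s sS; rewrite (perm_trans (PS' s sS)) // perm_sym PS'.
by apply: Qperm g; rewrite perm_sort.
Qed.

Lemma good_canon N base S : uniq base -> (forall s, s \in S -> perm_eq s base) ->
  S != [::] -> good N (canon S) -> good N S.
Proof.
apply: canon_transfer; first exact: good_perm.
  exact: good_relabel.
by move=> T PT; apply: good_rev PT.
Qed.

Definition table (cs : seq Number.uint) := map cert_words cs.
Definition covered (keys : seq (seq vtx)) S := canon S \in keys.

Lemma covered_good n base (t : seq (seq (seq nat))) S : uniq base ->
    (forall s, s \in S -> perm_eq s base) -> S != [::] ->
    all (cert_check n) t -> covered (map (cert_set n) t) S -> good n.-2 S.
Proof.
move=> ub PS nS /allP ok /mapP[w wt e]; apply: (good_canon ub PS nS).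
by rewrite e; apply/cert_checkP/ok.
Qed.

(** * Certificates for the small and the sparse sets *)

Section Tables.

Local Open Scope dec_uint_scope.

(** The first numeral reads as follows. The pairs 10, 00, 20, 30 exempt all four members for colour
    0. The members other than the identity are 0132, 0213, 0231, which form a path with it. Colour 0
    therefore needs no walk, and the words 020, 021010, 020 join consecutive members in colour 1. *)
Definition certs4 : seq Number.uint := [::
  10002030901329021390231902090210109020; 20001030901329021390312902090210109212; 0090132902139032191212921902090210109021010; 20001030901329021391032901010212191212901012;
  009013290213912039121292012102902090210109010; 009013290213912309121292012109020902101090102; 00901329021391302912129212010902090210109010121;
  00901329021391320912129212010290209021010901021; 100020309013290213920139020912129202; 009013290213920319121292090209021010902; 0090132902139210391212920121290209021010901;
  0090132902139213091212920121902090210109012; 0090132902139230191212920190209021010901212; 0090132902139231091212920129020902101090121;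
  009013290213930129121292120902090210109021012; 0090132902139302191212921090209021010902101; 00901329021393102912129212019020902101090101210;
  00901329021393120912129212012902090210109012101; 0090132902139320191212921019020902101090210; 009013290213932109121292101290209021010901210;
  00901329023191023901012101090101210129121219121920101; 109013290231910329010120902101291212191219120101; 901329023191203902090210120902109121219121912010212;
  901329023191230902090210120902102912121912191012010; 901329023191302912121912191201090209021012090210121; 901329023191320902090210120901021091212191219120102;
  9013290231920139020902101209029121219121920; 9013290231921039121219121920190209021021210901212; 9013290231921309020902101209021291212191219101201;
  901329023192301912121912191010902090210120901; 90132902319231091212191219101209020902101209012; 90132902319301291212191219120902090210120901012;
  901329023193021902090210120901019121219121910; 901329023193102912121912191201902090210120902101210; 9013290231931209020902101209010219121219121912012;
  901329023193201912121912191019020902101209010; 9013290231932109121219121912012190209021012090102; 00103020901329102391032912121910102121912121;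
  0090132910239123090292121912121912120101912; 0090132910239130290292191212191212010191212; 0090132910239132090292129121219121201019121;
  0090132910239203190292102102191212191210210191012; 009013291023921309029212109121219121201019102; 0090132910239230190292120120912121912120101910212;
  00901329102392310902921201091212191212010191021; 009013291023931209029210291212191212010191210; 00901329102393210902921021912121912120101910210;
  90132912039123091212191212010902090209021912121; 901329120391302912121912120109212902090219121; 901329120391320912121912120109219020902191212;
  90132912039201391212191212010901902090219201212; 90132912039203191212191210210901290209021920121; 9013291203921309121219121201090290209021920;
  90132912039230191212191210210901219020902192012; 90132912039231091212191212010902190209021921010; 901329120393012902090219121019121219121201090102120;
  901329120393021912121912120109010210902090219121012; 90132912039310291212191012012921029020902191210; 90132912039312090209021912102912121912120109210;
  9013291203932019121219101201292101290209021902120; 9013291203932109121219120121012921019020902190210; 901329123091320902090212921212912121912120120901010;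
  9013291230920139020901219012129121219121201029201; 9013291230920319121219121021029201290209012190121; 9013291230921039020902129209121219101021902;
  9013291230921309121219121201029202902090121910101; 90132912309230190209021292012191212191012019012; 90132912309231091212191201210191010902090212901;
  9013291230930129121219101201910219020902129012012; 9013291230930219121219101021912012902090212901021; 90132912309310291212191010219120902090212901012;
  901329123093120912121910102191090209021290101; 9013291230932019121219101201910212190209021290102; 901329123093210902090212901091212191012019101;
  901329201392130902090210191291212191210292121; 901329201392301902090210191212912121912102921; 901329201392310912121912102921290209021019121;
  9013292013930129121219121209021209020902101921012; 90132920139302190209021019210191212191212090210; 901329201393102912121912120902120190209021019101210;
  901329201393120912121912120902120129020902101912101; 90132920139320190209021019210912121912120902101; 9013292013932109020902101912109121219121209021012;
  901329203192103912121912109121290209021012921; 90132920319213091212191210921290209010210219121; 9013292031923019020902101292121291212191210901010;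
  901329203192310912121912109129020902101292121; 901329203193021912121912109010902090210129101; 901329203193102902090210129210210291212191210901201;
  901329203193120902090102120191021912121912109210210; 901329203193201912121912109010190209021012910; 90132920319321091212191210910290209021012921210;
  90132921039213091212191210219121219020902109020; 901329210392301902090210921291212191210219121; 901329210392310912121912102191212902090210921;
  9013292103931029121219121201920102902090210901210; 9013292103931209020902109012102912121912120192010; 9013292103932019020902109212091212191212019102101;
  9013292103932109020902109021019121219121012129210; 90132921309230191212191201021912902090210292121; 901329213092310912121912102129212129020902120901010;
  90132921309312091212191012010901090209021029101; 9013292130932019121219120120191029020902102921210; 90132921309321091212191210121910902090212090101;
  9013292301923109020901021209020912121912101912121; 9013292301932019121219121019101019020902102129202; 901329230193210912121912101920902090101210902;
  9013292310932109020902120191010191212191210129202; 9021390312910329212129212910901010901012101090101; 9021390312912039212129212910121290101090210120902101210;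
  9021390312912309010109012102120902120109212129212910121; 9021390312913029212129212910190101090102102109010; 902139031291320901010901210121090120921212921291012;
  9021390312920319212129212921090101090210120902101; 902139031292103921212921292101212901010901012101090101210; 9021390312921309212129212910121090101090210120902101212;
  902139031292301921212921292101901010901212012090210; 90213903129231092121292129101210190101090210120902102; 90213903129302192121292129209010109010121010902;
  90213903129310290101090210120901921212921291010; 9021390312931209010109021012090129212129212910120; 902139031293201921212921292101090101090101210109021;
  902139031293210901010901210121090121921212921292012; 90213910329123090101090101292129212129212109121; 902139103291302901010901012921212921212921210901010;
  90213910329132090101090101292121921212921210912; 902139103292031921212921210901210901010901012921012; 9021391032921309010109010129210292121292121091210;
  90213910329230192121292121090120109010109010129210121; 90213910329231090101090101292102192121292121090121012; 9021391032931209212129212109102901010901012921210;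
  902139103293210901010901012921021092121292121091201; 9021391230913029212129212010219129010109010292121; 9021391230913209010109010292121292121292120121010901010;
  9021391230923019010109010291012092121292012109012; 9021391230923109212129212101219101090101090102901; 90213912309301292121292120102191201901010901029010212;
  90213912309302190101090102912012921212921010210901201; 9021391230931029212129201210910290101090102921210; 9021391230931209010109010290101921212921210121910;
  9021391230932019010109010291012921212920121090120; 90213912309321090101090102910192121292012109010; 9021391302923019212129212101910120109010109010212921012;
  902139130292310921212921201090210901010901021292101; 90213913029312090101090102129209212129212010902; 902139130293210921212921021090121290101090102129201;
  9021391320923109212129212101290109010109010219101; 90213913209310292121292121012920901010901021902; 902139132093201921212920102109012901010901021920121;
  9021391320932109010109010219101092121292120120901; 90213931209321092121292102129212129010109010210901010; 90231903129103291290101209010192121912910;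
  90231903129120392121912912019129010120902102102; 90231903129123091290101209021210192121912912012; 90231903129130291292121910190101209129010;
  90231903129132092121912912012191290101209021210; 90231910329120392121912109121291292102921; 902319103291230912901201021912192121912109212;
  90231910329132092121912109129129210292121; 902319103292013912921029201092121912109121021; 902319103292103912921029210921219121090121021;
  90231910329213092121912109012101219129210292120; 90231910329230191292102921021292121912109012010; 90231910329231092121912109121019129210292010212;
  90231910329301292121912109010912921029101; 9023191032930219212191210901209129210291012; 90231910329310291292102910921219121090101; 902319103293120921219121090120121912921029102;
  90231910329320192121912109012019129210292012010; 902319103293210921219121090120129129210291201; 9023191203913029212191210219121912902109212;
  90231912039132092121902109219129210191212; 9023191203923019212190210901219129210192012; 9023191203923109129201090219212191212019102121012;
  90231912039301291292010921021921219121201910210; 902319120393102921219121021912109129201092102; 902319120393120921219121201921091292010902101;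
  9023191203932019212190121029201209129201091210121; 90231912039321092121912120192010912902109012102; 902319123091302921219120102191291292101292121;
  902319123092013921219021209021912921012921010; 90231912309210392121901210902912921012920; 902319123092301912920120901292121912120129210212101;
  902319123092310912920120901921219121012191010; 902319123093012921021010901210901201291292010291021; 90231912309310292121912101219120912920120901012;
  902319123093120921219121012191091292012090101; 9023191230932019129210212191201219212190121090102; 902319123093210921219012109010912921021219101;
  902319130292013921219121019121019129010121090121012; 90231913029210391292102191201019212191201092102; 9023191302921309129120109210901012090210121912102;
  90231913029230192121910210901210912921021920102; 90231913029231092121901210129210191292102190210; 902319130293012912901201209019212191210191010;
  9023191302931209129010210292092121912010902; 902319130293201912921021920129212191021090121; 9023191302932109212191201090219129210219120120120;
  9023191320920139212190212019102191292102129212010; 90231913209210391290121019102921219121012921210; 902319132092130912921012191092121912101290101;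
  90231913209230192121912101291012912901021090120; 90231913209231091290120109010921219121201219101; 90231913209301291292010219021921219121012921010;
  9023191320931029129010210902921219121012920; 90231913209320191292102129101209212191012109012; 902319132093210921219012101910109129210212901;
  9023192013923019212190292191292091212; 90231920139231091292091219212190292010120; 9023192013931209212190291201091292090102102; 90231920139321092121902920101291292091210;
  90231921039230191292101092129212190219121; 90231921039231092121902191212912921010921; 902319210393012912921010901210192121901212921210102;
  902319210393102912921010901210921021010902191210121; 90231921039312091292019021092102101090121292101; 902319210393201912902191210921219101201292102;
  9023192103932109129201902101921219012129210; 9023192130930129212190121912101209129210120901201; 90231921309310292121912101210901209129201291012;
  902319213093120912920129010921219120121019101; 90231921309320191290212921210921219121201209102; 90231923019301292121901910120912921021012109012;
  902319230193102921219101090212912901910210210; 902319231093012912920121901219212190129210102; 9023192310931029212190129012912920121910120;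
  90231923109312091290129101092121910120901; 902319231093201912920121902921219012920; 90231930129321091290101292129212191209121; 9023193102932019212191021912191290102129212;
  902319310293210921219121010921912901012191212; 9023193120932019212191201292102101091292012101912; 90321910329123091219121029212921292109121;
  90321910329210392129210902101902101209021019210; 9032191032921309121902101912109212921092102; 90321910329230192129210901021091219121029210212;
  90321910329231091219121029201201292129210912101; 90321910329301291219121029101921292109010; 9032191032931209121902101910292129210921210;
  903219103293210921292109012012912191210291021; 90321912309230192129210121920121912190102109012; 903219123093102912191010210191029212921201292102101;
  903219123093210921292101219101912191012109010; 90321913029210392129021092102912191210219120101; 903219130292130912191210219121029212902109210;
  90321913029230192129210192012091219021090120101; 9032191302923109121912012012921019212902109012102; 903219130293120912190210902921292101920;
  9032191320923019121912102129101292129021209021210; 903219132092310921292120121910191219012109010; 9032192103923019212901021292129121910219121;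
  91032920319312090292101291021920902120902120120; 910329203193210920902120901012902921021219120; 910329213093021902921029120192091210901210102;
  9103292130932019209021012921210902921209102; 91032923019321090292010219209209010210902; 91032923109320192090212012920902912010902;
  912309203193012910102920129101290212191201021090120; 912309203193102920121902129212012090129210120901201; 91230923019301290129012910102920121910120902121;
  9130292031932109210109210121912090219120120901012].

Definition certs5 : seq Number.uint := [::
  100020309012439013249013429030903121021019131913192320309030; 20001030901243901324901423903090320902320913191321219323;
  000190124390132490213492323931032101029123213219123123239030903209021010; 2000103090124390132490214390309032090231010913212129232393231212;
  100020309012439013249031249131923239313903090320901010; 000190124390132491023492103102123109029023023932032391319132121912120101;
  200010309012439013249102439032029232393230291319101032121090121231; 1000203090124390132491032490309032303930391319132121910101;
  009012439013249103429203213010191010319131912123123930903090320903; 009012439013249104239232393230913191210210132309032390309031012012191210210132;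
  00901243901324912034923239301321291319132121912120109030903209021; 00901243901324912043923239323012129030903209023191319132121912120103;
  0090124390132491302492323930139131913212191010903090320901; 0090124390132492013492130120121309012102190309023023932032101391319132121912120;
  0090124390132492014392323932301210219131913212191212309030903209021013; 0090124390132492103492323932312102319030903209021091319132121912101212;
  0090124390132492104392323932312102191319132121912120139030903209023212102; 0090124390132493012492132312032101090101913191321219109030902320393103;
  009012439013249310249232393010390309032090109131913212191201212; 90124390134290143290309023209020921232123212921232123213931232123213913191021012302121912121;
  9012439013429031429131913023101023121292121292121321321292123123121393139030903230901010; 00901243901342910234902320902323913191321231913212010192323292329302;
  10901243901342910243902309032391319132123191321230101923232923292302; 90124390134291032490309032103101910130192323292329309131910102123120903;
  90124390134291034290309023029202920101230123121292121321032101039303913191321231910101; 90124390134291043292323292329209131913212319132123212010139030903230902;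
  9012439013429130429201210213019103120121039301390309023209019121231232923291010; 90124390134293014290309032309010191319132123191092323292329212102;
  9012439013429310429030902320902323121023913191321231912012129232329232930130; 00103020901243902134902143903090321012012923232923232920121021309030;
  100020309012439021349023149030903101090209212132321913932323; 2000103090124390213491024392121231913930101903202920231010901013;
  009012439021349103249203231010212921201019030903101090101292321321219139321231230; 0090124390213491042392123123292321321092032132120101913930102121903090310109010132;
  00901243902134912034913930123023292323292323121292121323012123903090310109010; 00901243902134912043913930109232329232301212010901039030901201231023292320132102;
  0090124390213491230490130109010292323292323121292012109023123210232101913930123203; 009012439021349123409139301232090309013010901032329232329232312129212101231;
  009012439021349124039139321201021903090130109010329232329232312129201231230; 00901243902134912430913930120392323292323121292121012132903090310109012320;
  0090124390213491302491393010232312903090310109010121923232923231212921213013; 0090124390213491320491393012323019030903101090101212923232923231212921213012323;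
  0090124390213491324091393013023192323292323121292121012390309012302132120902123010; 009012439021349134209139301203212903090310109010121323923232923231212921213201231;
  00901243902134914023923213212921231230192031231231021019139301201290309031010901232130120; 0090124390213491420391393012301390309013010901032192323292323121292121323012;
  0090124390213491423091393010231903090310109010132123923232923231212921213201232; 00901243902134914320913930103231219030902123102321090123201292323292323121292121320123;
  0090124390213492014391393090309010120323292323029232329232301210210903; 00901243902134920314913930232392323292323121292090309031010902;
  009012439021349210349139301392323292323121292121323012123090309032102120120901; 00901243902134921043913930190309031010901392323292323121292121323012102;
  009012439021349213049012032132120902121901031019139301329232329232312129212101210; 0090124390213492134091393010232090309031010901239232329232312129201231;
  0090124390213492140391393012903090310109012323923232923231212920321321; 0090124390213492143091393021231903090130109010323092323292323121292012312;
  0090124390213492301491393203213903090321010212920192323292012120130901212; 0090124390213492310491393012323190309031010902129232329232312129210120;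
  009012439021349231409139323201323923232923231212921301230290309031010901231; 0090124390213492341091393201232190309031010901023101209232329232312129201232;
  00901243902134924130913932010230923232923231212923012132903090310109013213; 0090124390213492431091393201232903090310109012132192323292323121292013213;
  00901243902134931240913930102132102923232923231212921201239030903101090123101; 0090124390213493142091393232120312139232329232312129212130123090309031010901021302;
  00901243902134932140921231023209021023901031019139301321309232032090230231212921301232; 009012439021349324109139301232102903090310109023123092323292323121292103123;
  009012439021349341209139323102312039030903101090102103219232329232312129210321232; 0090124390213493421091393023102103923232923213212921232012329030903101090121321010;
  0090124390213494123091393201231010903090321012012921021032130292323292012102130903120103; 00901243902134941320913930102130292323292323121292121321012390309031010901013213230;
  00901243902134942130913930212309030901301090103210319232329232312129232010232; 009012439021349423109139302102329232329232312129210132310190309031010901213210;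
  00901243902134943120913930210213219232329232312129212130120310903090310109010132310213; 009012439021349432109139323010231903090130109010323102129232329232312129210312103;
  9012439023149032149232329212132393231213231290309031012090101091319132923023210103; 00901243902314910234901031209021301392323292323121912102913191329301321021;
  1090124390231491024390101209021013913191329232102101292323292323121932032101; 901243902314912034913191329230103903090210102132393231201012319232329232312190210;
  9012439023149120439030901301209021039232329232312191213230121291319132923010; 9012439023149201349030903120121090292323292323121932302391319132920;
  9012439023149203149131913292029030903120120101910101923232921213239303; 901243902314921034913191329201923232921213239323021390309031021210901212;
  901243902314923014923232923231219101091319132923023213903090310120901; 901243902314930214923232923212321393103903090321010219109131913290101;
  90124390231493201490309032101201910191319132901092323292123123931013; 90124390234192034192323292123129210120121903090310121010319130101391319132393232032;
  901243902341923041913191232920121292323292323121393101309030903101230901; 9012439031249032149232329232319132121323903090321301039302323091319132010212109012120101;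
  1090124390312491024392190102123190230232923213931032391319132129212321021012; 901243903124910324913191321290101923232923231910903090323101039301013;
  90124390312491203491319132129212010903090321010901012192323292321391301232312; 90124390312491204391319132129212301092323292323191012123903090232101039301012321;
  90124390312493012490309031012012921021012101923232923231913010139131912321232393232032; 9012439031249302149131913212920921032012312921321023090290309032301393103120121;
  009012439031429102349023210109010123239131913213232923231201019232329232191302; 109012439031429102439023101090101323913191323123292321323010192323292321912302;
  90124390314291034291319132123930101392323292321910903090232101090101; 901243903142930142903090231012012920292323292321910101913191321239303;
  0090124390321491023490101230213931203210139131913219120101923232923231292102; 1090124390321491024392129310323101913191321912321021012902320329230231012090210123;
  901243903214912034903090101320191023103913191232139310132120923232923231290210212; 9012439032149120439232329232312921323012129030901301201910210391319123213931232010;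
  901243903214920314923232923231292132312102329131913219109030903102121301393103; 90124390321493012491319132193203239232329232312920903090321201210902;
  901243903214930214923232923213292302312123190309010120321393039131913219101201212; 9012439032419302419232329232123292029030903101230191010191319132139303;
  90124390341293041291319121232191010192323292323123239303903090321013029202; 9012439034219304219123213212921232191010192320320902302123930390130101910321013029202;
  00103020901243910234910243913191010319131920323029203232923232; 009012439102349103429232013212191212319212312321912321321029239101301090393232;
  0090124391023491042390393292323292323029203230913191301019132121; 00901243910234910432903932391319130101912123129232329232302920320;
  0090124391023491304292302329231923101021231209039321321291319130101912123; 901243910324910342903090329232329131913210210191319232329232309030;
  90124391032491042392323292323090323091319121201013239323903090329232; 901243910324912034913191010321219121290309032921923232923230901210210;
  901243910324912043903090329231913191010321219121239232329232309032301212; 90124391032491302490309032921212910132012102920323931392123123219123213210901010;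
  9012439103249201349131913210231013931013201209030903292310139232329232309121201; 90124391032492014390309032921013913191321201019101021230923232923230903230121021;
  9012439103249210349131910132012191210290309032921092323292323090121021; 90124391032492104392323292323090323121021903090329210391319132120101912132320;
  9012439103429104329210103212301012921010321219121219131913213232109020903090323932323; 9012439103429130429101210123101232923209010109030902329212129212132321912323121039313;
  901243912034912043903090319131913191301090309232329232301212923232; 901243912034912304923232920121239323239131913010902090309031912121;
  90124391203492013490309031901923232923230121292121012102913191010393013; 901243912034920143903090319132120120129131910310901392323292323012129301;
  901243912034920314913191301090129232329201212392012190309031912101023103; 9012439120349204139030901393012913191301090123239232329232301212921210323120101;
  90124391203492104392323292323012129230232913191301090390309013930; 901243912034921304903090319209131913010902923232920121239323203;
  901243912304913204921012101230109010320901010902323029203232129212129131912012310239313; 9012439123049201349131913010292019232329232312101210901212903090321219121231013;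
  901243912304921034923232923231210212090291319101023239323203903090312920; 90124391230492310490121023101232923210132019101091319132012310393013920323209010320901;
  9012439123049312049030901232393010319232329232301219109131913010292010210212; 9012439123049321049232329232310123013931031913191301029201210290309010232309010;
  9012439123409213409030903212319132123120329232329201231292101201219131913012039303; 901243913024913204913191321021090209232329232013932323903090321912121;
  90124391302493120491319130120129209232329232310109029030903219302323; 901243913042931042903090232191212012012191319130123012329202923232923230139303;
  9012439132049213049131913021021090120121290309031219109232329232301293103; 90124391320493102490309012321393203239131913201201090292323292323012920;
  901243920134920314903090101393232392323292323102102121912121913191309020; 90124392013492103490309010139313923232923231210292012101212091319130903232013212;
  90124392013492104391319130923213212903090310191392323292121023931; 9012439201349213049131913092121903090312320132123932123102309232329201210231912;
  90124392013492301490309010139310321012092323292323121029219131913091212; 90124392013492310492323292123102329212913191309021012090309031019121;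
  9012439203149210349030901012323932321392323292323121091212913191302921; 901243920314923014913191320901031039030903101292102101209232329212310239321231232;
  9012439203419230419131913203931392323292121032921212903090321201231010901010; 901243921034921043903090130903091319132012129232329232329212102319131;
  9012439210349213049232329232312102191212190309010393232391319121012130123209020; 9012439213049231049131910123239313921210210310901302921212902302329232031210901010;
  9012439230149231049123213212921231201393232390101301910321912121920323209023230102109020; 90124392301493210492323292323101213203239323023903090312012920913191321010902;
  90124392310493201492323292323101210902913191301219121021019030903123013920; 9012439301249302149131913212090209232329212310231021219121219030903231013932323;
  90124393012493102492323292321039313903090312101212921212913191321209021201230123230; 901243930124931204923232923210392121913191321209021012301390309032101912;
  90124393012493201492323292321039219131913212090210109030903210191212; 901243930124932104923232923212302329231203230913191321209312321390309032101910121012102;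
  901243930142931042903090321013931391319132310232921212923232923210901010; 901243930214931024903090310212019219131913231039323213923232923231209021010;
  9012439302149312049131913201019121903090321012921292323292323120902130123230; 90124393021493201490231012320123219123210393139232329232312090101091010310901302101212921212;
  901243930214932104913191320120121292121903090101203213091292323292321023239312323; 901243930241932041923232923212320901010913191321039313903090323101232921212;
  90124393102493120492323292320103931232132190309032109020913191321021912010123013; 90124393102493201490309032310391219131913023103212921292323292301213232090210120;
  90124393102493210490309031210292192323292323101912129131913021203123239323213; 901243931204932014913191203212320139310232309232329232312102121019129030903210292121;
  901243931204932104903090312310393013201210291319132102129212312323923232923230120902103230123102310;
  901243931240932140921231232191232132012393139023023292320123029212129101031090130121231010901010;
  90124393201493210490309032101219121219131912321013931012323012109232329232312101090320323; 90124393412093421092323292320102139323239030903212032191212191319101231201209020;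
  90132490142390412390209023209010109101021231039323931393123231219121323212921212; 901324901423910243902090231010212191212010193232393239209121219101031230902;
  901324901423910432912121913012012130903902090210312012191210213012329323239323930; 90132490142391402391212191212031012090193213212139312123191010902090320393013;
  9013249014239401239323239323931039121219121232121910902090232090101; 901324901423941023902090310120312321910191212191212013012090109323239323931013;
  100020309013249021349023149020912102090209323239323213932323; 00901324902134910243912129212031012329020902101090101393232393232139310;
  009013249021349103429321321239321231209020902101090101239302132123010191212921201031; 0090132490213494123091212921203121013293232393232139312301232090209021010901032103;
  0090132490213494132091212921232102132329323239323213931230120390209021010901012312310;
  009013249021349423109032321013090312312090120121012191212920120321019323239323213932010232; 009013249021349432109121292101321039020902101090123120109323239323213931230102132;
  901324902143910243902090231010901019121219121239321203101232932323932321910; 90132490214392013493232393232190390209021012302329232032912121912123930;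
  90132490231490321491323121323191323121323292323121323290209010121010901010932323932320101232039313; 9013249023149203419121219121923230293232393123213930902090210120903;
  90132490231494123093232393123231913232120102329120101201910210109230102103902090212320132310239320132301;
  90132490231494132093232393232103209023012301203902090101230139310321232101912121912191230102310;
  9013249023149421309123123231913232139301321321093232393232103209023210239020901012019102121320102;
  901324902314942310902090231010232393232012310293232393103210109013213091212191219132012013;
  90132490231494312090209021012090102321029323239323212323932321232010231091212191219120321203;
  90132490231494321090209010120191021232102912312323191323213931012301019323239323210320903121013; 9013249023419203149020902310123209039323239312321910103191212191213930;
  901324902341941230912121912139312012032102932323932321232923010231902090210123090321032103;
  901324902341941320902090101230191032132310193232393232123292321230123091212191213932031203102;
  9013249023419421309020902101230903210323101912121912139203123093232393123219121201232;
  901324902341942310901301203231219121392120123193232393123219101230109101201210901210212309021023;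
  90132490234194312090209031021021032129212301239323239312321912012032912121912139312012032101; 901324902341943210932323932321232920120319121219121390120310902090101230191021023;
  90132490412391042393232393231910912121912123212921201012902090321301090101; 90132490412391402393232393231901090209021321012102920121029121219132123930103;
  901324904123941023931212312393213931013090209023201910232312102391212191213210320901; 90132491024391034290209023932393232393232090232091212191212301019232;
  9013249102439104239020902393232391212191212031019121219323239323209020; 90132491024391203490209023931932323932320902320132129121219121203101913;
  9013249102439120439020902393139323239323209010109121219130101232921212; 901324910423914023902090232921212932323932309010109121219130101239313;
  9013249104239401239323239323091019121219121321032310139310139020902329210102120; 90132491042394102393101021213023932039109121219132123109010190209023292323121203;
  9013249120349210439323239323201393091212191212010903902090219232302; 9013249120349402319323239323201393102102391212191212010901021321029020902192012312010;
  9013249120349403219020902191321012329323239323210103930101231023912121912120109010213210;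
  90132491203494203193232393232101309031012102139020902192012321029121219121032132102393201230; 901324912034942301932323932320139320312039121219121021090123210290209021920123210;
  90132491203494302193232393232013931023102139020902191213231012329121219101201292102123210;
  9013249120349432019020902191213021023293232393232103109013012321021320912121910120129210132103; 90132491204392103490209021393091212191212301090393232393232019102121032321;
  90132491230494023191212191212012090210213210290209021292132101239323239301321912310231230;
  9013249123049403219121219101021912010321039020902129212310123010932323932320103209023010210232;
  9013249123049420319020902312323932310212319323239301321912310232123010912121912120120902132103;
  9013249123049423019020902129012032101912121912103213231023932013230293232393013219103120130;
  901324912304943021912121912120120902102130121029020901219123201230932323932320132923102310231;
  90132491230494320193232393013219123102312031219121219120132032103930123010902090212901032103;
  901324912340940231902090213232923201201309323239301323191323102102329121219121201230902103213;
  9013249123409403219020902132329231230123912121912120120393021023210293232393013231913231021230;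
  901324912340942031902090123192031230932323932320132393231021230191212191212012309012120323;
  901324912340942301912121910102319132010213210129323239323201323902102390209032312132921021231;
  901324912340943021930132120101910102139312010232101902090312321912301230913212312393213212012302920123012;
  9013249123409432019020902123920120139323239301323191323102120132912121912120123090123101;
  901324912430940231932312123191321023123019103213232903232039302321239301230191012012109012132923021032310;
  901324912430940321912121912132101232101910123212903203239323021239321203102393103102121090121329231203120130;
  9013249124309420319032320393023123191301239121219121032132103930123093101302121090121329010232;
  90132491243094230193232393232101230901023912121912321012321021912012319020902123292012310;
  9013249124309430219020902123291023123912121912120312309032130213210193232393232012393210232102310;
  9013249124309432019323239323201239321021023121902090212329120132329121219123021203120109010213; 90132491402394012390209021321290193232393230191010912121913210210393013;
  901324914230940231912121912130212321019101232019020903121329310102139323239321013230903231232;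
  901324914230940321902090213231920312319323239323012393210312039121219123210213213090312312;
  90132491423094203190209031231292012312912121912120321023109013239323239323201231913210212301; 9013249142309421309121219121232120123090193232393230123910109020903212329201212;
  901324914230942301910102121090121232319012393232393231012039302123129032132120310191013021329201231;
  9013249142309423109121219120321203121090129323239320123291012090209021321393012323; 901324914230943021902090231213930132312912121910321023120902132393232393201232923201231;
  90132491423094320191212191212301201393102121032193232393231012309032101321230120902090212321920123;
  9013249201349210439323239323210393190209023212102319139121219121209021201021230; 90132492014392103493232393232109012320132120902090231019139121219121203931;
  9013249214309241309012120101910102103292121293023230903232123090101091321213239323121201239313; 9013249230149234019323239323210232139329121219120109032090209021012192323;
  901324923041923401913201232123010210901201023932323901012012191210319121219323239312320109020; 90132492310492341091212191201209032093232393232101321923239020902123013932;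
  901324923140923410902090212301912121932323932321013213932323912121912012309020; 9013249401239410239020902321210102129212010120912121913210239313932323932310901301203232;
  90132494123094213091212191213210123121292121290209023121039313932323932012320901010; 9013249412309423019323239323012309032103123012191212191210132132019102309020901232102921213;
  90132494123094231093232393230102392121912121912132010232191290209023123109010120; 901324942130942301912121912103210323932329020902132301090230932323932102132132923;
  9013249421309423109121219121320123209020902090210321039323239323239323101231912121; 9013429031249103249023090320121292121029323291390101923931910;
  901342903412934012902309010312302393203213212923912901932329212191010; 901342903421934021932329212319101091212319123930139239301012320901;
  9013429102439103249121231923029203213010190230903239329239323090320; 901342910243910432923932101301923902309032393232932329232090230;
  90134291032491043290210130191031019132121923930903209320320903932; 9013429103249130429121231913010191392393090320121290230903931;
  90143291024391034293023090329232913212139312120101913212319232923203930230; 90231490312494123091292102301393102130239212191292132031203193103209010120902121032102;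
  9023149031249413209129010120903102103921219129232130123193123239323212321393123012302].

(** Covers both the sets with at most four moved pairs and the exceptional ones. *)
Definition certs6 : seq Number.uint := [::
  009012354901243591032459343494342302349242923432432923423434090409043090329141914319132123103;
  00901235490124359103254912432321912323412310390409043090342924292432329232340910340134393434940243234;
  009012354901243591042359034304940249010140191041013090292429243232920913431439341341912102101;
  00901235490124359120345930410341019101309242924323292042143914191343149413430124029040904309031;
  0090123549012435912035491043019103104912041212310139343494341013090240292042309014343923234023430903432042924023431;
  009012354901243591204359201421023101910109214312323930134310901914191341349401490409042302329201212;
  009012354901243592013459343494341034914191431913092429243232923234012120419040904309031201212;
  009012354901243592013549304340901301491419143191340904090423230292032324101924292121023041349431403;
  00901235490124359201435931434191090409043090410149141914032012412494214210292429243232920121201;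
  0001901235490132459102345901241231039301321421493023234090293234234329249434324320391419142121912120101;
  20001030901235490132459102354912412129249402934343934342312123191321213243403901014019104101209024;
  0090123549013245910243590214310393023293234234329249434324320901431039301341209023914191421219121230101;
  009012354901324591025349249401212319040904209024393434393434232393232434091419142121914312032;
  1000203090123549013245910324590409042303930393434391214219101019104120121029249404;
  0090123549013245910325490210410191014019323423432924940903403439343043209049141914231232139304343;
  0090123549013245910342591043201231239309040904209039343439343402324014319134104912142129249401431;
  0090123549013245910352492494039141914212191431090409042090243232934343934342323930434;
  0090123549013245912034592494014212930134010191212419142120104913413439343243239323421430109040904209021;
  009012354901324591203549249403232139141914212191212010493434393434232393013421290409042090241;
  009012354901324591302459301321021041914012042904090420901930232134102924940149141914210230139310310;
  009012354901324591302549323423439301349012102410129249410109141914212191212401021293043430902409041;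
  00901235490132459201345930232340904323201034904090432320393023231019310324012129249412104291419142121912120;
  009012354901324592013549024090421019034034393430420323932302310149314343191214219124120912041012012924941021012;
  0090123549013245930124593023402343931203232934324323292494104914191421219109040904209013013;
  0090123549013245930125492494010191419142121910493434393434232393232434232130904090420902410120102;
  009012354901342591023459021431090134124934343934323432494234323401341924292439302914191421231920323;
  1090123549013425910235492393101041290234302432393234203409032491419101043120329230213419343042320329231431494134102323;
  901235490134259103245924292439309343439343423292012123191419142123194034349040904230903;
  901235490134259103254934343930232041341914314039040904320329230234291419140120121309034924292439340;
  9012354901342591034259304304393234234940491419143412432920292429243930390409021430101910101;
  009012354901423591023459034032494230434914191421021013230903232931434139314341292039242924323932340121241;
  1090123549014235910235492323932432403239314343191343412921434301019034304393403204940243491214212920432309032342;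
  9012354901423591024359242924323930132121913421210234309034320494024901041019101401320902934343934342920;
  901235490142359104235904090343024942034342323924292432393401431931434139314341292029141914232132191431034;
  00901235490213459102435914943410232342904090434014393410493243234239324323412312329232132120924292401212010901031;
  009012354902134591025349343143934134093041343010191494010319242924121292121403232904090410109010143;
  00901235490213459103245902430132129212310392429212104209024012140901401019149401041293434393434139301320121;
  0090123549021345910325492124129214210934343934341393143402323920420901401090104129031043410319149430132101201;
  00901235490213459201435934314393092123103420191494024323293043430901041090390240292121429241210421301;
  0090123549021345920153490101240292042393434393434139314340101921421219149430902402920421010903434;
  0090123549021345920314593010314090293413431914942049242924121292090409041031039302323;
  0090123549021345920315492104210120902493434393123234292409014010191494029204209024012312323932321340101;
  009012354902143591023459013430104940103431492429241210230903201210291419143934014019343439343419103;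
  10901235490214359102354931910434390130104341393143490103149242924123123292321321402914191439340101;
  901235490214359102435934343934341910912412129212142392121029201212301340191043090101904090434101049401014;
  90123549021435920134591241212921214239309014010191042302329232032923234234393431490393043430903434019101031;
  9012354902143592013549040901012043232923234029141914393409343439343419143410392429241201012309034;
  90123549021435920143592429241231232920293043430903434019101301391419143934013434190243203239314349404;
  1090123549023145910235490210102191201012493434393434103209023014342320329242921214940210191419142924301013;
  90123549023145920134591014301039301034102920924292121494024931434319134342323932320390409041201210902;
  9012354902314592013549034034393103204940292429241021010902491419142924093101340109010431023239323201341;
  901235490231459203154914191249409242924102101090490409031012320134191431039343439343412323932320342;
  109012354903124591023549323213931232043439021010214219124129010124910430139323213494312321031019242924191402;
  901235490312459103245913434139314343212903101392429241910934034309021010494010149014010191010413203213931230232;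
  901235490312459103254932342343292149410920420902401910490340343934304232013931010324021914191421290413013;
  901235490312459301254924292419140101914191212494093434393434232139340343904090421010904;
  0090123549102345910325490494291419143410439343243239242920124121912142193243232439342323430232924;
  009012354910234591035249121201042121912124139343439343403930434232092429240292343491014010904943232;
  0090123549102345910523491010419143212193434393434039304342091012012140292042921210234013249214312032309049432;
  009012354910234591205349049431924292012124191439343439343420323292323024301491419143010139310432402;
  009012354910234591305249201241219121423914191210214012921043092143102323090494323219343439343403932324134;
  901235491024359103245914191430101913212192032324340393043492323932342343292343243209023423430490409043932;
  901235491024359103254924292323402349432043230904090439342914191432121029232349343439343409043402323;
  90123549102435910423592343243239304349402409040904393234214319121421292012124319142121493103401910430109012123103;
  90123549102435912034590323204343292343402329319343439343409010310914191013043419139204209034349434314;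
  90123549102435912035493434393434090101304914191013403419143043090409043934192429203234234943243231212;
  9012354910243591204359134134393430494149242924302329212129040904393139321210234019104320121209021210210;
  901235491032459103254930130140191041021219141924292409040904090429242913413439302324343934343;
  901235491032459103425903403439343043292323293234023430292049434349104101090142121913192142121912124109030;
  90123549103245910352490409042924121231914191421021019439343439343423023934349242924090430;
  901235491032459120345934343934342032393230243401349040904292192429204941210240914191403103212191212;
  9012354910324591203549141914212310393013212430103904090429241924292049412412493434393434103121012019102101402;
  901235491032459130245904090429243234231439343439343402323932321321291419101201214941492429240901010;
  9012354910324591302549242924091491419142123103934134390409042924121293434393023234941;
  9012354912034591204359040904191423234231493434393013494310434019242924012129232032091419140109013412042;
  901235491203459120534934343932012312324943914191403103930130430109242924012129232342349040904191431;
  901235491203459123045904090419134124323914191401090420493434393434101039302323092429203232134943123234121;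
  9012354912034591230549141914010904209040904191421219301321024101292101420129249234342323930134942;
  90123549123045912305492143123239323213021204310393013410914191401209024029040904129214323213219302323402920412191343143;
  9012354913024591302549141912102310434393434390409041212924292043023239323203419141932321341292140109040;
  90123549201345920143592042090240123103292301321042343101491241212921214209030901401019104940343204293434393434010319131;
  9012354920134592015349141910494393010340109010419134134923432432393143403930434090240292142102920124103232101;
  901235492013459203145934343934340103191301012323090409010149412412191419140904204924292412013012323932323;
  90123549201345920315491419140904209242924121029249034034393103494293103104109010419142121;
  00901243590132459102354920423432049402913191301021210901212419434349434312124191421210903090121231203930213212134;
  0090124359013245910245394034320494023439123213212921231231219121321321402903090230239320324941043019104104321210901212341;
  0090124359013245910325492323934340394343494204323090491319134212149409030903121201019101041;
  9012435901325491023549232329232349432340234390214310232434943423239301341249401431090134102920913191342121902;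
  901243590132549103245943434943432914010191319130140120904903090323434039304343923232923234940;
  00901243590213459102354913934340130192402343409010310901301434390230232923213212921231032494343494343149410;
  0090124359021345910245391393421210292323292323121292121323012124194343494343149413430903090310109010134;
  0090124359021345920145392402104310901341903090314010494034392321302101201913930494343494124323292323402;
  901243590213549102354924021014340149410434090101902302329232134212921243103249434034090430431910913191349301013;
  9012435902135492013459131913494094343494341393023234290309034101090492323292323142129212410121021;
  901243590213549201435903090341010901431943434943431913431049232329232341212920423913191349430;
  901243591023549103245941343419143431090234304390309034942923232923230429249104101304349434039121421;
  9012435910235491032549131913403101393101302120101903090349434324323923232923230124121912142149434349434309020;
  901243591023549104235942343423292324343209023434230913191301041914341249204230434943403924323903090349432;
  90124359102354912034591319134010191490309034941923232923230429241212943434943430903430143;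
  901243591023549120354923232923204342323931390309034943103409131913421210292142124943434943430903401243232;
  90124359102354912043590309034943194343494343090101430913191041034319134349232329232304292412123;
  9012435912034591204539131910103934943434943430149410343101092323292042130434090434039030903191232132412;
  901243592013459201453943243234292121023934913191309034092320320901031913419041013401349431043494343;
  90124539013245910243593494213212319132123120904324323029203234234209023913419140101232039302329434393432494234034;
  90124539014235910243594343934320432309029232342924940142121903409121241914212104934942920;
  9012453901423591042539349429101041904340393023240343934304392302342090240904943243232924940;
  9012453901425391024359434393103201219121023014340391341914010124090429232434023230903232039302323493494249420;
  9012453901425391042359434393232393043439134191212191041019034090209049349424940; 901245390214359102435934941910913419149301031924023430901041090140149434393434032012129212102;
  90124539021435920134591341914930934941910130190232034290104109039434393431042032329232302; 901245390214359201453923234292412129204294314319149409034090430139340343934941904;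
  90124539102435910324591341914010191321219234234329204292403432430934940902302390340904932;
  9012453910243591042359403430904943431243231219134191401019142121490232430432923403423239323239349409020;
  90124539102435910425394343934301431912412191341904942934940902343403903240292042924; 901245391024359120453943439343014319149349409041010923234292042924121290340904941;
  9012453912034591204539034090431913419101430140393041034090434309413431914010393493494230234214942323423;
  901324590213549103254912121912124942120410194023043439343403201910290209021401090104124934314321214941212921210;
  90132459102354910325493232393013421219121219020902494249424942090209121219143102323932323;
  90132459102354910352491212191212041019101402124341049020902493232942494209023093232393013412923;
  9013254902135491032459429219123043439142121912129212401019249423103409043013209024090230139310324;
  9013254910235491032459142121912124104942942920902343043924940142121912124193043243230902924;
  90132549102354910342593232013410902921431924930232393232434912412191214210494239429209034320432].

Definition certs7 : seq Number.uint := [::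
  00901234659012354691032456934345345952054904545049405450904292529254292409315319135143439343402323910150109010510419140150125;
  009012346590123546910324659045204529254025429014510454945459545204931531910540191045120121925292054209024591212531232393232135214323213931232341253103;
  0090123465901235469103254693254234393503259025402494545954520454930530903543430902925292542920915191541912123103;
  00901234659012435691032456935950232359454549454503434090434324925292325329235235091519153191321231039050905134010149410104312;
  009012346590124356910324659413434519154343120492450425409035090532902502920524340349430434259151915032012129212102305210210194543543439359523023;
  009012346590124356910423569413434519154124305392529250342343024942049454354034039359502591519150103109029050902305232920;
  00901234659012435691042365941043501910512012191519150130109052925292302354204940245905090523203292509434534543935954204;
  00901234659012435691203456935950153912512129212152319130109454549454503432042924023431492054214010191035401494104531059050905309031;
  009012346590124356912034659454354349401435941014350103935950139025029205230903251212915191531913504104924502454090454205432329232345024541;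
  00901234659012435691204356935951051092052090350901942145129232532924021490105101910150143043494340341391254214941245231914012042;
  0090123465901243569120436593595401492125121913519150109105401494104531010901594024502923235292502190509013254210494012452;
  0090123465901243569201345690325029205231501915191531913094545494545340340901013925292121023405415494514504359023025323935952352132102;
  00901234659012435692013465924121204315010901051392325323935952352315210294545494014312502920521301905090510134014941043591519153191350;
  009012346590124356920143569359520152102192529251210234014941049151910235230121292121029454054090350905101590254024941343451910;
  00901234659012435692014365921210231501090105192054024942045323420494124052915191321251292152120905090510130191059434534543935954104;
  009012346590132456910235469421451915412504590350393053209024941545419145451249420932532329259532352434039105101090235039305345452;
  00901234659013245691023645912512191541029305309025090524943543453494354345324942354345309015413430439325323932352403439145142354343292595343453205;
  0090123465901324569102435690154120494021431945145419101301523203930232913513931532121912123410493235232925953253209025420494024509023;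
  009012346590132456910243659321532123191321235120915191524121494121425341049340145341049401435410423239323240145190509052090253945425429259530232;
  0090123465901324569103254693253423434940934340132124015012925951051041945454942045090491519152121914510590509053232039304343;
  0090123465901324569103264593232135191541090450454945405420901541941014504124029259504931531912541214940545910310153090352032393054343;
  00901234659013245691034256925950359454549454215419130101910315010393235423434943430493153191351203203930905090520903;
  009012346590132456910342659025090539353932013212534104940143519015410494014513230239320529151915212191341045945425429259530;
  0090123465901325469102345692354343934340232392105101209021015014941051012593539301534210210191012012419454549454529204915191521452159042;
  10901234659013254691023465942920145191421245129215419145140249024052454945425904259232532393235234943253203931531913514342323932324342035232;
  901234659013254691023546940343450393054343029209252925494504251451915191540120121090293434534549454259520590509052343043934034324;
  901234659013254691032456931531914512459540545903503932354234393432453205329252925494094214541249421454191431039101051090154120904;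
  901234659013254691032465945045409045405292504542913513931534212195405492529254945090105101910150124090459305430434943403423205434393434503;
  9012346590132546910325469014212010451292154191010192054024942045049404935393543243239303943143453191354341329235023235914510454090454025952052;
  009012346590134256910234569121523191301012925292539354524054932542343494343245329232039135139302302595203201530101942343405320902350905325;
  109012346590134256910234659315013021231059501321219252925393502912125412494214531913541204945145419145415204309025323903205239325329230235;
  90123465901342569103245694545494204530903905090532302920323292152121912125139309353935213212194304349121025301329235951035101;
  90123465901342569103246591454514940142120354014090410453019454254292135191531093539352329503905090532340249420432352921251219121521393450454;
  901234659013425691034256945454945453432432920292529253931013401491351393232595059010150191051014230434943403143193053090240143519153410453;
  90123465901342569103426592152121912125139301351945454945450234340905903520323292359509353935232920529105101090234054549454504;
  109012346590142356910234659329201531901015019105320121912102310159125121292320350905239402432035239325930235292452454945435432494234534504;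
  901234659014235691024356910540149410450341249420490509023425045439345405243253925292323595025941245219125421204323090293539352920;
  90123465901423569102436591519152123123932132120310159353935292509050905232309032325394545494343245950292529232135194205454;
  9012346590142356910423569304543543409043453454029202945454945453432494301341901531039302301351915310359151915212312393039252923423434595454054;
  90123465901423569104236592154124942145321231910510193539352925029105101090232503930539415454191341245950902305329235032320905;
  009012346590213456910243569159534545104935393513931090509045140105494501041545394545494104509051031592529251212921214021431;
  00901234659021345691024365931053090350109252925412124942121453203293053090350139310594541541915954513504349045450494010412052925021301;
  009012346590213456920143569454125429245230543492125121915953059353935413434943432042905090510109039402450292325132123930;
  009012346590213456920143659212152925402143193140545031434943413054504393405454903503930534101049402452394541541915953092052090150109035;
  109012346590214356910234659139015401439023053292352132129212312032593539351910153192125121910345450494054543140149454549413434595434312042;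
  9012346590214356910243569353935191091519135954104592529251210230901019402452090254203413494310349015410494014301250292052103513;
  90123465902143569102436590509035201212921210259454549431434595412402910105212102920121250103930105319353935191509212512191035090514014;
  9012346590214356920134569235023230903105109039025029205234014943403494010412052191253232923230293539315950359145145494541543930;
  901234659021435692013465915191539305905090534014905392054024941343459543430493539351915013019412451212921215323292323502;
  901234659021435692014365915191539350394545494545104309059305309035019205292323523931595090250292052105314540549450454;
  00901234659102345691032645920529254945454945450494054520913513931501013931053450125932502309059532342343921521219105101915412;
  00901234659102345691034265930539352329451454191454102154129215319252925402494234345912123150320905952393401435410494014519154123434;
  90123465910235469103245694545494545090214310392529245024595420545090509054942931531913514032432329249140104315039305134191431523235;
  9012346591023546910324659353935403439343045023239151915014019121245192054204940245429245945245429245425090524540905090549452;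
  9012346591023546910325469205402494534304539354034352045494214512921541209020914510454090454595259015010191010514943432432393539351013401912121;
  90123465910243569103245694014510901531913412491351393250292053201531902502920523932930510130191031015952352392452454945430543494345032540;
  90123465910243569103246591013501309035953290150101910105139342145193539350905203239452454292352302920325309205420494054354349434534524;
  901234659102435691042356945454945450343494343243239151915013019103103212109050905393523235935393509042049252923234024595421451;
  901234659102435691042365914514549454154301019101025121094214512923502329259205209035952935393509054204901051019101051393152123123;
  90123465910243569120345692121521913012052191391054014941041031595135905090539319353935090101309402450292053232923234214;
  9012346591024356912034659050905393519353930595434314941545419145450140319135912512129203523292325312129245245494542502343494154543;
  9012346591024356912043569145145494541543051015951594054540904545343494343104309353935090540124529252925320329241212490150101910105139313;
  901234659102435691204365905090539310530912512129212152031019159240234301453191354104941545493539350921251294545494304345951;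
  90123465910324569103254692529250901401019010351031913015301292145125910510109032532393434393539323021351915312052434309454549402459542054502;
  9012346591032456910326459050905292534324323925292509054093153191351232039154191053401439320323595494054504940545249425452;
  9012346591032456910342569454549454021541910310109050905292512123519252925090430434915191212310359535935393504343249423434232;
  9012346591032456910342659050902595394545494540215419153193539350232393591519154310324942145312329252925090530;
  901234659103425691034265945454943430423529252935393232150101910105109151915401012439353925292530904540549050904214345415494514541;
  901234659120345691204356913513931530109030925292504214943434945145419101205292502305932542343494014595410343245201905090519153215212;
  9012346591203456912043659125421494504514941343451941014325402104393401204523090325402493153191301035953925292501212925323290509051935;
  9012346591204356912043659353935101090154120429240214015019105103935390509052323421494545494545494010432502920520912152129203232519151;
  9012346592013456920143569121521292125120902323420492323523930513401494104301931531910595035090509010519153159454549454512042923232;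
  901234659201345692014365920520902501210295390350393051013935915191509054304349454549454501041915319325323292323521430434943403450;
  00901235469013245691023465951245412159502930134109014310232393232013415454902432302393203234090259545245292494542540914191421219121250101;
  00901235469013245691023564924943250323954545954540235039305320454093430430902409042590121243123023932032134010191010451291419142512159545024;
  0090123546901324569103246591241219150101950454250292494052454293523234254595452459509104301393232434393434534054904090420905;
  0090123546901324569103256492494509524523434539354343254595405493103401910410212109045904090452305393043453912452159512541219121452102;
  901235469013246591023465934343930534520494024924292459029135123205342090243503932320395454595454292090104101912451219121542014015;
  901235469013246591032456914191453123239305392429245950954545954542905901431039323213451915431232013412930534254520902545049405454;
  90123546901324659103254693434393434503209054954545954542924502145192429245954091419142125191545105904090432035239325302342;
  901235469102346591032456914191401501925935015341090143513931532121920452059504549454254903403439343043595295215412921451209023503;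
  9012354691023465910324659040904595454254952354343292343453209020915415459545049405420545921421219121245010212191212193434393434053932323;
  901235469102346591032546921451259521541302532393235213419024029204259524954514519154154090452045910410109012145212921254121293434393503454945430523023;
  90123546910324569103256493513454519154543123023595435434390409042924352032309201451205950215419145191341343934302432393232534524952154129204945;
  90123564901324569102354695454921541914510529343413519153143423239323243403945952494209121521405240904250459540524590415310393013514209024;
  90123564901324569103254691435139315342121910410193023234520902540904954254292354343934340394595249409054504940542059502542;
  901235649013245691032564951454191454132325393043453932132123451292154191451094594052450905415419143153935134251215954504904509025049405;
  9012356490132546910235469250245409045420549450245459459529209145192595215410495454942045090293403405393523239323203;
  9012356490132546910324569045090230539350325429154154942145191401019459529245025924529259409343453935203230904;
  90123564901325469103256493232134351034204940243015319135103924529259509043503930532090594595292502914519153123239301351;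
  90123564901325649102354693014345130902090259143153932323932325039241215219125121595420495454945215419145140542945950154120494021451;
  9012356490132564910324569459525951431039143513932323935034951454191212191212454102590214545120549450215410901541925450240904204945450;
  90123564901325649103254690410150191051012509059254502409042049454504945952595091431539323239305395454945402154501019101051;
  90123564910235469103245690430539350394295245429245420154191421219459509023043439204542049402452924934314531905951451245;
  9012356491023546910325469214310232503930539323239524542910510191015012509054504940545494249459509012102101935013454109059525;
  9012356491023546910325649343453935039152121914519150120121292595245429245425049405245409459509023053920542540905952;
  9012356491032456910325649245292540904509459545205954549014510901541292145129343453935032494591541549401241254191451;
  0090124356901324569102346595403430214519154120495135191531259520940145132052925023154102494201451903090320902591034014942143123930532;
  009012435690132456910243659420453203595302329535953420450905402430903090342049402435941214232123129213212319124121504543913191541243523932534204;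
  90124356901324659102346590101301910310123503930532591501013509053101021219121201019232329232359402494343494343201451090295359532920;
  9012435690132465910243659131913541249023953595329230903090323503930532359434349434321451915412343024529232329232359532354204;
  9012435690132465910324569131913212351393053942545214315951341249454504923232923235950950350905302905901341049401435212010191010212512;
  90124356902134659102436592540234305454945451439341049535953191309131913595325121029403434090434301245292542103434590232032923023251010901013;
  90124356902134659201436592323292323121529403434902532302595203235215201212090394343494154543930913191359501531950350905301910351015;
  901243569102346591032456925420430595039402450943434943430145191541249030903595295135191531090121231503912323121292053232925;
  90124356910234659103246595359530904204913191501013932302309434349434350454945405343024325390309035952592323292323101052121912121;
  901243569102346591042356953595309034250454924023434090539352902320329203232595232394343494504524323292323591319135010191532121;
  9012435691023465910423659232329232305292503235090309035953259153159503932950434305454945450343494343249401430101910103519132121;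
  901243569102346591204365951351915310901350105923232923235402494134349030903591394545343459503931914341349431434015201212921210230;
  90124356912034659120436592402143410494014359535910153120121259521210213090309030903254214941245235195135191531019101341014943453254292051213232923232;
  9012436590132465910234659401435109015341025454945452014351391351913212191212010193595230253090292352329232395205953932920;
  901243659013246591024356905403434943432494024539359132121912123150940143150901534124509054214319253232923239323052953932925134104;
  90124365901324659103245692015312302920321351059509053090340249420452953932905935952352393253234024913519153212519153103;
  901243659021346591024356953931913059153191393051019015341049401430109010513935951235232923253210941545124323292323421494124323502;
  9012436590213465920143569410343204521913932540249235232943413494314354514093595315950390530903201212923502329539319035;
  901243659102346591032456935953059529253232923234024942045091531913010191541249539309259434034509039352323;
  9012436591023465910423569203250329230523529253239359434034943043452090340145191541043595329539309153212194342323045209039325;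
  901243659102346591204356925323292323029205210310940343450903935193595201212531913595393090450145343490105134014941043150159513;
  90124365912034659120435692532329232301212923523291403410345109013935935951015309035095394104351059539054014319134104191531;
  9013425691023465910342659502305950329239021341049401431259521351932329232053932329121231913212501019101052123541049239354204940245305;
  9013426591023465910342569235952150130123932103105120950230903292359450452043934024942143519153123292321351059523930235420494024532153191351232].

Definition certs8 : seq Number.uint := [::
  0090123457690123546791032456794696520546950356039306403439343045325916191601041090249256256595652645245954254509320326032924629264306390609043013619163103462;
  0090123457690123546791032457692416212191212614092323623932632342920649016510595015614090416512593463434946960521541953056309036430439340346329161916045015951054062123103;
  00901234576901235467910325467901461090291619162452159524054549565659565621541292092629214212619162120651015936393643439360326901241213063249469623603;
  00901234576901235467910325476912146212921261521052921651259521562142191241264109520536032923063420902693639343246523595325603239060906343043936502323591064014946961041501254;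
  00901234576901324567910235467926964306532593639360434324090429143610340902360393063246951056019121621912612064101946494624942090560565956506205950254;
  009012345769013245679102354769126121910610412956565956523653935632563054343906090620902649326323292696450259136139316301041204940269464946524545954542560;
  009012345769013245679103254679269604691619162412149409501561090165102595015419464946520540904931653159521561916436103903603932326393623206342;
  0090123457690132456791032547693232163191361034914614941621214940694062540545292696545045901601019101061523503930463439306309052156109016419565659565625952656454250;
  0090123457690132546791023456795215641914651230563954052450624942690542514519262926494502594164191461292049363936434532595235434232032910160109042360393063246;
  10901234576901325467910234576924940629565659565621541914512015619034064393460434209024694649462926540545931631912415215696512514230101391216212921436139306324;
  901234576901325467910235467954010456010901065401540259520593043643049426962069161916041301203239323023904264520595025460902926292649450215419434634393436432920;
  901234576901325467910235476956565952054609062946494629260923613212191212316349436132124010191451256429246965025936393043462302393203263906090652015419145102564;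
  90123457690132546791032456791041013063494360320904931653159521546191645105694164191461292502454592629264940903603930635402545954520452956506509042069601461;
  90123457690132546791032457690609024101601910610149363936232434393434232601321219565659521541696145105916191645125950454569464946290143163926292649460;
  9012345769013254679103254679306530595215641914651056490609042069606914614945235639303926292649450454594343146319136413432923013212195365653935656342545952052;
  901234576901325467910325476926292649520562943463439343643292306532590609061241210906912126512595215461916010193503256432032349432302603930639516565191451256960;
  0090123457691023456791032547692140102146219126412195651651915615620529234634392365325952356340249426910160109069642946494634304393403436209363936503595656254;
  9012345769102354679103245679565265292460292492064204940696246940343465305950356434393434232390609064942914361434393434163510595215419316319136150315419145125;
  901234576910235467910324576903603930634943653259326523595450456962495205620902642924691541054536034943063954521456192361321219146010191010642123103942642924620902640;
  9012345769102354679103254679060906494249464946090209323263292405265659565625695656595656035434393232392145123564343934340369630653205916191604101912121;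
  90123457691023546791032547692065205950354634393436453254941641914610912126195652652924026962913613931632124102926906090649461431232393463434943650359562565;
  9012345769103245679103254679340343640902696246290365305950356329236534524569246249426409040941641914615024545954545952356329236039343439136139316321021019141;
  9012345769103245679103254769565659502569649243623234943232634090436039023063292360393063545045941641914212645105950154610930630903643432494691361393430432164191461;
  901234576910325467910325476902360329230634943643439363930434532656595656591619164510529262921651259521561409060952015612090216419146149464946323023931631;
  00901235467901324567910234576924945015461291341343934304532509052656590409026046964062469361346191642612191216231039646964523563936532509545459545425952454656054;
  0090123546790132456791023547692494306532595621654612696216419146120902450259520540904502305639343439343452323595323256034961461916412696042910104109014212310393013212416;
  00901235467901324567910325476952154191451201561290409045205950254365325916416961431032609064951054019104501652656965015419654542562924946093434393434232393232434260323;
  901235467901324576910234576934343936532549452356434603950154109014512350639360532156191419146512595205964696429209024029214619164104269254254595452456902;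
  901235467901324576910235476920420902406960426932362434653259523564343934304329521541292146190249014010191645125952154601061964696429240913413439306350254945205;
  901235467901324576910324567951054019104120120160191061019306340696042090692429246960961431639361341292143160232349040904230134614941643103912452159502454065659565605;
  90123546790132457691032546791419146512595605654924292469640904090462090264293232134512595215461916451059646964292402695315434139302320634943603;
  9012354679013245769103254769040904230639409524545292545465659540545914191401601209049210410152305393503251014016961041016964696429240293163264521595125461219101041;
  901235467910234576910324567914191460101916212195265065042696240292696043603930634942649040904696292429243263023932036230930534054595450465659565625;
  901235467910234576910324576936434369634340393232390409046964264961461916410902091245215951254652105956216519242926502549452454595015431039301346191651256;
  9012354679102345769103254679501541090146191641296469640904236039104501595105412012162926490643063936034942693613461916431039301346351032592429246520595025640;
  90123546791023457691032547691036101403436963430439323263469064360393063494293613461916431503595245459502156143603292306342924962416512595215614209024092160410241264109014619121421;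
  901235467910324567910325476954545954542059502454605652910410109024946901601406191604106129216014031230239646962430639360340924292409041651059343439343460326964;
  901235467910324576910325476905454059504545362323936134619545145191541241546109016451056934343936035452459542545291641696520145451915454159242924069604306396016410901461292164132630230;
  90123547690132457691023457691264121292494204904360393063201461916410246946964269630232639649429209361341914312302309029501561504545954542595025;
  901235476901324576910235467946964269624091436139249406293613419143153259523564340390460906426090624950454656059521541914512065659649429201461;
  9012354769013245769103245679146191214219106101964942923260323934634393436432696090246029249406494690420906950265602454595454259506565;
  9012354769013245769103254679052354343602924940691641914612696049364343934342323914610946952454595454256029524054652650905235434309034345365659649429205215641;
  901235476901324576910325476905420545629249409649429201451259204236039306324069604695203563420902409049165145459545425950154194691212419143103;
  90123547691023457691032456793023206342924360232639362323916419140101916512592016512035434393434530595215619545405609049462496494092694696406962;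
  901235476910234576910325467924629240292046094696320326434532595235434639501541609049462930631451059501541914512656591436139316341069624964940905210154601;
  90123547691032456791032547695235634292436039306340946960249469243623239323263409043603964940269649146191641029146193503156410901465125952156412;
  901235476910324576910325467964946236039306350454591264521595025494695454156191651251064101910146010936532542924090430639469601465125952156412906409042964;
  901324576910235467910325476952156191651250494052156431039462494260906209269604292691645145245954254056962930632090236134191431632496292502454656259526565;
  90132457691023547691032546795265659520549323623926964026962943650342545090545245956256591421621494029269629240905201561902306393603216419146124;
  9013254679102345769103254769361341269621431039301341209429206494290240904269624691421219106104512595215419545245954254560906545243056392494602924;
  90132546791023547691032457695025143103930623239323261341691451259520156191421219429236530595042545096426962090214310392491061012924904209026942;
  90132547691023457691032546796145125952154109062049143163290249426942696250154619164510520936234234393432432039302342346503595656215419145120595065630543432906204940292143613].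

End Tables.

(** * Enumeration of the small cases *)

Fixpoint all_tails A (f : A -> seq A -> bool) (l : seq A) :=
  if l is x :: l' then f x l' && all_tails f l' else true.

(** Triples are taken in the order of the list, and [R] prunes the second and third entries by
    comparison with the first. *)
Definition all3 A (R : rel A) (g : A -> A -> A -> bool) (l : seq A) :=
  all_tails (fun x r => all_tails (fun z r' => all (g x z) r') (filter (R x) r)) l.

Lemma all_tailsP (A : eqType) (f : A -> seq A -> bool) l x r : all_tails f l ->
  subseq (x :: r) l -> exists2 r', subseq r r' & f x r'.
Proof.
elim: l => // z l IHl /= /andP[fz fl]; case: eqP => [->|_] sub; first by exists l.
exact: IHl.
Qed.

Lemma all3P (A : eqType) (R : rel A) g l x z w : all3 R g l -> subseq [:: x; z; w] l ->
  R x z -> R x w -> g x z w.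
Proof.
move=> al sub xz xw; have [r sub1 al1] := all_tailsP al sub.
have sub1' : subseq [:: z; w] (filter (R x) r) by rewrite subseq_filter /= xz xw.
have [r' sub2 /allP al2] := all_tailsP al1 sub1'; apply: al2.
by rewrite -sub1seq.
Qed.

Lemma triple_sub (A : eqType) (l r : seq A) : uniq r -> {subset r <= l} -> size r = 3 ->
  exists x z w, subseq [:: x; z; w] l /\ perm_eq r [:: x; z; w].
Proof.
move=> ur sub sz; have P : perm_eq r (filter (mem r) (undup l)).
  apply: uniq_perm; rewrite ?filter_uniq ?undup_uniq // => e.
  by rewrite mem_filter mem_undup /=; case: (boolP (e \in r)) => // /sub->.
have := perm_size P; rewrite sz; case E : (filter _ _) P => [|x [|z [|w []]]] // P _.
exists x, z, w; split=> //; rewrite -E.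
exact: subseq_trans (filter_subseq _ _) (undup_subseq l).
Qed.

(* The value [n] in position [n - j] contributes [j] inversions. *)
Fixpoint few n e : seq vtx :=
  if n is n'.+1 then
    flatten [seq [seq ins n' (n' - j) s | s <- few n' (e - j)] | j <- iota 0 (minn e n').+1]
  else [:: [::]].

Definition inversions n s := [seq e <- pairs_of (iota 0 n) | ~~ before s e].

Lemma index_iota0 n p : p < n -> index p (iota 0 n) = p.
Proof. by move=> lt_p; rewrite -{1}[p]add0n -(nth_iota 0 0 lt_p) index_uniq ?size_iota
    ?iota_uniq. Qed.

Lemma mem_inversions n s p q : ((p, q) \in inversions n s) = [&& p < q, q < n & index q s <=
    index p s].
Proof.
rewrite !mem_filter /before /= -leqNgt; have -> : ((p, q) \in [seq (x, z) | x <- iota 0 n, z <-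
    iota 0 n]) = (p < n) && (q < n).
  apply/allpairsP/andP => [[[x z] /=]|[pn qn]]; first by rewrite !mem_iota => -[? ? [-> ->]].
  by exists (p, q); rewrite !mem_iota.
case: (ltnP q n) => qn; last by rewrite !andbF.
case: (ltnP p n) => pn; last by rewrite !andbF /=; apply/esym/negbTE; rewrite negb_and -leqNgt
    (leq_trans (ltnW qn) pn).
by rewrite !index_iota0 //= andbT andbC.
Qed.

Lemma inversions_uniq n s : uniq (inversions n s).
Proof. by rewrite !filter_uniq // allpairs_uniq ?iota_uniq // => -[? ?] [? ?]. Qed.

(** The inversions of [s] involving [n] correspond to the values after it; the remaining ones are
    those of [rem n s]. *)
Lemma mem_few n e s : perm_eq s (iota 0 n) -> size (inversions n s) <= e -> s \in few n e.
Proof.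
elim: n e s => [|n IHn] e s P; first by move: (perm_size P); case: s P.
move=> le_e; have us : uniq s by rewrite (perm_uniq P) iota_uniq.
have sz : size s = n.+1 by rewrite (perm_size P) size_iota.
have ns : n \in s by rewrite (perm_mem P) mem_iota /=.
pose d := n - index n s.
have P' : perm_eq (rem n s) (iota 0 n).
  apply: uniq_perm; rewrite ?rem_uniq ?iota_uniq // => x.
  by rewrite mem_rem_uniq // inE (perm_mem P) !mem_iota /= !add0n ltnS ltn_neqAle.
have le : size (inversions n (rem n s)) + d <= e.
  apply: leq_trans le_e.
  have -> : d = size (map (fun z => (z, n)) (drop (index n s).+1 s)).
    by rewrite size_map size_drop sz subSS.
  rewrite -size_cat; apply: uniq_leq_size.
    rewrite cat_uniq inversions_uniq map_inj_uniq ?drop_uniq //; last by move=> ? ? [].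
    rewrite andbT; apply/hasPn => _ /mapP[z _ ->]; rewrite mem_inversions ltnn andbF //.
  move=> [p q]; rewrite mem_cat mem_inversions => /orP[/and3P[pq qn le]|/mapP[z zd [-> ->]]].
    rewrite mem_inversions pq ltnS ltnW //= leqNgt -(index_rem us _ _ (v := n)) -?leqNgt //.
      by rewrite neq_ltn (ltn_trans pq qn).
    by rewrite neq_ltn qn.
  have lt : index n s < index z s.
    rewrite ltnNge -ltnS -in_take ?(mem_drop zd) //.
    by move: us; rewrite -{1}(cat_take_drop (index n s).+1 s) cat_uniq => /and3P[_ /hasPn h _];
        apply: h.
  have zn : z < n.+1 by have := perm_mem P z; rewrite (mem_drop zd) mem_iota => /esym.
  have nzn : z != n by apply: contraTneq lt => ->; rewrite ltnn.
  by rewrite mem_inversions leqnn (ltnW lt) !andbT ltn_neqAle nzn -ltnS zn.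
apply/flattenP; exists [seq ins n (n - d) t | t <- few n (e - d)].
  apply/mapP; exists d => //; rewrite mem_iota /= add0n ltnS leq_min leq_subr andbT.
  by apply: leq_trans le; rewrite leq_addl.
apply/mapP; exists (rem n s); first apply: IHn => //.
  by rewrite -(leq_add2r d) subnK //; apply: leq_trans le; rewrite leq_addl.
rewrite subKn ?ins_rem // -ltnS -sz index_mem //.
Qed.

Definition tagged n e := [seq (s, inversions n s) | s <- few n e & s != iota 0 n].

(** [U] lists the moved pairs when [y] is the identity ([moved_inversions]). [vm_compute] evaluates
    both arguments of a boolean connective but only one branch of an [if], so nested conditionals
    avoid needless computations of [canon]. *)
Definition sparse_ok n (keys : seq (seq vtx)) (x z w : vtx * seq (nat * nat)) :=
  let U := undup (x.2 ++ z.2 ++ w.2) in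
  if size U <= 4 then
    if all (fun v => has (touch v) U) (iota 0 n) then covered keys [:: iota 0 n; x.1; z.1; w.1]
    else true
  else true.

Definition sparse_check n keys :=
  all3 (fun x z => size (undup (x.2 ++ z.2)) <= 4) (sparse_ok n keys) (tagged n 4).

Definition exceptional_check n keys :=
  all (fun p => all (fun q => all (fun w =>
    let S := [:: iota 0 n; sw p (iota 0 n); sw q (iota 0 n); w] in
    let U := undup (inversions n (sw p (iota 0 n)) ++ inversions n (sw q (iota 0 n)) ++
        inversions n w) in
    let deg v := count (touch v) U in
    if [&& p.+1 < q, size U == 5, deg p.+1 == 1, deg q == 1,
        all (fun v => [|| v == p.+1, v == q | 1 < deg v]) (iota 0 n) & uniq S]
    then covered keys S else true)
    (few n 5)) (iota 0 n)) (iota 0 n).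

Lemma moved_inversions n S a b c : perm_eq S [:: iota 0 n; a; b; c] ->
  perm_eq (moved (iota 0 n) S) (undup (inversions n a ++ inversions n b ++ inversions n c)).
Proof.
move=> P; apply: uniq_perm; rewrite ?undup_uniq //; first by apply: moved_uniq; rewrite iota_uniq.
move=> e; rewrite mem_undup !mem_cat /moved /inversions !mem_filter (perm_has _ P) /=.
rewrite orbF; case: (before (iota 0 n) e) => //=; last by rewrite !andbF.
by case: (e \in _); rewrite ?andbT ?andbF.
Qed.

Lemma size_inversions n S s : s \in S -> size (inversions n s) <= size (moved (iota 0 n) S).
Proof.
move=> sS; rewrite /moved /inversions !size_filter; apply: sub_count => e ne.
by apply/hasP; exists s.
Qed.

Lemma sparse_good n (t : seq (seq (seq nat))) S : all (cert_check n) t -> sparse_check n (map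
    (cert_set n) t) ->
    uniq S -> size S = 4 -> (forall s, s \in S -> perm_eq s (iota 0 n)) -> iota 0 n \in S ->
    size (moved (iota 0 n) S) <= 4 -> (forall v, v < n -> 0 < deg (iota 0 n) S v) ->
  good n.-2 S.
Proof.
move=> okt chk uS szS PS yS le4 touched; set y := iota 0 n in yS le4 touched *.
have uy : uniq y by rewrite iota_uniq.
pose r := [seq (s, inversions n s) | s <- rem y S].
have ur : uniq r by rewrite map_inj_uniq ?rem_uniq // => ? ? [].
have sr : {subset r <= tagged n 4}.
  move=> _ /mapP[s sr ->]; have sS := mem_rem sr; apply/map_f; rewrite mem_filter.
  rewrite mem_few ?PS ?(leq_trans (size_inversions n sS)) // andbT.
  by move: sr; rewrite mem_rem_uniq // inE => /andP[].
have szr : size r = 3 by rewrite size_map size_rem // szS.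
have [x [z [w [sub P]]]] := triple_sub ur sr szr.
have rP e : e \in r -> e.1 \in S /\ e.2 = inversions n e.1.
  by case/mapP=> s /mem_rem sS ->.
have [[xS xE] [zS zE] [wS wE]] : [/\ x.1 \in S /\ x.2 = inversions n x.1,
    z.1 \in S /\ z.2 = inversions n z.1 & w.1 \in S /\ w.2 = inversions n w.1].
  by split; apply: rP; rewrite (perm_mem P) !inE eqxx ?orbT.
have PT : perm_eq S [:: y; x.1; z.1; w.1].
  rewrite (perm_trans (perm_to_rem yS)) // perm_cons.
  have -> : rem y S = map fst r by rewrite -map_comp map_id.
  exact: perm_map P.
have PU := moved_inversions PT.
have pairU e e' : e \in r -> e' \in r -> size (undup (e.2 ++ e'.2)) <= 4.
  move=> er e'r; have [eS ->] := rP e er; have [eS' ->] := rP e' e'r.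
  apply: leq_trans le4; apply: uniq_leq_size; first exact: undup_uniq.
  move=> f; rewrite mem_undup mem_cat /moved /inversions !mem_filter => /orP[] /andP[nb ->];
    rewrite andbT; apply/hasP; [by exists e.1 | by exists e'.1].
have [xr zr wr] : [/\ x \in r, z \in r & w \in r] by rewrite !(perm_mem P) !inE !eqxx ?orbT.
have := all3P chk sub (pairU _ _ xr zr) (pairU _ _ xr wr); rewrite /sparse_ok xE zE wE.
rewrite -(perm_size PU) le4 /=.
have -> : all (fun v => has (touch v) (undup (inversions n x.1 ++ inversions n z.1 ++ inversions
    n w.1))) (iota 0 n).
  apply/allP => v; rewrite mem_iota => /touched; rewrite /deg -has_count.
  by rewrite (perm_has _ PU).
move=> /= cov; rewrite perm_sym in PT; apply: (good_perm PT).
by apply: (covered_good (base := y) _ _ _ okt cov) => // s; rewrite (perm_mem PT); apply: PS.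
Qed.

Lemma exceptional_good n (t : seq (seq (seq nat))) S : all (cert_check n) t -> exceptional_check
    n (map (cert_set n) t) ->
    uniq S -> size S = 4 -> (forall s, s \in S -> perm_eq s (iota 0 n)) -> exceptional S (iota 0
        n) ->
  good n.-2 S.
Proof.
move=> okt chk uS szS PS [e5 [p [q [fk lt_pq dp dq others]]]]; set y := iota 0 n in e5 fk dp dq
    others *.
have uy : uniq y by rewrite iota_uniq.
have [yS xS zS /andP[lt_p lt_q] npq] := fk; rewrite size_iota in lt_p lt_q.
have nxz : sw p y != sw q y.
  by apply: contraNneq npq => /(sw_inj uy) ->; rewrite ?size_iota.
have [nxy nzy] : sw p y != y /\ sw q y != y by rewrite !sw_neq ?size_iota.
have [z [w P0]] := perm_pick szS uS xS zS nxz.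
have [w' P] : exists w', perm_eq S [:: y; sw p y; sw q y; w'].
  move: (yS); rewrite (perm_mem P0) !inE ![y == sw _ _]eq_sym (negPf nxy) (negPf nzy) /=.
  case/orP=> /eqP e; [exists w | exists z]; rewrite (permPl P0) e.
    by rewrite (perm_catCA [:: _; _] [:: _]).
  by rewrite (perm_catCA [:: _; _; _] [:: _]) /= perm_cons (perm_catCA [:: _; _] [:: _]) perm_catCA.
have PU := moved_inversions P.
have degE v : count (touch v) (undup (inversions n (sw p y) ++ inversions n (sw q y) ++
    inversions n w')) = deg y S v.
  by rewrite -(seq.permP PU).
have w'S : w' \in S by rewrite (perm_mem P) !inE eqxx !orbT.
have pn : p \in iota 0 n by rewrite mem_iota /= ltnW.
have qn : q \in iota 0 n by rewrite mem_iota /= ltnW.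
have w'f : w' \in few n 5 by rewrite mem_few ?PS // (leq_trans (size_inversions n w'S)) // e5.
have nE i : i < n -> nth 0 y i = i by move=> lt_i; rewrite nth_iota.
have := allP (allP (allP chk p pn) q qn) w' w'f; rewrite /= -/y !degE -(perm_size PU) e5 lt_pq.
rewrite !nE // in dp dq others; last exact: ltnW.
rewrite dp dq !eqxx -/(uniq [:: y; sw p y; sw q y; w']) -(perm_uniq P) uS andbT /=.
have -> : all (fun v => [|| v == p.+1, v == q | 1 < count (touch v) (undup (inversions n (sw p y)
    ++ inversions n (sw q y) ++ inversions n w'))]) (iota 0 n).
  apply/allP => v vn; rewrite degE; case: eqVneq => //= nv1; case: eqVneq => //= nv2.
  exact: others.
move=> /= cov; rewrite perm_sym in P; apply: (good_perm P).
by apply: (covered_good (base := y) _ _ _ okt cov) => // s; rewrite (perm_mem P); apply: PS.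
Qed.

Definition degrees T := [seq count (swadj s) T | s <- T].
(** For four permutations: the induced graph consists of two disjoint edges. The sum of [degrees] is
    twice the number of edges, so the bound 6 used below corresponds to the three edges of a
    tree. *)
Definition matched T := all (pred1 1) (degrees T).

(** Besides completeness of the two lists, this records that a set in a bad orbit is matched or has
    at least three edges. At five values, columns of neither kind are then known to be [good]
    without a lookup. *)
Definition four_ok (keys bads : seq (seq vtx)) a b c :=
  let T := [:: iota 0 4; a; b; c] in
  let C := canon T in
  if C \in keys then true else
  if C \in bads then matched T || (6 <= sumn (degrees T)) else false.

Definition four_check keys bads :=
  all3 (fun _ _ => true) (four_ok keys bads) [seq s <- few 4 6 | s != iota 0 4].

(** * Sets of permutations of five values *)

Definition admissible S v := ~~ ((v \in map (head 0) S) && (v \in map (last 0) S)).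

(** Tests whether deleting [v] succeeds. Fewer than three edges among the columns rule out the tree
    alternative of [distinct_tree], and only matched columns have to be looked up. *)
Definition five_rule (keys4 : seq (seq vtx)) S v :=
  let P := map (rem v) S in
  if admissible S v then
    if uniq P then
      if sumn (degrees P) < 6 then
        if matched P then covered keys4 P else true
      else false
    else false
  else false.

Definition five_slow (keys4 keys : seq (seq vtx)) S :=
  if has (five_rule keys4 S) (iota 0 5) then true else covered keys S.

(** The weights are such that a total of at most 1 over the six pairs means distinct columns with at
    most one edge, a case that needs no lookup ([clash_sum]). *)
Definition clash s t : nat := if s == t then 2 else swadj s t.
Definition clashes s t := [seq clash (rem v s) (rem v t) | v <- iota 0 5].

Fixpoint addv (l r : seq nat) :=
  match l, r with x :: l', z :: r' => x + z :: addv l' r' | _, _ => [::] end.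

(** A test sufficient for deletion that computes no columns, since [l] holds the total of clashes
    for each [v]. The default 2 of [nth] fails the test. *)
Definition five_quick S (l : seq nat) :=
  has (fun v => if nth 2 l v <= 1 then admissible S v else false) (iota 0 5).

Section Loop.

Variables (y : vtx) (test : vtx -> vtx -> vtx -> seq nat -> bool).

(** Clashes are computed once for every pair of permutations; the loops over triples only add them
    up. *)
Fixpoint rows (l : seq vtx) : seq (vtx * seq nat * seq (seq nat)) :=
  if l is s :: l' then (s, clashes y s, map (clashes s) l') :: rows l' else [::].

Fixpoint join_row (R : seq (vtx * seq nat * seq (seq nat))) (row : seq (seq nat)) :
    seq (vtx * seq (seq nat) * seq nat) :=
  match R, row with
  | (t, l, row') :: R', r :: row'' => (t, row', addv l r) :: join_row R' row''
  | _, _ => [::]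
  end.

Fixpoint inner_loop (f : vtx -> seq nat -> bool) (L : seq (vtx * seq (seq nat) * seq nat)) row :=
  match L, row with
  | (w, _, l) :: L', r :: row' => f w (addv l r) && inner_loop f L' row'
  | _, _ => true
  end.

Fixpoint middle_loop s l (L : seq (vtx * seq (seq nat) * seq nat)) :=
  if L is (t, row, l') :: L' then
    (let x := addv l l' in inner_loop (fun w r => test s t w (addv x r)) L' row) &&
    middle_loop s l L'
  else true.

Fixpoint outer_loop (R : seq (vtx * seq nat * seq (seq nat))) :=
  if R is (s, l, row) :: R' then middle_loop s l (join_row R' row) && outer_loop R' else true.

Lemma outer_loopP l s t u : outer_loop (rows l) -> subseq [:: s; t; u] l ->
  test s t u (addv (addv (clashes y s) (addv (clashes y t) (clashes s t)))
                (addv (addv (clashes y u) (clashes s u)) (clashes t u))).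
Proof.
have innerP f s1 t1 r u1 : inner_loop f (join_row (rows r) (map (clashes s1) r)) (map (clashes
    t1) r) ->
    u1 \in r -> f u1 (addv (addv (clashes y u1) (clashes s1 u1)) (clashes t1 u1)).
  by elim: r => //= x r IHr /andP[fx /IHr fr]; rewrite inE => /predU1P[->|].
have middleP s1 r : middle_loop s1 (clashes y s1) (join_row (rows r) (map (clashes s1) r)) ->
    subseq [:: t; u] r -> test s1 t u (addv (addv (clashes y s1) (addv (clashes y t) (clashes s1
        t)))
                (addv (addv (clashes y u) (clashes s1 u)) (clashes t u))).
  elim: r => // x r IHr /= /andP[inn /IHr mid]; case: eqP => [ex|_] sub; last exact: mid.
  by rewrite -ex in inn; have := innerP _ _ _ _ u inn; rewrite -sub1seq; apply.
elim: l => // x l IHl /= /andP[mid /IHl out]; case: eqP => [ex|_] sub; last exact: out.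
by rewrite -ex in mid; apply: middleP sub.
Qed.

End Loop.

Definition five_check (keys4 keys : seq (seq vtx)) :=
  outer_loop (fun s t u l => let S := [:: iota 0 5; s; t; u] in
      if five_quick S l then true else five_slow keys4 keys S)
    (rows (iota 0 5) [seq s <- few 5 10 | s != iota 0 5]).

Lemma degrees_perm T T' : perm_eq T T' -> perm_eq (degrees T) (degrees T').
Proof.
move=> P; rewrite /degrees (eq_map (g := fun s => count (swadj s) T')) ?perm_map // => s.
exact: seq.permP.
Qed.

Lemma adj_relabel y s t : uniq y -> perm_eq s y -> perm_eq t y ->
  swadj (relabel y s) (relabel y t) = swadj s t.
Proof.
move=> uy Ps Pt; apply/idP/idP; last exact: adj_map.
by move/(adj_map (nth 0 y)); rewrite !relabelK // => x; rewrite ?(perm_mem Ps) ?(perm_mem Pt).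
Qed.

Lemma degrees_relabel y T : uniq y -> (forall s, s \in T -> perm_eq s y) ->
  degrees (map (relabel y) T) = degrees T.
Proof.
move=> uy PT; rewrite /degrees -map_comp; apply/eq_in_map => s sT /=.
rewrite count_map; apply: eq_in_count => t tT /=.
by rewrite adj_relabel ?PT.
Qed.

Lemma normal_form base S l : uniq base -> (forall s, s \in S -> perm_eq s base) -> uniq S ->
    size S = 4 -> (forall s, perm_eq s (iota 0 (size base)) -> s != iota 0 (size base) -> s \in
        l) ->
  exists y a b c, let T := [:: iota 0 (size base); a; b; c] in
    [/\ y \in S, subseq [:: a; b; c] l, perm_eq (map (relabel y) S) T & uniq T /\
        forall s, s \in T -> perm_eq s (iota 0 (size base))].
Proof.
move=> ub PS uS szS full; set e := iota 0 (size base).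
have [y yS] : exists y, y \in S by case: S szS {PS uS} => // y r _; exists y; rewrite mem_head.
have Py := PS y yS; have uy : uniq y by rewrite (perm_uniq Py).
have PS' s : s \in S -> perm_eq s y by move=> sS; rewrite (perm_trans (PS s sS)) // perm_sym.
have PT s : s \in map (relabel y) S -> perm_eq s e.
  by case/mapP=> t tS ->; rewrite /e -(perm_size Py); apply: relabel_perm (PS' t tS).
have uT : uniq (map (relabel y) S).
  rewrite map_inj_in_uniq // => s t sS tS est; rewrite -(relabelK uy (s := s)) ?est ?relabelK //
      => x.
    by rewrite (perm_mem (PS' t tS)).
  by rewrite (perm_mem (PS' s sS)).
have eT : e \in map (relabel y) S by apply/mapP; exists y; rewrite // relabel_iota ?(perm_size Py).
have sub : {subset rem e (map (relabel y) S) <= l}.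
  move=> s; rewrite mem_rem_uniq // inE => /andP[ne sT].
  by apply: full => //; apply: PT.
have sz3 : size (rem e (map (relabel y) S)) = 3 by rewrite size_rem // size_map szS.
have [a [b [c [sl P]]]] := triple_sub (rem_uniq _ uT) sub sz3.
have P' : perm_eq (map (relabel y) S) [:: e; a; b; c].
  by rewrite (perm_trans (perm_to_rem eT)) // perm_cons.
exists y, a, b, c; split=> //; split; first by rewrite -(perm_uniq P').
by move=> s; rewrite -(perm_mem P'); apply: PT.
Qed.

Lemma good_normal N base S y T : uniq base -> (forall s, s \in S -> perm_eq s base) -> y \in S ->
  perm_eq (map (relabel y) S) T -> good N T -> good N S.
Proof.
move=> ub PS yS P; rewrite perm_sym in P; move/(good_perm P); apply: good_relabel.
  by rewrite (perm_uniq (PS y yS)).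
by move=> s sS; rewrite (perm_trans (PS s sS)) // perm_sym PS.
Qed.

Lemma size_inversions_le n s m : size (pairs_of (iota 0 n)) = m -> size (inversions n s) <= m.
Proof. by move=> <-; rewrite /inversions size_filter count_size. Qed.

Lemma four_good (t : seq (seq (seq nat))) bads base S : all (cert_check 4) t -> four_check (map
    (cert_set 4) t) bads ->
    uniq base -> size base = 4 -> (forall s, s \in S -> perm_eq s base) -> uniq S -> size S = 4 ->
    ~~ matched S -> sumn (degrees S) < 6 ->
  good 2 S.
Proof.
move=> okt chk ub szb PS uS szS nm lt6.
have [|y [a [b [c []]]]] := normal_form (l := [seq s <- few 4 6 | s != iota 0 4]) ub PS uS szS.
  move=> s; rewrite szb => P ne; rewrite mem_filter ne mem_few //.
  exact: (@size_inversions_le 4 s 6).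
rewrite szb => yS sub P [uT PT].
apply: (good_normal ub PS yS P); have := all3P chk sub isT isT; rewrite /four_ok.
set T := [:: _; a; b; c] in P uT PT *; case: ifP => [cov _|_].
  exact: (covered_good (base := iota 0 4) _ PT _ okt cov).
have uy : uniq y by rewrite (perm_uniq (PS y yS)).
have PS' s : s \in S -> perm_eq s y by move=> sS; rewrite (perm_trans (PS s sS)) // perm_sym PS.
have PD := degrees_perm P; rewrite degrees_relabel // in PD.
case: ifP => // _; rewrite /matched -(perm_all _ PD) -/(matched S) (negPf nm) orFb.
by rewrite -(perm_sumn PD) leqNgt lt6.
Qed.

Lemma tree_degrees T a b c d : perm_eq T [:: a; b; c; d] -> swadj a b ->
  swadj b c && swadj c d || swadj a c && swadj a d -> 6 <= sumn (degrees T).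
Proof.
move=> P ab tr; rewrite (perm_sumn (degrees_perm P)) /degrees /= !addn0.
rewrite ![swadj b a]adj_sym ![swadj c a]adj_sym ![swadj d a]adj_sym ![swadj c b]adj_sym ![swadj d
    b]adj_sym ![swadj d c]adj_sym.
rewrite ab; case/orP: tr => /andP[-> ->]; by arith.
Qed.

(** [delete_value] would need all 4-sets of permutations of four values to be [good], which [bad4]
    prevents; [distinct_tree] asks this of the present columns only. Reversal handles the case where
    [v] is never last. *)
Lemma five_delete (t : seq (seq (seq nat))) bads S v : all (cert_check 4) t -> four_check (map
    (cert_set 4) t) bads ->
    (forall s, s \in S -> perm_eq s (iota 0 5)) -> uniq S -> size S = 4 -> v < 5 ->
    admissible S v -> let P := map (rem v) S in uniq P -> sumn (degrees P) < 6 ->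
    (matched P -> covered (map (cert_set 4) t) P) ->
  good 3 S.
Proof.
move=> okt chk PS uS szS lt_v adm P uP lt6 cov.
have vin : v \in iota 0 5 by rewrite mem_iota.
pose base := rem v (iota 0 5); have Pb := perm_to_rem vin.
have ub : uniq (v :: base) by rewrite -(perm_uniq Pb) iota_uniq.
have szb : size base = 4 by rewrite size_rem // size_iota.
have PSb s : s \in S -> perm_eq s (v :: base) by move=> sS; rewrite (perm_trans (PS s sS)).
have ub' : uniq base by case/andP: ub.
have PP s : s \in P -> perm_eq s base by case/mapP=> s' s'S ->; apply: rem_perm (PSb _ s'S).
have szP : size P = 4 by rewrite size_map.
have gP : good 2 P.
  have [mt|nm] := boolP (matched P); last exact: (four_good okt chk ub' szb PP uP szP nm lt6).
  by apply: (covered_good ub' PP _ okt (cov mt)); rewrite -size_eq0 szP.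
have nn s : s \in S -> s != [::] by move=> /PS/perm_size; case: s.
move: adm; rewrite /admissible negb_and => /orP[] nv.
  have S_lv s : s \in S -> 0 < index v s.
    move=> sS; rewrite lt0n -head_index ?nn //; apply: contra nv => /eqP <-.
    exact: map_f.
  have := distinct_tree ub PSb S_lv; rewrite szb => /(_ isT uP gP)[//|].
  move=> [a [b [c [d [PT ab tr]]]]].
  by have := tree_degrees PT ab tr; rewrite leqNgt lt6.
have us s : s \in S -> uniq s by move/PS/perm_uniq->.
have PrS := rev_perm PSb.
have PrS' s : s \in map rev S -> perm_eq s (v :: rev base).
  move=> sS; rewrite (perm_trans (PrS s sS)) // rev_cons perm_rcons perm_cons perm_refl //.
have ubr : uniq (v :: rev base) by rewrite /= mem_rev rev_uniq.
have eP : map (rem v) (map rev S) = map rev P.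
  by rewrite -!map_comp; apply/eq_in_map => s sS /=; rewrite rem_rev ?us.
have uP' : uniq (map (rem v) (map rev S)) by rewrite eP map_inj_uniq //; apply: (can_inj revK).
have gP' : good 2 (map (rem v) (map rev S)) by rewrite eP; apply: good_rev PP gP.
have S_lv s : s \in map rev S -> 0 < index v s.
  case/mapP=> u uS' ->; rewrite lt0n -head_index; last by rewrite -size_eq0 size_rev size_eq0 nn.
  have -> : head 0 (rev u) = last 0 u by case/lastP: u {uS'} => // r x; rewrite rev_rcons
      last_rcons.
  by apply: contra nv => /eqP <-; apply: map_f.
have := distinct_tree ubr PrS' S_lv; rewrite size_rev szb => /(_ isT uP' gP')[g|].
  by have := good_rev PrS g; rewrite mapK //; apply: revK.
move=> [a [b [c [d [PT ab tr]]]]]; have := tree_degrees PT ab tr; rewrite eP.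
have -> : degrees (map rev P) = degrees P.
  rewrite /degrees -map_comp; apply: eq_map => s /=; rewrite count_map.
  by apply: eq_count => u /=; rewrite adj_rev.
by rewrite leqNgt lt6.
Qed.

Lemma nth_addv l r v : size l = 5 -> size r = 5 -> v < 5 ->
  size (addv l r) = 5 /\ nth 2 (addv l r) v = nth 2 l v + nth 2 r v.
Proof.
case: l => [|x1 [|x2 [|x3 [|x4 [|x5 []]]]]] //; case: r => [|z1 [|z2 [|z3 [|z4 [|z5 []]]]]] //.
by move=> _ _; case: v => [|[|[|[|[|]]]]].
Qed.

Lemma nth_clashes s u v : v < 5 -> nth 2 (clashes s u) v = clash (rem v s) (rem v u).
Proof. by move=> lt_v; rewrite (nth_map 0) ?size_iota // nth_iota. Qed.

Lemma clash_sum a b c d : uniq a -> uniq b -> uniq c -> uniq d ->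
    (clash a b + (clash a c + clash b c)) + ((clash a d + clash b d) + clash c d) <= 1 ->
  let P := [:: a; b; c; d] in [/\ uniq P, sumn (degrees P) < 6 & ~~ matched P].
Proof.
move=> ua ub uc ud h.
have [h1 [h2 [h3 [h4 [h5 h6]]]]] : clash a b <= 1 /\ (clash a c <= 1 /\ (clash b c <= 1 /\
    (clash a d <= 1 /\ (clash b d <= 1 /\ clash c d <= 1)))).
  by move: h; move: (clash a b) (clash a c) (clash b c) (clash a d) (clash b d) (clash c d);
      clear => *; lia.
have ne s t : clash s t <= 1 -> (s == t) = false /\ clash s t = swadj s t.
  by rewrite /clash; case: eqP.
move: h; have [[n1 ->] [n2 ->] [n3 ->]] := And3 (ne _ _ h1) (ne _ _ h2) (ne _ _ h3).
have [[n4 ->] [n5 ->] [n6 ->]] := And3 (ne _ _ h4) (ne _ _ h5) (ne _ _ h6).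
rewrite /matched /degrees /= !inE n1 n2 n3 n4 n5 n6.
rewrite !(adj_irrefl ua, adj_irrefl ub, adj_irrefl uc, adj_irrefl ud).
rewrite ![swadj b a]adj_sym ![swadj c a]adj_sym ![swadj d a]adj_sym ![swadj c b]adj_sym ![swadj d
    b]adj_sym ![swadj d c]adj_sym.
by case: (swadj a b); case: (swadj a c); case: (swadj a d); case: (swadj b c); case: (swadj b d);
    case: (swadj c d).
Qed.

Lemma five_good (t4 t5 : seq (seq (seq nat))) bads base S :
    all (cert_check 4) t4 -> four_check (map (cert_set 4) t4) bads -> all (cert_check 5) t5 ->
    five_check (map (cert_set 4) t4) (map (cert_set 5) t5) ->
    uniq base -> size base = 5 -> (forall s, s \in S -> perm_eq s base) -> uniq S -> size S = 4 ->
  good 3 S.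
Proof.
move=> ok4 chk4 ok5 chk5 ub szb PS uS szS.
have [|y [a [b [c []]]]] := normal_form (l := [seq s <- few 5 10 | s != iota 0 5]) ub PS uS szS.
  move=> s; rewrite szb => P ne; rewrite mem_filter ne mem_few //.
  exact: (@size_inversions_le 5 s 10).
rewrite szb => yS sub P [uT PT]; apply: (good_normal ub PS yS P).
set T := [:: _; a; b; c] in P uT PT *.
have szT : size T = 4 by [].
move: chk5; rewrite /five_check => /outer_loopP-/(_ a b c sub); rewrite -/T /=; case: ifP =>
    [/hasP[v]|_].
  rewrite mem_iota /= add0n => lt_v; case: leqP => // le1 adm _.
  have us s : s \in T -> uniq (rem v s).
    by move=> /PT/perm_uniq us; rewrite rem_uniq // us iota_uniq.
  have [uP lt6 nm] : [/\ uniq (map (rem v) T), sumn (degrees (map (rem v) T)) < 6 & ~~ matched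
      (map (rem v) T)].
    apply: clash_sum; try by apply: us; rewrite !inE eqxx ?orbT.
    have sz s u : size (clashes s u) = 5 by [].
    move: le1; have [s1 e1] := nth_addv (sz (iota 0 5) b) (sz a b) lt_v.
    have [s2 e2] := nth_addv (sz (iota 0 5) a) s1 lt_v.
    have [s3 e3] := nth_addv (sz (iota 0 5) c) (sz a c) lt_v.
    have [s4 e4] := nth_addv s3 (sz b c) lt_v.
    have [_ ->] := nth_addv s2 s4 lt_v.
    by rewrite e4 e3 e2 e1 !nth_clashes.
  by apply: (five_delete ok4 chk4 PT uT szT lt_v adm uP lt6) => mt; rewrite mt in nm.
rewrite /five_slow; case: ifP => [/hasP[v]|_ cov].
  rewrite mem_iota /= add0n /five_rule => lt_v; case: ifP => // adm; case: ifP => // uP; case: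
      ifP => // lt6 h _.
  apply: (five_delete ok4 chk4 PT uT szT lt_v adm uP lt6) => mt; move: h.
  by rewrite mt.
exact: (covered_good (base := iota 0 5) _ PT _ ok5 cov).
Qed.

(** * Moved pairs under relabelling *)

Section Relabel.

Variables (y : vtx) (S : seq vtx).
Hypothesis uy : uniq y.
Hypothesis PS : forall s, s \in S -> perm_eq s y.
Let f (e : nat * nat) := (index e.1 y, index e.2 y).
Let R := map (relabel y) S.

Lemma index_relabel s x : perm_eq s y -> x \in y -> index (index x y) (relabel y s) = index x s.
Proof.
move=> Ps xy; have sub : {subset s <= y} by move=> z; rewrite (perm_mem Ps).
elim: s {Ps} sub => //= z s IHs sub; rewrite IHs; last by move=> w ws; apply: sub; rewrite inE ws
    orbT.
congr (if _ then _ else _); apply/eqP/eqP => [e|->//].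
by rewrite -(nth_index 0 (sub z (mem_head _ _))) e nth_index.
Qed.

Lemma moved_relabel : moved (iota 0 (size y)) R = map f (moved y S).
Proof.
have eb s e : perm_eq s y -> e.1 \in y -> e.2 \in y -> before (relabel y s) (f e) = before s e.
  by move=> Ps e1 e2; rewrite /before /= !index_relabel.
have ep : pairs_of (iota 0 (size y)) = map f (pairs_of y).
  rewrite -(relabel_iota uy) /pairs_of.
  have -> : [seq (p, q) | p <- relabel y y, q <- relabel y y] = map f [seq (p, q) | p <- y, q <- y].
    by rewrite allpairs_mapl allpairs_mapr map_allpairs.
  rewrite filter_map; congr map; apply: eq_in_filter => -[p q] /allpairsP[[x z] /= [xy zy [-> ->]]].
  by rewrite eb.
rewrite /moved ep filter_map; congr map; apply: eq_in_filter => e.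
rewrite mem_filter => /andP[_ /allpairsP[[x z] /= [xy zy ->]]].
rewrite has_map; apply: eq_in_has => s sS /=.
by rewrite eb ?PS.
Qed.

Lemma deg_relabel v : v \in y -> deg (iota 0 (size y)) R (index v y) = deg y S v.
Proof.
move=> vy; rewrite /deg moved_relabel count_map; apply: eq_in_count => -[p q].
rewrite mem_moved => /and4P[_ _ py qy]; rewrite /touch /=.
have eq x : x \in y -> (index v y == index x y) = (v == x).
  by move=> xy; apply/eqP/eqP => [e|->//]; rewrite -(nth_index 0 vy) e nth_index.
by rewrite !eq.
Qed.

Lemma size_relabel_moved : size (moved (iota 0 (size y)) R) = size (moved y S).
Proof. by rewrite moved_relabel size_map. Qed.

Lemma exceptional_relabel : exceptional S y -> exceptional R (iota 0 (size y)).
Proof.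
have nthE j : j < size y -> nth 0 (iota 0 (size y)) j = index (nth 0 y j) y.
  by move=> lt_j; rewrite nth_iota // index_uniq.
have mem s : s \in S -> relabel y s \in R by apply: map_f.
case=> e5 [p [q [[yS xS zS /andP[lt_p lt_q] npq] lt_pq dp dq others]]].
split; first by rewrite size_relabel_moved.
exists p, q; split=> //.
- by split; rewrite ?size_iota ?lt_p // -?(relabel_iota uy) /relabel ?sw_map; apply: mem.
- by rewrite nthE // deg_relabel ?mem_nth.
- by rewrite nthE ?(ltnW lt_q) // deg_relabel ?mem_nth // ltnW.
move=> v; rewrite mem_iota add0n /= => lt_v; have lt_q' := ltnW lt_q.
rewrite !nthE // -{1 2}[v](index_uniq 0 lt_v uy) => n1 n2.
rewrite -[v](index_uniq 0 lt_v uy) deg_relabel ?mem_nth //.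
by apply: others; rewrite ?mem_nth //; [apply: contraNneq n1 => -> | apply: contraNneq n2 => ->].
Qed.

End Relabel.

(* The orbits of 4-sets without a [good] colouring at [n = 4]. *)
Definition bad4 : seq (seq vtx) := [::
 [:: [:: 0; 1; 2; 3]; [:: 0; 1; 3; 2]; [:: 0; 2; 1; 3]; [:: 1; 0; 2; 3]];
 [:: [:: 0; 1; 2; 3]; [:: 0; 1; 3; 2]; [:: 0; 2; 3; 1]; [:: 0; 3; 2; 1]];
 [:: [:: 0; 1; 2; 3]; [:: 0; 1; 3; 2]; [:: 0; 2; 3; 1]; [:: 2; 0; 3; 1]];
 [:: [:: 0; 1; 2; 3]; [:: 0; 1; 3; 2]; [:: 2; 0; 1; 3]; [:: 2; 1; 0; 3]]].

Lemma certs4_ok : all (cert_check 4) (table certs4).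
Proof. by vm_compute. Qed.

Lemma certs5_ok : all (cert_check 5) (table certs5).
Proof. by vm_compute. Qed.

Lemma certs6_ok : all (cert_check 6) (table certs6).
Proof. by vm_compute. Qed.

Lemma certs7_ok : all (cert_check 7) (table certs7).
Proof. by vm_compute. Qed.

Lemma certs8_ok : all (cert_check 8) (table certs8).
Proof. by vm_compute. Qed.

Lemma four_checked : four_check (map (cert_set 4) (table certs4)) bad4.
Proof. by vm_compute. Qed.

Lemma five_checked : five_check (map (cert_set 4) (table certs4)) (map (cert_set 5) (table certs5)).
Proof. by vm_compute. Qed.

Lemma sparse6_checked : sparse_check 6 (map (cert_set 6) (table certs6)).
Proof. by vm_compute. Qed.

Lemma sparse7_checked : sparse_check 7 (map (cert_set 7) (table certs7)).
Proof. by vm_compute. Qed.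

Lemma sparse8_checked : sparse_check 8 (map (cert_set 8) (table certs8)).
Proof. by vm_compute. Qed.

Lemma exceptional_checked : exceptional_check 6 (map (cert_set 6) (table certs6)).
Proof. by vm_compute. Qed.

(** * The induction on the number of values *)

Lemma good5 base S : uniq base -> size base = 5 -> (forall s, s \in S -> perm_eq s base) ->
  uniq S -> size S = 4 -> good 3 S.
Proof. exact: (five_good certs4_ok four_checked certs5_ok five_checked). Qed.

Lemma good_sparse n S : n \in [:: 5; 6; 7] ->
    uniq S -> size S = 4 -> (forall s, s \in S -> perm_eq s (iota 0 n.+1)) -> iota 0 n.+1 \in S ->
    size (moved (iota 0 n.+1) S) <= 4 -> (forall v, v < n.+1 -> 0 < deg (iota 0 n.+1) S v) ->
  good n.-1 S.
Proof.
rewrite !inE => /or3P[]/eqP->.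
- exact: (sparse_good certs6_ok sparse6_checked).
- exact: (sparse_good certs7_ok sparse7_checked).
exact: (sparse_good certs8_ok sparse8_checked).
Qed.

Lemma good_exceptional S : uniq S -> size S = 4 -> (forall s, s \in S -> perm_eq s (iota 0 6)) ->
  exceptional S (iota 0 6) -> good 4 S.
Proof. exact: (exceptional_good certs6_ok exceptional_checked). Qed.

(** The induction starts from five values. A failure at [n.+1] values gives either the exceptional
    case, with six values, or [n < 2 * size (moved y S) <= 8], hence six, seven or eight values; the
    tables exclude all of these. *)
Theorem all_good n base S : 4 < n -> uniq base -> size base = n ->
  uniq S -> size S = 4 -> (forall s, s \in S -> perm_eq s base) -> good n.-2 S.
Proof.
elim: n base S => // n IHn base S; rewrite ltnS leq_eqVlt => /predU1P[<-|n4] ub szb uS szS PS.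
  exact: good5 ub szb PS uS szS.
(* [good] is an existential statement over functions, so the argument by contradiction is
   classical. *)
apply: NNPP => ng.
have [y [yS touched small]] := near_or_exceptional n4 (fun b T ub szb uT szT PT => IHn b T n4 ub
    szb uT szT PT)
  ub szb uS szS PS ng.
have Py := PS y yS; have uy : uniq y by rewrite (perm_uniq Py).
have szy : size y = n.+1 by rewrite (perm_size Py).
have PS' s : s \in S -> perm_eq s y by move=> sS; rewrite (perm_trans (PS s sS)) // perm_sym.
pose R := map (relabel y) S.
have PR s : s \in R -> perm_eq s (iota 0 n.+1).
  by case/mapP=> u uS' ->; rewrite -szy; apply: relabel_perm (PS' u uS').
have uR : uniq R.
  rewrite map_inj_in_uniq // => s u sS uS' e; rewrite -(relabelK uy (s := s)) ?e ?relabelK // => x.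
    by rewrite (perm_mem (PS' u uS')).
  by rewrite (perm_mem (PS' s sS)).
have szR : size R = 4 by rewrite size_map.
have iR : iota 0 n.+1 \in R by apply/mapP; exists y; rewrite // relabel_iota // szy.
apply: ng; apply: (good_relabel uy PS'); rewrite -/R.
have touched' v : v < n.+1 -> 0 < deg (iota 0 n.+1) R v.
  rewrite -szy => lt_v; rewrite -[v](index_uniq 0 lt_v uy) deg_relabel ?mem_nth //.
  by apply: touched; rewrite mem_nth.
have szm := size_relabel_moved uy PS'; rewrite szy -/R in szm.
case: small => [[le4 le8]|[n5 exc]]; last first.
  have exR := exceptional_relabel uy PS' exc; rewrite -/R szy in exR.
  move: PR exR; rewrite n5 => PR exR.
  exact: good_exceptional uR szR PR exR.
rewrite -szm in le4.
have n567 : n \in [:: 5; 6; 7].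
  by rewrite !inE; move: le4 le8 n4; rewrite szm; clear; move: (size _) => e; lia.
exact: good_sparse n567 uR szR PR iR le4 touched'.
Qed.

(** * From colourings to trees *)

Definition link (F : vtx -> nat) (S : seq vtx) (L : seq (vtx * vtx * nat)) j : rel vtx :=
  fun s t => [|| ecol F S j s t, (s, t, j) \in L | (t, s, j) \in L].

(* Besides the colour classes, the tree of colour [j] may use the edges inside [S] listed
   in [L] with that colour. *)
Definition packed N (S : seq vtx) := exists F L,
  [/\ forall s, s \in S -> N <= F s, forall s t j, (s, t, j) \in L -> [/\ s \in S, t \in S &
      swadj s t],
      forall s t i j, (s, t, i) \in L -> (s, t, j) \in L \/ (t, s, j) \in L -> i = j &
      forall j s t, j < N -> s \in S -> t \in S -> conn (link F S L j) s t].

Lemma link_sym F S L j : symmetric (link F S L j).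
Proof. by move=> s t; rewrite /link ecol_sym; congr (_ || _); rewrite orbC. Qed.

(** A single tree may use the whole graph: all vertices outside [S] and all edges inside [S] receive
    colour 0. This settles three values. *)
Lemma packed1 base S : uniq base -> (forall s, s \in S -> perm_eq s base) -> packed 1 S.
Proof.
move=> ub PS; pose F s := if s \in S then 1 else 0.
pose L := [seq (e, 0) | e <- [seq (s, t) | s <- S, t <- S] & swadj e.1 e.2].
have memL s t j : (s, t, j) \in L -> [/\ s \in S, t \in S, swadj s t & j = 0].
  case/mapP=> -[a b]; rewrite mem_filter => /andP[/= ab /allpairsP[[x z] /= [xS zS [ea eb]]]] [->
      -> ->].
  by rewrite ea eb in ab *.
exists F, L; split.
- by move=> s sS; rewrite /F sS.
- by move=> s t j /memL[].
- by move=> s t i j /memL[_ _ _ ->] [] /memL[_ _ _ ->].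
move=> [|j] s t // _ sS tS.
have : conn swadj s t by apply: perm_conn; rewrite (perm_trans (PS s sS)) // perm_sym PS.
apply: conn_mono => a b ab; rewrite /link /ecol ab /F /=.
case aS : (a \in S); case bS : (b \in S) => //=.
apply/orP; left; apply/mapP; exists (a, b) => //; rewrite mem_filter /= ab.
by apply/allpairsP; exists (a, b).
Qed.

Section Words.

Variable n : nat.
Implicit Types g h : 'S_n.

Definition word g : vtx := [seq val (g x) | x <- enum 'I_n].

Lemma size_word g : size (word g) = n.
Proof. by rewrite size_map size_enum_ord. Qed.

Lemma nth_word g (i : 'I_n) : nth 0 (word g) i = g i.
Proof. by rewrite (nth_map i) ?size_enum_ord // nth_ord_enum. Qed.

Lemma word_perm g : perm_eq (word g) (iota 0 n).
Proof.
apply: uniq_perm; rewrite ?iota_uniq //.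
  by rewrite map_inj_uniq ?enum_uniq // => i j /val_inj/perm_inj.
move=> k; rewrite mem_iota /=; apply/mapP/idP => [[i _ ->]|lt_k]; first exact: ltn_ord.
by exists ((g^-1)%g (Ordinal lt_k)); rewrite ?mem_enum // permKV.
Qed.

Lemma word_inj : injective word.
Proof. by move=> g h e; apply/permP => i; apply/val_inj; rewrite /= -!nth_word e. Qed.

Lemma word_onto s : perm_eq s (iota 0 n) -> exists g, word g = s.
Proof.
move=> P; have sz : size s = n by rewrite (perm_size P) size_iota.
have lt (i : 'I_n) : nth 0 s i < n.
  have : nth 0 s i \in s by rewrite mem_nth ?sz.
  by rewrite (perm_mem P) mem_iota.
have inj : injective (fun i : 'I_n => Ordinal (lt i)).
  move=> i j [] /eqP; rewrite nth_uniq ?sz ?(perm_uniq P) ?iota_uniq // => /eqP.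
  exact: val_inj.
exists (perm inj); apply: (@eq_from_nth _ 0); rewrite size_word ?sz // => i lt_i.
by rewrite (nth_word (perm inj) (Ordinal lt_i)) permE.
Qed.

(** Composition from left to right makes [tperm i j * g] exchange the entries in positions [i] and
    [j], not the values. *)
Lemma word_tperm g (i j : 'I_n) : j = i.+1 :> nat -> word (tperm i j * g)%g = sw i (word g).
Proof.
move=> ij; have lt_i : i.+1 < size (word g) by rewrite size_word -ij.
have nthsw k s x : k.+1 < size s -> nth 0 (sw k s) x =
    if x == k then nth 0 s k.+1 else if x == k.+1 then nth 0 s k else nth 0 s x.
  by elim: k s x => [|k IHk] [|a [|b r]] [|[|x]] //= lt_k; rewrite (IHk (b :: r)).
apply: (@eq_from_nth _ 0); rewrite ?size_sw !size_word // => x lt_x.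
have nji : ((j : nat) == i) = false by rewrite ij gtn_eqF.
rewrite (nth_word _ (Ordinal lt_x)) nthsw // -ij permM.
case: tpermP => [e|e|n1 n2].
- have -> : x = i by rewrite -e.
  by rewrite eqxx nth_word.
- have -> : x = j by rewrite -e.
  by rewrite nji eqxx nth_word.
rewrite -(nth_word _ (Ordinal lt_x)) /=.
case: eqP => [e|_]; first by case: n1; apply: val_inj.
by case: eqP => [e|//]; case: n2; apply: val_inj.
Qed.

Lemma bubble_word g h : bubble_rel g h = swadj (word g) (word h).
Proof.
apply/exists_inP/adjP => [[s /imsetP[[i j]]]|[k]].
  rewrite inE /= => /eqP ij -> /eqP ->; exists i; last exact: word_tperm.
  by rewrite size_word -ij.
rewrite size_word => lt_k e; pose i := Ordinal (ltnW lt_k); pose j := Ordinal lt_k.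
exists (tperm i j); first by apply/imsetP; exists (i, j); rewrite ?inE.
by apply/eqP/word_inj; rewrite e (@word_tperm g i j).
Qed.

(** An edge with an end outside [S] gets its colour from that end, and an edge inside [S] from [L];
    this makes the relations [link] edge disjoint, as [kappaS_packing] requires. *)
Lemma packed_kappaS N (S : {set bubble_sort_graph n}) : 1 < #|S| ->
  packed N [seq word g | g : 'S_n <- enum S] -> N <= kappaS S.
Proof.
set T := map _ _; move=> S2 [F [L [FT LT L1 con]]].
have memT g : (word g \in T) = (g \in S).
  by rewrite mem_map ?mem_enum //; apply: word_inj.
have linkE j s t : link F T L j s t -> swadj s t.
  by case/or3P=> [/and4P[]//|/LT[]//|/LT[_ _]]; rewrite adj_sym.
have endp j s t : link F T L j s t -> F s = j \/ s \in T.
  case/or3P=> [/and4P[_ _ /orP[/eqP->|->] _]|/LT[-> _ _]|/LT[_ -> _]]; auto.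
apply: (@kappaS_packing (bubble_sort_graph n) S N (fun j (g h : 'S_n) => link F T L j (word g)
    (word h))) => //.
- by move=> j g h; apply: link_sym.
- by move=> j lt_j g h /linkE; rewrite /= bubble_word.
- move=> j g h lt_j gS hS.
  have [p pp] := con j (word g) (word h) lt_j (etrans (memT g) gS) (etrans (memT h) hS).
  elim: p g pp {gS} => [|s p IHp] g /=; first by move=> _ /word_inj->; apply: connect0.
  case/andP=> gs pp ep; have Ps : perm_eq s (iota 0 n).
    by rewrite (perm_trans _ (word_perm g)) // perm_sym; apply: adj_perm (linkE _ _ _ gs).
  have [g' eg'] := word_onto Ps; rewrite -eg' in gs pp ep.
  by apply: (@connect_trans _ _ g'); [apply: connect1 | apply: (IHp g' pp ep)].
- move=> i j g z w lt_i lt_j /endp gi /endp gj nij; rewrite -memT.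
  case: gi => // gi; case: gj => // gj.
  by rewrite -gi gj eqxx in nij.
move=> i j g h lt_i lt_j gi gj.
have low s : s \in T -> F s = i -> False by move=> /FT le e; rewrite e leqNgt lt_i in le.
have low' s : s \in T -> F s = j -> False by move=> /FT le e; rewrite e leqNgt lt_j in le.
case/orP: gi => [/and4P[_ fi gi hi]|Li]; case/orP: gj => [/and4P[_ fj gj hj]|Lj].
- case/orP: fi => /eqP e.
    by case/orP: gj => [/eqP <-//|gT]; case: (low _ gT e).
  by case/orP: hj => [/eqP <-//|hT]; case: (low _ hT e).
- have [gT hT] : word g \in T /\ word h \in T by case/orP: Lj => /LT[].
  by case/orP: fi => /eqP e; [case: (low _ gT e) | case: (low _ hT e)].
- have [gT hT] : word g \in T /\ word h \in T by case/orP: Li => /LT[].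
  by case/orP: fj => /eqP e; [case: (low' _ gT e) | case: (low' _ hT e)].
case/orP: Li => Li; apply: (L1 _ _ _ _ Li); case/orP: Lj; auto.
Qed.

End Words.

(** Exemptions are paid for with edges inside [S]: the edge from [y] to [x] for the middle of a
    path, all three edges in the colour [j] for a path through [S], and one edge for each of the two
    colours at the centre of a star. *)
Lemma good_packed N S : uniq S -> (forall s, s \in S -> uniq s) -> good N S -> packed N S.
Proof.
move=> uS us [F [ex [okx [FS ct]]]].
have hub L : (forall j, j < N -> exists2 x, x \in S & forall s, s \in S -> conn (link F S L j) s
    x) ->
    forall j s t, j < N -> s \in S -> t \in S -> conn (link F S L j) s t.
  move=> H j s t lt_j sS tS; have [x xS hx] := H j lt_j.
  exact: conn_trans (hx s sS) (conn_sym (@link_sym F S L j) (hx t tS)).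
have low L j s t : j < N -> s \in S -> t \in S -> (s, j) \notin ex -> (t, j) \notin ex ->
    conn (link F S L j) s t.
  move=> lt_j sS tS ns nt; apply: conn_mono (ct j s t lt_j sS tS ns nt) => a b.
  by rewrite /link => ->.
have inL L a b j : (a, b, j) \in L -> conn (link F S L j) a b /\ conn (link F S L j) b a.
  by move=> abL; split; apply: conn1; rewrite /link abL ?orbT.
case: okx ct low => [|y x w j yS xS wS nxw yx yw|a b c d j P ab bc cd|c x y z i j P cx cy cz nij]
    _ low.
- by exists F, [::]; split=> // j s t lt_j sS tS; apply: low.
- have nxy : x != y by rewrite eq_sym; apply: adj_neq yx; apply: us.
  exists F, [:: (y, x, j)]; split=> //.
  + by move=> s t k; rewrite inE => /eqP[-> -> _].
  + by move=> s t k l; rewrite !inE => /eqP[-> -> ->] [] /eqP[] //.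
  apply: hub => k lt_k; exists x => // s sS; have [e|ns] := eqVneq (s, k) (y, j).
    by case: e => -> ->; apply: (inL _ _ _ _ _).1; rewrite mem_head.
  by apply: low; rewrite // mem_seq1 // xpair_eqE (negPf nxy).
- have [aS bS cS dS] : [/\ a \in S, b \in S, c \in S & d \in S].
    by rewrite !(perm_mem P) !inE !eqxx !orbT.
  pose L := [:: (a, b, j); (b, c, j); (c, d, j)].
  have [abL bcL cdL] : [/\ (a, b, j) \in L, (b, c, j) \in L & (c, d, j) \in L].
    by rewrite !inE !eqxx !orbT.
  exists F, L; split=> //.
  + by move=> s t k; rewrite !inE => /or3P[]/eqP[-> -> _].
  + have cl s t k : (s, t, k) \in L -> k = j by rewrite !inE => /or3P[]/eqP[_ _ ->].
    by move=> s t k l /cl-> [/cl->|/cl->].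
  apply: hub => k lt_k; exists b => // s sS; have [->|nk] := eqVneq k j; last first.
    by apply: low; rewrite // !inE !xpair_eqE (negPf nk) !andbF.
  have [_ cb] := inL _ _ _ _ bcL; have [ab' _] := inL _ _ _ _ abL; have [_ dc] := inL _ _ _ _ cdL.
  move: sS; rewrite (perm_mem P) !inE => /or4P[]/eqP-> //; first exact: conn_refl.
  exact: conn_trans dc cb.
have [cS xS yS zS] : [/\ c \in S, x \in S, y \in S & z \in S].
  by rewrite !(perm_mem P) !inE !eqxx !orbT.
have [ncx ncy] : c != x /\ c != y by split; [apply: adj_neq cx | apply: adj_neq cy]; apply: us.
have nxy : x != y.
  by move: uS; rewrite (perm_uniq P) /= !inE !negb_or => /andP[_ /andP[/andP[]]].
pose L := [:: (c, x, i); (c, y, j)].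
exists F, L; split=> //.
- by move=> s t k; rewrite !inE => /orP[]/eqP[-> -> _].
- by move=> s t k l; rewrite !inE => /orP[]/eqP[-> -> ->] [] /orP[]/eqP[] // *; subst;
    rewrite ?eqxx in nxy ncx ncy.
apply: hub => k lt_k; have [ek|nki] := eqVneq k i.
  exists x => // s sS; have [->|ns] := eqVneq s c.
    by apply: (inL _ _ _ _ _).1; rewrite ek !inE eqxx.
  by apply: low; rewrite // !inE !xpair_eqE ?(negPf ns) // eq_sym (negPf ncx).
have [ek|nkj] := eqVneq k j.
  exists y => // s sS; have [->|ns] := eqVneq s c.
    by apply: (inL _ _ _ _ _).1; rewrite ek !inE eqxx orbT.
  by apply: low; rewrite // !inE !xpair_eqE ?(negPf ns) // eq_sym (negPf ncy).
by exists x => // s sS; apply: low; rewrite // !inE !xpair_eqE (negPf nki) (negPf nkj) !andbF.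
Qed.

Lemma packed_perm N S S' : perm_eq S S' -> packed N S -> packed N S'.
Proof.
move=> P [F [L [FS LS L1 con]]]; have eS := perm_mem P; exists F, L; split=> //.
- by move=> s; rewrite -eS; apply: FS.
- by move=> s t j /LS; rewrite !eS.
move=> j s t lt_j; rewrite -!eS => sS tS; apply: conn_mono (con j s t lt_j sS tS) => a b.
by rewrite /link /ecol !eS.
Qed.

Lemma packed_transport N S base (phi psi : vtx -> vtx) :
    (forall s, perm_eq s base -> psi (phi s) = s) ->
    (forall s t, perm_eq s base -> swadj s t -> swadj (phi s) (phi t)) ->
    (forall s, s \in S -> perm_eq s base) ->
  packed N S -> packed N (map phi S).
Proof.
move=> K A PS [F [L [FS LS L1 con]]].
have inj s t : s \in S -> t \in S -> phi s = phi t -> s = t.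
  by move=> sS tS e; rewrite -(K s (PS s sS)) e K ?PS.
exists (F \o psi), [seq (phi e.1.1, phi e.1.2, e.2) | e <- L]; split.
- by move=> _ /mapP[s sS ->] /=; rewrite K ?PS ?FS.
- move=> s t j /mapP[[[a b] k] abL [-> -> _]]; have [aS bS ab] := LS _ _ _ abL.
  by rewrite !map_f // A // PS.
- move=> s t i j /mapP[[[a b] k] abL [-> -> ->]]; have [aS bS _] := LS _ _ _ abL.
  by case=> /mapP[[[a' b'] k'] abL' /= [e1 e2 ->]]; have [aS' bS' _] := LS _ _ _ abL';
    move: abL'; rewrite -(inj _ _ _ _ e1) // -(inj _ _ _ _ e2) // => abL'; apply: (L1 _ _ _ _
        abL); auto.
move=> j _ _ lt_j /mapP[s sS ->] /mapP[t tS ->]; have [p pp <-] := con j s t lt_j sS tS.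
move: (PS s sS) pp; clear sS; elim: p s => [|u p IHp] s Ps /=; first by move=> _; apply: conn_refl.
case/andP=> su pp; have ad : swadj s u.
  by case/or3P: su => [/and4P[]//|/LS[]//|/LS[_ _]]; rewrite adj_sym.
have Pu : perm_eq u base by rewrite (perm_trans _ Ps) // perm_sym adj_perm.
apply: conn_trans (IHp u Pu pp); apply: conn1; case/or3P: su => [/and4P[_ c1 c2 c3]|su|us].
- rewrite /link /ecol A //= !K // c1 /=; apply/orP; left; apply/andP; split.
    by case/orP: c2 => [->|/(map_f phi)->]; rewrite ?orbT.
  by case/orP: c3 => [->|/(map_f phi)->]; rewrite ?orbT.
- by apply/or3P; constructor 2; apply/mapP; exists (s, u, j).
by apply/or3P; constructor 3; apply/mapP; exists (u, s, j).
Qed.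

Lemma packed_relabel N y S : uniq y -> (forall s, s \in S -> perm_eq s y) ->
  packed N (map (relabel y) S) -> packed N S.
Proof.
move=> uy PS g; have -> : S = map (map (nth 0 y)) (map (relabel y) S).
  rewrite -map_comp -[LHS]map_id; apply/eq_in_map => s sS /=.
  by rewrite relabelK // => x; rewrite (perm_mem (PS s sS)).
apply: (packed_transport (psi := relabel y) (base := iota 0 (size y)) _ _ _ g).
- move=> s P; rewrite /relabel -map_comp -[RHS]map_id; apply/eq_in_map => x.
  by rewrite (perm_mem P) mem_iota /= => lt_x; rewrite index_uniq.
- by move=> s t _; apply: adj_map.
by move=> _ /mapP[s sS ->]; apply: relabel_perm (PS s sS).
Qed.

Lemma packed_canon N base S : uniq base -> (forall s, s \in S -> perm_eq s base) ->
  S != [::] -> packed N (canon S) -> packed N S.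
Proof.
apply: canon_transfer; first exact: packed_perm.
  exact: packed_relabel.
move=> T PT; apply: packed_transport PT; first by move=> s _; apply: revK.
by move=> s t _; rewrite adj_rev.
Qed.

(** The boolean is read as a colour: vertices outside [S] on the walks of colour 1 get 1, all the
    others 0. *)
Definition two_paint S (ws : seq (seq nat)) s : nat :=
  if s \in S then 2 else s \in flatten [seq trace e.1.1 e.2 | e <- zip (zip S (behead S)) (drop 3
      ws)].

(* For the four remaining shapes at [n = 4]: the coloured edges inside [S], and three words
   for each of the two colours. *)
Definition packed_check S (L : seq (nat * nat * nat)) (ws : seq (seq nat)) :=
  let nS i := nth [::] S i in
  let L' := [seq (nS e.1.1, nS e.1.2, e.2) | e <- L] in
  [&& size S == 4, size ws == 6,
      all (fun e => [&& e.1.1 \in S, e.1.2 \in S & swadj e.1.1 e.1.2]) L',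
      all (fun e => all (fun f => ((f.1 == e.1) || (f.1 == (e.1.2, e.1.1))) ==> (e.2 == f.2)) L')
          L' &
      all (fun j => all (fun e => path (link (two_paint S ws) S L' j) e.1.1 (trace e.1.1 e.2) &&
                                  (last e.1.1 (trace e.1.1 e.2) == e.1.2))
                        (zip (zip S (behead S)) (take 3 (drop (3 * j) ws)))) [:: 0; 1]].

Lemma packed_checkP S L ws : packed_check S L ws -> packed 2 S.
Proof.
rewrite /packed_check; set L' := map _ L; set st := zip S _.
case/and5P=> /eqP szS /eqP szw /allP ok1 /allP ok2 ok3; exists (two_paint S ws), L'; split.
- by move=> s sS; rewrite /two_paint sS.
- by move=> s t j /ok1 /and3P[].
- move=> s t i j e [] f.
    by have /allP/(_ _ f)/implyP := ok2 _ e; rewrite /= eqxx => /(_ isT)/eqP.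
  by have /allP/(_ _ f)/implyP := ok2 _ e; rewrite /= eqxx orbT => /(_ isT)/eqP.
move=> j s t lt_j; apply: consecutive_conn; first exact: link_sym.
have jin : j \in [:: 0; 1] by case: j lt_j => [|[|]].
move=> e est; have szst : size st = 3 by rewrite size_zip size_behead szS.
have szt : size (take 3 (drop (3 * j) ws)) = 3.
  by rewrite size_takel // size_drop szw; case: j lt_j {jin} => [|[|]].
have /mapP[[f w] fin /= ef] : e \in unzip1 (zip st (take 3 (drop (3 * j) ws))).
  by rewrite unzip1_zip // szst szt.
have /andP[pp /eqP lp] := allP (allP ok3 j jin) _ fin.
by rewrite ef; exists (trace f.1 w).
Qed.

Lemma bad4_packed S : S \in bad4 -> packed 2 S.
Proof.
rewrite !inE => /or4P[]/eqP->.
- apply: (@packed_checkP _ [:: (0, 1, 1); (0, 2, 0); (0, 3, 0)]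
    [:: [:: 1; 2; 1; 2; 1]; [:: 1; 2; 1; 2]; [:: 1; 0]; [:: 2]; [:: 0; 2; 1; 0; 1; 0]; [:: 0; 1;
        0; 1]]).
  by vm_compute.
- apply: (@packed_checkP _ [:: (0, 1, 0); (2, 3, 1)]
    [:: [:: 2]; [:: 2; 1; 2]; [:: 0; 1; 0; 1; 0]; [:: 0; 2; 0]; [:: 1; 2; 1]; [:: 1]]).
  by vm_compute.
- apply: (@packed_checkP _ [:: (0, 1, 0); (2, 3, 0)]
    [:: [:: 2]; [:: 2; 0; 1; 2; 1; 0; 1; 0; 2; 1; 0]; [:: 0]; [:: 1; 2; 1; 2; 1]; [:: 1; 2; 1];
        [:: 2; 0; 2]]).
  by vm_compute.
apply: (@packed_checkP _ [:: (0, 1, 1); (2, 3, 1)]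
  [:: [:: 1; 2; 1; 2; 1]; [:: 1; 2; 1; 2; 0]; [:: 0; 2; 1; 2; 1; 0; 1; 2; 1; 0; 2]; [:: 2];
      [:: 2; 0; 1; 0; 1]; [:: 1]]).
by vm_compute.
Qed.

(** On the orbits in [bad4] the coloured edges are supplied directly, so for four values only
    [packed] is claimed. *)
Lemma packed4 base S : uniq base -> size base = 4 -> (forall s, s \in S -> perm_eq s base) ->
  uniq S -> size S = 4 -> packed 2 S.
Proof.
move=> ub szb PS uS szS.
have [|y [a [b [c []]]]] := normal_form (l := [seq s <- few 4 6 | s != iota 0 4]) ub PS uS szS.
  move=> s; rewrite szb => P ne; rewrite mem_filter ne mem_few //.
  exact: (@size_inversions_le 4 s 6).
rewrite szb => yS sub P [uT PT].
have := all3P four_checked sub isT isT; rewrite /four_ok.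
set T := [:: _; a; b; c] in P uT PT *; set C := canon T => chk.
have : packed 2 T.
  move: chk; case: ifP => [cov _|_].
    apply: (good_packed uT) => [s /PT/perm_uniq->|]; first exact: iota_uniq.
    exact: (covered_good (base := iota 0 4) _ PT _ certs4_ok cov).
  case: ifP => // bad _; apply: (packed_canon (base := iota 0 4) _ PT) => //.
  exact: bad4_packed.
rewrite perm_sym in P; move/(packed_perm P); apply: packed_relabel.
  by rewrite (perm_uniq (PS y yS)).
by move=> s sS; rewrite (perm_trans (PS s sS)) // perm_sym PS.
Qed.

Lemma kappaS_lower n (S : {set bubble_sort_graph n}) : 2 < n -> #|S| = 4 -> n - 2 <= kappaS S.
Proof.
move=> n3 S4; apply: packed_kappaS; first by rewrite S4.
set T := map _ _; have uT : uniq T by rewrite map_inj_uniq ?enum_uniq //; apply: word_inj.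
have szT : size T = 4 by rewrite size_map -cardE.
have PT s : s \in T -> perm_eq s (iota 0 n) by case/mapP=> g _ ->; apply: word_perm.
have ui := iota_uniq 0 n; have szi := size_iota 0 n.
(* Three values require one tree and four values two; from five values on every 4-set is [good]. *)
move: n3; rewrite leq_eqVlt => /predU1P[e|]; first by rewrite -e; apply: packed1 ui PT.
rewrite leq_eqVlt => /predU1P[e|n5].
  by rewrite -e; apply: packed4 ui _ PT uT szT; rewrite szi -e.
apply: (good_packed uT) => [s /PT/perm_uniq->//|].
by rewrite subn2; apply: all_good n5 ui szi uT szT PT.
Qed.

Lemma bubble_degree n (g : 'S_n) :
  #|[set h : bubble_sort_graph n | @sedge (bubble_sort_graph n) g h]| <= n.-1.
Proof.
rewrite cardE -(size_map (@word n)).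
have -> : n.-1 = size [seq sw k (word g) | k <- iota 0 n.-1] by rewrite size_map size_iota.
apply: uniq_leq_size; first by rewrite map_inj_uniq ?enum_uniq //; apply: word_inj.
move=> s /mapP[h]; rewrite mem_enum inE /= bubble_word => gh ->.
by move: gh; rewrite /swadj size_word.
Qed.

Lemma four_set_of (T : finType) (x y : T) : x != y -> 3 < #|T| ->
  exists2 S : {set T}, #|S| = 4 & x \in S /\ y \in S.
Proof.
move=> nxy T4; pose s := [:: x, y & [seq z <- enum T | z \notin [:: x; y]]].
have us : uniq s.
  by rewrite /= inE negb_or nxy !mem_filter !inE !eqxx ?orbT filter_uniq ?enum_uniq.
have sz : #|T| <= size s.
  by rewrite cardE; apply: uniq_leq_size (enum_uniq T) _ => z _; rewrite !inE mem_filter !inE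
      mem_enum; do 2 case: (z == _).
exists [set z in take 4 s].
  by rewrite cardsE (card_uniqP _) ?take_uniq // size_takel // (leq_trans T4).
by split; rewrite inE !in_cons eqxx ?orbT.
Qed.

Lemma card_Sn_gt3 n : 2 < n -> 3 < #|{: 'S_n}|.
Proof.
rewrite card_Sn; case: n => [|[|[|n]]] // _; rewrite factS.
apply: leq_trans (_ : n.+3 * 2 <= _); first by rewrite muln2 doubleS.
by rewrite leq_mul // (leq_trans _ (fact_geq n.+2)).
Qed.

Lemma kappa_upper n : 2 < n -> kappa 4 (bubble_sort_graph n) <= n - 2.
Proof.
case: n => [|[|n]] // n3.
pose x : 'S_n.+2 := 1%g; have Px : perm_eq (sw 0 (word x)) (iota 0 n.+2).
  by rewrite (perm_trans (perm_sw _ _)) ?word_perm.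
have [y ey] := word_onto Px.
have xy : @sedge (bubble_sort_graph n.+2) x y by rewrite /= bubble_word ey adj_sw // size_word.
have nxy : x != y by apply: contraTneq xy => <-; rewrite sedge_irrefl.
have [|S S4 [xS yS]] := @four_set_of (bubble_sort_graph n.+2) x y nxy.
  exact: card_Sn_gt3.
apply: leq_trans (kappa_le S4) _; rewrite subSS subn1.
by apply: (kappaS_adjacent (d := n.+1) _ xS yS xy); rewrite ?S4 ?bubble_degree.
Qed.

Theorem theorem1p1 (n : nat) (hn : 3 <= n) :
  kappa 4 (bubble_sort_graph n) = n - 2.
Proof.
apply/eqP; rewrite eqn_leq kappa_upper //.
have [|S S4 <-] := @kappa_attained 4 (bubble_sort_graph n); last exact: kappaS_lower.
exact: card_Sn_gt3.
Qed.
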